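(* Let $1<p<\infty$, $p'=\frac{p}{p-1}$, and $\omega\in\widehat{\mathcal{D}}$. Then the following statements are equivalent: (i) $T(D^p_\omega,H^\infty)$ consists of constant functions only (equivalently, $T_c(D^p_\omega,H^\infty)$ consists of constant functions only); (ii) $\displaystyle\int_0^1\frac{(1-r)^{p'}}{\widehat\omega(r)^{p'-1}}\,dr=\infty$; (iii) $\displaystyle\sum_{k=0}^\infty\frac{1}{(k+1)^{2+p'}\omega_k^{p'-1}}=\infty$; (iv) for any $y>p'$ and $0<p^*<\infty$, setting $x=p(y-1)$ (so that $x>y>p'$), the identity map $I:D^{p^*}_{\widehat\omega_{[x]}}\to D^{p^*/p}_y$ is not bounded.
   Context: $\mathbb{D}$ is the open unit disc, $\mathcal{H}(\mathbb{D})$ the analytic functions on it, $dA(z)=\frac{dx\,dy}{\pi}$. A radial weight is a non-negative $\omega\in L^1([0,1))$ extended by $\omega(z)=\omega(|z|)$; always assume $\widehat\omega(r)=\int_r^1\omega(s)\,ds>0$ for all $0\le r<1$, and $\widehat\omega(z)=\widehat\omega(|z|)$. $\omega\in\widehat{\mathcal{D}}$ means there is $C\ge1$ with $\widehat\omega(r)\le C\widehat\omega(\frac{1+r}{2})$ for all $0\le r<1$. Moments: $\omega_x=\int_0^1 r^x\omega(r)\,dr$. For a radial weight $\nu$ and $0<q<\infty$, $D^q_\nu$ consists of $f\in\mathcal H(\mathbb D)$ with $\|f\|_{D^q_\nu}^q=\int_{\mathbb D}|f'|^q\nu\,dA+|f(0)|^q<\infty$; for $-1<\alpha<\infty$, $D^q_\alpha$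 denotes $D^q_\nu$ with $\nu(z)=(\alpha+1)(1-|z|^2)^\alpha$. For a function $\nu$ on $\mathbb D$ and $\beta\in\mathbb R$, $\nu_{[\beta]}(z)=\nu(z)(1-|z|)^\beta$; thus $\widehat\omega_{[x]}(z)=\widehat\omega(z)(1-|z|)^x$. For $g\in\mathcal H(\mathbb D)$, $T_g(f)(z)=\int_0^z f(\zeta)g'(\zeta)\,d\zeta$. $T(X,H^\infty)$ (resp. $T_c(X,H^\infty)$) is the set of $g\in\mathcal H(\mathbb D)$ such that $T_g:X\to H^\infty$ is bounded (resp. compact). *)

(* Defs.v *)
From HB Require Import structures.
From mathcomp Require Import all_boot all_order all_algebra.
From mathcomp Require Import all_classical all_reals all_analysis.
From mathcomp Require Import complex.
Import Order.TTheory GRing.Theory Num.Theory.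
Import numFieldNormedType.Exports.

Set Implicit Arguments.
Unset Strict Implicit.
Unset Printing Implicit Defensive.

Local Open Scope ring_scope.
Local Open Scope classical_set_scope.

Section Defs.
Variable R : realType.

Definition C := (R[i])^o.

Local Notation leb := (@lebesgue_measure R).

Definition cabs (z : C) : R := Num.sqrt (complex.Re (z : R[i]) ^+ 2 + complex.Im (z : R[i]) ^+ 2).

Definition pt (xy : R * R) : C := (Complex xy.1 xy.2 : R[i]).

Definition inD (z : C) : Prop := cabs z < 1.

Definition holo (f : C -> C) : Prop := forall z, inD z -> derivable f z 1.

Definition cderiv (f : C -> C) (z : C) : C := 'D_1 f z.

Definition discR : set (R * R) := [set xy | xy.1 ^+ 2 + xy.2 ^+ 2 < 1].

Definition dA_int (h : C -> R) : \bar R :=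
  ((pi^-1)%:E * \int[(leb \x leb)%E]_(xy in discR) (h (pt xy))%:E)%E.

Definition omhat (om : R -> R) (r : R) : R :=
  Rintegral leb `[r, 1[ om.

Definition moment (om : R -> R) (k : nat) : R :=
  Rintegral leb `[0, 1[ (fun r => r ^+ k * om r).

Definition radial_weight (om : R -> R) : Prop :=
  [/\ (forall r, 0 <= r < 1 -> 0 <= om r),
      leb.-integrable `[0, 1[ (EFin \o om)
    & (forall r, 0 <= r < 1 -> 0 < omhat om r)].

Definition Dhat (om : R -> R) : Prop :=
  exists C0 : R, 1 <= C0 /\
    forall r, 0 <= r < 1 -> omhat om r <= C0 * omhat om ((1 + r) / 2).

Definition Dpow (q : R) (nu : C -> R) (f : C -> C) : \bar R :=
  (dA_int (fun z => (cabs (cderiv f z) `^ q * nu z)%R)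
   + (cabs (f 0) `^ q)%:E)%E.

Definition inDsp (q : R) (nu : C -> R) (f : C -> C) : Prop :=
  holo f /\ (Dpow q nu f < +oo)%E.

Definition Dnorm (q : R) (nu : C -> R) (f : C -> C) : R :=
  fine (Dpow q nu f) `^ q^-1.

Definition std_weight (alpha : R) (z : C) : R :=
  (alpha + 1) * (1 - cabs z ^+ 2) `^ alpha.

Definition omhat_x (om : R -> R) (x : R) (z : C) : R :=
  omhat om (cabs z) * (1 - cabs z) `^ x.

Definition radial (om : R -> R) (z : C) : R := om (cabs z).

Definition cint01 (F : R -> C) : C :=
  (Complex (Rintegral leb `[0, 1] (fun t => complex.Re (F t : R[i])))
           (Rintegral leb `[0, 1] (fun t => complex.Im (F t : R[i]))) : R[i]).

(* T_g f (z) = \int_0^z f(zeta) g'(zeta) dzeta, along the segment [0,z] *)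
Definition Tg (g f : C -> C) (z : C) : C :=
  cint01 (fun t => f ((Complex t 0 : R[i]) * z) * cderiv g ((Complex t 0 : R[i]) * z) * z).

Definition Tbounded (q : R) (nu : C -> R) (g : C -> C) : Prop :=
  exists C0 : R, forall f, inDsp q nu f ->
    forall z, inD z -> cabs (Tg g f z) <= C0 * Dnorm q nu f.

(* T_g : D^q_nu -> H^infty is compact: bounded, and the image of every
   bounded sequence of D^q_nu has a subsequence that is Cauchy in H^infty
   (i.e. uniformly Cauchy on D; H^infty being complete). *)
Definition Tcompact (q : R) (nu : C -> R) (g : C -> C) : Prop :=
  Tbounded q nu g /\
  forall (fs : nat -> C -> C) (M : R),
    (forall n, inDsp q nu (fs n)) -> (forall n, Dnorm q nu (fs n) <= M) ->
    exists phi : nat -> nat, (forall n, (phi n < phi n.+1)%N) /\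
      forall e : R, 0 < e -> exists N : nat, forall m n, (N <= m)%N -> (N <= n)%N ->
        forall z, inD z -> cabs (Tg g (fs (phi m)) z - Tg g (fs (phi n)) z) <= e.

Definition const_on_D (g : C -> C) : Prop :=
  exists c : C, forall z, inD z -> g z = c.

Definition id_bounded (q1 : R) (nu1 : C -> R) (q2 : R) (nu2 : C -> R) : Prop :=
  exists C0 : R, forall f, inDsp q1 nu1 f ->
    inDsp q2 nu2 f /\ Dnorm q2 nu2 f <= C0 * Dnorm q1 nu1 f.

End Defs.

(* Main.v *)
Require Import Defs.
From HB Require Import structures.
From mathcomp Require Import all_boot all_order all_algebra.
From mathcomp Require Import all_classical all_reals all_analysis.
From mathcomp Require Import measurable_realfun complex.
From mathcomp Require Import ring lra zify.
Import Order.TTheory GRing.Theory Num.Theory.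
Import numFieldNormedType.Exports.
Local Open Scope ring_scope.
Local Open Scope classical_set_scope.

Set Implicit Arguments.
Unset Strict Implicit.
Unset Printing Implicit Defensive.

Local Notation "x %:C" := (real_complex _ x) (at level 1, format "x %:C").

(** Put eps_k = 2^-k and s_k = eps_k^(p'+1) / omhat(1 - eps_k)^(p'-1).  By doubling,
(ii) and (iii) both say that the series of the s_k diverges.

If it converges, average the Cauchy formula over the circles |z| = r, r > 1 - eps_k / 4,
with weight omega: this bounds eps_k^2 |f'| at the points at distance about eps_k from a
boundary point zeta by the integral of |f'| omega against a kernel in |z - zeta|.  Young's
inequality and a Schur estimate over the shells |z - zeta| ~ 2^-m control the integral of
(1 - t) |f'(t zeta)| by the norm of f, with uniformly small tails; after one integration by
parts this makes T_g compact for g(z) = z.  Young's inequality also gives the embedding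
for y = p' + 1 and p^* = p.

If T_g is bounded and g is not constant, averaging over rotations of f by roots of unity
replaces g' by one of its Taylor monomials, and the test functions
sum_k (eps_k / omhat(1 - eps_k))^(p'-1) eps_k (eps_k / (1 + eps_k - z))^M bound the series.
If an identity map of (iv) is bounded, lacunary polynomials bound it.  Both times the
partial sums satisfy S_n <= c + C S_n^(1/p). *)

(** * Complex differentiability in Caratheodory's form *)

Section ComplexDifferentiation.
Variable R : realType.
Implicit Types (A B : set (C R)) (f g : C R -> C R) (z w l : C R).

(** Doubling controls [omhat] only: [om] itself may vanish on large sets, so neither a single circle
    nor a small disc around a point need bound |f'| there by the norm. Averaging with the weight
    [om] uses the whole tail mass omhat(1 - eps_k/4), which doubling compares with omhat(1 - eps_k).
    Hence all estimates are dyadic and up to constants. The exponent p' in s_k is that of duality: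
    the p'-th power of the k-th kernel has weighted integral about s_k, and the coefficients of both
    families of test functions are the equality case of Hoelder's inequality, where both sides of
    the estimate produce the same sum. What remains is the interaction of different scales j and k,
    which must be at most geometric in |j - k|; this is why M is chosen against the doubling
    constant, why the polynomials are lacunary and where y > p' enters. Optimising the parameter of
    Young's inequality gives bounds linear in the norm; choosing it small, and the truncation index
    afterwards, gives compactness. One symbol and one pair (y, [ps]) suffice in the convergent case,
    since (i) and (iv) deny existence. *)

Lemma normE z : `|z| = (cabs z)%:C.
Proof. by case: z. Qed.

Lemma cabs_ge0 z : 0 <= cabs z.
Proof. exact: sqrtr_ge0. Qed.

Lemma cabsM z w : cabs (z * w) = cabs z * cabs w.
Proof. by apply: complexI; rewrite rmorphM /= -!normE normrM. Qed.

Lemma cabs0 : cabs (0 : C R) = 0.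
Proof. by apply: complexI; rewrite -normE normr0. Qed.

Lemma cabs1 : cabs (1 : C R) = 1.
Proof. by apply: complexI; rewrite -normE normr1. Qed.

Lemma cabs_eq0 z : (cabs z == 0) = (z == 0).
Proof. by rewrite -(inj_eq (@complexI R)) -normE normr_eq0. Qed.

Lemma cabs_gt0 z : (0 < cabs z) = (z != 0).
Proof. by rewrite lt_neqAle cabs_ge0 andbT eq_sym cabs_eq0. Qed.

Lemma cabsD z w : cabs (z + w) <= cabs z + cabs w.
Proof. by rewrite -lecR rmorphD /= -!normE ler_normD. Qed.

Lemma cabsN z : cabs (- z) = cabs z.
Proof. by apply: complexI; rewrite -!normE normrN. Qed.

Lemma cabsC z w : cabs (z - w) = cabs (w - z).
Proof. by rewrite -cabsN opprB. Qed.

Lemma cabsB z w : cabs (z - w) <= cabs z + cabs w.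
Proof. by rewrite -(cabsN w) cabsD. Qed.

Lemma cabs_subl z w : cabs z - cabs w <= cabs (z - w).
Proof. by rewrite lerBlDr -{1}(subrK w z) cabsD. Qed.

Lemma cabsV z : cabs z^-1 = (cabs z)^-1.
Proof. by apply: complexI; rewrite fmorphV /= -!normE normfV. Qed.

Lemma cabsX z n : cabs (z ^+ n) = cabs z ^+ n.
Proof. by apply: complexI; rewrite rmorphXn /= -!normE normrX. Qed.

Lemma cabs_rc (t : R) : cabs (t%:C : C R) = `|t|.
Proof. by rewrite /cabs /= expr0n addr0 sqrtr_sqr. Qed.

Lemma cabs_rcge0 (t : R) : 0 <= t -> cabs (t%:C : C R) = t.
Proof. by move=> t0; rewrite cabs_rc ger0_norm. Qed.

Lemma cabs_sum (I : Type) (r : seq I) (P : pred I) (F : I -> C R) :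
  cabs (\sum_(i <- r | P i) F i) <= \sum_(i <- r | P i) cabs (F i).
Proof.
elim/big_ind2 : _ => [|x a y b xa yb|//]; first by rewrite cabs0.
by rewrite (le_trans (cabsD _ _))// lerD.
Qed.

Lemma Re_cabs z : `|complex.Re (z : R[i])| <= cabs z.
Proof. by case: z => a b; rewrite /cabs/= -sqrtr_sqr ler_wsqrtr// lerDl sqr_ge0. Qed.

Lemma Im_cabs z : `|complex.Im (z : R[i])| <= cabs z.
Proof. by case: z => a b; rewrite /cabs/= -sqrtr_sqr ler_wsqrtr// lerDr sqr_ge0. Qed.

Lemma cabs_ReIm z : cabs z <= `|complex.Re (z : R[i])| + `|complex.Im (z : R[i])|.
Proof.
case: z => a b; rewrite /cabs/= -[leRHS]ger0_norm ?addr_ge0// -[leRHS]sqrtr_sqr; apply: ler_wsqrtr.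
rewrite sqrrD !real_normK ?num_real// lerD2r lerDl mulrn_wge0//.
Qed.

Lemma cvgC (T : Type) (F : set_system T) {FF : Filter F} (f : T -> C R) l :
  f x @[x --> F] --> l <->
  forall e : R, 0 < e -> \forall x \near F, cabs (f x - l) <= e.
Proof.
split=> [/cvgrPdist_le h e e0|h].
  have := h e%:C; rewrite ltcR => /(_ e0); apply: filterS => x.
  by rewrite normE lecR cabsC.
apply/cvgrPdist_le => -[e e'] e0; move: (e0); rewrite ltcE /= => /andP[/eqP e'0 ep].
rewrite e'0; apply: filterS (h e ep) => x.
by rewrite cabsC normE lecE /= eqxx.
Qed.

(** The point [z] is not excluded: for [z] in [A] this is continuity with value [l], as
    Caratheodory's factor requires. *)
Definition lim_at A f z l := forall e : R, 0 < e -> exists2 d : R, 0 < d &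
  forall w, A w -> cabs (w - z) < d -> cabs (f w - l) <= e.

Lemma lim_cst A c z : lim_at A (fun=> c) z c.
Proof. by move=> e e0; exists 1 => // w _ _; rewrite subrr cabs0 ltW. Qed.

Lemma lim_id A z : lim_at A id z z.
Proof. by move=> e e0; exists e => // w _ /ltW. Qed.

Lemma lim_near A f g z l m : lim_at A f z l -> lim_at A g z m ->
  forall e : R, 0 < e -> exists2 d : R, 0 < d &
  forall w, A w -> cabs (w - z) < d -> cabs (f w - l) <= e /\ cabs (g w - m) <= e.
Proof.
move=> fl gm e e0; have [d d0 hd] := fl e e0; have [d' d'0 hd'] := gm e e0.
exists (Num.min d d'); first by rewrite lt_min d0.
by move=> w Aw; rewrite lt_min => /andP[w1 w2]; split; [exact: hd|exact: hd'].
Qed.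

Lemma limD A f g z l m : lim_at A f z l -> lim_at A g z m ->
  lim_at A (fun w => f w + g w) z (l + m).
Proof.
move=> fl gm e e0; have [d d0 hd] := lim_near fl gm (divr_gt0 e0 (ltr0n R 2)).
exists d => // w Aw wz; have [h1 h2] := hd w Aw wz.
have -> : f w + g w - (l + m) = (f w - l) + (g w - m) by ring.
by rewrite (le_trans (cabsD _ _))// [leRHS](splitr e) lerD.
Qed.

Lemma limM A f g z l m : lim_at A f z l -> lim_at A g z m ->
  lim_at A (fun w => f w * g w) z (l * m).
Proof.
move=> fl gm e e0; have K0 : 0 < cabs l + cabs m + 1.
  by rewrite ltr_wpDl// addr_ge0// cabs_ge0.
set e1 := Num.min 1 (e / (cabs l + cabs m + 1)).
have e10 : 0 < e1 by rewrite lt_min ltr01 divr_gt0.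
have [d d0 hd] := lim_near fl gm e10.
exists d => // w Aw wz; have [h1 h2] := hd w Aw wz.
have -> : f w * g w - l * m = (f w - l) * (g w - m) + ((f w - l) * m + l * (g w - m)) by ring.
apply: (@le_trans _ _ (e1 * 1 + (e1 * cabs m + cabs l * e1))).
  rewrite (le_trans (cabsD _ _))// lerD//; last rewrite (le_trans (cabsD _ _))// lerD//.
  - rewrite cabsM ler_pM ?cabs_ge0//; apply: le_trans h2 _; by rewrite ge_min lexx.
  - by rewrite cabsM ler_wpM2r ?cabs_ge0.
  - by rewrite cabsM ler_wpM2l ?cabs_ge0.
have -> : e1 * 1 + (e1 * cabs m + cabs l * e1) = e1 * (cabs l + cabs m + 1) by ring.
by rewrite -ler_pdivlMr// ge_min lexx orbT.
Qed.

Lemma limN A f z l : lim_at A f z l -> lim_at A (fun w => - f w) z (- l).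
Proof.
move=> fl e /fl[d d0 hd]; exists d => // w Aw wz.
by rewrite -opprD cabsN hd.
Qed.

Lemma limV A f z l : l != 0 -> lim_at A f z l -> lim_at A (fun w => (f w)^-1) z l^-1.
Proof.
move=> l0 fl e e0; have L0 : 0 < cabs l by rewrite cabs_gt0.
have [|d d0 hd] := fl (Num.min (cabs l / 2) (e * (cabs l ^+ 2 / 2))).
  by rewrite lt_min divr_gt0//= mulr_gt0// divr_gt0// exprn_gt0.
exists d => // w Aw wz; have := hd w Aw wz; rewrite le_min => /andP[h1 h2].
have h3 : cabs l / 2 <= cabs (f w).
  by have := cabs_subl l (f w); rewrite cabsC; lra.
have fw0 : f w != 0 by rewrite -cabs_gt0; lra.
have -> : (f w)^-1 - l^-1 = - (f w - l) / (f w * l) by field; rewrite l0.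
rewrite cabsM cabsN cabsV cabsM ler_pdivrMr ?mulr_gt0 ?cabs_gt0//.
apply: le_trans h2 _; rewrite ler_pM2l// expr2 mulrAC ler_pM2r//.
Qed.

Lemma lim_comp A B f g z m l : (forall w, A w -> B (g w)) ->
  lim_at B f m l -> lim_at A g z m -> lim_at A (fun w => f (g w)) z l.
Proof.
move=> AB fl gm e /fl[d d0 hd].
have [d' d'0 hd'] := gm _ (divr_gt0 d0 (ltr0n R 2)).
by exists d' => // w Aw wz; apply: hd; [exact: AB|have := hd' w Aw wz; lra].
Qed.

(* Caratheodory's form of complex differentiability at z relative to A; it also
   covers paths, as functions differentiable relative to a real segment *)
Definition cdif A f z l := exists phi : C R -> C R,
  [/\ forall w, A w -> f w - f z = phi w * (w - z), phi z = l &
      lim_at A phi z l].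

Definition dfb A f := forall z, A z -> exists l, cdif A f z l.

Lemma cdif_cont A f z l : cdif A f z l -> lim_at A f z (f z).
Proof.
move=> [phi [fE _ cphi]] e e0.
have h : lim_at A (fun w => f z + phi w * (w - z)) z (f z + l * (z - z)).
  by apply: limD (lim_cst _ _ _) (limM cphi (limD (lim_id _ _) (lim_cst _ _ _))).
rewrite subrr mulr0 addr0 in h; have [d d0 hd] := h e e0.
by exists d => // w Aw wz; have := hd w Aw wz; rewrite -fE// subrKC.
Qed.

Lemma dfb_cont A f z : dfb A f -> A z -> lim_at A f z (f z).
Proof. by move=> h /h[l]; exact: cdif_cont. Qed.

Lemma cdif_subset A B f z l : A `<=` B -> cdif B f z l -> cdif A f z l.
Proof.
move=> AB [phi [fE pz cphi]]; exists phi; split=> [w /AB| //|e /cphi[d d0 hd]]; first exact: fE.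
by exists d => // w /AB; exact: hd.
Qed.

Lemma dfb_subset A B f : A `<=` B -> dfb B f -> dfb A f.
Proof. by move=> AB h z /AB/h[l fl]; exists l; exact: cdif_subset fl. Qed.

Lemma cdif_ext A f g z l : A z -> (forall w, A w -> f w = g w) ->
  cdif A f z l -> cdif A g z l.
Proof.
by move=> Az fg [phi [fE pz cphi]]; exists phi; split=> // w Aw; rewrite -!fg// fE.
Qed.

Lemma dfb_ext A f g : (forall w, A w -> f w = g w) -> dfb A f -> dfb A g.
Proof. by move=> fg h z Az; have [l fl] := h z Az; exists l; exact: cdif_ext fl. Qed.

Lemma cdif_cst A c z : cdif A (fun=> c) z 0.
Proof. by exists (fun=> 0); split=> // [w _|]; [rewrite subrr mul0r | exact: lim_cst]. Qed.

Lemma cdif_id A z : cdif A id z 1.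
Proof. by exists (fun=> 1); split=> // [w _|]; [rewrite mul1r | exact: lim_cst]. Qed.

Lemma cdifD A f g z l m : cdif A f z l -> cdif A g z m ->
  cdif A (fun w => f w + g w) z (l + m).
Proof.
move=> [p [fE pz cp]] [q [gE qz cq]]; exists (fun w => p w + q w); split=> [w Aw||].
- by rewrite mulrDl -fE// -gE//; ring.
- by rewrite pz qz.
- exact: limD.
Qed.

Lemma cdifM A f g z l m : cdif A f z l -> cdif A g z m ->
  cdif A (fun w => f w * g w) z (l * g z + f z * m).
Proof.
move=> [p [fE pz cp]] [q [gE qz cq]]; exists (fun w => p w * g w + f z * q w); split=> [w Aw||].
- transitivity ((f w - f z) * g w + f z * (g w - g z)); first by ring.
  by rewrite fE// gE//; ring.
- by rewrite pz qz.
- apply: limD; apply: limM; [exact: cp| |exact: lim_cst|exact: cq].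
  by apply: (@cdif_cont _ _ _ m); exists q.
Qed.

Lemma cdifZ A c f z l : cdif A f z l -> cdif A (fun w => c * f w) z (c * l).
Proof. by move=> h; have := cdifM (cdif_cst A c z) h; rewrite mul0r add0r. Qed.

Lemma cdifN A f z l : cdif A f z l -> cdif A (fun w => - f w) z (- l).
Proof.
move=> h; have := cdifZ (-1) h; rewrite mulN1r => -[p [e pz c]]; exists p; split=> // w Aw.
by rewrite -e//; ring.
Qed.

Lemma cdifV A f z l : (forall w, A w -> f w != 0) -> f z != 0 -> cdif A f z l ->
  cdif A (fun w => (f w)^-1) z (- l / (f z ^+ 2)).
Proof.
move=> f0 fz0 fl; have cf := cdif_cont fl; case: fl => [p [fE pz cp]].
exists (fun w => - p w / (f w * f z)); split=> [w Aw||].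
- have fw0 := f0 w Aw; transitivity (- (f w - f z) / (f w * f z)); last by rewrite fE//; ring.
  by field; rewrite fz0.
- by rewrite pz expr2.
- rewrite expr2; apply: limM; first exact: limN.
  apply: limV; first by rewrite mulf_neq0.
  by apply: limM; [exact: cf|exact: lim_cst].
Qed.

Lemma cdif_comp A B f g z l m : (forall w, A w -> B (g w)) ->
  cdif B f (g z) l -> cdif A g z m -> cdif A (fun w => f (g w)) z (l * m).
Proof.
move=> AB [p [fE pz cp]] gm; have cg := cdif_cont gm; case: gm => [q [gE qz cq]].
exists (fun w => p (g w) * q w); split=> [w Aw||].
- by rewrite fE ?gE ?mulrA//; exact: AB.
- by rewrite pz qz.
- apply: limM; last exact: cq.
  exact: lim_comp AB cp cg.
Qed.

Lemma dfb_cst A c : dfb A (fun=> c).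
Proof. by move=> z _; exists 0; exact: cdif_cst. Qed.

Lemma dfb_id A : dfb A id.
Proof. by move=> z _; exists 1; exact: cdif_id. Qed.

Lemma dfbD A f g : dfb A f -> dfb A g -> dfb A (fun w => f w + g w).
Proof. by move=> hf hg z Az; have [l fl] := hf z Az; have [m gm] := hg z Az; exists (l + m); exact: cdifD. Qed.

Lemma dfbM A f g : dfb A f -> dfb A g -> dfb A (fun w => f w * g w).
Proof. by move=> hf hg z Az; have [l fl] := hf z Az; have [m gm] := hg z Az; exists (l * g z + f z * m); exact: cdifM. Qed.

Lemma dfbN A f : dfb A f -> dfb A (fun w => - f w).
Proof. by move=> hf z Az; have [l fl] := hf z Az; exists (- l); exact: cdifN. Qed.

Lemma dfbB A f g : dfb A f -> dfb A g -> dfb A (fun w => f w - g w).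
Proof. by move=> hf hg; apply: dfbD => //; exact: dfbN. Qed.

Lemma dfbV A f : (forall w, A w -> f w != 0) -> dfb A f -> dfb A (fun w => (f w)^-1).
Proof. by move=> f0 hf z Az; have [l fl] := hf z Az; exists (- l / f z ^+ 2); apply: cdifV fl => //; exact: f0. Qed.

Lemma dfbX A f n : dfb A f -> dfb A (fun w => f w ^+ n).
Proof.
move=> hf; elim: n => [|n ih]; first exact: (@dfb_cst _ 1).
apply: (dfb_ext (f := fun w => f w * f w ^+ n)) => [w _|]; first by rewrite exprS.
exact: dfbM.
Qed.

Lemma dfb_comp A B f g : (forall w, A w -> B (g w)) -> dfb B f -> dfb A g ->
  dfb A (fun w => f (g w)).
Proof.
move=> AB hf hg z Az; have [l fl] := hf _ (AB _ Az); have [m gm] := hg z Az.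
by exists (l * m); exact: (cdif_comp AB).
Qed.

Lemma dfb_sum A (I : Type) (r : seq I) (F : I -> C R -> C R) :
  (forall i, dfb A (F i)) -> dfb A (fun w => \sum_(i <- r) F i w).
Proof.
move=> h; elim: r => [|i r ih].
  by apply: dfb_ext (@dfb_cst A 0) => w _; rewrite big_nil.
by apply: dfb_ext (dfbD (h i) ih) => w _; rewrite big_cons.
Qed.

Lemma dnbhs0E (P : set R[i]) :
  (0 : (R[i] : numFieldType))^' P <-> exists2 d : R, 0 < d & forall h : R[i], h != 0 -> cabs h < d -> P h.
Proof.
split=> [/nbhs_normP[[d d'] /= d0 h]|[d d0 h]].
  move: (d0); rewrite ltcE /= => /andP[/eqP d'0 dp]; exists d => // w w0 wd.
  by apply: h => //=; rewrite sub0r normrN normE d'0 ltcR.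
apply/nbhs_normP; exists d%:C; rewrite /= ?ltcR// => w /= wd w0.
by apply: h => //; move: wd; rewrite sub0r normrN normE ltcR.
Qed.

(** Links Caratheodory's form with the [derivable] and [cderiv] of the statement: the factor is the
    difference quotient, completed at [z] by the derivative. *)
Lemma cdif_derive f z l : cdif setT f z l <-> derivable f z 1 /\ cderiv f z = l.
Proof.
have key (m : C R) :
    h^-1 *: (f (h *: (1 : C R) + z) - f z) @[h --> (0 : (R[i] : numFieldType))^'] --> m <->
    forall e : R, 0 < e -> exists2 d : R, 0 < d & forall w, w != z ->
      cabs (w - z) < d -> cabs ((f w - f z) / (w - z) - m) <= e.
  rewrite (cvgC (F := (0 : (R[i] : numFieldType))^')); split=> h e e0.
    have [d d0 hd] := (dnbhs0E _).1 (h e e0); exists d => // w wz wd.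
    have := hd (w - z); rewrite subr_eq0 => /(_ wz wd).
    by rewrite /GRing.scale/= mulr1 subrK mulrC.
  apply/dnbhs0E; have [d d0 hd] := h e e0; exists d => // k k0 kd.
  have := hd (k + z); rewrite addrK -subr_eq0 addrK => /(_ k0 kd).
  by rewrite /GRing.scale/= mulr1 mulrC.
split=> [[phi [fE pz cphi]]|[df <-]].
  have h : h^-1 *: (f (h *: (1 : C R) + z) - f z) @[h --> (0 : (R[i] : numFieldType))^'] --> l.
    apply/key => e /cphi[d d0 hd]; exists d => // w wz wd.
    by rewrite fE// mulfK ?subr_eq0// hd.
  split; first by apply/cvg_ex; exists l.
  exact: cvg_lim h.
have {}df : h^-1 *: (f (h *: (1 : C R) + z) - f z) @[h --> (0 : (R[i] : numFieldType))^'] --> cderiv f z by [].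
exists (fun w => if w == z then cderiv f z else (f w - f z) / (w - z)); split=> [w _||e e0].
- case: eqP => [->|/eqP wz]; first by rewrite !subrr mulr0.
  by rewrite divfK// subr_eq0.
- by rewrite eqxx.
- have [d d0 hd] := (key _).1 df e e0; exists d => // w _ wd.
  by case: eqP => [_|/eqP wz]; [rewrite subrr cabs0 ltW|exact: hd].
Qed.

(** Differentiability is local: outside the ball the factor is replaced by the difference quotient,
    defined there because [w] differs from [z]. *)
Lemma cdif_ball (r : R) f z l : cabs z < r -> cdif [set w | cabs w < r] f z l -> cdif setT f z l.
Proof.
move=> zD [p [fE pz cp]].
exists (fun w => if `[< cabs w < r >] then p w else (f w - f z) / (w - z)); split=> [w _||].
- case: asboolP => [/fE//|wD]; rewrite divfK// subr_eq0.
  by apply/eqP => wz; apply: wD; rewrite wz.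
- by rewrite asboolT.
- move=> e /cp[d d0 hd]; exists (Num.min d (r - cabs z)).
    by rewrite lt_min d0 subr_gt0.
  move=> w _; rewrite lt_min => /andP[w1 w2].
  have wD : cabs w < r by have := cabs_subl w z; lra.
  by rewrite asboolT// hd.
Qed.

Lemma cdif_disc f z l : inD z -> cdif (@inD R) f z l -> cdif setT f z l.
Proof. exact: cdif_ball. Qed.

Lemma holo_cdif f z : holo f -> inD z -> cdif setT f z (cderiv f z).
Proof. by move=> hf zD; apply/cdif_derive; split=> //; exact: hf. Qed.

Lemma holo_dfb f : holo f <-> dfb (@inD R) f.
Proof.
split=> [hf z zD|h z zD]; first by exists (cderiv f z); apply: cdif_subset (holo_cdif hf zD).
by have [l /cdif_disc/cdif_derive[]] := h z zD.
Qed.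

Lemma cderivE f z l : inD z -> cdif (@inD R) f z l -> cderiv f z = l.
Proof. by move=> zD /cdif_disc => /(_ zD)/cdif_derive[]. Qed.

End ComplexDifferentiation.

(** * Integrals of complex functions over real segments *)

Section PathIntegrals.
Variable R : realType.
Local Notation leb := (@lebesgue_measure R).
Implicit Types (a b c t : R) (F G : C R -> C R).

Definition seg a b : set (C R) := [set w | exists2 t, a <= t <= b & w = t%:C].

(** The integrand is a function of a complex variable, sampled at real points, so that the calculus
    of [cdif] and [dfb] applies to it. *)
Definition cint a b F : C R :=
  Complex (Rintegral leb `[a, b] (fun t => complex.Re (F t%:C : R[i])))
          (Rintegral leb `[a, b] (fun t => complex.Im (F t%:C : R[i]))).

Lemma segP a b t : a <= t <= b -> seg a b (t%:C : C R).
Proof. by move=> h; exists t. Qed.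

Lemma rcB_cabs (s t : R) : cabs (s%:C - t%:C : C R) = `|s - t|.
Proof. by rewrite -rmorphB cabs_rc. Qed.

Definition rcont a b (u : R -> R) := forall t, a <= t <= b -> forall e, 0 < e ->
  exists2 d, 0 < d & forall s, a <= s <= b -> `|s - t| < d -> `|u s - u t| <= e.

Lemma rcont_within a b u : rcont a b u -> {within `[a, b], continuous u}.
Proof.
move=> h; apply/subspace_continuousP => t /=; rewrite in_itv/= => tab.
apply/cvgrPdist_le => e e0; have [d d0 hd] := h t tab e e0.
rewrite near_withinE; apply: filterS (nbhsx_ballx t d d0) => s st /=.
by rewrite in_itv/= distrC => sab; apply: hd => //; rewrite distrC.
Qed.

Lemma rcont_integrable a b u : rcont a b u -> leb.-integrable `[a, b] (EFin \o u).
Proof.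
by move=> h; apply: continuous_compact_integrable; [exact: segment_compact|exact: rcont_within].
Qed.

(* p is Re, Im or the modulus *)
Lemma dfb_rcont a b (p : C R -> R) F : (forall z w, `|p z - p w| <= cabs (z - w)) ->
  dfb (seg a b) F -> rcont a b (fun t => p (F t%:C)).
Proof.
move=> lip h t tab e e0; have [d d0 hd] := dfb_cont h (segP tab) e0.
exists d => // s sab st; apply: le_trans (lip _ _) _.
by apply: hd; [exact: segP|rewrite rcB_cabs].
Qed.

Lemma Re_lip (z w : C R) :
  `|complex.Re (z : R[i]) - complex.Re (w : R[i])| <= cabs (z - w).
Proof. by have := Re_cabs (z - w); case: z => ? ?; case: w. Qed.

Lemma Im_lip (z w : C R) :
  `|complex.Im (z : R[i]) - complex.Im (w : R[i])| <= cabs (z - w).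
Proof. by have := Im_cabs (z - w); case: z => ? ?; case: w. Qed.

Lemma cabs_lip (z w : C R) : `|cabs z - cabs w| <= cabs (z - w).
Proof. by rewrite ler_norml lerNl opprB cabsC cabs_subl cabsC cabs_subl. Qed.

Lemma Re_integrable a b F : dfb (seg a b) F ->
  leb.-integrable `[a, b] (EFin \o (fun t => complex.Re (F t%:C : R[i]))).
Proof. by move=> h; exact: rcont_integrable (dfb_rcont Re_lip h). Qed.

Lemma Im_integrable a b F : dfb (seg a b) F ->
  leb.-integrable `[a, b] (EFin \o (fun t => complex.Im (F t%:C : R[i]))).
Proof. by move=> h; exact: rcont_integrable (dfb_rcont Im_lip h). Qed.

Lemma cabs_integrable a b F : dfb (seg a b) F ->
  leb.-integrable `[a, b] (EFin \o (fun t => cabs (F t%:C))).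
Proof. by move=> h; exact: rcont_integrable (dfb_rcont cabs_lip h). Qed.

Lemma eq_cint a b F G : (forall t, a <= t <= b -> F t%:C = G t%:C) ->
  cint a b F = cint a b G.
Proof.
by move=> FG; rewrite /cint; congr Complex; apply: eq_Rintegral => t;
  rewrite inE/= in_itv/= => tab; rewrite FG.
Qed.

Lemma cintD a b F G : dfb (seg a b) F -> dfb (seg a b) G ->
  cint a b (fun w => F w + G w) = cint a b F + cint a b G.
Proof.
move=> hF hG; rewrite /cint; apply/eqP; rewrite eq_complex/=; apply/andP; split; apply/eqP.
  rewrite -RintegralD//; [|exact: Re_integrable..].
  by apply: eq_Rintegral => t _; case: (F _) => ? ?; case: (G _).
rewrite -RintegralD//; [|exact: Im_integrable..].
by apply: eq_Rintegral => t _; case: (F _) => ? ?; case: (G _).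
Qed.

Lemma cintZ a b (c0 : C R) F : dfb (seg a b) F -> cint a b (fun w => c0 * F w) = c0 * cint a b F.
Proof.
case: c0 => x y hF; have Ri := Re_integrable hF; have Ii := Im_integrable hF.
have Z r u : leb.-integrable `[a, b] (EFin \o u) ->
    leb.-integrable `[a, b] (EFin \o (fun t : R => r * u t)).
  by move=> hu; apply: eq_integrable (integrableZl _ r hu).
rewrite /cint; apply/eqP; rewrite eq_complex/=; apply/andP; split; apply/eqP.
  rewrite -mulNr -!RintegralZl// -RintegralD//; [|exact: Z..].
  by apply: eq_Rintegral => t _; case: (F _) => ? ? /=; rewrite mulNr.
rewrite -!RintegralZl// -RintegralD//; [|exact: Z..].
by apply: eq_Rintegral => t _; case: (F _) => ? ? /=.
Qed.

Lemma cintB a b F G : dfb (seg a b) F -> dfb (seg a b) G ->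
  cint a b (fun w => F w - G w) = cint a b F - cint a b G.
Proof.
move=> hF hG; rewrite cintD//; last exact: dfbN.
congr (_ + _); rewrite -mulN1r -cintZ//; by apply: eq_cint => t _; rewrite mulN1r.
Qed.

Lemma cint_sum a b (I : Type) (r : seq I) (F : I -> C R -> C R) :
  (forall i, dfb (seg a b) (F i)) ->
  cint a b (fun w => \sum_(i <- r) F i w) = \sum_(i <- r) cint a b (F i).
Proof.
move=> h; elim: r => [|i r ih].
  rewrite big_nil (@eq_cint _ _ _ (fun=> 0)) => [|t _]; last by rewrite big_nil.
  by rewrite /cint/= !Rintegral_cst//= !mul0r.
rewrite big_cons -ih -cintD//; last exact: dfb_sum.
by apply: eq_cint => t _; rewrite big_cons.
Qed.

(** Multiplication by the unimodular [u] makes the integral real and nonnegative; its real part is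
    then bounded pointwise by the modulus. *)
Lemma cint_cabs a b F : dfb (seg a b) F ->
  cabs (cint a b F) <= Rintegral leb `[a, b] (fun t => cabs (F t%:C)).
Proof.
move=> hF; set I := cint a b F; have [->|I0] := eqVneq I 0.
  by rewrite cabs0; apply: Rintegral_ge0 => t _; exact: cabs_ge0.
set u : C R := (cabs I)%:C / I.
have u1 : cabs u = 1.
  by rewrite /u cabsM cabsV cabs_rcge0 ?cabs_ge0// divff// gt_eqF// cabs_gt0.
have : (cabs I)%:C = cint a b (fun w => u * F w) by rewrite cintZ// -/I /u divfK.
move=> /(congr1 (fun z : R[i] => complex.Re z))/= ->.
apply: le_Rintegral => //; [|exact: cabs_integrable|].
  by apply: (@Re_integrable a b (fun w => u * F w)); apply: dfbM => //; exact: dfb_cst.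
by move=> t _; apply: le_trans (ler_norm _) _; apply: le_trans (Re_cabs _) _; rewrite cabsM u1 mul1r.
Qed.

Lemma cint_le a b F (M : R) : a <= b -> dfb (seg a b) F ->
  (forall t, a <= t <= b -> cabs (F t%:C) <= M) -> cabs (cint a b F) <= M * (b - a).
Proof.
move=> ab hF hM; apply: le_trans (cint_cabs hF) _.
have -> : M * (b - a) = Rintegral leb `[a, b] (fun=> M).
  rewrite Rintegral_cst//= lebesgue_measure_itv/= lte_fin; case: ltP => //= ba.
  by rewrite (_ : b = a) ?subrr//; apply/le_anti/andP; split.
apply: le_Rintegral => //; first exact: cabs_integrable.
  by apply: (@rcont_integrable a b (fun=> M)) => t _ e e0; exists 1 => // s _ _; rewrite subrr normr0 ltW.
Qed.

Lemma seg_sub a b a' b' : a <= a' -> b' <= b -> seg a' b' `<=` seg a b.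
Proof.
by move=> aa bb w [t /andP[t1 t2] ->]; apply: segP; rewrite (le_trans aa t1) (le_trans t2 bb).
Qed.

Lemma cint_cat a b c F : a <= b -> b <= c -> dfb (seg a c) F ->
  cint a c F = cint a b F + cint b c F.
Proof.
move=> ab bc hF.
have key u : leb.-integrable `[a, c] (EFin \o u) -> Rintegral leb `[a, c] u =
    Rintegral leb `[a, b] u + Rintegral leb `[b, c] u.
  move=> hu; rewrite -(@Rintegral_itv_obnd_cbnd R b); last first.
    by apply: integrableS hu => //; apply: subset_itvr; rewrite bnd_simp.
  by rewrite -(@Rintegral_itvB R u (BLeft a) (BRight c) b)// subrKC.
rewrite /cint; apply/eqP; rewrite eq_complex/=; apply/andP; split; apply/eqP; apply: key.
  exact: Re_integrable.
exact: Im_integrable.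
Qed.

(** One proof for the real and the imaginary part, which are the two values taken by [p]. *)
Lemma FTC_part a b (p : {additive C R -> R}) F G : a < b ->
  (forall (r : R) (z : C R), p (z * r%:C) = p z * r) ->
  (forall z w, `|p z - p w| <= cabs (z - w)) ->
  (forall t, a <= t <= b -> cdif (seg a b) F t%:C (G t%:C)) -> dfb (seg a b) G ->
  Rintegral leb `[a, b] (fun t => p (G t%:C)) = p (F b%:C) - p (F a%:C).
Proof.
move=> ab pr lip FG hG; rewrite /Rintegral.
have hF : dfb (seg a b) F by move=> _ [t tab ->]; exists (G t%:C); exact: FG.
have drv t : t \in `]a, b[%R -> is_derive t (1 : R) (fun t : R => p (F t%:C)) (p (G t%:C)).
  rewrite in_itv/= => /andP[at_ tb]; have tab : a <= t <= b by rewrite !ltW.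
  have [phi [fE pz cphi]] := FG t tab.
  have h : (h^-1 *: (p (F (h *: (1 : R) + t)%:C) - p (F t%:C))) @[h --> 0^'] --> p (G t%:C).
    apply/cvgrPdist_le => e e0; have [d d0 hd] := cphi e e0.
    near=> h; have h0 : h != 0 by near: h; exact: nbhs_dnbhs_neq.
    have hm : `|h| < Num.min d (Num.min (t - a) (b - t)).
      near: h; apply: dnbhs0_lt; rewrite !lt_min d0 !subr_gt0 at_ tb//.
    move: hm; rewrite !lt_min !ltr_norml => /and3P[hd1 /andP[h1 h2] /andP[h3 h4]].
    rewrite /GRing.scale/= mulr1 -raddfB fE; last by apply: segP; apply/andP; split; lra.
    rewrite -rmorphB addrK pr mulrCA mulVf// mulr1.
    apply: le_trans (lip _ _) _; rewrite cabsC; apply: hd; first by apply: segP; apply/andP; split; lra.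
    by rewrite rcB_cabs addrK ltr_norml.
  by apply: DeriveDef; [apply/cvg_ex; exists (p (G t%:C))|exact: cvg_lim h].
rewrite (@continuous_FTC2 R _ (fun t => p (F t%:C)) a b)//.
- exact: rcont_within (dfb_rcont lip hG).
- have := rcont_within (dfb_rcont lip hF); rewrite continuous_within_itvP// => -[_ ca cb].
  by split=> // t tab; have [] := drv t tab.
- by move=> t tab; rewrite derive1E; have [_ ->] := drv t tab.
Unshelve. all: by end_near. Qed.

Lemma cint_FTC a b F G : a <= b ->
  (forall t, a <= t <= b -> cdif (seg a b) F t%:C (G t%:C)) -> dfb (seg a b) G ->
  cint a b G = F b%:C - F a%:C.
Proof.
rewrite le_eqVlt => /predU1P[<- _ _|ab FG hG].
  rewrite subrr /cint set_itv1; have Z u : Rintegral leb [set a] u = 0.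
    by rewrite Rintegral_set1.
  by rewrite !Z.
rewrite /cint; apply/eqP; rewrite eq_complex/=.
rewrite (@FTC_part a b (@complex.Re R) F G)//; last exact: Re_lip; last first.
  by move=> r [x y] /=; rewrite mulr0 subr0.
rewrite (@FTC_part a b (@complex.Im R) F G)//; last exact: Im_lip; last first.
  by move=> r [x y] /=; rewrite mulr0 add0r.
by case: (F _) => ? ?; case: (F _) => ? ? /=; rewrite !eqxx.
Qed.

End PathIntegrals.

(** * Goursat's theorem for a homotopy of circles *)

Section CircleHomotopy.
Variable R : realType.
Implicit Types (a b c h : R).

(** One of the four quarters of a failing square fails, and choice iterates this; the inequalities
    say that the successive squares are nested. *)
Lemma bisection_step (P : R -> R -> R -> Prop) :
  (forall a c h, 0 <= a -> a + h <= 1 -> 0 <= c -> c + h <= 1 -> 0 < h ->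
    P a c (h / 2) -> P (a + h / 2) c (h / 2) -> P a (c + h / 2) (h / 2) ->
    P (a + h / 2) (c + h / 2) (h / 2) -> P a c h) ->
  ~ P 0 0 1 -> exists u v : nat -> R, forall n,
    [/\ ~ P (u n) (v n) (2^-1 ^+ n), 0 <= u n <= u n.+1 /\ u n.+1 + 2^-1 ^+ n.+1 <= u n + 2^-1 ^+ n,
        0 <= v n <= v n.+1 /\ v n.+1 + 2^-1 ^+ n.+1 <= v n + 2^-1 ^+ n,
        u n + 2^-1 ^+ n <= 1 & v n + 2^-1 ^+ n <= 1].
Proof.
move=> hP nP.
pose Q n (x : R * R) := [/\ ~ P x.1 x.2 (2^-1 ^+ n), 0 <= x.1, 0 <= x.2,
  x.1 + 2^-1 ^+ n <= 1 & x.2 + 2^-1 ^+ n <= 1].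
pose S n (x y : R * R) := [/\ x.1 <= y.1, x.2 <= y.2,
  y.1 + 2^-1 ^+ n.+1 <= x.1 + 2^-1 ^+ n & y.2 + 2^-1 ^+ n.+1 <= x.2 + 2^-1 ^+ n].
have step n x : Q n x -> exists y, Q n.+1 y /\ S n x y.
  case: x => a c [/= nPac a0 c0 a1 c1]; apply: contrapT => no.
  have h0 : 0 < 2^-1 ^+ n :> R by rewrite exprn_gt0.
  have E : 2^-1 ^+ n.+1 = 2^-1 ^+ n / 2 :> R by rewrite exprSr.
  have key y1 y2 : a <= y1 <= a + 2^-1 ^+ n / 2 -> c <= y2 <= c + 2^-1 ^+ n / 2 ->
      P y1 y2 (2^-1 ^+ n / 2).
    move=> /andP[? ?] /andP[? ?]; apply: contrapT => nP'; apply: no; exists (y1, y2).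
    by rewrite /Q /S /= E; split; split => //; lra.
  by apply: nPac; apply: hP => //; apply: key; lra.
have [F hF] : exists F : nat -> R * R -> R * R, forall n x, Q n x -> Q n.+1 (F n x) /\ S n x (F n x).
  have : forall nx : nat * (R * R), exists y, Q nx.1 nx.2 -> Q nx.1.+1 y /\ S nx.1 nx.2 y.
    move=> [n x]; have [q|nq] := pselect (Q n x); last by exists x.
    by have [y hy] := step n x q; exists y.
  by move=> /choice[F hF]; exists (fun n x => F (n, x)) => n x q; exact: (hF (n, x)).
pose w := fix w n := if n is k.+1 then F k (w k) else (0, 0).
have Qw n : Q n (w n).
  elim: n => [|n ih] /=; last by have [] := hF n _ ih.
  by split => //=; rewrite expr0 add0r.
exists (fun n => (w n).1), (fun n => (w n).2) => n.
have [q1 q2 q3 q4 q5] := Qw n; have [_ [s1 s2 s3 s4]] := hF n _ (Qw n).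
by split => //; split => //; apply/andP.
Qed.

Lemma nested_intervals (u : nat -> R) :
  (forall n, u n <= u n.+1 /\ u n.+1 + 2^-1 ^+ n.+1 <= u n + 2^-1 ^+ n) ->
  exists x, forall n, u n <= x <= u n + 2^-1 ^+ n.
Proof.
move=> hu.
have mono n m : u n <= u (n + m)%N /\ u (n + m)%N + 2^-1 ^+ (n + m) <= u n + 2^-1 ^+ n.
  elim: m => [|m [ih1 ih2]]; first by rewrite addn0.
  have [h1 h2] := hu (n + m)%N; rewrite addnS; split; lra.
have e0 n : 0 < 2^-1 ^+ n :> R by rewrite exprn_gt0.
have le n m : u m <= u n + 2^-1 ^+ n.
  have [nm|/ltnW mn] := leqP n m.
    by have [] := mono n (m - n)%N; rewrite subnKC// => _; have := e0 m; lra.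
  by have [] := mono m (n - m)%N; rewrite subnKC// => h _; have := e0 n; lra.
have hs : has_sup (range u) by split; [exists (u 0%N), 0%N|exists (u 0%N + 2^-1 ^+ 0) => _ [m _ <-]].
exists (sup (range u)) => n; apply/andP; split.
  by apply: sup_upper_bound => //; exists n.
by apply: ge_sup; [exact: hs.1|move=> _ [m _ <-]].
Qed.

(** Cousin's lemma: [P a c h] speaks of the square with lower corner (a, c) and side h. Failing
    squares, quartered forever, shrink to a point and contradict the local hypothesis there. *)
Lemma square_bisection (P : R -> R -> R -> Prop) :
  (forall a c h, 0 <= a -> a + h <= 1 -> 0 <= c -> c + h <= 1 -> 0 < h ->
    P a c (h / 2) -> P (a + h / 2) c (h / 2) -> P a (c + h / 2) (h / 2) ->
    P (a + h / 2) (c + h / 2) (h / 2) -> P a c h) ->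
  (forall x y, 0 <= x <= 1 -> 0 <= y <= 1 -> exists2 d : R, 0 < d &
    forall a c h, 0 <= a -> a + h <= 1 -> 0 <= c -> c + h <= 1 -> 0 < h -> h < d ->
      a <= x <= a + h -> c <= y <= c + h -> P a c h) -> P 0 0 1.
Proof.
move=> hP loc; apply: contrapT => nP.
have [u [v huv]] := bisection_step hP nP.
have [x hx] := @nested_intervals u (fun n => let: And5 _ (conj a b) _ _ _ := huv n in conj (andP a).2 b).
have [y hy] := @nested_intervals v (fun n => let: And5 _ _ (conj a b) _ _ := huv n in conj (andP a).2 b).
have x01 : 0 <= x <= 1.
  have [_ [/andP[u0 _] _] _ u1 _] := huv 0%N; have /andP[h1 h2] := hx 0%N.
  by apply/andP; split; lra.
have y01 : 0 <= y <= 1.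
  have [_ _ [/andP[u0 _] _] _ u1] := huv 0%N; have /andP[h1 h2] := hy 0%N.
  by apply/andP; split; lra.
have [d d0 hd] := loc x y x01 y01.
have [n nd] : exists n, 2^-1 ^+ n < d :> R.
  have : (2^-1 : R) ^+ n @[n --> \oo] --> 0.
    by apply: cvg_expr; rewrite ger0_norm// invf_lt1// ltr1n.
  move=> /cvgrPdist_lt/(_ d d0)[n _ /(_ n (leqnn n))]; rewrite /= sub0r normrN => h.
  by exists n; rewrite -[ltLHS]ger0_norm// exprn_ge0.
have [nPn [/andP[u0 _] _] [/andP[v0 _] _] u1 v1] := huv n.
apply: nPn; apply: hd => //; by rewrite exprn_gt0.
Qed.

Definition rline : set (C R) := [set w | exists t : R, w = t%:C].

Lemma seg_rline a b : seg a b `<=` rline.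
Proof. by move=> w [t _ ->]; exists t. Qed.

Lemma cdif_real (u v : R -> R) (u' v' t : R) :
  is_derive t (1 : R) u u' -> is_derive t (1 : R) v v' ->
  cdif rline (fun w => Complex (u (complex.Re (w : R[i]))) (v (complex.Re (w : R[i]))) : C R)
    t%:C (Complex u' v' : C R).
Proof.
have key (g : R -> R) g' : is_derive t (1 : R) g g' -> forall e, 0 < e -> exists2 d, 0 < d &
    forall s : R, s != t -> `|s - t| < d -> `|(g s - g t) / (s - t) - g'| <= e.
  move=> [dg g'E] e e0; have : h^-1 *: (g (h *: (1 : R) + t) - g t) @[h --> 0^'] --> g' by rewrite -g'E.
  move=> /cvgrPdist_le/(_ e e0)/nbhs_normP[d /= d0 hd]; exists d => // s st sd.
  have := hd (s - t); rewrite /= sub0r normrN subr_eq0 => /(_ sd st).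
  by rewrite /GRing.scale/= mulr1 subrK distrC mulrC.
move=> du dv; pose F (w : C R) : C R := Complex (u (complex.Re (w : R[i]))) (v (complex.Re (w : R[i]))).
exists (fun w => if w == t%:C then (Complex u' v' : C R) else (F w - F t%:C) / (w - t%:C)).
split=> [w _||e e0].
- case: eqP => [->|/eqP wz]; first by rewrite !subrr mulr0.
  by rewrite divfK// subr_eq0.
- by rewrite eqxx.
- have e20 : 0 < e / 2 by rewrite divr_gt0.
  have [d d0 hd] := key u u' du _ e20; have [d' d'0 hd'] := key v v' dv _ e20.
  exists (Num.min d d'); first by rewrite lt_min d0.
  move=> _ [s ->]; case: eqP => [_ _|/eqP st]; first by rewrite subrr cabs0 ltW.
  have {}st : s != t by apply: contra st => /eqP ->.
  rewrite rcB_cabs lt_min => /andP[sd sd'].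
  apply: le_trans (cabs_ReIm _) _; rewrite [leRHS]splitr -rmorphB -fmorphV /F.
  have -> : ((Complex (u s) (v s) : C R) - Complex (u t) (v t)) * (s - t)^-1%:C - (Complex u' v' : C R) =
    Complex ((u s - u t) / (s - t) - u') ((v s - v t) / (s - t) - v').
    by apply/eqP; rewrite eq_complex/= !mulr0 subr0 add0r !eqxx.
  by rewrite /= lerD// ?hd ?hd'.
Qed.

(** The circle is traversed once while the parameter runs over [0, 1]. Only the real part of [w] is
    read, so derivatives are taken relative to [rline]. *)
Definition cis (w : C R) : C R :=
  Complex (cos (2 * pi * complex.Re (w : R[i]))) (sin (2 * pi * complex.Re (w : R[i]))).

Definition twopii : C R := Complex 0 (2 * pi).

Lemma cis_cdif (t : R) : cdif rline cis t%:C (twopii * cis t%:C).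
Proof.
have -> : twopii * cis t%:C =
    (Complex (- sin (2 * pi * t) * (2 * pi)) (cos (2 * pi * t) * (2 * pi)) : C R).
  by apply/eqP; rewrite eq_complex/=; apply/andP; split; apply/eqP; ring.
have lin : is_derive t (1 : R) (fun s : R => 2 * pi * s) (2 * pi).
  have /is_derive_eq := is_deriveZ (2 * pi) (is_derive_id t (1 : R)); apply.
  by rewrite /GRing.scale/= mulr1.
by apply: (@cdif_real (fun s => cos (2 * pi * s)) (fun s => sin (2 * pi * s)));
  apply: is_derive1_comp.
Qed.

Lemma cis_dfb : dfb rline cis.
Proof. by move=> _ [t ->]; exists (twopii * cis t%:C); exact: cis_cdif. Qed.

Lemma cabs_cis (w : C R) : cabs (cis w) = 1.
Proof. by rewrite /cabs /= cos2Dsin2 sqrtr1. Qed.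

Lemma cis_neq0 (w : C R) : cis w != 0.
Proof. by rewrite -cabs_gt0 cabs_cis. Qed.

Lemma cis0 : cis (0 : R)%:C = 1.
Proof. by rewrite /cis /= mulr0 cos0 sin0. Qed.

Lemma cis1 : cis (1 : R)%:C = 1.
Proof. by rewrite /cis /= mulr1 mulr_natl cos2pi sin2pi. Qed.

Lemma cabs_twopii : cabs twopii = 2 * pi.
Proof. by rewrite /cabs /= expr0n add0r sqrtr_sqr ger0_norm// mulr_ge0// pi_ge0. Qed.

Lemma cis_lip (s t : R) : cabs (cis s%:C - cis t%:C) <= 2 * pi * `|s - t|.
Proof.
wlog ts : s t / t <= s => [hw|].
  by have [/hw//|/ltW/hw] := leP t s; rewrite cabsC distrC.
have dg : dfb (seg t s) (fun w => twopii * cis w).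
  by apply: dfbM; [exact: dfb_cst|apply: dfb_subset cis_dfb; exact: seg_rline].
rewrite -(@cint_FTC R t s cis (fun w => twopii * cis w))//; last first.
  by move=> x _; apply: cdif_subset (cis_cdif x); exact: seg_rline.
rewrite (ger0_norm (x := s - t)) ?subr_ge0//; apply: cint_le => // x _.
by rewrite cabsM cabs_cis mulr1 cabs_twopii.
Qed.

Variables (A0 A1 B0 B1 : C R).

(** A homotopy of circles: at time [u] the centre is A0 + u A1 and the radius B0 + u B1. Its
    derivatives in time and along the circle are [gam_l] and [gam_s]. *)
Definition gam (u v : C R) : C R := A0 + u * A1 + (B0 + u * B1) * cis v.
Definition gam_l (v : C R) : C R := A1 + B1 * cis v.
Definition gam_s (u v : C R) : C R := (B0 + u * B1) * (twopii * cis v).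

Lemma gam_cdif_l u v : cdif setT (fun w => gam w v) u (gam_l v).
Proof.
have h (c d : C R) : cdif setT (fun w => c + w * d) u d.
  have := cdifD (cdif_cst setT c u) (cdifM (cdif_id setT u) (cdif_cst setT d u)).
  by rewrite mul1r mulr0 addr0 add0r.
have := cdifD (h A0 A1) (cdifM (h B0 B1) (cdif_cst setT (cis v) u)).
by rewrite mulr0 addr0.
Qed.

Lemma gam_cdif_s u (t : R) : cdif rline (gam u) t%:C (gam_s u t%:C).
Proof.
have := cdifD (cdif_cst rline (A0 + u * A1) t%:C) (cdifZ (B0 + u * B1) (cis_cdif t)).
by rewrite add0r.
Qed.

Lemma gam_s_dfb u : dfb rline (gam_s u).
Proof.
apply: dfbM; first exact: dfb_cst.
by apply: dfbM; [exact: dfb_cst|exact: cis_dfb].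
Qed.

Definition side_s (f : C R -> C R) u c d := cint c d (fun w => f (gam u w) * gam_s u w).
Definition side_l (f : C R -> C R) v a b := cint a b (fun w => f (gam w v) * gam_l v).
(** The contour integral of [f] along the image under [gam] of the boundary of [a, b] x [c, d], run
    counterclockwise. *)
Definition bdry f a b c d : C R :=
  side_s f b%:C c d - side_s f a%:C c d - side_l f d%:C a b + side_l f c%:C a b.

Section Goursat.
Variables (U : set (C R)) (f : C R -> C R).
Hypothesis fU : dfb U f.
Hypothesis gU : forall l s : R, 0 <= l <= 1 -> 0 <= s <= 1 -> U (gam l%:C s%:C).

Lemma side_s_dfb (F : C R -> C R) (l c d : R) : 0 <= l <= 1 -> 0 <= c -> d <= 1 -> dfb U F ->
  dfb (seg c d) (fun w => F (gam l%:C w) * gam_s l%:C w).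
Proof.
move=> l01 c0 d1 hF; apply: dfbM; last by apply: dfb_subset (@gam_s_dfb _); exact: seg_rline.
apply: (@dfb_comp _ _ U) => // [w [t tcd ->]|w /seg_rline[t ->]].
  by apply: gU => //; lra.
by exists (gam_s l%:C t%:C); apply: cdif_subset (gam_cdif_s _ _); exact: seg_rline.
Qed.

Lemma side_l_dfb (F : C R -> C R) (s a b : R) : 0 <= s <= 1 -> 0 <= a -> b <= 1 -> dfb U F ->
  dfb (seg a b) (fun w => F (gam w s%:C) * gam_l s%:C).
Proof.
move=> s01 c0 d1 hF; apply: dfbM; last exact: dfb_cst.
apply: (@dfb_comp _ _ U) => // [w [t tcd ->]|w _].
  by apply: gU => //; lra.
by exists (gam_l s%:C); apply: cdif_subset (gam_cdif_l _ _).
Qed.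

(** An affine function has a quadratic primitive, so each side is a difference of its values at two
    corners, and these cancel. *)
Lemma bdry_affine (c0 c1 z0 : C R) a b c d : 0 <= a -> a <= b -> b <= 1 -> 0 <= c -> c <= d -> d <= 1 ->
  bdry (fun w => c0 + c1 * (w - z0)) a b c d = 0.
Proof.
move=> a0 ab b1 c00 cd d1; pose G (w : C R) := c0 * w + c1 / 2 * ((w - z0) * (w - z0)).
have affdfb (A : set (C R)) : dfb A (fun w => c0 + c1 * (w - z0)).
  apply: dfbD; first exact: dfb_cst.
  by apply: dfbM; [exact: dfb_cst|apply: dfbB; [exact: dfb_id|exact: dfb_cst]].
have Gd w : cdif setT G w (c0 + c1 * (w - z0)).
  have hB := cdifD (cdif_id setT w) (cdif_cst setT (- z0) w).
  have := cdifD (cdifZ c0 (cdif_id setT w)) (cdifZ (c1 / 2) (cdifM hB hB)).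
  by congr cdif; field.
have Ss l : 0 <= l <= 1 -> side_s (fun w => c0 + c1 * (w - z0)) l%:C c d =
    G (gam l%:C d%:C) - G (gam l%:C c%:C).
  move=> l01; rewrite /side_s (@cint_FTC R c d (fun w => G (gam l%:C w)))//; last exact: (@side_s_dfb (fun w => c0 + c1 * (w - z0))).
  move=> t _; apply: (@cdif_comp _ _ setT) => //.
  by apply: cdif_subset (gam_cdif_s _ _); exact: seg_rline.
have Sl s : 0 <= s <= 1 -> side_l (fun w => c0 + c1 * (w - z0)) s%:C a b =
    G (gam b%:C s%:C) - G (gam a%:C s%:C).
  move=> s01; rewrite /side_l (@cint_FTC R a b (fun w => G (gam w s%:C)))//; last exact: (@side_l_dfb (fun w => c0 + c1 * (w - z0))).
  move=> t _; apply: (@cdif_comp _ _ setT) => //.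
  exact: cdif_subset (gam_cdif_l _ _).
rewrite /bdry !Ss ?Sl; [ring|lra..].
Qed.

Lemma bdry_split a c h : 0 <= a -> a + h <= 1 -> 0 <= c -> c + h <= 1 -> 0 < h ->
  let m := a + h / 2 in let n := c + h / 2 in
  bdry f a (a + h) c (c + h) = bdry f a m c n + bdry f m (a + h) c n
    + bdry f a m n (c + h) + bdry f m (a + h) n (c + h).
Proof.
move=> a0 a1 c0 c1 h0 m n; rewrite /bdry.
have Ss l : 0 <= l <= 1 -> side_s f l%:C c (c + h) = side_s f l%:C c n + side_s f l%:C n (c + h).
  by move=> l01; apply: cint_cat; rewrite /n; [lra|lra|exact: side_s_dfb].
have Sl s : 0 <= s <= 1 -> side_l f s%:C a (a + h) = side_l f s%:C a m + side_l f s%:C m (a + h).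
  by move=> l01; apply: cint_cat; rewrite /m; [lra|lra|exact: side_l_dfb].
have h2 : 0 <= h / 2 by lra.
have [a01 b01 m01] : [/\ 0 <= a <= 1, 0 <= a + h <= 1 & 0 <= m <= 1] by split; rewrite /m; lra.
have [c01 d01 n01] : [/\ 0 <= c <= 1, 0 <= c + h <= 1 & 0 <= n <= 1] by split; rewrite /n; lra.
rewrite (Ss _ a01) (Ss _ b01) (Sl _ c01) (Sl _ d01).
have E (s1 s2 s3 s4 s5 s6 l1 l2 l3 l4 l5 l6 : C R) : s1 + s2 - (s3 + s4) - (l1 + l2) + (l3 + l4) =
  s5 - s3 - l5 + l3 + (s1 - s5 - l6 + l4) + (s6 - s4 - l1 + l5) + (s2 - s6 - l2 + l6) by ring.
exact: E.
Qed.

(** Bounds both partial derivatives of [gam] on the unit square and is a Lipschitz constant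
    there. *)
Let L : R := cabs A1 + cabs B1 + 2 * pi * (cabs B0 + cabs B1).

Let pi2_ge0 : 0 <= 2 * pi :> R.
Proof. by rewrite mulr_ge0// pi_ge0. Qed.

Let Lge0 : 0 <= L.
Proof. by rewrite /L !addr_ge0 ?cabs_ge0// mulr_ge0// addr_ge0 ?cabs_ge0. Qed.

Let radius_le (l : R) : 0 <= l <= 1 -> cabs (B0 + l%:C * B1) <= cabs B0 + cabs B1.
Proof.
move=> l01; apply: le_trans (cabsD _ _) _; rewrite lerD2l cabsM cabs_rcge0; last lra.
by rewrite ler_piMl ?cabs_ge0//; lra.
Qed.

Lemma gam_l_le v : cabs (gam_l v) <= L.
Proof.
apply: le_trans (cabsD _ _) _; rewrite cabsM cabs_cis mulr1 lerDl.
by rewrite mulr_ge0// addr_ge0 ?cabs_ge0.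
Qed.

Lemma gam_s_le (l : R) v : 0 <= l <= 1 -> cabs (gam_s l%:C v) <= L.
Proof.
move=> l01; rewrite /gam_s 2!cabsM cabs_cis mulr1 cabs_twopii mulrC.
have h := ler_wpM2l pi2_ge0 (radius_le l01).
by rewrite /L (le_trans h)// lerDr addr_ge0 ?cabs_ge0.
Qed.

Lemma gam_lip (l s x y : R) : 0 <= x <= 1 ->
  cabs (gam l%:C s%:C - gam x%:C y%:C) <= L * (`|l - x| + `|s - y|).
Proof.
move=> x01; have -> : gam l%:C s%:C - gam x%:C y%:C =
   (l%:C - x%:C) * gam_l s%:C + (B0 + x%:C * B1) * (cis s%:C - cis y%:C).
  by rewrite /gam /gam_l; ring.
apply: le_trans (cabsD _ _) _; rewrite 2!cabsM rcB_cabs mulrDr lerD//.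
  by rewrite mulrC ler_wpM2r// gam_l_le.
have h1 := cis_lip s y; have h2 := radius_le x01.
apply: (@le_trans _ _ ((cabs B0 + cabs B1) * (2 * pi * `|s - y|))).
  by apply: ler_pM => //; exact: cabs_ge0.
rewrite mulrA ler_wpM2r// /L mulrC lerDr addr_ge0 ?cabs_ge0//.
Qed.

Lemma bdryB (F G : C R -> C R) a b c d : dfb U F -> dfb U G ->
  0 <= a -> a <= b -> b <= 1 -> 0 <= c -> c <= d -> d <= 1 ->
  bdry (fun w => F w - G w) a b c d = bdry F a b c d - bdry G a b c d.
Proof.
move=> hF hG a0 ab b1 c0 cd d1.
have [a01 b01] : 0 <= a <= 1 /\ 0 <= b <= 1 by split; lra.
have [c01 d01] : 0 <= c <= 1 /\ 0 <= d <= 1 by split; lra.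
have Ss l : 0 <= l <= 1 -> side_s (fun w => F w - G w) l%:C c d = side_s F l%:C c d - side_s G l%:C c d.
  move=> l01; rewrite /side_s -cintB; [|exact: side_s_dfb..].
  by apply: eq_cint => t _; rewrite mulrBl.
have Sl s : 0 <= s <= 1 -> side_l (fun w => F w - G w) s%:C a b = side_l F s%:C a b - side_l G s%:C a b.
  move=> s01; rewrite /side_l -cintB; [|exact: side_l_dfb..].
  by apply: eq_cint => t _; rewrite mulrBl.
rewrite /bdry (Ss _ a01) (Ss _ b01) (Sl _ c01) (Sl _ d01).
have E (s1 s2 s3 s4 l1 l2 l3 l4 : C R) : s1 - s2 - (s3 - s4) - (l1 - l2) + (l3 - l4) =
  s1 - s3 - l1 + l3 - (s2 - s4 - l2 + l4) by ring.
exact: E.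
Qed.

Lemma bdry_le (F : C R -> C R) a b c d (M : R) : dfb U F ->
  0 <= a -> a <= b -> b <= 1 -> 0 <= c -> c <= d -> d <= 1 -> 0 <= M ->
  (forall l s : R, a <= l <= b -> c <= s <= d -> cabs (F (gam l%:C s%:C)) <= M) ->
  cabs (bdry F a b c d) <= 2 * (M * L * ((b - a) + (d - c))).
Proof.
move=> hF a0 ab b1 c0 cd d1 M0 hM.
have [a01 b01] : 0 <= a <= 1 /\ 0 <= b <= 1 by split; lra.
have [c01 d01] : 0 <= c <= 1 /\ 0 <= d <= 1 by split; lra.
have Ss l : a <= l <= b -> cabs (side_s F l%:C c d) <= M * L * (d - c).
  move=> lab; have l01 : 0 <= l <= 1 by lra.
  apply: cint_le => // [|t tcd]; first exact: side_s_dfb.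
  by rewrite cabsM; apply: ler_pM; rewrite ?cabs_ge0// ?hM// gam_s_le.
have Sl s : c <= s <= d -> cabs (side_l F s%:C a b) <= M * L * (b - a).
  move=> scd; have s01 : 0 <= s <= 1 by lra.
  apply: cint_le => // [|t tab]; first exact: side_l_dfb.
  by rewrite cabsM; apply: ler_pM; rewrite ?cabs_ge0// ?hM// gam_l_le.
have h1 := Ss a; have h2 := Ss b; have h3 := Sl c; have h4 := Sl d.
rewrite !lexx ab cd in h1 h2 h3 h4.
rewrite /bdry (le_trans (cabsD _ _))//.
have -> : 2 * (M * L * (b - a + (d - c))) =
  M * L * (d - c) + M * L * (d - c) + M * L * (b - a) + M * L * (b - a) by ring.
rewrite lerD ?h3// (le_trans (cabsB _ _))// lerD ?h4// (le_trans (cabsB _ _))// lerD ?h1 ?h2//.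
Qed.

(** Goursat's argument: the bound e h^2 for a square of side h is additive under quartering, and it
    holds on small squares, where [f] is affine up to an error small relative to the distance. *)
Lemma bdry_eq0 : bdry f 0 1 0 1 = 0.
Proof.
apply/eqP; rewrite -cabs_eq0 eq_le cabs_ge0 andbT; apply/ler_addgt0Pr => e e0; rewrite add0r.
have := @square_bisection (fun a c h => cabs (bdry f a (a + h) c (c + h)) <= e * h ^+ 2).
rewrite add0r expr1n mulr1; apply.
  move=> a c h a0 a1 c0 c1 h0.
  have E b : b + h / 2 + h / 2 = b + h by rewrite -addrA -splitr.
  rewrite !E => P1 P2 P3 P4; rewrite (bdry_split a0 a1 c0 c1 h0).
  have -> : e * h ^+ 2 = e * (h / 2) ^+ 2 + e * (h / 2) ^+ 2 + e * (h / 2) ^+ 2 + e * (h / 2) ^+ 2.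
    by field.
  exact: le_trans (cabsD _ _) (lerD (le_trans (cabsD _ _)
    (lerD (le_trans (cabsD _ _) (lerD P1 P2)) P3)) P4).
move=> x y x01 y01; have Uz := gU x01 y01; set z0 := gam x%:C y%:C in Uz.
have [l0 [phi [fE _ cphi]]] := fU Uz.
have K0 : 0 < 8 * L ^+ 2 + 1 by rewrite ltr_wpDl// mulr_ge0// exprn_ge0.
(* On a square of side h the error is at most [e1] times the distance 2 L h, and the image of its
   boundary has length at most 4 L h, whence 8 L^2. *)
have e10 : 0 < e / (8 * L ^+ 2 + 1) by rewrite divr_gt0.
set e1 := e / _ in e10.
have [d d0 hd] := cphi e1 e10.
have L20 : 0 < 2 * L + 1 by rewrite ltr_wpDl// mulr_ge0.
exists (d / (2 * L + 1)); first by rewrite divr_gt0.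
move=> a c h a0 a1 c0 c1 h0 hd1 xa yc.
have aff : dfb U (fun w => f z0 + l0 * (w - z0)).
  apply: dfbD; first exact: dfb_cst.
  by apply: dfbM; [exact: dfb_cst|apply: dfbB; [exact: dfb_id|exact: dfb_cst]].
have ah : a <= a + h by lra.
have ch : c <= c + h by lra.
have := bdryB fU aff a0 ah a1 c0 ch c1.
rewrite bdry_affine// subr0 => <-.
have Lh : L * (h + h) < d.
  apply: (@le_lt_trans _ _ (h * (2 * L + 1))); last by rewrite -ltr_pdivlMr.
  have -> : h * (2 * L + 1) = L * (h + h) + h by ring.
  by rewrite lerDl ltW.
apply: (@le_trans _ _ (2 * (e1 * (L * (h + h)) * L * ((a + h - a) + (c + h - c))))).
  apply: bdry_le => //; first exact: dfbB.
    by rewrite mulr_ge0 ?(ltW e10)// mulr_ge0//; lra.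
  move=> l s lab scd; have Uw : U (gam l%:C s%:C) by apply: gU; lra.
  have -> : f (gam l%:C s%:C) - (f z0 + l0 * (gam l%:C s%:C - z0)) =
      (phi (gam l%:C s%:C) - l0) * (gam l%:C s%:C - z0).
    by rewrite mulrBl -fE//; ring.
  have dist : cabs (gam l%:C s%:C - z0) <= L * (h + h).
    apply: le_trans (gam_lip _ _ _ x01) _; rewrite ler_wpM2l// lerD// ler_norml; lra.
  rewrite cabsM; apply: ler_pM; rewrite ?cabs_ge0//.
  by apply: hd => //; exact: le_lt_trans dist Lh.
have -> : 2 * (e1 * (L * (h + h)) * L * (a + h - a + (c + h - c))) =
  e1 * (8 * L ^+ 2) * h ^+ 2 by ring.
rewrite ler_wpM2r ?exprn_ge0 ?(ltW h0)// /e1 mulrAC ler_pdivrMr// ler_wpM2l ?(ltW e0)//.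
by rewrite lerDl.
Qed.

(** The curves are closed, so the sides at parameters 0 and 1 coincide and cancel in [bdry]. *)
Lemma circle_homotopy : side_s f 1 0 1 = side_s f 0 0 1.
Proof.
have := bdry_eq0; rewrite /bdry.
have -> : side_l f (1 : R)%:C 0 1 = side_l f (0 : R)%:C 0 1.
  by rewrite /side_l /gam /gam_l cis0 cis1.
by rewrite subrK => /eqP; rewrite subr_eq0 => /eqP.
Qed.

End Goursat.
End CircleHomotopy.
Arguments rline {R}.
Arguments twopii {R}.

(** * Cauchy's formula and Taylor coefficients *)

Section CauchyFormula.
Variable R : realType.
Implicit Types (r t : R) (f E : C R -> C R).

Lemma dfb_bounded a b (F : C R -> C R) : a <= b -> dfb (seg a b) F ->
  exists2 M : R, 0 <= M & forall t, a <= t <= b -> cabs (F t%:C) <= M.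
Proof.
move=> ab hF; have [c _ hc] := EVT_max ab (rcont_within (dfb_rcont (@cabs_lip R) hF)).
exists (cabs (F c%:C)); first exact: cabs_ge0.
by move=> t tab; apply: hc; rewrite in_itv.
Qed.

Section Circle.
Variable r : R.
Hypothesis r0 : 0 < r.

Definition circ (w : C R) : C R := r%:C * cis w.

Lemma cabs_circ w : cabs (circ w) = r.
Proof. by rewrite cabsM cabs_cis mulr1 cabs_rcge0// ltW. Qed.

Lemma circ_dfb : dfb rline circ.
Proof. by apply: dfbM; [exact: dfb_cst|exact: cis_dfb]. Qed.

Lemma circ_neq0 w : circ w != 0.
Proof. by rewrite -cabs_gt0 cabs_circ. Qed.

Lemma circ_sub_ge (a w : C R) : r - cabs a <= cabs (circ w - a).
Proof. by have := cabs_subl (circ w) a; rewrite cabs_circ. Qed.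

Lemma circ_sub_neq0 (a w : C R) : cabs a < r -> circ w - a != 0.
Proof. by move=> ar; rewrite -cabs_gt0; have := circ_sub_ge a w; lra. Qed.

Definition kern (a w : C R) : C R := (circ w - a)^-1.

Lemma kern_dfb (a : C R) : cabs a < r -> dfb rline (kern a).
Proof.
move=> ar; apply: dfbV; first by move=> w _; exact: circ_sub_neq0.
by apply: dfbB; [exact: circ_dfb|exact: dfb_cst].
Qed.

Lemma kern_le (a w : C R) (d : R) : 0 < d -> cabs a <= r - d -> cabs (kern a w) <= d^-1.
Proof.
move=> d0 ad; rewrite cabsV lef_pV2 ?posrE//; first by have := circ_sub_ge a w; lra.
by have := circ_sub_ge a w; lra.
Qed.

Lemma kernB (a b w : C R) : cabs a < r -> cabs b < r ->
  kern b w - kern a w = (b - a) * (kern b w * kern a w).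
Proof.
move=> ar br; have h1 := circ_sub_neq0 w ar; have h2 := circ_sub_neq0 w br.
rewrite /kern; field; exact/andP.
Qed.

Section Transform.
Variable E : C R -> C R.
Hypothesis hE : dfb (seg 0 1) E.

(** The Cauchy transform, with the n-th power of the kernel, of a density [E] on the circle. *)
Definition ctr n (a : C R) : C R := cint 0 1 (fun w => E w * kern a w ^+ n).

Lemma kernX_dfb (a : C R) n : cabs a < r -> dfb (seg (0 : R) 1) (fun w => kern a w ^+ n).
Proof. by move=> ar; apply: dfbX; apply: dfb_subset (kern_dfb ar); exact: seg_rline. Qed.

Lemma ctr_dfb (a : C R) n : cabs a < r -> dfb (seg 0 1) (fun w => E w * kern a w ^+ n).
Proof. by move=> ar; apply: dfbM => //; exact: kernX_dfb. Qed.

Lemma ctr_cont n (a : C R) : cabs a < r -> lim_at [set w | cabs w < r] (ctr n) a (ctr n a).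
Proof.
move=> ar; have [M M0 hM] := dfb_bounded ler01 hE.
pose d := (r - cabs a) / 2.
have d0 : 0 < d by rewrite /d divr_gt0// subr_gt0.
(* Collects the bound of [E], the two kernels left by [kernB], and the n products of n - 1 kernels
   in the factorisation of a difference of n-th powers; each kernel is at most 1/d. *)
pose K := M * (d^-1 * d^-1 * (n%:R * d^-1 ^+ n.-1)).
have K0 : 0 <= K by rewrite /K !mulr_ge0// ?exprn_ge0// invr_ge0 ltW.
have K1 : 0 < K + 1 by rewrite ltr_wpDl.
move=> e e0; exists (Num.min d (e / (K + 1))).
  by rewrite lt_min d0 divr_gt0.
move=> b /= br; rewrite lt_min => /andP[bd be].
have ad : cabs a <= r - d by rewrite /d; lra.
have bd' : cabs b <= r - d by have := cabs_subl b a; rewrite /d in bd *; lra.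
rewrite /ctr -cintB; [|exact: ctr_dfb..].
apply: (@le_trans _ _ (K * cabs (b - a) * (1 - 0))); last first.
  rewrite subr0 mulr1; apply: (@le_trans _ _ ((K + 1) * (e / (K + 1)))).
    by apply: ler_pM; rewrite ?cabs_ge0// ?lerDl// ltW.
  by rewrite mulrC divfK// gt_eqF.
apply: cint_le => // [|t t01]; first by apply: dfbB; exact: ctr_dfb.
rewrite -mulrBr cabsM.
have -> : K * cabs (b - a) = M * (cabs (b - a) * (d^-1 * d^-1) * (n%:R * d^-1 ^+ n.-1)).
  by rewrite /K; ring.
apply: ler_pM; rewrite ?cabs_ge0// ?hM//.
have kb := kern_le t%:C d0 bd'; have ka := kern_le t%:C d0 ad.
rewrite subrXX cabsM kernB// !cabsM; apply: ler_pM; rewrite ?cabs_ge0 ?mulr_ge0 ?cabs_ge0//.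
  by rewrite ler_wpM2l ?cabs_ge0//; apply: ler_pM; rewrite ?cabs_ge0.
apply: le_trans (cabs_sum _ _ _) _.
rewrite -[X in X%:R * _]card_ord mulr_natl -sumr_const; apply: ler_sum => i _.
rewrite cabsM !cabsX.
have in1 : (i <= n.-1)%N by rewrite -ltnS (ltn_predK (ltn_ord i)).
rewrite -[X in _ <= _ ^+ X](subnK in1) exprD.
by apply: ler_pM; rewrite ?exprn_ge0 ?cabs_ge0//; apply: lerXn2r;
  rewrite ?nnegrE ?cabs_ge0// invr_ge0 ltW.
Qed.

End Transform.

(** By [kernB] the difference quotient is again a Cauchy transform, with density E times the kernel
    at [a], hence continuous by [ctr_cont]. *)
Lemma ctr_cdif1 E (a : C R) : dfb (seg 0 1) E -> cabs a < r ->
  cdif [set w | cabs w < r] (ctr E 1) a (ctr E 2 a).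
Proof.
move=> hE ar; have hEk : dfb (seg 0 1) (fun w => E w * kern a w ^+ 1) by exact: ctr_dfb.
exists (ctr (fun w => E w * kern a w ^+ 1) 1); split=> [b br||].
- rewrite /ctr mulrC -cintZ; last exact: ctr_dfb.
  rewrite -cintB; [|exact: ctr_dfb..].
  apply: eq_cint => t _; rewrite !expr1 -mulrBr kernB//; ring.
- by apply: eq_cint => t _; rewrite !expr1 expr2 mulrA.
- have -> : ctr E 2 a = ctr (fun w => E w * kern a w ^+ 1) 1 a.
    by apply: eq_cint => t _; rewrite !expr1 expr2 mulrA.
  exact: ctr_cont.
Qed.

Lemma ctr_cdif2 E (a : C R) : dfb (seg 0 1) E -> cabs a < r ->
  exists l, cdif [set w | cabs w < r] (ctr E 2) a l.
Proof.
move=> hE ar; pose E1 := fun w => E w * kern a w ^+ 1; pose E2 := fun w => E w * kern a w ^+ 2.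
have h1 : dfb (seg 0 1) E1 by exact: ctr_dfb.
have h2 : dfb (seg 0 1) E2 by exact: ctr_dfb.
exists (ctr E1 2 a + ctr E2 1 a); exists (fun b => ctr E1 2 b + ctr E2 1 b); split=> [b br|//|].
- rewrite /ctr -cintD; [|exact: ctr_dfb..].
  rewrite mulrC -cintZ; last by apply: dfbD; exact: ctr_dfb.
  rewrite -cintB; [|exact: ctr_dfb..].
  apply: eq_cint => t _; rewrite /E1 /E2 !expr1 -mulrBr subr_sqr kernB//; ring.
- by apply: limD; exact: ctr_cont.
Qed.

End Circle.

Lemma holo_circ_dfb f r : holo f -> 0 < r -> r < 1 -> dfb rline (fun w => f (circ r w)).
Proof.
move=> /holo_dfb hf r0 r1; apply: (dfb_comp _ hf); last exact: circ_dfb.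
by move=> w _; rewrite /inD cabs_circ.
Qed.

(** Up to the factor 2 pi i, the mean of [F] over a circle about 0 is the contour integral of
    F(w)/w, invariant under the homotopy of concentric circles in the punctured disc. *)
Lemma coef_indep (F : C R -> C R) r r' : dfb [set w | inD w /\ w != 0] F ->
  0 < r -> r < 1 -> 0 < r' -> r' < 1 ->
  cint 0 1 (fun w => F (circ r w)) = cint 0 1 (fun w => F (circ r' w)).
Proof.
move=> hF r0 r1 r'0 r'1.
have FD s : 0 < s -> s < 1 -> dfb (seg 0 1) (fun w => F (circ s w)).
  move=> s0 s1; apply: (dfb_comp _ hF) => [w _ /=|].
    by rewrite /inD cabs_circ// circ_neq0.
  by apply: dfb_subset (@circ_dfb s); exact: seg_rline.
have hG : dfb [set w | inD w /\ w != 0] (fun w => F w * w^-1).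
  by apply: dfbM => //; apply: dfbV => [w []//|]; exact: dfb_id.
have gU (l s : R) : 0 <= l <= 1 -> 0 <= s <= 1 ->
    [set w | inD w /\ w != 0] (gam 0 0 r%:C (r'%:C - r%:C) l%:C s%:C).
  move=> l01 _; have -> : gam 0 0 r%:C (r'%:C - r%:C) l%:C s%:C = circ (r + l * (r' - r)) s%:C.
    by rewrite /gam /circ !rmorphD rmorphM rmorphB /=; ring.
  have s0 : 0 < r + l * (r' - r) by nra.
  split; last by rewrite circ_neq0.
  by rewrite /inD cabs_circ//; have [h|h] := lerP l (1 / 2); nra.
have := circle_homotopy hG gU.
have E u s : 0 < s -> s < 1 -> (r%:C + u * (r'%:C - r%:C) : C R) = s%:C ->
    side_s 0 0 r%:C (r'%:C - r%:C) (fun w => F w * w^-1) u 0 1 = twopii * cint 0 1 (fun w => F (circ s w)).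
  move=> s0 s1 us; rewrite /side_s -cintZ; last exact: FD.
  apply: eq_cint => t _; rewrite /gam /gam_s us mulr0 !add0r -/(circ s _).
  have c0 := circ_neq0 s0 t%:C; rewrite (mulrCA (s%:C)) -/(circ s _).
  by field.
rewrite (E 1 r')//; last by ring.
rewrite (E 0 r)//; last by ring.
by move=> /mulfI ->//; rewrite -cabs_gt0 cabs_twopii mulr_gt0// pi_gt0.
Qed.

(** The circle of radius r about 0 is deformed into one of radius d r about [a], moving centre and
    radius linearly without meeting [a]; there the integral is the mean of [f], close to [f a] for
    small d. *)
Lemma cauchy_formula f (a : C R) r : holo f -> cabs a < r -> r < 1 ->
  f a = cint 0 1 (fun w => f (circ r w) * (circ r w * kern r a w)).
Proof.
move=> hf ar r1; have r0 : 0 < r by apply: le_lt_trans ar; exact: cabs_ge0.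
have fD := (holo_dfb f).1 hf.
pose U := [set w : C R | inD w /\ w - a != 0].
have hG : dfb U (fun w => f w * (w - a)^-1).
  apply: dfbM; first by apply: dfb_subset fD => w [].
  apply: dfbV => [w []//|]; by apply: dfbB; [exact: dfb_id|exact: dfb_cst].
have hI : dfb (seg 0 1) (fun w => f (circ r w) * (circ r w * kern r a w)).
  apply: (dfb_subset (@seg_rline R 0 1)); apply: dfbM; first exact: holo_circ_dfb.
  by apply: dfbM; [exact: circ_dfb|exact: kern_dfb].
have tp0 : (twopii : C R) != 0 by rewrite -cabs_gt0 cabs_twopii mulr_gt0// pi_gt0.
have key d : 0 < d -> d < 1 -> cabs a + d * r <= r ->
    cint 0 1 (fun w => f (circ r w) * (circ r w * kern r a w)) =
    cint 0 1 (fun w => f (a + circ (d * r) w)).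
  move=> d0 d1 dr.
  have gU (l s : R) : 0 <= l <= 1 -> 0 <= s <= 1 ->
      U (gam a (- a) (d * r)%:C (r%:C - (d * r)%:C) l%:C s%:C).
    move=> l01 _; have l10 : 0 <= 1 - l by lra.
    have ra : 0 < r - cabs a by lra.
    have ca := cabs_ge0 a.
    have p0 : 0 < d * r + l * (r - d * r) by nra.
    have E : gam a (- a) (d * r)%:C (r%:C - (d * r)%:C) l%:C s%:C =
       (1 - l)%:C * a + circ (d * r + l * (r - d * r)) s%:C.
      by rewrite /gam /circ !(rmorphD, rmorphB, rmorphM, rmorph1) /=; ring.
    split.
      rewrite /inD E; apply: le_lt_trans (cabsD _ _) _.
      by rewrite cabsM cabs_rcge0// cabs_circ//; nra.
    rewrite E -cabs_gt0; have -> : (1 - l)%:C * a + circ (d * r + l * (r - d * r)) s%:C - a =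
        circ (d * r + l * (r - d * r)) s%:C - l%:C * a.
      by rewrite rmorphB/= rmorph1; ring.
    apply: lt_le_trans (cabs_subl _ _); rewrite cabs_circ// cabsM cabs_rcge0; last lra.
    by nra.
  have := circle_homotopy hG gU.
  have -> : side_s a (- a) (d * r)%:C (r%:C - (d * r)%:C) (fun w => f w * (w - a)^-1) 1 0 1 =
      twopii * cint 0 1 (fun w => f (circ r w) * (circ r w * kern r a w)).
    rewrite /side_s -cintZ//; apply: eq_cint => t _; rewrite /gam /gam_s /kern.
    have -> : a + 1 * - a + ((d * r)%:C + 1 * (r%:C - (d * r)%:C)) * cis t%:C = circ r t%:C.
      by rewrite /circ; ring.
    by rewrite /circ; ring.
  have hfa : dfb (seg 0 1) (fun w => f (a + circ (d * r) w)).
    apply: (dfb_comp _ fD) => [w _|].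
      rewrite /inD; apply: le_lt_trans (cabsD _ _) _; rewrite cabs_circ ?mulr_gt0//; lra.
    apply: dfbD; first exact: dfb_cst.
    by apply: dfb_subset (@circ_dfb (d * r)); exact: seg_rline.
  have -> : side_s a (- a) (d * r)%:C (r%:C - (d * r)%:C) (fun w => f w * (w - a)^-1) 0 0 1 =
      twopii * cint 0 1 (fun w => f (a + circ (d * r) w)).
    rewrite /side_s -cintZ//; apply: eq_cint => t _; rewrite /gam /gam_s !mul0r !addr0.
    have -> : a + (d * r)%:C * cis t%:C - a = (d * r)%:C * cis t%:C by ring.
    have h : (d * r)%:C * cis t%:C != 0 by rewrite circ_neq0// mulr_gt0.
    rewrite (mulrCA (d * r)%:C).
    have K (F k tp : C R) : k != 0 -> F / k * (tp * k) = tp * F by move=> k0; field.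
    exact: K.
  by move=> /mulfI ->.
apply/eqP; rewrite -subr_eq0 -cabs_eq0 eq_le cabs_ge0 andbT; apply/ler_addgt0Pr => e e0.
have aD : inD a by rewrite /inD; lra.
have [d' d'0 hd'] := dfb_cont fD aD e0.
(* The last bound keeps the small circle inside the large one, the middle one keeps it in the
   neighbourhood where [f] is close to [f a]. *)
pose d := Num.min (1 / 2) (Num.min (d' / 2) (1 - cabs a / r)).
have d0 : 0 < d by rewrite !lt_min !divr_gt0//= subr_gt0 ltr_pdivrMr// mul1r.
have [dh dd da] : [/\ d <= 1 / 2, d <= d' / 2 & d <= 1 - cabs a / r].
  by split; rewrite /d !ge_min lexx ?orbT.
have dr : cabs a + d * r <= r.
  by have := ler_wpM2r (ltW r0) da; rewrite mulrBl divfK ?gt_eqF// mul1r; lra.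
rewrite add0r (key d)//; last by lra.
have dr0 : 0 < d * r by rewrite mulr_gt0.
have inDa w : inD (a + circ (d * r) w).
  rewrite /inD; apply: le_lt_trans (cabsD _ _) _; rewrite cabs_circ//; lra.
have -> : f a = cint 0 1 (fun=> f a).
  by rewrite /cint !Rintegral_cst//= lebesgue_measure_itv/= lte01 -EFinB subr0 !mulr1; case: (f a).
have hfa : dfb (seg 0 1) (fun w => f (a + circ (d * r) w)).
  apply: (dfb_comp _ fD) => //.
  apply: dfbD; first exact: dfb_cst.
  by apply: dfb_subset (@circ_dfb (d * r)); exact: seg_rline.
rewrite -cintB//; last exact: dfb_cst.
apply: (@le_trans _ _ (e * (1 - 0))); last by rewrite subr0 mulr1.
apply: cint_le => // [|t t01].
  by apply: dfbB => //; exact: dfb_cst.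
rewrite cabsC hd'//.
have -> : a + circ (d * r) t%:C - a = circ (d * r) t%:C by ring.
by rewrite cabs_circ//; nra.
Qed.

Lemma cderiv_ctr f r (a : C R) : holo f -> cabs a < r -> r < 1 ->
  cdif [set w | cabs w < r] f a (ctr r (fun w => f (circ r w) * circ r w) 2 a).
Proof.
move=> hf ar r1; have r0 : 0 < r by apply: le_lt_trans ar; exact: cabs_ge0.
have hE : dfb (seg 0 1) (fun w => f (circ r w) * circ r w).
  apply: (dfb_subset (@seg_rline R 0 1)); apply: dfbM; first exact: holo_circ_dfb.
  exact: circ_dfb.
apply: (cdif_ext _ _ (ctr_cdif1 r0 hE ar)) => // b br.
rewrite (cauchy_formula hf br r1); apply: eq_cint => t _; by rewrite expr1 mulrA.
Qed.

(** On the disc of radius (1 + |a|)/2 the derivative is a Cauchy transform with squared kernel,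
    differentiable by [ctr_cdif2]. *)
Lemma holo_cderiv f : holo f -> holo (cderiv f).
Proof.
move=> hf a aD; pose r := (1 + cabs a) / 2; have := aD; rewrite /inD => a1.
have ar : cabs a < r by rewrite /r; lra.
have r1 : r < 1 by rewrite /r; lra.
have r0 : 0 < r by apply: le_lt_trans ar; exact: cabs_ge0.
have hE : dfb (seg 0 1) (fun w => f (circ r w) * circ r w).
  apply: (dfb_subset (@seg_rline R 0 1)); apply: dfbM; first exact: holo_circ_dfb.
  exact: circ_dfb.
have [l hl] := ctr_cdif2 r0 hE ar.
suff /cdif_derive[] : cdif setT (cderiv f) a l by [].
apply: (cdif_ball ar); apply: cdif_ext hl => // b br.
by have /cdif_derive[_ ->] := cdif_ball br (cderiv_ctr hf br r1).
Qed.

(** For holomorphic [f], the m-th Taylor coefficient at 0, computed on the circle of radius [r]. *)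
Definition coef f r m : C R := cint 0 1 (fun w => f (circ r w) * (circ r w ^+ m)^-1).

Lemma coef_dfb f r m : holo f -> 0 < r -> r < 1 ->
  dfb (seg 0 1) (fun w => f (circ r w) * (circ r w ^+ m)^-1).
Proof.
move=> hf r0 r1; apply: (dfb_subset (@seg_rline R 0 1)); apply: dfbM; first exact: holo_circ_dfb.
apply: dfbV; first by move=> w _; rewrite expf_neq0// circ_neq0.
by apply: dfbX; exact: circ_dfb.
Qed.

Lemma coef_radius f r r' m : holo f -> 0 < r -> r < 1 -> 0 < r' -> r' < 1 ->
  coef f r m = coef f r' m.
Proof.
move=> hf r0 r1 r'0 r'1; apply: (@coef_indep (fun w => f w * (w ^+ m)^-1)) => //.
apply: dfbM; first by apply: dfb_subset ((holo_dfb f).1 hf) => w [].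
by apply: dfbV => [w [_ w0]|]; [rewrite expf_neq0|apply: dfbX; exact: dfb_id].
Qed.

(** Expanding z/(z - a) as a geometric series in a/z under Cauchy's integral leaves z/(z - a)
    (a/z)^M after M terms. *)
Lemma taylor_remainder f r (a : C R) (B : R) M : holo f -> cabs a < r -> r < 1 ->
  (forall t, 0 <= t <= 1 -> cabs (f (circ r t%:C)) <= B) ->
  cabs (f a - \sum_(m < M) coef f r m * a ^+ m) <= B * (r / (r - cabs a)) * (cabs a / r) ^+ M.
Proof.
move=> hf ar r1 hB; have r0 : 0 < r by apply: le_lt_trans ar; exact: cabs_ge0.
have B0 : 0 <= B by apply: le_trans (hB 0 _); rewrite ?cabs_ge0 ?lexx ?ler01.
have hI : dfb (seg 0 1) (fun w => f (circ r w) * (circ r w * kern r a w)).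
  apply: (dfb_subset (@seg_rline R 0 1)); apply: dfbM; first exact: holo_circ_dfb.
  by apply: dfbM; [exact: circ_dfb|exact: kern_dfb].
have hS i : dfb (seg 0 1) (fun w => a ^+ i * (f (circ r w) * (circ r w ^+ i)^-1)).
  by apply: dfbM; [exact: dfb_cst|exact: coef_dfb].
have -> : \sum_(m < M) coef f r m * a ^+ m =
    cint 0 1 (fun w => \sum_(m < M) a ^+ m * (f (circ r w) * (circ r w ^+ m)^-1)).
  rewrite cint_sum//; apply: eq_bigr => i _; rewrite cintZ 1?mulrC//; exact: coef_dfb.
rewrite (cauchy_formula hf ar r1) -cintB//; last exact: dfb_sum.
rewrite -[leRHS]mulr1 -[X in _ * X]subr0; apply: cint_le => // [|t t01].
  by apply: dfbB => //; exact: dfb_sum.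
have z0 := circ_neq0 r0 t%:C; have za := circ_sub_neq0 r0 t%:C ar.
set z := circ r t%:C in z0 za *.
have kE : kern r a t%:C = (z - a)^-1 by [].
have -> : f z * (z * kern r a t%:C) - \sum_(m < M) a ^+ m * (f z * (z ^+ m)^-1) =
   f z * (z * kern r a t%:C * (a / z) ^+ M).
  have -> : \sum_(m < M) a ^+ m * (f z * (z ^+ m)^-1) = f z * \sum_(m < M) (a / z) ^+ m.
    by rewrite mulr_sumr; apply: eq_bigr => i _; rewrite expr_div_n; ring.
  rewrite -mulrBr; congr (_ * _); apply: (mulfI za).
  have -> : (z - a) * (z * kern r a t%:C - \sum_(m < M) (a / z) ^+ m) =
     z - z * ((1 - a / z) * \sum_(m < M) (a / z) ^+ m).
    rewrite kE; set S := \sum_(_ < _) _; by field; rewrite ?z0 ?za.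
  have -> : (1 - a / z) * \sum_(m < M) (a / z) ^+ m = 1 - (a / z) ^+ M.
    by rewrite -[1 - _]opprB -[RHS]opprB subrX1 mulNr.
  rewrite kE; set S := _ ^+ M; by field; rewrite ?z0 ?za.
rewrite !cabsM cabsX cabsM cabsV cabs_circ// -!mulrA; apply: ler_pM; rewrite ?cabs_ge0 ?hB//.
  by rewrite !mulr_ge0 ?cabs_ge0 ?exprn_ge0 ?divr_ge0 ?cabs_ge0// ltW.
rewrite cabs_rcge0 ?(ltW r0)// cabs_cis mul1r ler_wpM2l ?(ltW r0)// ler_wpM2r ?exprn_ge0 ?divr_ge0 ?cabs_ge0 ?(ltW r0)//.
by apply: kern_le => //; rewrite ?subr_gt0//; lra.
Qed.

Lemma coef_eq0 f r : holo f -> 0 < r -> r < 1 -> (forall m, coef f r m = 0) ->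
  forall a, inD a -> f a = 0.
Proof.
move=> hf r0 r1 hc a; rewrite /inD => a1; pose s := (1 + cabs a) / 2.
have ar : cabs a < s by rewrite /s; lra.
have s1 : s < 1 by rewrite /s; lra.
have s0 : 0 < s by apply: le_lt_trans ar; exact: cabs_ge0.
have [B B0 hB] := dfb_bounded ler01 (dfb_subset (@seg_rline R 0 1) (holo_circ_dfb hf s0 s1)).
apply/eqP; rewrite -cabs_eq0 eq_le cabs_ge0 andbT; apply/ler_addgt0Pr => e e0; rewrite add0r.
have q1 : cabs a / s < 1 by rewrite ltr_pdivrMr// mul1r.
have q0 : 0 <= cabs a / s by rewrite divr_ge0 ?cabs_ge0// ltW.
have : B * (s / (s - cabs a)) * (cabs a / s) ^+ n @[n --> \oo] --> B * (s / (s - cabs a)) * 0.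
  by apply: cvgM; [exact: cvg_cst|apply: cvg_expr; rewrite ger0_norm].
rewrite mulr0 => /cvgrPdist_lt/(_ e e0)[n _ /(_ n (leqnn n))]; rewrite /= sub0r normrN => h.
have := taylor_remainder n hf ar s1 hB.
rewrite big1 ?subr0 => [h2|i _]; last by rewrite (coef_radius i hf s0 s1 r0 r1) hc mul0r.
exact: le_trans h2 (le_trans (ler_norm _) (ltW h)).
Qed.

End CauchyFormula.

(** * Rotation invariance of plane Lebesgue measure *)

Section PlaneMeasure.
Variable R : realType.
Local Notation leb := (@lebesgue_measure R).
Local Notation leb2 := (leb \x leb)%E.
Implicit Types (F : R * R -> \bar R).

Definition pushforward_meas (d d' : measure_display) (T : measurableType d) (T' : measurableType d')
    (m : {measure set T -> \bar R}) (f : T -> T') (mf : measurable_fun setT f) :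
    {measure set T' -> \bar R} :=
  measure_function_pushforward__canonical__measure_function_Measure m mf.

Lemma integral_pushforward_meas (d d' : measure_display) (T : measurableType d) (T' : measurableType d')
    (m : {measure set T -> \bar R}) (f : T -> T') (mf : measurable_fun setT f) (g : T' -> \bar R) :
  measurable_fun setT g -> (forall x, 0 <= g x)%E ->
  (\int[pushforward_meas m mf]_x g x = \int[m]_x g (f x))%E.
Proof. by move=> mg g0; rewrite ge0_integral_pushforward. Qed.

Lemma lebesgue_affine (a b : R) (A : set R) : a != 0 -> measurable A ->
  (leb A = `|a|%:E * leb ((fun x => (a * x + b)%R) @^-1` A))%E.
Proof.
move=> a0 mA.
have mphi : measurable_fun setT ((fun x : R => a * x + b) : measurableTypeR R -> measurableTypeR R).
  by apply: measurable_funD => //; exact: measurable_funM.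
pose mu := mscale (NngNum (normr_ge0 a)) (pushforward_meas leb mphi).
rewrite (@lebesgue_measure_unique R mu)// => _ [[x y] _ <-].
change (leb `]x, y] = (`|a|%:E * leb ((fun x : R => (a * x + b)%R) @^-1` `]x, y]))%E).
have [a_gt0|] := ltP 0 a; last rewrite le_eqVlt (negbTE a0)/= => a_lt0.
  have -> : (fun x : R => a * x + b) @^-1` `]x, y] = `]((x - b) / a), ((y - b) / a)]%classic.
    apply/seteqP; split=> z /=; rewrite !in_itv/= ltr_pdivrMr// ler_pdivlMr// mulrC;
    by move=> /andP[h1 h2]; apply/andP; split; lra.
  rewrite !lebesgue_measure_itv/= !lte_fin ltr_pM2r ?invr_gt0// ltrD2r.
  case: ifP => _; last by rewrite mule0.
  rewrite gtr0_norm// -!EFinB -EFinM; congr EFin; by field.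
have -> : (fun x : R => a * x + b) @^-1` `]x, y] = `[((y - b) / a), ((x - b) / a)[%classic.
  apply/seteqP; split=> z /=; rewrite !in_itv/= ltr_ndivlMr// ler_ndivrMr// mulrC;
  by move=> /andP[h1 h2]; apply/andP; split; lra.
rewrite !lebesgue_measure_itv/= !lte_fin ltr_nM2r ?invr_lt0// ltrD2r.
case: ifP => _; last by rewrite mule0.
rewrite ltr0_norm// -!EFinB -EFinM; congr EFin; by field.
Qed.

Lemma integral_affine (a b : R) (f : R -> \bar R) : a != 0 ->
  measurable_fun setT f -> (forall x, 0 <= f x)%E ->
  (\int[leb]_x f x = `|a|%:E * \int[leb]_x f (a * x + b)%R)%E.
Proof.
move=> a0 mf f0.
have mphi : measurable_fun setT ((fun x : R => a * x + b) : measurableTypeR R -> measurableTypeR R).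
  by apply: measurable_funD => //; exact: measurable_funM.
have := @ge0_integral_mscale _ _ R (pushforward_meas leb mphi) setT measurableT
  (NngNum (normr_ge0 a)) f mf (fun x _ => f0 x).
rewrite integral_pushforward_meas// => <-.
apply: eq_measure_integral => A mA _.
by rewrite /mscale /= /pushforward; exact: lebesgue_affine.
Qed.

Lemma tonelli1 F : measurable_fun setT F -> (forall z, 0 <= F z)%E ->
  (\int[leb2]_z F z = \int[leb]_x \int[leb]_y F (x, y))%E.
Proof. exact: (@fubini_tonelli1 _ _ (measurableTypeR R) (measurableTypeR R) R leb leb F). Qed.

Lemma tonelli2 F : measurable_fun setT F -> (forall z, 0 <= F z)%E ->
  (\int[leb2]_z F z = \int[leb]_y \int[leb]_x F (x, y))%E.
Proof. exact: (@fubini_tonelli2 _ _ (measurableTypeR R) (measurableTypeR R) R leb leb F). Qed.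

Lemma measurable_tonelli1 F : measurable_fun setT F -> (forall z, 0 <= F z)%E ->
  measurable_fun setT (fun x => \int[leb]_y F (x, y))%E.
Proof. exact: (@measurable_fun_fubini_tonelli_F _ _ (measurableTypeR R) (measurableTypeR R) R leb F). Qed.

Lemma measurable_tonelli2 F : measurable_fun setT F -> (forall z, 0 <= F z)%E ->
  measurable_fun setT (fun y => \int[leb]_x F (x, y))%E.
Proof. exact: (@measurable_fun_fubini_tonelli_G _ _ (measurableTypeR R) (measurableTypeR R) R leb F). Qed.

(** The plane integral is split into its two coordinates, which are exchanged with [t] one after the
    other. *)
Lemma tonelli3 (G : R * (R * R) -> \bar R) : measurable_fun setT G -> (forall z, 0 <= G z)%E ->
  (\int[leb]_t \int[leb2]_z G (t, z) = \int[leb2]_z \int[leb]_t G (t, z))%E.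
Proof.
move=> mG G0.
have mGs t : measurable_fun setT (fun z => G (t, z)) by exact: measurableT_comp.
have mH : measurable_fun setT (fun tx : R * R => \int[leb]_y G (tx.1, (tx.2, y)))%E.
  have mK : measurable_fun setT (fun w : (R * R) * R => G (w.1.1, (w.1.2, w.2))).
    apply: (measurableT_comp mG); apply: measurable_fun_pair.
      exact: (measurableT_comp measurable_fst measurable_fst).
    apply: measurable_fun_pair; last exact: measurable_snd.
    exact: (measurableT_comp measurable_snd measurable_fst).
  exact: (@measurable_fun_fubini_tonelli_F _ _ (measurableTypeR R * measurableTypeR R)%type
    (measurableTypeR R) R leb _ mK (fun w => G0 _)).
have mF : measurable_fun setT (fun z => \int[leb]_t G (t, z))%E.
  exact: (@measurable_fun_fubini_tonelli_G _ _ (measurableTypeR R)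
    (measurableTypeR R * measurableTypeR R)%type R leb _ mG G0).
have H0 tx : (0 <= \int[leb]_y G (tx.1, (tx.2, y)))%E by exact: integral_ge0.
rewrite (tonelli1 mF); last by move=> z; exact: integral_ge0.
transitivity (\int[leb]_t \int[leb]_x \int[leb]_y G (t, (x, y)))%E.
  by apply: eq_integral => t _; exact: (tonelli1 (mGs t) (fun z => G0 _)).
transitivity (\int[leb]_x \int[leb]_t \int[leb]_y G (t, (x, y)))%E.
  by rewrite -(tonelli1 mH H0) (tonelli2 mH H0).
apply: eq_integral => x _.
have mGx : measurable_fun setT (fun ty : R * R => G (ty.1, (x, ty.2))).
  apply: (measurableT_comp mG); apply: measurable_fun_pair; first exact: measurable_fst.
  by apply: measurable_fun_pair; [exact: measurable_cst|exact: measurable_snd].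
by rewrite -(tonelli1 mGx (fun w => G0 _)) (tonelli2 mGx (fun w => G0 _)).
Qed.

Lemma measurable_plane_map F (u v : R * R -> R) : measurable_fun setT F ->
  measurable_fun setT u -> measurable_fun setT v ->
  measurable_fun setT (fun z => F (u z, v z)).
Proof.
move=> mF mu mv; apply: (@measurableT_comp _ _ _ _ _ _ F) => //.
exact: measurable_fun_pair.
Qed.

Lemma integral_shear1 F (t : R) : measurable_fun setT F -> (forall z, 0 <= F z)%E ->
  (\int[leb2]_z F z = \int[leb2]_z F (z.1 + t * z.2, z.2)%R)%E.
Proof.
move=> mF F0.
have mG : measurable_fun setT (fun z : R * R => F (z.1 + t * z.2, z.2)).
  apply: measurable_plane_map => //.
  by apply: measurable_funD => //; apply: measurable_funM.
rewrite (tonelli2 mF F0) (tonelli2 mG (fun z => F0 _))/=.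
apply: eq_integral => y _;
rewrite (@integral_affine 1 (t * y) (fun x => F (x, y)))//; last exact: measurableT_comp.
by rewrite normr1 mul1e; apply: eq_integral => x _; rewrite mul1r.
Qed.

Lemma integral_shear2 F (t : R) : measurable_fun setT F -> (forall z, 0 <= F z)%E ->
  (\int[leb2]_z F z = \int[leb2]_z F (z.1, z.2 + t * z.1)%R)%E.
Proof.
move=> mF F0.
have mG : measurable_fun setT (fun z : R * R => F (z.1, z.2 + t * z.1)).
  apply: measurable_plane_map => //.
  by apply: measurable_funD => //; apply: measurable_funM.
rewrite (tonelli1 mF F0) (tonelli1 mG (fun z => F0 _))/=.
apply: eq_integral => x _;
rewrite (@integral_affine 1 (t * x) (fun y => F (x, y)))//; last exact: measurableT_comp.
by rewrite normr1 mul1e; apply: eq_integral => y _; rewrite mul1r.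
Qed.

Lemma integral_dilation F (a b : R) : a != 0 -> b != 0 ->
  measurable_fun setT F -> (forall z, 0 <= F z)%E ->
  (\int[leb2]_z F z = (`|a| * `|b|)%:E * \int[leb2]_z F (a * z.1, b * z.2)%R)%E.
Proof.
move=> a0 b0 mF F0.
have mG : measurable_fun setT (fun z : R * R => F (a * z.1, b * z.2)).
  by apply: measurable_plane_map => //; apply: measurable_funM.
have mH : measurable_fun setT (fun z : R * R => F (z.1, b * z.2)).
  by apply: measurable_plane_map => //; apply: measurable_funM.
rewrite EFinM -muleA.
have -> : (`|b|%:E * \int[leb2]_z F (a * z.1, b * z.2)%R = \int[leb2]_z F (a * z.1, z.2)%R)%E.
  have mK : measurable_fun setT (fun z : R * R => F (a * z.1, z.2)).
    by apply: measurable_plane_map => //; apply: measurable_funM.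
  rewrite (@tonelli1 (fun z : R * R => F (a * z.1, b * z.2)))//.
  rewrite (@tonelli1 (fun z : R * R => F (a * z.1, z.2)))//=.
  rewrite -ge0_integralZl//; first last.
  - by move=> x _; exact: integral_ge0.
  - exact: (@measurable_tonelli1 (fun z : R * R => F (a * z.1, b * z.2))).
  apply: eq_integral => x _; rewrite (@integral_affine b 0 (fun y => F (a * x, y)))//.
    by congr (_ * _)%E; apply: eq_integral => y _; rewrite addr0.
  exact: measurableT_comp.
have mK : measurable_fun setT (fun z : R * R => F (a * z.1, z.2)).
  by apply: measurable_plane_map => //; apply: measurable_funM.
rewrite (@tonelli2 (F))//.
rewrite (@tonelli2 (fun z : R * R => F (a * z.1, z.2)))//=.
rewrite -ge0_integralZl//; first last.
- by move=> x _; exact: integral_ge0.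
- exact: (@measurable_tonelli2 (fun z : R * R => F (a * z.1, z.2))).
apply: eq_integral => y _; rewrite (@integral_affine a 0 (fun x => F (x, y)))//.
  by congr (_ * _)%E; apply: eq_integral => x _; rewrite addr0.
exact: measurableT_comp.
Qed.

Definition rot (c s : R) (z : R * R) : R * R := (c * z.1 - s * z.2, s * z.1 + c * z.2).

(* a rotation by an angle other than pi is a product of three shears *)
Lemma integral_rot F (c s : R) : c ^+ 2 + s ^+ 2 = 1 ->
  measurable_fun setT F -> (forall z, 0 <= F z)%E ->
  (\int[leb2]_z F z = \int[leb2]_z F (rot c s z))%E.
Proof.
move=> cs mF F0; have [c1|c1] := eqVneq (1 + c) 0.
  have cE : c = -1 by lra.
  have s0 : s = 0 by move: cs; rewrite cE sqrrN expr1n => h; apply/eqP; rewrite -sqrf_eq0; apply/eqP; lra.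
  rewrite (@integral_dilation F (-1) (-1))// ?oppr_eq0 ?oner_eq0//.
  rewrite normrN normr1 mulr1 mul1e; apply: eq_integral => z _.
  by rewrite /rot cE s0 !mul0r subr0 add0r.
pose t := s / (1 + c).
have tc : t * (1 + c) = s by rewrite /t divfK.
have ts : 1 - t * s = c.
  apply: (mulIf c1); rewrite mulrBl mulrAC tc; rewrite -expr2; lra.
rewrite (@integral_shear1 F (- t))//.
set F1 := fun z : R * R => F (z.1 + - t * z.2, z.2).
have mF1 : measurable_fun setT F1.
  apply: measurable_plane_map => //.
  by apply: measurable_funD => //; apply: measurable_funM.
rewrite (@integral_shear2 F1 s)//; last by move=> z; exact: F0.
set F2 := fun z : R * R => F1 (z.1, z.2 + s * z.1).
have mF2 : measurable_fun setT F2.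
  apply: measurable_plane_map => //.
  by apply: measurable_funD => //; apply: measurable_funM.
rewrite (@integral_shear1 F2 (- t))//; last by move=> z; exact: F0.
apply: eq_integral => z _; rewrite /F2 /F1 /rot /=; congr (F (_, _)); last first.
  rewrite -[in RHS]ts; ring.
transitivity ((1 - t * s) * z.1 - t * (1 + (1 - t * s)) * z.2); first by ring.
by rewrite ts tc.
Qed.

Lemma pt_rot (w : C R) z :
  pt (rot (cos (2 * pi * complex.Re (w : R[i]))) (sin (2 * pi * complex.Re (w : R[i]))) z) = cis w * pt z.
Proof. by rewrite /pt /rot /cis; apply/eqP; rewrite eq_complex /= eqxx addrC eqxx. Qed.

Definition crot (t : R) := rot (cos (2 * pi * t)) (sin (2 * pi * t)).

Lemma pt_crot (t : R) z : pt (crot t z) = cis t%:C * pt z.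
Proof. exact: (pt_rot t%:C). Qed.

Lemma measurable_cos2pi : measurable_fun setT (fun t : R => cos (2 * pi * t)).
Proof.
apply: (measurableT_comp (f := @cos R)); last exact: measurable_funM.
apply: continuous_measurable_fun; exact: continuous_cos.
Qed.

Lemma measurable_sin2pi : measurable_fun setT (fun t : R => sin (2 * pi * t)).
Proof.
apply: (measurableT_comp (f := @sin R)); last exact: measurable_funM.
apply: continuous_measurable_fun; exact: continuous_sin.
Qed.

Lemma measurable_crot F : measurable_fun setT F ->
  measurable_fun setT (fun tz : R * (R * R) => F (crot tz.1 tz.2)).
Proof.
move=> mF; apply: (@measurableT_comp _ _ _ _ _ _ F) => //.
have m1 : measurable_fun setT (fun tz : R * (R * R) => cos (2 * pi * tz.1)).
  exact: (measurableT_comp measurable_cos2pi).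
have m2 : measurable_fun setT (fun tz : R * (R * R) => sin (2 * pi * tz.1)).
  exact: (measurableT_comp measurable_sin2pi).
have mx : measurable_fun setT (fun tz : R * (R * R) => tz.2.1).
  exact: (measurableT_comp measurable_fst measurable_snd).
have my : measurable_fun setT (fun tz : R * (R * R) => tz.2.2).
  exact: (measurableT_comp measurable_snd measurable_snd).
apply: measurable_fun_pair.
  by apply: measurable_funB; exact: measurable_funM.
by apply: measurable_funD; exact: measurable_funM.
Qed.

(** Does the work of the angular variable of polar coordinates: a plane integral becomes one of
    means over circles, to which Cauchy's formula and arc lengths apply. *)
Lemma rot_average F : measurable_fun setT F -> (forall z, 0 <= F z)%E ->
  (\int[leb2]_z F z = \int[leb2]_z \int[leb]_(t in `[0%R, 1%R]) F (crot t z))%E.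
Proof.
move=> mF F0.
pose G (tz : R * (R * R)) := ((\1_`[0%R, 1%R] tz.1)%:E * F (crot tz.1 tz.2))%E.
have mG : measurable_fun setT G.
  apply: emeasurable_funM; last exact: measurable_crot.
  by apply/measurable_EFinP; apply: measurableT_comp.
have G0 tz : (0 <= G tz)%E by rewrite mule_ge0// lee_fin.
have h : (\int[leb]_t \int[leb2]_z G (t, z) = \int[leb2]_z \int[leb]_t G (t, z))%E.
  exact: tonelli3.
transitivity (\int[leb]_t \int[leb2]_z G (t, z))%E.
  rewrite -[LHS]mul1e.
  have -> : (1 = \int[leb]_(t in `[0%R, 1%R]) 1)%E.
    by rewrite integral_cst//= lebesgue_measure_itv/= lte_fin ltr01 oppr0 adde0 mule1.
  rewrite -ge0_integralZr//; last exact: integral_ge0.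
  rewrite integral_mkcond; apply: eq_integral => t _; rewrite /G/= patchE.
  case: ifPn => h1; last first.
    by rewrite indicE (negbTE h1) (eq_integral (fun=> 0%E)) ?integral0// => z _; rewrite mul0e.
  rewrite indicE h1 mul1e (@integral_rot F (cos (2 * pi * t)) (sin (2 * pi * t)))//; last exact: cos2Dsin2.
  by apply: eq_integral => z _; rewrite mul1e.
rewrite h; apply: eq_integral => z _; rewrite [RHS]integral_mkcond.
apply: eq_integral => t _; rewrite /G/= patchE indicE; case: ifPn => _; rewrite ?mul1e ?mul0e//.
Qed.

End PlaneMeasure.

(** * Radial integrals in the plane *)

Section RadialIntegration.
Variable R : realType.
Local Notation leb := (@lebesgue_measure R).
Local Notation leb2 := (leb \x leb)%E.

Lemma indic_setE (T : Type) (P : T -> bool) z : \1_[set z | P z] z = (P z)%:R :> R.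
Proof. by rewrite indicE; congr ((nat_of_bool _)%:R); apply/idP/idP; rewrite inE. Qed.

Definition nrm (z : R * R) : R := cabs (pt z).
Definition supnorm (z : R * R) : R := Num.max `|z.1| `|z.2|.

Lemma nrmE z : nrm z = Num.sqrt (z.1 ^+ 2 + z.2 ^+ 2).
Proof. by []. Qed.

Lemma nrm_ge0 z : 0 <= nrm z.
Proof. exact: cabs_ge0. Qed.

Lemma measurable_nrm : measurable_fun setT nrm.
Proof.
apply: (measurableT_comp (f := @Num.sqrt R)).
  by apply: continuous_measurable_fun; exact: sqrt_continuous.
by apply: measurable_funD; apply: measurable_funX; [exact: measurable_fst|exact: measurable_snd].
Qed.

Lemma measurable_supnorm : measurable_fun setT supnorm.
Proof.
apply: measurable_maxr; apply: (measurableT_comp (f := @Num.Def.normr R R)) => //.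
Qed.

Lemma supnorm_le z : supnorm z <= nrm z.
Proof. by rewrite ge_max; apply/andP; split; [exact: (Re_cabs (pt z))|exact: (Im_cabs (pt z))]. Qed.

Lemma nrm_scale (b : R) z : 0 <= b -> nrm (b * z.1, b * z.2) = b * nrm z.
Proof.
move=> b0; have E : (pt (b * z.1, b * z.2) : C R) = b%:C * pt z.
  by rewrite /pt; apply/eqP; rewrite eq_complex /= !mul0r subr0 addr0 !eqxx.
by rewrite /nrm E cabsM cabs_rcge0.
Qed.

Lemma supnorm_scale (b : R) z : 0 <= b -> supnorm (b * z.1, b * z.2) = b * supnorm z.
Proof. by move=> b0; rewrite /supnorm/= !normrM (ger0_norm b0) maxr_pMr. Qed.

Lemma measurable_sublevel (g : R * R -> R) b : measurable_fun setT g ->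
  measurable [set z | g z < b].
Proof.
move=> mg; rewrite -[X in measurable X]setTI; apply: (mg _ `]-oo, b[%classic) => //.
Qed.

Lemma measure_sublevel_scale (g : R * R -> R) b : measurable_fun setT g -> 0 < b ->
  (forall z : R * R, g (b * z.1, b * z.2) = b * g z) ->
  (leb2 [set z | (g z < b)%R] = (b ^+ 2)%:E * leb2 [set z | (g z < 1)%R])%E.
Proof.
move=> mg b0 hg; have b1 : b != 0 by rewrite gt_eqF.
have mb := measurable_sublevel b mg; have m1 := measurable_sublevel 1 mg.
rewrite -(setIT [set z | g z < b]) -(setIT [set z | g z < 1]) -!integral_indic//.
rewrite (integral_dilation b1 b1)//.
- rewrite (ger0_norm (ltW b0)) expr2; congr (_ * _)%E; apply: eq_integral => z _.
  have E : (g (b * z.1, b * z.2) < b) = (g z < 1) by rewrite hg -[X in _ < X]mulr1 ltr_pM2l.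
  by rewrite !indicE; congr ((nat_of_bool _)%:R%:E); apply/idP/idP; rewrite !inE /= E.
- by apply/measurable_EFinP; exact: measurable_indic.
Qed.

Lemma measure_square (a b : R) : a <= b -> leb2 (`]a, b[ `*` `]a, b[) = ((b - a) ^+ 2)%:E.
Proof.
move=> ab; have -> : leb2 (`]a, b[ `*` `]a, b[) = (leb `]a, b[ * leb `]a, b[)%E.
  exact: (@product_measure1E _ _ (measurableTypeR R) (measurableTypeR R) R leb leb).
rewrite lebesgue_measure_itv/= lte_fin; case: ltP => [_|ba]; first by rewrite -EFinB -EFinM expr2.
by rewrite (_ : b = a) ?subrr ?expr0n ?mule0//; apply/le_anti/andP; split.
Qed.

Lemma disc_area : exists2 k : R, 0 < k & leb2 [set z | nrm z < 1] = k%:E.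
Proof.
have m1 := measurable_sublevel 1 measurable_nrm.
have up : (leb2 [set z | (nrm z < 1)%R] <= 4%:E)%E.
  have -> : (4 : R) = (1 - -1) ^+ 2 by ring.
  rewrite -measure_square; last by lra.
  apply: le_measure; rewrite ?inE//; first exact: measurableX.
  move=> z /= z1; rewrite !in_itv/= -!ltr_norml.
  by have := supnorm_le z; rewrite ge_max => /andP[h1 h2]; split; lra.
have lo : (((2^-1) ^+ 2)%:E <= leb2 [set z | (nrm z < 1)%R])%E.
  rewrite -{1}(subr0 (2^-1 : R)) -measure_square ?invr_ge0//.
  apply: le_measure; rewrite ?inE//; first exact: measurableX.
  move=> [x y] /= []; rewrite !in_itv/= => /andP[x0 x1] /andP[y0 y1].
  apply: le_lt_trans (cabs_ReIm _) _; rewrite /= !gtr0_norm//; lra.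
have fin : leb2 [set z | (nrm z < 1)%R] \is a fin_num.
  by rewrite ge0_fin_numE//; exact: le_lt_trans up (ltry _).
exists (fine (leb2 [set z | (nrm z < 1)%R])); last by rewrite fineK.
by rewrite -lte_fin fineK//; apply: lt_le_trans lo; rewrite lte_fin exprn_gt0.
Qed.

Lemma square_area : leb2 [set z | supnorm z < 1] = 4%:E.
Proof.
have -> : (4 : R) = (1 - -1) ^+ 2 by ring.
rewrite -measure_square; last by lra.
congr (leb2 _); apply/seteqP; split=> z /=; rewrite !in_itv/= -!ltr_norml gt_max.
  by move=> /andP[].
by move=> [-> ->].
Qed.

(* both norms have homogeneous sublevel sets, so that radial integrals reduce,
   up to a constant, to integrals of functions of the sup norm *)
Lemma integral_nrm_supnorm : exists2 k : R, 0 < k & forall u : R -> \bar R,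
  measurable_fun setT u -> (forall r, 0 <= u r)%E ->
  (\int[leb2]_z u (nrm z) = k%:E * \int[leb2]_z u (supnorm z))%E.
Proof.
have [k k0 kE] := disc_area.
have k40 : 0 <= k / 4 by rewrite divr_ge0// ltW.
exists (k / 4) => [|u mu u0]; first by rewrite divr_gt0.
have m1 : measurable_fun setT (nrm : measurableTypeR R * measurableTypeR R -> measurableTypeR R).
  exact: measurable_nrm.
have m2 : measurable_fun setT (supnorm : measurableTypeR R * measurableTypeR R -> measurableTypeR R).
  exact: measurable_supnorm.
have <- := integral_pushforward_meas leb2 m1 mu u0.
have <- := integral_pushforward_meas leb2 m2 mu u0.
have <- := @ge0_integral_mscale _ _ R (pushforward_meas leb2 m2) setT measurableT
  (NngNum k40) u mu (fun x _ => u0 x).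
apply: eq_measure_integral => A mA _.
have sub b : leb2 [set z | nrm z < b] = ((k / 4)%:E * leb2 [set z | (supnorm z < b)%R])%E.
  have [b0|b0] := ltP 0 b.
    rewrite (measure_sublevel_scale measurable_nrm b0) => [|z]; last by rewrite nrm_scale// ltW.
    rewrite (measure_sublevel_scale measurable_supnorm b0) => [|z]; last by rewrite supnorm_scale// ltW.
    by rewrite kE square_area -!EFinM; congr EFin; field.
  have E (g : R * R -> R) : (forall z, 0 <= g z) -> [set z | g z < b] = set0.
    by move=> g0; rewrite -subset0 => z /= zb; have := g0 z; lra.
  rewrite !E ?measure0 ?mule0//; first by move=> z; rewrite le_max normr_ge0.
  exact: nrm_ge0.
apply: (@measure_unique _ R (measurableTypeR R) (@RGenInftyO.G R) (fun n => `]-oo, n%:R[%classic)) => //.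
- exact: RGenInftyO.measurableE.
- move=> _ _ [x ->] [y ->]; exists (Num.min x y).
  by apply/seteqP; split=> z /=; rewrite !in_itv/= lt_min; [move=> [-> ->]|move=> /andP[]].
- by move=> n; exists n%:R.
- apply/seteqP; split=> // x _; exists (Num.truncn x).+1 => //=; rewrite in_itv/=.
  exact: truncnS_gt.
- by move=> _ [b ->]; have := sub b; rewrite /mscale/=.
- move=> n; have [n0|n0] := ltP 0 (n%:R : R).
    have := measure_sublevel_scale measurable_nrm n0.
    rewrite kE => h; change (leb2 [set z | (nrm z < n%:R)%R] < +oo)%E.
    by rewrite h ?ltry// => z; rewrite nrm_scale// ltW.
  change (leb2 [set z | (nrm z < n%:R)%R] < +oo)%E.
  have -> : [set z | nrm z < n%:R] = set0; last by rewrite measure0.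
  by rewrite -subset0 => z /= zb; have := nrm_ge0 z; lra.
Qed.

Lemma measure_sym_itv (x : R) : 0 <= x -> leb `]-x, x[ = (2 * x)%:E /\ leb `[-x, x] = (2 * x)%:E.
Proof.
move=> x0; rewrite !lebesgue_measure_itv/= lte_fin.
have -> : (2 * x)%:E = (x - - x)%:E by congr EFin; ring.
case: ltP => [//|h]; have -> : x = 0 by lra.
by rewrite oppr0 subrr.
Qed.

(** The plane is split according to which coordinate attains the maximum; when it is r, the other
    one runs over an interval of length 2 |r|. *)
Lemma integral_supnorm (u : R -> \bar R) : measurable_fun setT u -> (forall r, 0 <= u r)%E ->
  (\int[leb2]_z u (supnorm z) = \int[leb]_r ((4 * `|r|)%:E * u `|r|%R))%E.
Proof.
move=> mu u0.
have mn : measurable_fun setT (fun x : R => `|x|) by [].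
have mlt : measurable [set z : R * R | `|z.1| < `|z.2|].
  have := @measurable_fun_ltr _ _ R setT (fun z : R * R => `|z.1|) (fun z => `|z.2|).
  move=> h; have {}h : measurable_fun setT (fun z : R * R => `|z.1| < `|z.2|).
    by apply: h; apply: (measurableT_comp mn); [exact: measurable_fst|exact: measurable_snd].
  have := h measurableT [set true] I; rewrite setTI; congr measurable.
have mle : measurable [set z : R * R | `|z.2| <= `|z.1|].
  rewrite (_ : [set _ | _] = ~` [set z : R * R | `|z.1| < `|z.2|]); first exact: measurableC.
  by apply/seteqP; split=> z /=; [move=> h1 h2; lra|move/negP; rewrite -leNgt].
pose F1 (z : R * R) := (u `|z.2|%R * (\1_[set z : R * R | (`|z.1| < `|z.2|)%R] z)%:E)%E.
pose F2 (z : R * R) := (u `|z.1|%R * (\1_[set z : R * R | (`|z.2| <= `|z.1|)%R] z)%:E)%E.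
have mF1 : measurable_fun setT F1.
  apply: emeasurable_funM; last by apply/measurable_EFinP.
  by apply: (measurableT_comp mu); apply: (measurableT_comp mn); exact: measurable_snd.
have mF2 : measurable_fun setT F2.
  apply: emeasurable_funM; last by apply/measurable_EFinP.
  by apply: (measurableT_comp mu); apply: (measurableT_comp mn); exact: measurable_fst.
have F10 z : (0 <= F1 z)%E by rewrite mule_ge0// lee_fin.
have F20 z : (0 <= F2 z)%E by rewrite mule_ge0// lee_fin.
have -> : (\int[leb2]_z u (supnorm z) = \int[leb2]_z (F1 z + F2 z))%E.
  apply: eq_integral => z _; rewrite /F1 /F2 (indic_setE (fun z : R * R => `|z.1| < `|z.2|)).
  rewrite (indic_setE (fun z : R * R => `|z.2| <= `|z.1|)) /supnorm.
  by case: ltP => h; rewrite ?mule0 ?mule1 ?adde0 ?add0e.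
rewrite (@ge0_integralD _ _ _ leb2 setT measurableT F1 F2)//.
rewrite (tonelli2 mF1 F10) (tonelli1 mF2 F20).
have mg : measurable_fun setT (fun r : R => (2 * `|r|)%:E * u `|r|%R)%E.
  apply: emeasurable_funM; last exact: (measurableT_comp mu mn).
  by apply/measurable_EFinP; exact: measurable_funM.
have g0 r : (0 <= (2 * `|r|)%:E * u `|r|%R)%E by rewrite mule_ge0// lee_fin mulr_ge0.
transitivity (\int[leb]_r ((2 * `|r|)%:E * u `|r|%R) + \int[leb]_r ((2 * `|r|)%:E * u `|r|%R))%E.
  congr (_ + _)%E; apply: eq_integral => r _; rewrite /F1 /F2 /=.
    have h1 : measurable_fun setT (fun x : R => \1_[set z : R * R | `|z.1| < `|z.2|] (x, r) : R).
      apply: (measurableT_comp (@measurable_indic _ _ R setT _ mlt)).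
      by apply: measurable_fun_pair; [exact: measurable_id|exact: measurable_cst].
    rewrite ge0_integralZl//; last exact/measurable_EFinP.
    rewrite muleC; congr (_ * _)%E.
    have := (measure_sym_itv (normr_ge0 r)).1 => <-.
    rewrite -[in RHS](setIT `]_, _[%classic) -integral_indic//; apply: eq_integral => x _.
    rewrite (indic_setE (fun z : R * R => `|z.1| < `|z.2|)) indicE /=; congr ((nat_of_bool _)%:R%:E).
    by apply/idP/idP; rewrite inE/= in_itv/= -ltr_norml.
  have h2 : measurable_fun setT (fun y : R => \1_[set z : R * R | `|z.2| <= `|z.1|] (r, y) : R).
    apply: (measurableT_comp (@measurable_indic _ _ R setT _ mle)).
    by apply: measurable_fun_pair; [exact: measurable_cst|exact: measurable_id].
  rewrite ge0_integralZl//; last exact/measurable_EFinP.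
  rewrite muleC; congr (_ * _)%E.
  have := (measure_sym_itv (normr_ge0 r)).2 => <-.
  rewrite -[in RHS](setIT `[_, _]%classic) -integral_indic//; apply: eq_integral => x _.
  rewrite (indic_setE (fun z : R * R => `|z.2| <= `|z.1|)) indicE /=; congr ((nat_of_bool _)%:R%:E).
  by apply/idP/idP; rewrite inE/= in_itv/= -ler_norml.
rewrite -ge0_integralD//; apply: eq_integral => r _.
by rewrite -ge0_muleDl ?lee_fin ?mulr_ge0//; congr (_ * _)%E; rewrite -EFinD; congr EFin; ring.
Qed.

Lemma integral_even (g : R -> \bar R) : measurable_fun setT g -> (forall r, 0 <= g r)%E ->
  (\int[leb]_r g `|r|%R = 2%:E * \int[leb]_(r in `[0%R, +oo[) g r)%E.
Proof.
move=> mg g0.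
have mgn : measurable_fun setT (fun r : R => g `|r|) by exact: (measurableT_comp mg).
have U : [set: R] = `]-oo, 0] `|` `]0, +oo[.
  by apply/seteqP; split=> // x _; case: (leP x 0) => h; [left|right]; rewrite /= in_itv/= ?andbT.
rewrite U ge0_integral_setU//=; last 2 first.
- by rewrite -U.
- rewrite disj_set2E; apply/eqP; rewrite -subset0 => x /= []; rewrite !in_itv/= andbT; lra.
have -> : (2 : R) = 1 + 1 by [].
rewrite EFinD ge0_muleDl// !mul1e; congr (_ + _)%E.
  rewrite ge0_integration_by_substitution0//.
  by apply: eq_integral => r; rewrite inE/= in_itv/= => r0; rewrite ler0_norm.
have mo : measurable_fun (`]0, +oo[ : set R) (fun r : R => g `|r|) by exact: measurable_funTS.
rewrite integral_itv_obnd_cbnd//; apply: eq_integral => r.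
by rewrite inE/= in_itv/= andbT => r0; rewrite ger0_norm.
Qed.

Lemma discRE : @discR R = [set z | nrm z < 1].
Proof.
apply/seteqP; split=> z; rewrite /discR /= nrmE.
  by move=> h; rewrite -sqrtr1 ltr_sqrt.
by rewrite -{1}sqrtr1 ltr_sqrt.
Qed.

Lemma measurable_discR : measurable (@discR R).
Proof. by rewrite discRE; apply: measurable_sublevel; exact: measurable_nrm. Qed.

(** Polar coordinates with an unevaluated constant, since the estimates are up to constants. *)
Lemma radial_integral : exists2 k : R, 0 < k & forall f : R -> \bar R,
  measurable_fun (`[0, 1[ : set R) f -> (forall r : R, (0 <= r < 1)%R -> (0 <= f r)%E) ->
  (\int[leb2]_(z in @discR R) f (nrm z) = k%:E * \int[leb]_(r in `[0%R, 1%R[) (r%:E * f r))%E.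
Proof.
(* The 8 is the 4 of [integral_supnorm] times the 2 of [integral_even]. *)
have [k k0 hk] := integral_nrm_supnorm; exists (k * 8) => [|f mf f0]; first exact: mulr_gt0.
pose u := f \_ (`[0, 1[ : set R).
have mu : measurable_fun setT u by apply/(measurable_restrictT f).
have u0 r : (0 <= u r)%E.
  by rewrite /u patchE; case: ifPn => //; rewrite inE/= in_itv/=; exact: f0.
have -> : (\int[leb2]_(z in @discR R) f (nrm z) = \int[leb2]_z u (nrm z))%E.
  rewrite integral_mkcond; apply: eq_integral => z _; rewrite /u !patchE discRE.
  by rewrite !mem_setE /= in_itv/= nrm_ge0.
rewrite hk// integral_supnorm//.
have mru : measurable_fun setT (fun r : R => r%:E * u r)%E.
  by apply: emeasurable_funM => //; apply/measurable_EFinP.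
have ru0 r : (0 <= r%:E * u r)%E.
  rewrite /u patchE; case: ifPn => [|_]; last by rewrite mule0.
  rewrite inE/= in_itv/= => r01; rewrite mule_ge0 ?f0// lee_fin.
  by case/andP: r01.
have -> : (\int[leb]_r ((4 * `|r|)%:E * u `|r|%R) = \int[leb]_r (4%:E * (`|r|%:E * u `|r|%R)))%E.
  by apply: eq_integral => r _; rewrite EFinM muleA.
rewrite (@integral_even (fun r => 4%:E * (r%:E * u r))%E); last 2 first.
- exact: emeasurable_funM.
- by move=> r; rewrite mule_ge0// lee_fin.
rewrite ge0_integralZl//; last exact: measurable_funTS.
have -> : (\int[leb]_(x in `[0%R, +oo[) (x%:E * u x) = \int[leb]_(r in `[0%R, 1%R[) (r%:E * f r))%E.
  rewrite integral_mkcond [RHS]integral_mkcond; apply: eq_integral => r _.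
  rewrite /u !patchE !mem_setE /= !in_itv/= andbT.
  by case: (0 <= r) => //=; case: (r < 1) => //; rewrite mule0.
by rewrite !muleA -!EFinM; congr ((_)%:E * _)%E; ring.
Qed.

End RadialIntegration.

(** * Dyadic intervals, series and elementary decay estimates *)

Section DyadicWeights.
Variable R : realType.
Local Notation leb := (@lebesgue_measure R).
Implicit Types (u v : nat -> R).

Definition eps (k : nat) : R := 2^-1 ^+ k.

Lemma eps_gt0 k : 0 < eps k. Proof. by rewrite exprn_gt0. Qed.
Lemma eps_ge0 k : 0 <= eps k. Proof. exact: ltW (eps_gt0 k). Qed.
Lemma epsS k : eps k.+1 = eps k / 2. Proof. by rewrite /eps exprSr. Qed.
Lemma eps0 : eps 0 = 1. Proof. by rewrite /eps expr0. Qed.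
Lemma eps_le k l : (k <= l)%N -> eps l <= eps k.
Proof. by move=> kl; apply: ler_wiXn2l => //; rewrite invf_le1// ler1n. Qed.
Lemma eps_le1 k : eps k <= 1. Proof. by rewrite -eps0 eps_le. Qed.
Lemma epsD k l : eps (k + l) = eps k * eps l. Proof. by rewrite /eps exprD. Qed.
Lemma epsV k : eps k = (2 ^+ k)^-1. Proof. by rewrite /eps exprVn. Qed.

Lemma eps_cvg0 (d : R) : 0 < d -> exists n, eps n < d.
Proof.
move=> d0; have : (2^-1 : R) ^+ n @[n --> \oo] --> 0.
  by apply: cvg_expr; rewrite ger0_norm// invf_lt1// ltr1n.
move=> /cvgrPdist_lt/(_ d d0)[n _ /(_ n (leqnn n))]; rewrite /= sub0r normrN => h.
by exists n; rewrite -[ltLHS]ger0_norm// exprn_ge0.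
Qed.

Lemma sum_eps n : \sum_(k < n) eps k <= 2.
Proof.
suff -> : \sum_(k < n) eps k = 2 - 2 * eps n by have := eps_gt0 n; lra.
elim: n => [|n ih]; first by rewrite big_ord0 eps0; ring.
by rewrite big_ord_recr/= ih epsS; field.
Qed.

Definition bdd u := exists B : R, forall n, \sum_(k < n) u k <= B.

Lemma bdd_le u v (c : R) : 0 <= c -> (forall k, u k <= c * v k) -> bdd v -> bdd u.
Proof.
move=> c0 uv [B hB]; exists (c * B) => n.
apply: (@le_trans _ _ (\sum_(k < n) c * v k)); first by apply: ler_sum => k _; exact: uv.
by rewrite -mulr_sumr ler_wpM2l.
Qed.

Lemma nneseries_bdd u : (forall k, 0 <= u k) ->
  ((\sum_(0 <= k <oo) (u k)%:E)%E = +oo%E <-> ~ bdd u).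
Proof.
move=> u0; have u0' k : (0 <= (u k)%:E)%E by rewrite lee_fin.
split=> [uoo [B hB]|nb].
  have : ((\sum_(0 <= k <oo) (u k)%:E)%E <= B%:E)%E.
    apply: lime_le; first exact: is_cvg_nneseries.
    by near=> n; rewrite sumEFin lee_fin big_mkord.
  by rewrite uoo leye_eq.
apply: contrapT => noo; apply: nb.
have S0 : (0 <= \sum_(0 <= k <oo) (u k)%:E)%E by exact: nneseries_ge0.
exists (fine (\sum_(0 <= k <oo) (u k)%:E)%E) => n.
rewrite -lee_fin fineK; last by rewrite ge0_fin_numE// ltey; apply/eqP.
by rewrite -sumEFin -(big_mkord xpredT (fun k => (u k)%:E)); apply: nneseries_lim_ge => k _ _; exact: u0'.
Unshelve. all: by end_near. Qed.

Definition dyad (k : nat) : set R := `[1 - eps k, 1 - eps k.+1[.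

Lemma dyadP k r : dyad k r <-> 1 - eps k <= r < 1 - eps k.+1.
Proof. by rewrite /dyad /= in_itv. Qed.

Lemma dyad_cover : `[0, 1[%classic = \bigcup_k dyad k.
Proof.
apply/seteqP; split=> [r /=|r [k _ /dyadP/andP[h1 h2]]]; last first.
  by rewrite /= in_itv/=; have := eps_gt0 k.+1; have := eps_le1 k; lra.
rewrite in_itv/= => /andP[r0 r1].
have ex : exists k, eps k < 1 - r by apply: eps_cvg0; lra.
case: (ex_minnP ex) => -[|k]; first by rewrite eps0; lra.
move=> h1 h2; exists k => //; apply/dyadP; apply/andP; split; last by lra.
by rewrite lerBlDl -lerBlDr leNgt; apply/negP => /h2; rewrite ltnn.
Qed.

Lemma dyad_disjoint : trivIset [set: nat] dyad.
Proof.
move=> i j _ _ [r [/dyadP/andP[h1 h2] /dyadP/andP[h3 h4]]].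
by case: (ltngtP i j) => // ij; have h := eps_le ij; exfalso; lra.
Qed.

Lemma measurable_dyad k : measurable (dyad k).
Proof. exact: measurable_itv. Qed.

Lemma dyad_length k : leb (dyad k) = (eps k.+1)%:E.
Proof.
rewrite /dyad lebesgue_measure_itv/= lte_fin.
have h := epsS k; have h2 := eps_gt0 k; case: ltP => [_|h3]; last by exfalso; lra.
by rewrite -EFinB; congr EFin; lra.
Qed.

Lemma dyad_sub01 k r : dyad k r -> 0 <= r < 1.
Proof.
by move=> /dyadP/andP[h1 h2]; have := eps_le1 k; have := eps_gt0 k.+1; lra.
Qed.

Lemma integral_dyad (f : R -> R) : measurable_fun (`[0, 1[ : set R) f ->
  (forall r, 0 <= r < 1 -> 0 <= f r) ->
  (\int[leb]_(r in `[0%R, 1%R[) (f r)%:E =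
   \sum_(0 <= k <oo) \int[leb]_(r in dyad k) (f r)%:E)%E.
Proof.
move=> mf f0; rewrite dyad_cover ge0_integral_bigcup//.
- exact: measurable_dyad.
- by rewrite -dyad_cover; exact/measurable_EFinP.
- by move=> r [k _ /dyad_sub01]; rewrite lee_fin; exact: f0.
- exact: dyad_disjoint.
Qed.

Lemma integral_dyad_bounds (f : R -> R) k (a b : R) : measurable_fun (`[0, 1[ : set R) f ->
  0 <= a -> (forall r, dyad k r -> a <= f r <= b) ->
  exists2 x : R, (\int[leb]_(r in dyad k) (f r)%:E)%E = x%:E & a * eps k.+1 <= x <= b * eps k.+1.
Proof.
move=> mf a0 fab; have sub : dyad k `<=` `[0, 1[ by rewrite dyad_cover; exact: bigcup_sup.
have mfk : measurable_fun (dyad k) (EFin \o f).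
  by apply/measurable_EFinP; apply: measurable_funS mf.
have mk := measurable_dyad k.
have lo : ((a * eps k.+1)%:E <= \int[leb]_(r in dyad k) (f r)%:E)%E.
  rewrite EFinM -dyad_length -integral_cst//; apply: ge0_le_integral => //.
  by move=> r /fab/andP[h _]; rewrite lee_fin.
have hi : (\int[leb]_(r in dyad k) (f r)%:E <= (b * eps k.+1)%:E)%E.
  rewrite [leRHS]EFinM -dyad_length -integral_cst//; apply: ge0_le_integral => //.
    by move=> r /fab/andP[h _]; rewrite lee_fin (le_trans a0).
  by move=> r /fab/andP[_ h]; rewrite lee_fin.
exists (fine (\int[leb]_(r in dyad k) (f r)%:E)).
  rewrite fineK// ge0_fin_numE; first exact: le_lt_trans hi (ltry _).
  by apply: le_trans lo; rewrite lee_fin mulr_ge0// eps_ge0.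
have fin : (\int[leb]_(r in dyad k) (f r)%:E)%E \is a fin_num.
  rewrite ge0_fin_numE; first exact: le_lt_trans hi (ltry _).
  by apply: le_trans lo; rewrite lee_fin mulr_ge0// eps_ge0.
by rewrite -!lee_fin fineK// lo hi.
Qed.

Lemma integral_dyad_infty (f : R -> R) (a b : nat -> R) : measurable_fun (`[0, 1[ : set R) f ->
  (forall r, 0 <= r < 1 -> 0 <= f r) -> (forall k, 0 <= a k) ->
  (forall k r, dyad k r -> a k <= f r <= b k) ->
  (~ bdd (fun k => a k * eps k.+1) -> (\int[leb]_(r in `[0%R, 1%R[) (f r)%:E)%E = +oo%E) /\
  ((\int[leb]_(r in `[0%R, 1%R[) (f r)%:E)%E = +oo%E -> ~ bdd (fun k => b k * eps k.+1)).
Proof.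
move=> mf f0 a0 fab.
have [x hx] : exists x : nat -> R, forall k, (\int[leb]_(r in dyad k) (f r)%:E)%E = (x k)%:E /\
    a k * eps k.+1 <= x k <= b k * eps k.+1.
  have : forall k, exists x : R, (\int[leb]_(r in dyad k) (f r)%:E)%E = x%:E /\
      a k * eps k.+1 <= x <= b k * eps k.+1.
    by move=> k; have [x h1 h2] := integral_dyad_bounds mf (a0 k) (fab k); exists x.
  by move=> h; have [x hx] := choice h; exists x.
have x0 k : 0 <= x k.
  by have [_ /andP[h _]] := hx k; apply: le_trans h; rewrite mulr_ge0// eps_ge0.
rewrite integral_dyad//.
have -> : (\sum_(0 <= k <oo) \int[leb]_(r in dyad k) (f r)%:E = \sum_(0 <= k <oo) (x k)%:E)%E.
  by apply: eq_eseriesr => k _; have [] := hx k.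
split=> [na|/(nneseries_bdd x0) nx].
  apply/(nneseries_bdd x0) => bx; apply: na; apply: (bdd_le ler01 _ bx) => k.
  by have [_ /andP[h _]] := hx k; rewrite mul1r.
move=> bb; apply: nx; apply: (bdd_le ler01 _ bb) => k.
by have [_ /andP[_ h]] := hx k; rewrite mul1r.
Qed.

(** Exponential decay beats geometric growth: (1 - x)^n <= e^(-n x) <= (M/(n x))^M, which for n x >=
    2^d/4 is at most (4 M)^M 2^(-d M). With 2 A <= 2^M this absorbs A^d and still leaves 2^(-d). *)
Lemma decay (A : R) : 0 <= A -> exists2 K : R, 0 <= K & forall d n (x : R),
  0 <= x -> x <= 1 -> 2 ^+ d <= 4 * (n%:R * x) -> A ^+ d * (1 - x) ^+ n <= K * eps d.
Proof.
move=> A0.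
have [M M0 hM] : exists2 M : nat, (0 < M)%N & 2 * A <= 2 ^+ M.
  have [n hn] : exists n : nat, 2 * A <= n%:R.
    by exists (Num.truncn (2 * A)).+1; exact: ltW (truncnS_gt _).
  exists n.+1 => //; apply: le_trans hn _.
  by rewrite -natrX ler_nat; apply: leq_trans (leqnSn _) (ltnW (ltn_expl _ _)).
exists ((4 * M%:R) ^+ M); first by rewrite exprn_ge0// mulr_ge0.
move=> d n x x0 x1 hd; have d0 : 0 < 2 ^+ d :> R by rewrite exprn_gt0.
have nx0 : 0 < n%:R * x by lra.
have M0' : 0 < M%:R :> R by rewrite ltr0n.
have h1 : (1 - x) ^+ n <= (M%:R / (n%:R * x)) ^+ M.
  have e1 : (1 - x) ^+ n <= expR (- (n%:R * x)).
    have -> : - (n%:R * x) = n%:R * - x by ring.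
    rewrite expRM_natl; apply: lerXn2r; rewrite ?nnegrE ?expR_ge0 ?subr_ge0//.
    by have := expR_ge1Dx (- x); rewrite -[1 + _]/(1 - x).
  apply: le_trans e1 _.
  have e2 : (n%:R * x / M%:R) ^+ M <= expR (n%:R * x).
    have {2}-> : n%:R * x = M%:R * (n%:R * x / M%:R) by field; rewrite gt_eqF.
    rewrite expRM_natl; apply: lerXn2r; rewrite ?nnegrE ?expR_ge0 ?divr_ge0 ?(ltW nx0)//.
    by apply: le_trans (expR_ge1Dx _); rewrite lerDr.
  rewrite expRN -[M%:R / _]invf_div exprVn lef_pV2 ?posrE ?expR_gt0//.
  by rewrite exprn_gt0// divr_gt0.
have h2 : M%:R / (n%:R * x) <= 4 * M%:R * eps d.
  rewrite epsV ler_pdivrMr// mulrC mulrA ler_pdivlMr//.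
  have := ler_wpM2l (ltW M0') hd; lra.
have h3 : (1 - x) ^+ n <= (4 * M%:R * eps d) ^+ M.
  apply: le_trans h1 _; apply: lerXn2r => //; rewrite nnegrE.
    by rewrite divr_ge0// ltW.
  by rewrite !mulr_ge0// eps_ge0.
apply: (@le_trans _ _ (A ^+ d * (4 * M%:R * eps d) ^+ M)).
  by rewrite ler_wpM2l// exprn_ge0.
rewrite exprMn mulrCA ler_wpM2l ?exprn_ge0 ?mulr_ge0//.
rewrite /eps -exprM mulnC exprM -exprMn; apply: lerXn2r.
- by rewrite nnegrE mulr_ge0// exprn_ge0.
- by rewrite nnegrE.
rewrite exprVn ler_pdivrMr ?exprn_gt0//; lra.
Qed.

Lemma eps01 k : 0 <= 1 - eps k < 1.
Proof. by have := eps_gt0 k; have := eps_le1 k; lra. Qed.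

(** Since (1 - x/2)^2 >= 1 - x, the numbers (1 - 2^-i)^(2^i) increase from 1/4 at i = 1; the
    exponent [k] is at most twice 2^j. *)
Lemma pow_eps_ge j k : (k.+1 < 2 ^ j.+1)%N -> 16^-1 <= (1 - eps j) ^+ k.
Proof.
case: j => [|j] hk.
  by have -> : k = 0%N; [lia|rewrite expr0 invf_le1// ler1n].
have base i : 4^-1 <= (1 - eps i.+1) ^+ (2 ^ i.+1).
  elim: i => [|i ih]; first by rewrite epsS eps0 expn1 expr2; lra.
  apply: le_trans ih _; rewrite [in leRHS]expnS exprM; apply: lerXn2r.
  - by rewrite nnegrE; case/andP: (eps01 i.+1).
  - by rewrite nnegrE exprn_ge0//; case/andP: (eps01 i.+2).
  by rewrite (epsS i.+1); have := sqr_ge0 (eps i.+1 / 2); rewrite sqrrB; lra.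
apply: (@le_trans _ _ ((1 - eps j.+1) ^+ (2 ^ j.+1 * 2))).
  rewrite exprM (_ : 16^-1 = (4^-1) ^+ 2 :> R); last by field.
  by apply: lerXn2r; rewrite ?nnegrE ?invr_ge0// exprn_ge0//; case/andP: (eps01 j.+1).
have /andP[e0 e1] := eps01 j.+1; apply: ler_wiXn2l => //; first exact: ltW.
by rewrite -expnSr; lia.
Qed.

End DyadicWeights.

(** * Conditions (ii) and (iii) as dyadic series *)

Section WeightSeries.
Variable R : realType.
Local Notation leb := (@lebesgue_measure R).
Variables (p : R) (om : R -> R) (C0 : R).
Hypotheses (p1 : 1 < p) (hom : radial_weight om) (C01 : 1 <= C0).
Hypothesis hC0 : forall r, 0 <= r < 1 -> omhat om r <= C0 * omhat om ((1 + r) / 2).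

Definition conj_exp : R := p / (p - 1).
Local Notation pp := conj_exp.

Lemma conj_exp_gt1 : 1 < pp.
Proof. by have h := p1; rewrite /conj_exp ltr_pdivlMr; lra. Qed.

Lemma conj_exp_mul : p * (pp - 1) = pp.
Proof. by rewrite /conj_exp; field; rewrite subr_eq0 gt_eqF. Qed.

Lemma conj_exp_sub : p * pp - p = pp.
Proof. by rewrite -[X in _ - X]mulr1 -mulrBr conj_exp_mul. Qed.

Lemma om_integrable r : 0 <= r -> leb.-integrable `[r, 1[ (EFin \o om).
Proof.
move=> r0; have [_ h _] := hom; apply: integrableS h => //.
by apply: subset_itvr; rewrite bnd_simp.
Qed.

Lemma omhatE r : 0 <= r -> (omhat om r)%:E = (\int[leb]_(s in `[r, 1%R[) (om s)%:E)%E.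
Proof.
by move=> r0; rewrite /omhat /Rintegral fineK//; apply: integrable_fin_num => //; exact: om_integrable.
Qed.

Lemma om_ge0 r : 0 <= r < 1 -> 0 <= om r.
Proof. by have [h _ _] := hom; exact: h. Qed.

Lemma om_measurable : measurable_fun (`[0, 1[ : set R) (EFin \o om).
Proof. by have [_ /measurable_int] := hom. Qed.

Lemma omhat_ge0 r : 0 <= r -> 0 <= omhat om r.
Proof.
move=> r0; apply: Rintegral_ge0 => s /=; rewrite in_itv/= => /andP[rs s1].
by apply: om_ge0; rewrite s1 (le_trans r0).
Qed.

Lemma omhat_gt0 r : 0 <= r < 1 -> 0 < omhat om r.
Proof. by have [_ _ h] := hom; exact: h. Qed.

Lemma omhat_le r s : 0 <= r -> r <= s -> omhat om s <= omhat om r.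
Proof.
move=> r0 rs; rewrite -lee_fin !omhatE//; last exact: le_trans rs.
apply: ge0_subset_integral => //.
- by have /measurable_int := om_integrable r0.
- move=> x /=; rewrite in_itv/= => /andP[h1 h2]; rewrite lee_fin; apply: om_ge0.
  by rewrite h2 (le_trans r0).
- by apply: subset_itvr; rewrite bnd_simp.
Qed.

Lemma omhat_measurable : measurable_fun (`[0, 1[ : set R) (omhat om).
Proof.
(* For negative arguments nothing is known of [om]; the cut-off at 0 makes the function
   nonincreasing on the whole line. *)
have h : measurable_fun (`[0, 1[ : set R) (fun r => omhat om (Num.max r 0)); last first.
  apply: eq_measurable_fun h => r.
  by rewrite inE/= in_itv/= => /andP[r0 _]; rewrite max_l.
apply: nonincreasing_measurable => // r s rs; apply: omhat_le.
  by rewrite le_max lexx orbT.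
by rewrite ge_max !le_max rs lexx orbT.
Qed.

Definition omk (k : nat) : R := omhat om (1 - eps R k).

Lemma omk_gt0 k : 0 < omk k.
Proof. exact: omhat_gt0 (eps01 R k). Qed.

Lemma omk_le k l : (k <= l)%N -> omk l <= omk k.
Proof.
by move=> kl; apply: omhat_le; [case/andP: (eps01 R k)|have := eps_le R kl; lra].
Qed.

Lemma omk_doubling k : omk k <= C0 * omk k.+1.
Proof.
have := hC0 (eps01 R k); congr (_ <= _ * omhat om _).
by rewrite epsS; field.
Qed.

Lemma omk_growth k d : omk k <= C0 ^+ d * omk (k + d).
Proof.
elim: d => [|d ih]; first by rewrite expr0 mul1r addn0.
apply: le_trans ih _; rewrite exprSr -mulrA ler_wpM2l ?exprn_ge0 ?(le_trans ler01 C01)//.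
by rewrite addnS omk_doubling.
Qed.

Lemma omhat_dyad k r : dyad k r -> omk k.+1 <= omhat om r <= omk k.
Proof.
move=> h; have /andP[r0 r1] := dyad_sub01 h; move/dyadP: h => /andP[h1 h2].
apply/andP; split; first by apply: omhat_le => //; exact: ltW.
by apply: omhat_le => //; case/andP: (eps01 R k).
Qed.

Definition sk (k : nat) : R := eps R k * (eps R k `^ pp / omk k `^ (pp - 1)).

Lemma sk_gt0 k : 0 < sk k.
Proof. by rewrite mulr_gt0 ?divr_gt0 ?powR_gt0 ?eps_gt0 ?omk_gt0. Qed.

Lemma pp0 : 0 <= pp. Proof. by have := conj_exp_gt1; lra. Qed.
Lemma pp10 : 0 <= pp - 1. Proof. by have := conj_exp_gt1; lra. Qed.

Lemma powR_le (a x y : R) : 0 <= a -> 0 <= x -> x <= y -> x `^ a <= y `^ a.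
Proof. by move=> a0 x0 xy; apply: ge0_ler_powR; rewrite ?nnegrE// (le_trans x0). Qed.

Lemma powR_le_inv (a x y : R) : 0 <= a -> 0 < x -> x <= y -> (y `^ a)^-1 <= (x `^ a)^-1.
Proof.
move=> a0 x0 xy; have y0 := lt_le_trans x0 xy.
by rewrite lef_pV2 ?posrE ?powR_gt0//; apply: powR_le => //; exact: ltW.
Qed.

Lemma weight_quotient_measurable :
  measurable_fun (`[0, 1[ : set R) (fun r => (1 - r) `^ pp / omhat om r `^ (pp - 1)).
Proof.
apply: measurable_funM.
  by apply: (measurableT_comp (f := fun x : R => x `^ pp)) => //; exact: measurable_funB.
have h : measurable_fun (`[0, 1[ : set R) (fun r => (omhat om r `^ (pp - 1)) `^ (-1)).
  apply: (measurableT_comp (f := fun x : R => x `^ (-1))) => //.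
  by apply: (measurableT_comp (f := fun x : R => x `^ (pp - 1))) => //; exact: omhat_measurable.
by apply: eq_measurable_fun h => r _; rewrite powR_inv1// powR_ge0.
Qed.

(** On [dyad k] the integrand is eps_k^p' / omk_k^(p'-1) up to constants: 1 - r is at least eps_k/2,
    and by doubling omhat is at least omk_k / C0. *)
Theorem integral_series :
  (\int[leb]_(r in `[0%R, 1%R[) (((1 - r) `^ pp / omhat om r `^ (pp - 1))%R)%:E = +oo)%E <->
  ~ bdd sk.
Proof.
pose c := (2^-1 : R) `^ pp; pose d := C0 `^ (pp - 1).
have c0 : 0 < c by rewrite powR_gt0 ?invr_gt0.
have C0ge : 0 < C0 := lt_le_trans ltr01 C01.
have d0 : 0 < d by rewrite powR_gt0.
have mq := weight_quotient_measurable.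
have q0 r : 0 <= r < 1 -> 0 <= (1 - r) `^ pp / omhat om r `^ (pp - 1).
  by move=> _; rewrite divr_ge0 ?powR_ge0.
have [] := @integral_dyad_infty R _ (fun k => c * (eps R k `^ pp / omk k `^ (pp - 1)))
  (fun k => d * (eps R k `^ pp / omk k `^ (pp - 1))) mq q0.
- by move=> k; rewrite mulr_ge0 ?(ltW c0)// divr_ge0 ?powR_ge0.
- move=> k r hr; have /andP[w1 w2] := omhat_dyad hr.
  have or0 : 0 < omhat om r by apply: omhat_gt0; exact: dyad_sub01 hr.
  move/dyadP: hr => /andP[r1 r2]; apply/andP; split.
    have A1 : c * eps R k `^ pp <= (1 - r) `^ pp.
      rewrite /c -powRM ?eps_ge0 ?invr_ge0 ?ler0n//.
      apply: powR_le; first exact: pp0.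
        by rewrite mulr_ge0 ?eps_ge0 ?invr_ge0 ?ler0n.
      by have := epsS R k; lra.
    have A2 : (omk k `^ (pp - 1))^-1 <= (omhat om r `^ (pp - 1))^-1 by exact: powR_le_inv pp10 or0 w2.
    rewrite mulrA; apply: ler_pM A1 A2; last by rewrite invr_ge0 powR_ge0.
    exact: mulr_ge0 (ltW c0) (powR_ge0 _ _).
  have A1 : (1 - r) `^ pp <= eps R k `^ pp.
    by apply: powR_le; [exact: pp0|have := eps_gt0 R k.+1; lra|lra].
  have A2 : (omhat om r `^ (pp - 1))^-1 <= d * (omk k `^ (pp - 1))^-1.
    rewrite ler_pdivlMr ?powR_gt0 ?omk_gt0// mulrC ler_pdivrMr ?powR_gt0//.
    rewrite /d -powRM ?(ltW C0ge) ?(ltW or0)//.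
    apply: powR_le pp10 (ltW (omk_gt0 k)) _.
    by apply: le_trans (omk_doubling k) _; rewrite ler_wpM2l// ltW.
  rewrite mulrCA; apply: ler_pM A1 A2; first exact: powR_ge0.
  by rewrite invr_ge0 powR_ge0.
move=> h1 h2; split=> [/h2 nb b|nb].
  apply: nb; apply: (@bdd_le _ _ sk (d / 2)) b => [|k]; first by rewrite divr_ge0// ltW.
  by rewrite /sk epsS [leRHS](_ : _ = d * (eps R k `^ pp / omk k `^ (pp - 1)) * (eps R k / 2))//; ring.
apply: h1 => b; apply: nb; apply: (@bdd_le _ _ _ (2 / c) _ _ b) => [|k]; first by rewrite divr_ge0// ltW.
have G (e Q : R) : e * Q <= 2 / c * (c * Q * (e / 2)).
  by rewrite le_eqVlt; apply/orP; left; apply/eqP; field; rewrite gt_eqF.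
by rewrite epsS; exact: G.
Qed.

Lemma dyadic_block_sum (t : nat -> R) n :
  \sum_(k < 2 ^ n - 1) t k = \sum_(j < n) \sum_(2 ^ j - 1 <= k < 2 ^ j.+1 - 1) t k.
Proof.
elim: n => [|n ih]; first by rewrite !big_ord0.
rewrite big_ord_recr/= -ih -!(big_mkord xpredT) -big_cat_nat//=.
by rewrite expnS leq_sub2r// leq_pmull.
Qed.

(** Cauchy condensation: the block 2^j <= k + 1 < 2^(j+1) has 2^j terms, each comparable to 2^-j
    s_j. *)
Lemma dyadic_block_bdd (t s : nat -> R) (c d : R) : 0 < c -> 0 <= d -> (forall k, 0 <= t k) ->
  (forall j k, (2 ^ j <= k.+1 < 2 ^ j.+1)%N -> c * (eps R j * s j) <= t k <= d * (eps R j * s j)) ->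
  (bdd t <-> bdd s).
Proof.
move=> c0 d0 t0 h.
have card j : ((2 ^ j.+1 - 1) - (2 ^ j - 1) = 2 ^ j)%N.
  by rewrite expnS; have := expn_gt0 2 j; lia.
have blk j : c * s j <= \sum_(2 ^ j - 1 <= k < 2 ^ j.+1 - 1) t k <= d * s j.
  have cst (x : R) : \sum_(2 ^ j - 1 <= k < 2 ^ j.+1 - 1) x * (eps R j * s j) = x * s j.
    rewrite sumr_const_nat card -mulr_natl epsV natrX; field.
    by rewrite expf_neq0.
  rewrite -(cst c) -(cst d); apply/andP; split; rewrite !big_nat; apply: ler_sum => k /andP[k1 k2];
    have /andP[] // : c * (eps R j * s j) <= t k <= d * (eps R j * s j);
    by apply: h; have := expn_gt0 2 j; have := expn_gt0 2 j.+1; lia.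
split=> [[B hB]|[B hB]].
  exists (B / c) => n; rewrite ler_pdivlMr// mulrC mulr_sumr.
  apply: le_trans (hB (2 ^ n - 1)%N); rewrite dyadic_block_sum; apply: ler_sum => j _.
  by case/andP: (blk j).
exists (d * B) => n; apply: (@le_trans _ _ (\sum_(k < 2 ^ n - 1) t k)).
  have nn : (n <= 2 ^ n - 1)%N by have := ltn_expl n (isT : (1 < 2)%N); lia.
  by rewrite -!(big_mkord xpredT t) (big_cat_nat (leq0n n) nn)//= lerDl sumr_ge0.
rewrite dyadic_block_sum; apply: (@le_trans _ _ (\sum_(j < n) d * s j)).
  by apply: ler_sum => j _; case/andP: (blk j).
by rewrite -mulr_sumr ler_wpM2l.
Qed.

(** For k about 2^j, r^k is at least 1/16 from 1 - 2^-j on. On an earlier interval [dyad l], omhat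
    is larger by at most C0^(j-l), which the decay of r^k outweighs. *)
Lemma moment_bounds : exists2 K : R, 0 < K & forall j k, (2 ^ j <= k.+1 < 2 ^ j.+1)%N ->
  16^-1 * omk j <= moment om k <= K * omk j.
Proof.
have [K K0 hK] := @decay R C0 (le_trans ler01 C01).
exists (1 + K * 2) => [|j k /andP[k1 k2]]; first by rewrite ltr_wpDr// mulr_ge0.
pose g r := r ^+ k * om r.
have g0 r : 0 <= r < 1 -> 0 <= g r.
  by move=> /[dup] h /andP[r0 _]; rewrite mulr_ge0 ?exprn_ge0// om_ge0.
have mg : measurable_fun (`[0, 1[ : set R) (EFin \o g).
  apply/measurable_EFinP; apply: measurable_funM; first by apply: measurable_funX.
  by apply/measurable_EFinP; exact: om_measurable.
have sub (a b : itv_bound R) : (BLeft 0 <= a)%O -> (b <= BLeft 1)%O ->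
    [set` Interval a b] `<=` (`[0, 1[ : set R).
  by move=> ha hb; apply: subset_itv.
have mgs (A : set R) : measurable A -> A `<=` `[0, 1[ -> measurable_fun A (EFin \o g).
  by move=> mA As; apply: measurable_funS mg.
have mos (A : set R) : measurable A -> A `<=` `[0, 1[ -> measurable_fun A (EFin \o om).
  by move=> mA As; apply: measurable_funS om_measurable.
have /andP[e0 e1] := eps01 R j.
have up (i : nat) (A : set R) (b : R) : measurable A -> A `<=` `[1 - eps R i, 1[ -> 0 <= b ->
    (forall r, A r -> r ^+ k <= b) -> (\int[leb]_(r in A) (g r)%:E <= (b * omk i)%:E)%E.
  move=> mA Ai b0 hb; have A01 : A `<=` `[0, 1[.
    apply: subset_trans Ai _; apply: subset_itvr; rewrite bnd_simp.
    by case/andP: (eps01 R i).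
  have A01' r : A r -> 0 <= r < 1 by move=> /A01; rewrite /= in_itv.
  rewrite EFinM omhatE; last by case/andP: (eps01 R i).
  have i0 := andP (eps01 R i); have I01 : `[1 - eps R i, 1[ `<=` (`[0, 1[ : set R).
    by apply: subset_itvr; rewrite bnd_simp; case: i0.
  have omI (r : R) : `[1 - eps R i, 1[%classic r -> (0 <= (om r)%:E)%E.
    by move=> /I01; rewrite /= in_itv/= => h; rewrite lee_fin om_ge0.
  have -> : (b%:E * \int[leb]_(s in `[(1 - eps R i)%R, 1%R[) (om s)%:E =
      \int[leb]_(s in `[(1 - eps R i)%R, 1%R[) (b%:E * (om s)%:E))%E.
    by rewrite ge0_integralZl_EFin//; exact: mos.
  apply: (@le_trans _ _ (\int[leb]_(r in A) (b%:E * (om r)%:E))%E).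
    apply: ge0_le_integral => //.
    - by move=> r /A01' h; rewrite lee_fin g0.
    - exact: mgs.
    - by apply: emeasurable_funM => //; exact: mos.
    - by move=> r Ar; rewrite -EFinM lee_fin ler_wpM2r ?hb// om_ge0// A01'.
  apply: ge0_subset_integral => //.
  - by apply: emeasurable_funM => //; exact: mos.
  - by move=> r /omI h; rewrite mule_ge0// lee_fin.
have tail : (\int[leb]_(r in `[(1 - eps R j)%R, 1%R[) (g r)%:E <= (omk j)%:E)%E.
  rewrite -[omk j]mul1r; apply: up => // r /=; rewrite in_itv/= => /andP[h1 h2].
  by apply: exprn_ile1; [exact: le_trans h1|exact: ltW].
have headS i : (\int[leb]_(r in `[0%R, (1 - eps R i)%R[) (g r)%:E <=
    (\sum_(l < i) (1 - eps R l.+1) ^+ k * omk l)%:E)%E.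
  elim: i => [|i ih].
    by rewrite eps0 subrr set_itvco0 integral_set0 big_ord0.
  have h := epsS R i; have h' := eps_gt0 R i.
  have /andP[f0 f1] := eps01 R i.
  have -> : `[0, 1 - eps R i.+1[%classic = `[0, 1 - eps R i[ `|` dyad i :> set R.
    apply/seteqP; split=> r /=; rewrite !in_itv/=; last first.
      by case=> [/andP[]|/dyadP/andP[]]; lra.
    move=> /andP[r0 r1]; case: (ltP r (1 - eps R i)) => h1; [left|right].
      by rewrite r0.
    by apply/dyadP; rewrite h1.
  rewrite ge0_integral_setU//=.
  - rewrite big_ord_recr/= EFinD leeD//; apply: up.
    + exact: measurable_dyad.
    + move=> r /dyadP/andP[h1 h2] /=; rewrite in_itv/=; lra.
    + by rewrite exprn_ge0//; case/andP: (eps01 R i.+1).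
    + move=> r /dyadP/andP[h1 h2]; apply: lerXn2r; rewrite ?nnegrE; lra.
  - exact: measurable_dyad.
  - apply: mgs; first by apply: measurableU => //; exact: measurable_dyad.
    by move=> r /= [|/dyadP/andP[h1 h2]]; rewrite !in_itv/=; lra.
  - move=> r [rI|/dyad_sub01 h3]; rewrite lee_fin g0//.
    by move: rI; rewrite in_itv/= => /andP[]; lra.
  - rewrite disj_set2E; apply/eqP; rewrite -subset0 => r /= [].
    by rewrite in_itv/= => /andP[h1 h2] /dyadP/andP[h3 h4]; lra.
have head : (\int[leb]_(r in `[0%R, (1 - eps R j)%R[) (g r)%:E <= (K * 2 * omk j)%:E)%E.
  apply: le_trans (headS j) _; rewrite lee_fin.
  apply: (@le_trans _ _ (\sum_(l < j) K * eps R (j - l) * omk j)).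
    apply: ler_sum => l _; have lj := ltn_ord l.
    have h1 := omk_growth l (j - l); rewrite subnKC ?(ltnW lj)// in h1.
    have h2 := hK (j - l)%N k (eps R l.+1) (eps_ge0 R _) (eps_le1 R _).
    apply: (@le_trans _ _ ((1 - eps R l.+1) ^+ k * (C0 ^+ (j - l) * omk j))).
      by rewrite ler_wpM2l// exprn_ge0//; case/andP: (eps01 R l.+1).
    rewrite mulrA ler_wpM2r ?(ltW (omk_gt0 _))// mulrC; apply: h2.
    rewrite epsV mulrA ler_pdivlMr ?exprn_gt0// -exprD.
    have -> : (j - l + l.+1 = j.+1)%N by lia.
    (* From l < j follows j >= 1, so that 4 k >= 4 (2^j - 1) >= 2^(j+1), as [decay] requires. *)
    have j2 : (2 ^ 1 <= 2 ^ j)%N by rewrite leq_exp2l// (leq_ltn_trans _ lj).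
    by rewrite -natrX -natrM ler_nat expnS; rewrite expn1 in j2; lia.
  rewrite -mulr_suml -mulr_sumr ler_wpM2r ?(ltW (omk_gt0 _))// ler_wpM2l//.
  apply: le_trans (sum_eps R j); rewrite -(big_mkord xpredT (fun l => eps R (j - l))) big_nat_rev/= add0n big_mkord.
  by apply: ler_sum => l _; apply: eps_le; have := ltn_ord l; lia.
have U : (`[0, 1[ = `[0, 1 - eps R j[ `|` `[1 - eps R j, 1[ :> set R)%classic.
  apply/seteqP; split=> r /=; rewrite !in_itv/=; last by case=> /andP[]; lra.
  by move=> /andP[r0 r1]; case: (ltP r (1 - eps R j)) => h1; [left|right]; rewrite ?r0 ?r1.
have mE : (\int[leb]_(r in `[0%R, 1%R[) (g r)%:E = (moment om k)%:E)%E.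
  rewrite /moment /Rintegral fineK// -/g.
  rewrite ge0_fin_numE; last by apply: integral_ge0 => r /=; rewrite in_itv/= => h; rewrite lee_fin g0.
  apply: (@le_lt_trans _ _ (1 * omk 0)%:E); last exact: ltry.
  apply: up => //; first by rewrite eps0 subrr.
  by move=> r /=; rewrite in_itv/= => /andP[h1 h2]; apply: exprn_ile1 => //; exact: ltW.
rewrite -!lee_fin -mE; apply/andP; split.
  apply: (@le_trans _ _ (\int[leb]_(r in `[(1 - eps R j)%R, 1%R[) (g r)%:E)%E); last first.
    apply: ge0_subset_integral => //.
    by apply: subset_itvr; rewrite bnd_simp.
  have I01 : `[1 - eps R j, 1[ `<=` (`[0, 1[ : set R) by apply: subset_itvr; rewrite bnd_simp.
  have omI (r : R) : `[1 - eps R j, 1[%classic r -> (0 <= (om r)%:E)%E.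
    by move=> /I01; rewrite /= in_itv/= => h; rewrite lee_fin om_ge0.
  have -> : ((16^-1 * omk j)%:E = \int[leb]_(s in `[(1 - eps R j)%R, 1%R[) (16^-1%:E * (om s)%:E))%E.
    by rewrite EFinM omhatE// ge0_integralZl_EFin ?invr_ge0//; exact: mos.
  apply: ge0_le_integral => //.
  - move=> r /=; rewrite in_itv/= => /andP[h1 h2]; rewrite -EFinM lee_fin mulr_ge0 ?invr_ge0//.
    by rewrite om_ge0// h2 (le_trans e0).
  - by apply: emeasurable_funM => //; apply: mos => //; apply: subset_itvr; rewrite bnd_simp.
  - by apply: mgs => //; apply: subset_itvr; rewrite bnd_simp.
  - move=> r /=; rewrite in_itv/= => /andP[h1 h2]; rewrite -EFinM lee_fin ler_wpM2r//.
      by rewrite om_ge0// h2 (le_trans e0).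
    apply: le_trans (pow_eps_ge R k2) _; apply: lerXn2r => //; rewrite nnegrE//.
    exact: le_trans h1.
rewrite U ge0_integral_setU//=.
- by rewrite mulrDl mul1r [(_ + K * 2 * _)]addrC EFinD leeD.
- by rewrite -U.
- by move=> r; rewrite !in_itv/= => h; rewrite lee_fin g0//; case: h => /andP[]; lra.
- rewrite disj_set2E; apply/eqP; rewrite -subset0 => r /= [].
  by rewrite !in_itv/= => /andP[h1 h2] /andP[h3 h4]; lra.
Qed.

Theorem moment_series :
  (\sum_(0 <= k <oo)
     ((1 / ((k.+1)%:R `^ (2 + pp) * moment om k `^ (pp - 1)))%R)%:E = +oo)%E <-> ~ bdd sk.
Proof.
have [K K0 hK] := moment_bounds.
pose t k : R := 1 / ((k.+1)%:R `^ (2 + pp) * moment om k `^ (pp - 1)).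
have t0 k : 0 <= t k by rewrite divr_ge0 ?mulr_ge0 ?powR_ge0.
rewrite (nneseries_bdd t0).
(* 4 2^p' = 2^(2+p') comes from k + 1 <= 2^(j+1); K and 16 are the constants of [moment_bounds]. *)
pose c := (4 * 2 `^ pp * K `^ (pp - 1))^-1; pose d : R := 16 `^ (pp - 1).
have c0 : 0 < c by rewrite invr_gt0 !mulr_gt0 ?powR_gt0.
suff h : bdd t <-> bdd sk by split=> nb b; apply: nb; apply/h.
apply: (@dyadic_block_bdd t sk c d) => // [|j k jk]; first by rewrite powR_ge0.
have /andP[m1 m2] := hK j k jk; have ok0 := omk_gt0 j; have e0 := eps_gt0 R j.
have mom0 : 0 < moment om k by apply: lt_le_trans m1; rewrite mulr_gt0 ?invr_gt0.
have /andP[k1 k2] := jk.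
have n1 : (eps R j)^-1 <= k.+1%:R by rewrite epsV invrK -natrX ler_nat.
have n2 : k.+1%:R <= 2 * (eps R j)^-1 by rewrite epsV invrK -exprS -natrX ler_nat ltnW.
have E (x : R) : 0 < x -> x `^ (2 + pp) = x ^+ 2 * x `^ pp.
  move=> x0; rewrite powRD; last by rewrite (gt_eqF x0) implybT.
  by rewrite -powR_mulrn// ltW.
have pe : (eps R j)^-1 `^ pp = (eps R j `^ pp)^-1.
  apply: (mulfI (x := eps R j `^ pp)); first by rewrite gt_eqF// powR_gt0.
  by rewrite -powRM ?invr_ge0 ?eps_ge0// !divff ?powR1// gt_eqF// powR_gt0.
have P0 : 0 < eps R j `^ pp by rewrite powR_gt0.
have O0 : 0 < omk j `^ (pp - 1) by rewrite powR_gt0.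
have D0 : 0 < (k.+1)%:R `^ (2 + pp) * moment om k `^ (pp - 1) by rewrite mulr_gt0 ?powR_gt0.
have pp20 : 0 <= 2 + pp by rewrite addr_ge0// pp0.
have es0 : 0 <= eps R j * sk j := mulr_ge0 (eps_ge0 R j) (ltW (sk_gt0 j)).
rewrite /t; apply/andP; split.
  rewrite ler_pdivlMr//.
  apply: (@le_trans _ _ (c * (eps R j * sk j) *
      ((2 * (eps R j)^-1) `^ (2 + pp) * (K * omk j) `^ (pp - 1)))).
    apply: ler_wpM2l; first exact: mulr_ge0 (ltW c0) es0.
    apply: ler_pM (powR_ge0 _ _) (powR_ge0 _ _) _ _.
      by apply: powR_le; [exact: pp20|rewrite ler0n|exact: n2].
    exact: powR_le pp10 (ltW mom0) m2.
  rewrite E ?mulr_gt0 ?invr_gt0// !powRM ?invr_ge0 ?eps_ge0 ?(ltW K0) ?(ltW ok0)// pe /c /sk.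
  rewrite le_eqVlt; apply/orP; left; apply/eqP; field.
  by rewrite !gt_eqF// powR_gt0.
rewrite ler_pdivrMr//.
apply: (@le_trans _ _ (d * (eps R j * sk j) *
    ((eps R j)^-1 `^ (2 + pp) * (16^-1 * omk j) `^ (pp - 1)))).
  rewrite E ?invr_gt0// !powRM ?invr_ge0 ?eps_ge0 ?(ltW ok0)// pe /d /sk.
  have Z : (16 : R) `^ (pp - 1) * 16^-1 `^ (pp - 1) = 1 by rewrite -powRM ?invr_ge0// divff ?powR1.
  rewrite le_eqVlt; apply/orP; left; apply/eqP.
  rewrite -[LHS]Z; field; by rewrite !gt_eqF.
apply: ler_wpM2l; first exact: mulr_ge0 (powR_ge0 _ _) es0.
apply: ler_pM (powR_ge0 _ _) (powR_ge0 _ _) _ _.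
  by apply: powR_le; [exact: pp20|rewrite invr_ge0 eps_ge0|exact: n1].
by apply: powR_le pp10 _ m1; apply: mulr_ge0 (ltW ok0); rewrite invr_ge0 ler0n.
Qed.

End WeightSeries.

(** * Measurability of continuous functions on the disc *)

Section DiscMeasurability.
Variable R : realType.
Local Notation leb := (@lebesgue_measure R).
Local Notation leb2 := (leb \x leb)%E.

Definition grid (n : nat) (x : R) : R := (Num.floor (2 ^+ n * x))%:~R * eps R n.

Lemma grid_close n x : `|grid n x - x| <= eps R n.
Proof.
have /andP[h1 h2] := mem_rg1_floor (2 ^+ n * x).
have p0 : 0 < 2 ^+ n :> R by rewrite exprn_gt0.
rewrite /grid epsV; set m := (Num.floor _)%:~R in h1 h2 *.
have -> : m * (2 ^+ n)^-1 - x = (m - 2 ^+ n * x) / 2 ^+ n by field; rewrite gt_eqF.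
rewrite normrM (ger0_norm (x := _^-1)) ?invr_ge0 ?(ltW p0)// ler_piMl ?invr_ge0 ?(ltW p0)//.
by rewrite ler_norml; lra.
Qed.

Lemma measurable_grid_fun (f : R * R -> R) n :
  measurable_fun setT (fun z => f (grid n z.1, grid n z.2)).
Proof.
move=> _ Y mY; rewrite setTI.
pose B (ij : int * int) : set (R * R) :=
  [set z | Num.floor (2 ^+ n * z.1) = ij.1 /\ Num.floor (2 ^+ n * z.2) = ij.2 /\
    Y (f (ij.1%:~R * eps R n, ij.2%:~R * eps R n))].
have -> : (fun z => f (grid n z.1, grid n z.2)) @^-1` Y = \bigcup_ij B ij.
  apply/seteqP; split=> [z /= Yz|z [[i j] _ /= [h1 [h2 h3]]]].
    by exists (Num.floor (2 ^+ n * z.1), Num.floor (2 ^+ n * z.2)).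
  by rewrite /preimage /= /grid h1 h2.
apply: countable_bigcupT_measurable => // -[i j]; rewrite /B /=.
have [hY|hY] := pselect (Y (f (i%:~R * eps R n, j%:~R * eps R n))); last first.
  by rewrite (_ : [set _ | _] = set0)//; apply/seteqP; split=> // z [_ [_ /hY]].
have mf (k : int) : measurable [set x : R | Num.floor (2 ^+ n * x) = k].
  apply: is_interval_measurable => x y /= hx hy t /andP[xt ty].
  apply/le_anti/andP; split.
    by rewrite -hy; apply: le_floor; rewrite ler_pM2l ?exprn_gt0.
  by rewrite -hx; apply: le_floor; rewrite ler_pM2l ?exprn_gt0.
rewrite (_ : [set _ | _] = [set x | Num.floor (2 ^+ n * x) = i] `*` [set x | Num.floor (2 ^+ n * x) = j]).
  exact: measurableX.
by apply/seteqP; split=> z /=; [move=> [? []]|move=> []].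
Qed.

(** On the disc [g] is the pointwise limit of its samples on finer and finer dyadic grids, which are
    constant on countably many squares. *)
Lemma measurable_disc_fun (g : C R -> R) : (forall z, inD z -> forall e, 0 < e ->
    exists2 d : R, 0 < d & forall w, cabs (w - z) < d -> `|g w - g z| <= e) ->
  measurable_fun (@discR R) (fun z => g (pt z)).
Proof.
move=> hg; pose h n (z : R * R) := g (pt (grid n z.1, grid n z.2)).
apply: (@measurable_fun_cvg _ _ R _ h) => [n|z].
  by apply: measurable_funTS; exact: (@measurable_grid_fun (fun z => g (pt z))).
rewrite discRE => zD; apply/cvgrPdist_le => e e0.
have [d d0 hd] := hg (pt z) zD e e0.
have [N hN] : exists N, eps R N < d / 2 by apply: eps_cvg0; rewrite divr_gt0.
near=> n; rewrite distrC; apply: hd.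
apply: le_lt_trans (cabs_ReIm _) _; rewrite /=.
have h1 := grid_close n z.1; have h2 := grid_close n z.2.
have h3 : eps R n <= eps R N by apply: eps_le; near: n; exact: nbhs_infty_ge.
by apply: (@le_lt_trans _ _ (eps R n + eps R n)); [exact: lerD|lra].
Unshelve. all: by end_near. Qed.

Lemma holo_cabs_cont (f : C R -> C R) : holo f -> forall z, inD z -> forall e, 0 < e ->
    exists2 d : R, 0 < d & forall w, cabs (w - z) < d -> `|cabs (f w) - cabs (f z)| <= e.
Proof.
move=> hf z zD e e0; have [d d0 hd] := cdif_cont (holo_cdif hf zD) e0.
by exists d => // w wd; apply: le_trans (cabs_lip _ _) (hd w I wd).
Qed.

Lemma measurable_cabs_holo (f : C R -> C R) : holo f ->
  measurable_fun (@discR R) (fun z => cabs (f (pt z))).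
Proof. by move=> hf; apply: (measurable_disc_fun (g := fun z => cabs (f z))); exact: holo_cabs_cont. Qed.

Lemma measurable_radial (u : R -> R) : measurable_fun (`[0, 1[ : set R) u ->
  measurable_fun (@discR R) (fun z => u (nrm z)).
Proof.
move=> mu; apply: (measurable_comp (F := (`[0, 1[ : set R)) (f := u)) => //.
- move=> _ [z zD <-]; rewrite discRE in zD.
  by rewrite /= in_itv/= nrm_ge0.
- by apply: measurable_funTS; exact: measurable_nrm.
Qed.

Lemma powR_measurable (D : set (R * R)) (f : R * R -> R) (q : R) : measurable_fun D f ->
  measurable_fun D (fun z => f z `^ q).
Proof. exact: (measurableT_comp (measurable_powR (q))). Qed.

End DiscMeasurability.

(** * Young's inequality with a parameter *)

Section YoungOpt.
Variable R : realType.
Variable p : R.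
Hypothesis p1 : 1 < p.
Local Notation pp := (conj_exp p).

Lemma conj_exp_inv : p^-1 = 1 - pp^-1.
Proof. by have h := p1; rewrite /conj_exp; field; apply/andP; split; rewrite gt_eqF//; lra. Qed.

Lemma conj_exp_sub1 : pp - 1 = (p - 1)^-1.
Proof. by have h := p1; rewrite /conj_exp; field; rewrite subr_eq0 gt_eqF. Qed.

(* either b <= (s a)^(p-1) or s a <= b^(p'-1) *)
Lemma young_le (a b s : R) : 0 <= a -> 0 <= b -> 0 < s ->
  a * b <= s `^ (p - 1) * a `^ p + s^-1 * b `^ pp.
Proof.
move=> a0 b0 s0; have p0 : 0 < p := lt_trans ltr01 p1; have p10 : 0 < p - 1 by rewrite subr_gt0.
have pp0 : 0 < pp := lt_trans ltr01 (conj_exp_gt1 p1).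
have A0 := mulr_ge0 (powR_ge0 s (p - 1)) (powR_ge0 a p).
have B0 : 0 <= s^-1 * b `^ pp by rewrite mulr_ge0 ?powR_ge0 ?invr_ge0 ?(ltW s0).
have [h|/ltW h] := leP b ((s * a) `^ (p - 1)).
  apply: (@le_trans _ _ (s `^ (p - 1) * a `^ p)); last by rewrite lerDl.
  apply: le_trans (ler_wpM2l a0 h) _.
  by rewrite powRM ?(ltW s0)// mulrCA mulr_powRB1.
apply: (@le_trans _ _ (s^-1 * b `^ pp)); last by rewrite lerDr.
have h2 : s * a <= b `^ (pp - 1).
  have := powR_le (ltW _) (powR_ge0 _ _) h; rewrite conj_exp_sub1 => /(_ (p - 1)^-1).
  rewrite -powRrM mulfV ?gt_eqF// powRr1 ?mulr_ge0 ?(ltW s0)//; apply.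
  by rewrite invr_gt0.
rewrite mulrC -(mulr_powRB1 b0 pp0) mulrCA ler_wpM2l// ler_pdivlMl//.
Qed.

(** The value s = A^(-1/p) turns the two terms into A^(1/p) and J A^(1/p); for A = 0, s tends to
    infinity. *)
Lemma young_opt (B A J : R) : 0 <= A -> 0 <= J ->
  (forall s, 0 < s -> B <= s `^ (p - 1) * A + s^-1 * J) -> B <= (1 + J) * A `^ p^-1.
Proof.
move=> A0 J0 h; have p0 : 0 < p := lt_trans ltr01 p1.
have [A00|A00] := eqVneq A 0.
  rewrite A00 powR0 ?invr_neq0 ?gt_eqF// mulr0; apply/ler_addgt0Pr => e e0; rewrite add0r.
  have s0 : 0 < (J + 1) / e by rewrite divr_gt0// ltr_wpDl.
  apply: le_trans (h _ s0) _; rewrite A00 mulr0 add0r invf_div mulrAC ler_pdivrMr ?ltr_wpDl//.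
  by rewrite ler_wpM2l ?(ltW e0)// lerDl.
have Agt : 0 < A by rewrite lt_neqAle eq_sym A00.
have Q0 : 0 < A `^ p^-1 by rewrite powR_gt0.
have s0 : 0 < (A `^ p^-1)^-1 by rewrite invr_gt0.
apply: le_trans (h _ s0) _; rewrite invrK mulrDl mul1r mulrC [J * _]mulrC lerD2r.
have E : (A `^ p^-1)^-1 `^ (p - 1) * (A `^ p^-1) `^ (p - 1) = 1.
  by rewrite -powRM ?invr_ge0 ?powR_ge0// mulVf ?powR1// gt_eqF.
have AE : A = A `^ p^-1 * (A `^ p^-1) `^ (p - 1).
  by rewrite mulr_powRB1 ?powR_ge0// -powRrM mulVf ?powRr1 ?gt_eqF.
by rewrite [X in X * _]AE -mulrA [X in _ * X]mulrC E mulr1.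
Qed.

(** For U >= 1 the right side is at most (s + c) U^(1/p), and division leaves U^(1/p') <= s + c. *)
Lemma le_powR_bounded (U s c : R) : 0 <= U -> 0 <= s -> 0 <= c -> U <= s + c * U `^ p^-1 ->
  U <= Num.max 1 ((s + c) `^ pp).
Proof.
move=> U0 s0 c0 h; have p0 : 0 < p := lt_trans ltr01 p1.
have pp0 : 0 < pp := lt_trans ltr01 (conj_exp_gt1 p1).
rewrite le_max; have [//|/ltW U1] := leP U 1; apply/orP; right.
have E1 : (1 : R) `^ p^-1 = 1 by rewrite powR1.
have pV0 : 0 <= p^-1 by rewrite invr_ge0 ltW.
have Q1 : 1 <= U `^ p^-1 by rewrite -[leLHS]E1; exact: powR_le pV0 ler01 U1.
have h2 : U <= (s + c) * U `^ p^-1.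
  apply: le_trans h _; rewrite mulrDl lerD2r; exact: ler_peMr.
have Ugt : 0 < U := lt_le_trans ltr01 U1.
have h3 : U `^ pp^-1 <= s + c.
  rewrite -(ler_pM2r (lt_le_trans ltr01 Q1)) -powRD; last by rewrite (gt_eqF Ugt) implybT.
  by have -> : pp^-1 + p^-1 = 1; [rewrite conj_exp_inv addrC subrK|rewrite powRr1].
have := powR_le (ltW pp0) (powR_ge0 _ _) h3.
by rewrite -powRrM mulVf ?gt_eqF// powRr1.
Qed.

End YoungOpt.

(** * Dirichlet norms, and the embedding when the series converges *)

Section DirichletNorm.
Variable R : realType.
Local Notation leb := (@lebesgue_measure R).
Local Notation leb2 := (leb \x leb)%E.
Implicit Types (q : R) (nu : C R -> R) (f : C R -> C R).

Definition Dint q nu f : \bar R :=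
  (\int[leb2]_(z in @discR R) (cabs (cderiv f (pt z)) `^ q * nu (pt z))%:E)%E.

Lemma DpowE q nu f : Dpow q nu f = ((pi^-1)%:E * Dint q nu f + (cabs (f 0) `^ q)%:E)%E.
Proof. by []. Qed.

Definition weight_ge0 nu := forall z, inD z -> 0 <= nu z.

Lemma Dint_ge0 q nu f : weight_ge0 nu -> (0 <= Dint q nu f)%E.
Proof.
move=> nu0; apply: integral_ge0 => z; rewrite discRE => zD.
by rewrite lee_fin mulr_ge0 ?powR_ge0// nu0.
Qed.

Lemma pi_gt0R : 0 < pi :> R. Proof. exact: pi_gt0. Qed.

(** Unpacks [fine] and the root in [Dnorm], so that estimates can be made on [Dint]; [inDsp_bound]
    goes the other way. *)
Lemma Dnorm_split q nu f : 0 < q -> weight_ge0 nu -> inDsp q nu f ->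
  exists2 A : R, 0 <= A &
    [/\ Dint q nu f = A%:E, A <= pi * Dnorm q nu f `^ q & cabs (f 0) <= Dnorm q nu f].
Proof.
move=> q0 nu0 [hf]; rewrite DpowE => fin; have D0 := Dint_ge0 q f nu0.
have Dfin : Dint q nu f \is a fin_num.
  rewrite ge0_fin_numE// ltNge; apply/negP; rewrite leye_eq => /eqP DE.
  by move: fin; rewrite DE mulry gtr0_sg ?invr_gt0 ?pi_gt0R// mul1e addye.
have DE := fineK Dfin; set A := fine _ in DE.
have A0 : 0 <= A by rewrite -lee_fin DE.
have PE : Dnorm q nu f `^ q = pi^-1 * A + cabs (f 0) `^ q.
  rewrite /Dnorm -powRrM mulVf ?gt_eqF// DpowE -DE -EFinM -EFinD /= powRr1//.
  by rewrite addr_ge0 ?powR_ge0// mulr_ge0// invr_ge0 ltW// pi_gt0R.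
exists A => //; split=> //.
  by rewrite PE mulrDr mulrA divff ?gt_eqF ?pi_gt0R// mul1r lerDl mulr_ge0 ?powR_ge0// ltW// pi_gt0R.
have h : cabs (f 0) `^ q <= Dnorm q nu f `^ q.
  by rewrite PE lerDr mulr_ge0// invr_ge0 ltW// pi_gt0R.
have qV0 : 0 <= q^-1 by rewrite invr_ge0 ltW.
have := powR_le qV0 (powR_ge0 _ _) h.
have : 0 <= Dnorm q nu f by exact: powR_ge0.
move: (Dnorm q nu f) => N N0; by rewrite -!powRrM mulfV ?gt_eqF// !powRr1 ?cabs_ge0 ?powR_ge0.
Qed.

Lemma inDsp_bound q nu f (A : R) : 0 < q -> weight_ge0 nu -> holo f -> 0 <= A ->
  (Dint q nu f <= A%:E)%E ->
  inDsp q nu f /\ Dnorm q nu f <= (pi^-1 * A + cabs (f 0) `^ q) `^ q^-1.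
Proof.
move=> q0 nu0 hf A0 DA; have D0 := Dint_ge0 q f nu0.
have piV : 0 <= pi^-1 :> R by rewrite invr_ge0 ltW// pi_gt0R.
have le : (Dpow q nu f <= (pi^-1 * A + cabs (f 0) `^ q)%:E)%E.
  by rewrite DpowE EFinD leeD// EFinM lee_wpmul2l// lee_fin.
split; first by split => //; exact: le_lt_trans le (ltry _).
have P0 : (0 <= Dpow q nu f)%E by rewrite DpowE adde_ge0 ?mule_ge0 ?lee_fin// ?powR_ge0.
apply: powR_le; rewrite ?invr_ge0 ?(ltW q0)//; first exact: fine_ge0.
by rewrite -lee_fin fineK// ge0_fin_numE//; exact: le_lt_trans le (ltry _).
Qed.

Lemma radial_integral_le : exists2 k : R, 0 < k & forall u : R -> R,
  measurable_fun (`[0, 1[ : set R) u -> (forall r, 0 <= r < 1 -> 0 <= u r) ->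
  (\int[leb2]_(z in @discR R) (u (nrm z))%:E <= k%:E * \int[leb]_(r in `[0%R, 1%R[) (u r)%:E)%E.
Proof.
have [k k0 hk] := radial_integral R; exists k => // u mu u0.
rewrite (hk (EFin \o u)); last 2 first.
- exact/measurable_EFinP.
- by move=> r r01; rewrite lee_fin u0.
apply: lee_wpmul2l; first by rewrite lee_fin ltW.
apply: ge0_le_integral => //.
- by move=> r /=; rewrite in_itv/= => r01; rewrite -EFinM lee_fin mulr_ge0 ?u0//; case/andP: r01.
- by apply: emeasurable_funM; [apply/measurable_EFinP|exact/measurable_EFinP].
- exact/measurable_EFinP.
- by move=> r /=; rewrite in_itv/= => r01; rewrite -EFinM lee_fin ler_piMl ?u0//; case/andP: r01 => _ /ltW.
Qed.

Variables (p : R) (om : R -> R) (C0 : R).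
Hypotheses (p1 : 1 < p) (hom : radial_weight om) (C01 : 1 <= C0).
Hypothesis hC0 : forall r, 0 <= r < 1 -> omhat om r <= C0 * omhat om ((1 + r) / 2).
Local Notation pp := (conj_exp p).

Lemma omhat_x_ge0 x : weight_ge0 (omhat_x om x).
Proof. by move=> z zD; rewrite mulr_ge0 ?powR_ge0// omhat_ge0// cabs_ge0. Qed.

Lemma std_weight_ge0 y : -1 <= y -> weight_ge0 (@std_weight R y).
Proof. by move=> y1 z zD; rewrite mulr_ge0 ?powR_ge0//; lra. Qed.

Lemma radial_ge0 : weight_ge0 (radial om).
Proof. by move=> z zD; apply: (om_ge0 hom); rewrite cabs_ge0. Qed.

Lemma id_bounded_of_bdd : bdd (sk p om) ->
  exists y ps : R, [/\ pp < y, 0 < ps & id_bounded ps (omhat_x om (p * (y - 1))) (ps / p) (@std_weight R y)].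
Proof.
move=> sB; have p0 : 0 < p := lt_trans ltr01 p1.
have pp1 := conj_exp_gt1 p1; have pp0 : 0 < pp := lt_trans ltr01 pp1.
have [k k0 hk] := radial_integral_le.
pose Fq r := (1 - r) `^ pp / omhat om r `^ (pp - 1).
have mFq : measurable_fun (`[0, 1[ : set R) Fq by exact: weight_quotient_measurable.
have Fq0 r : 0 <= Fq r by rewrite divr_ge0 ?powR_ge0.
have [J J0 hJ] : exists2 J : R, 0 <= J & (\int[leb2]_(z in @discR R) (Fq (nrm z))%:E <= J%:E)%E.
  have I0 : (0 <= \int[leb]_(r in `[0%R, 1%R[) (Fq r)%:E)%E.
    by apply: integral_ge0 => r _; rewrite lee_fin.
  have Ifin : (\int[leb]_(r in `[0%R, 1%R[) (Fq r)%:E)%E \is a fin_num.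
    rewrite ge0_fin_numE// ltNge; apply/negP; rewrite leye_eq => /eqP/(integral_series p1 hom C01 hC0).
    by apply.
  exists (k * fine (\int[leb]_(r in `[0%R, 1%R[) (Fq r)%:E)%E).
    by rewrite mulr_ge0 ?(ltW k0)// fine_ge0.
  by rewrite EFinM fineK//; apply: hk.
exists (pp + 1), p; split => //; first by rewrite ltrDl.
rewrite addrK divff ?gt_eqF//.
(* Compares [std_weight (pp + 1)] with (1 - |z|)^(p'+1), by 1 - |z|^2 <= 2 (1 - |z|). *)
pose c : R := (pp + 1 + 1) * 2 `^ (pp + 1).
have c0 : 0 <= c by rewrite mulr_ge0 ?powR_ge0// !addr_ge0// ltW.
pose K := pi^-1 * (c * ((1 + J) * pi `^ p^-1)) + 1.
have piV : 0 <= pi^-1 :> R by rewrite invr_ge0 ltW// pi_gt0R.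
exists K => f fD; have hf := fD.1; have hh := holo_cderiv hf.
have [A A0 [AE AN f0N]] := Dnorm_split p0 (omhat_x_ge0 (p * pp)) fD.
(* The product a b is |f'| (1 - |z|)^(p'+1), while a^p is the integrand of the source norm and b^p'
   that of condition (ii). *)
pose a z := cabs (cderiv f (pt z)) * (omhat om (nrm z) `^ p^-1 * (1 - nrm z) `^ pp).
pose b z := (1 - nrm z) / omhat om (nrm z) `^ p^-1.
have mo : measurable_fun (@discR R) (fun z => omhat om (nrm z)).
  by apply: measurable_radial; exact: omhat_measurable.
have m1 : measurable_fun (@discR R) (fun z => 1 - nrm z).
  by apply: measurable_funB => //; apply: measurable_funTS; exact: measurable_nrm.
have ma : measurable_fun (@discR R) a.
  apply: measurable_funM; first exact: measurable_cabs_holo.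
  by apply: measurable_funM; apply: powR_measurable.
have mb : measurable_fun (@discR R) b.
  apply: measurable_funM => //.
  have h : measurable_fun (@discR R) (fun z => (omhat om (nrm z) `^ p^-1) `^ (-1)).
    by apply: powR_measurable; apply: powR_measurable.
  by apply: eq_measurable_fun h => z _; rewrite powR_inv1// powR_ge0.
have inD' z : @discR R z -> [/\ 0 < 1 - nrm z, 0 < omhat om (nrm z) & 0 <= nrm z < 1].
  rewrite discRE /= => z1; have z0 := nrm_ge0 z; split; first by rewrite subr_gt0.
    by apply: (omhat_gt0 hom); rewrite z0.
  by rewrite z0.
have a0 z : @discR R z -> 0 <= a z by move=> _; rewrite !mulr_ge0 ?powR_ge0// cabs_ge0.
have b0 z : @discR R z -> 0 <= b z.
  by move=> /inD'[z1 _ _]; rewrite divr_ge0 ?powR_ge0// ltW.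
have abE z : @discR R z -> a z * b z = cabs (cderiv f (pt z)) * (1 - nrm z) `^ (pp + 1).
  move=> /inD'[z1 o1 _]; rewrite /a /b powRD; last by rewrite (gt_eqF z1) implybT.
  by rewrite powRr1 ?(ltW z1)//; field; rewrite gt_eqF// powR_gt0.
have apE z : @discR R z -> a z `^ p = cabs (cderiv f (pt z)) `^ p * omhat_x om (p * pp) (pt z).
  move=> /inD'[z1 o1 _]; rewrite /a !powRM ?mulr_ge0 ?powR_ge0 ?cabs_ge0// -!powRrM mulVf ?gt_eqF//.
  by rewrite powRr1 ?(ltW o1)// mulrC [pp * p]mulrC [LHS]mulrC.
have bpE z : @discR R z -> b z `^ pp = Fq (nrm z).
  move=> /inD'[z1 o1 _]; rewrite /b powRM ?(ltW z1) ?invr_ge0 ?powR_ge0//; congr (_ * _).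
  have -> : pp - 1 = p^-1 * pp.
    by rewrite (conj_exp_inv p1) mulrBl mul1r mulVf ?gt_eqF.
  rewrite (powRrM _ p^-1 pp); apply: (mulfI (x := (omhat om (nrm z) `^ p^-1) `^ pp)).
    by rewrite gt_eqF// powR_gt0// powR_gt0.
  by rewrite -powRM ?invr_ge0 ?powR_ge0// !divff ?powR1// gt_eqF ?powR_gt0.
have mab : measurable_fun (@discR R) (EFin \o (fun z => a z * b z)).
  by apply/measurable_EFinP; exact: measurable_funM.
have map : measurable_fun (@discR R) (fun z => a z `^ p) by exact: powR_measurable.
have mbp : measurable_fun (@discR R) (fun z => b z `^ pp) by exact: powR_measurable.
have mD := @measurable_discR R.
have young s : 0 < s ->
    (\int[leb2]_(z in @discR R) (a z * b z)%:E <= (s `^ (p - 1) * A + s^-1 * J)%:E)%E.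
  move=> s0; have sV0 : 0 <= s^-1 by rewrite invr_ge0 ltW.
  apply: (@le_trans _ _ (\int[leb2]_(z in @discR R)
      ((s `^ (p - 1))%:E * (a z `^ p)%:E + (s^-1)%:E * (b z `^ pp)%:E))%E).
    apply: ge0_le_integral => //.
    - by move=> z zD; rewrite lee_fin mulr_ge0 ?a0 ?b0.
    - by apply: emeasurable_funD; apply: emeasurable_funM => //; exact/measurable_EFinP.
    - move=> z zD; rewrite -!EFinM -EFinD lee_fin.
      exact: (young_le p1 (a0 z zD) (b0 z zD) s0).
  rewrite ge0_integralD//; last 4 first.
  - by move=> z _; rewrite -EFinM lee_fin mulr_ge0 ?powR_ge0.
  - by apply: emeasurable_funM => //; exact/measurable_EFinP.
  - by move=> z _; rewrite -EFinM lee_fin mulr_ge0 ?powR_ge0.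
  - by apply: emeasurable_funM => //; exact/measurable_EFinP.
  rewrite !ge0_integralZl_EFin ?powR_ge0//; try by [exact/measurable_EFinP|move=> z _; rewrite lee_fin powR_ge0].
  rewrite EFinD !EFinM; apply: leeD.
    apply: lee_wpmul2l; first by rewrite lee_fin powR_ge0.
    rewrite -AE; rewrite le_eqVlt; apply/orP; left; apply/eqP; apply: eq_integral => z; rewrite inE => zD.
    by rewrite apE.
  apply: lee_wpmul2l; first by rewrite lee_fin.
  apply: le_trans hJ; rewrite le_eqVlt; apply/orP; left; apply/eqP; apply: eq_integral => z; rewrite inE => zD.
  by rewrite bpE.
have I0 : (0 <= \int[leb2]_(z in @discR R) (a z * b z)%:E)%E.
  by apply: integral_ge0 => z zD; rewrite lee_fin mulr_ge0 ?a0 ?b0.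
have Ifin : (\int[leb2]_(z in @discR R) (a z * b z)%:E)%E \is a fin_num.
  by rewrite ge0_fin_numE//; exact: le_lt_trans (young 1 ltr01) (ltry _).
have IE := fineK Ifin; set B := fine _ in IE.
have Bopt : B <= (1 + J) * A `^ p^-1.
  by apply: (young_opt p1 A0 J0) => s s0; rewrite -lee_fin IE; exact: young.
have B0 : 0 <= B by rewrite -lee_fin IE.
have pp2 : -1 <= pp + 1 by lra.
have DI : (Dint 1 (@std_weight R (pp + 1)) f <= (c * B)%:E)%E.
  rewrite EFinM IE -ge0_integralZl_EFin//; last by move=> z zD; rewrite lee_fin mulr_ge0 ?a0 ?b0.
  apply: ge0_le_integral => //.
  - by move=> z; rewrite discRE => zD; rewrite lee_fin mulr_ge0 ?powR_ge0// std_weight_ge0.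
  - apply/measurable_EFinP; apply: measurable_funM.
      by apply: powR_measurable; exact: measurable_cabs_holo.
    apply: measurable_funM => //; apply: powR_measurable.
    apply: measurable_funB => //; apply: measurable_funX.
    by apply: measurable_funTS; exact: measurable_nrm.
  - exact: emeasurable_funM.
  - move=> z zD; rewrite -EFinM lee_fin abE// powRr1 ?cabs_ge0// [c * _]mulrCA.
    apply: ler_wpM2l; first exact: cabs_ge0.
    have [z1 _ /andP[z0 z2]] := inD' z zD.
    rewrite /std_weight /c -mulrA; apply: ler_wpM2l; first by lra.
    rewrite -(powRM _ (ler0n _ 2) (ltW z1)); apply: powR_le; [by lra| |].
      by rewrite -/(nrm z) subr_ge0 expr_le1// ltW.
    by rewrite -/(nrm z) -{1}(expr1n _ 2) subr_sqr mulrC ler_wpM2r ?(ltW z1)//; lra.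
have [fD1 N1] := inDsp_bound ltr01 (std_weight_ge0 pp2) hf (mulr_ge0 c0 B0) DI.
split=> //; apply: le_trans N1 _; rewrite invr1 !powRr1 ?cabs_ge0 ?addr_ge0 ?mulr_ge0 ?cabs_ge0//.
have NN0 : 0 <= Dnorm p (omhat_x om (p * pp)) f by exact: powR_ge0.
have pV0 : 0 <= p^-1 by rewrite invr_ge0 ltW.
have A1 : A `^ p^-1 <= pi `^ p^-1 * Dnorm p (omhat_x om (p * pp)) f.
  have := powR_le pV0 A0 AN; rewrite powRM ?powR_ge0 ?(ltW pi_gt0R)//.
  by rewrite -(powRrM _ p) mulfV ?gt_eqF// powRr1.
have -> : K * Dnorm p (omhat_x om (p * pp)) f
    = pi^-1 * (c * ((1 + J) * (pi `^ p^-1 * Dnorm p (omhat_x om (p * pp)) f)))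
      + Dnorm p (omhat_x om (p * pp)) f by rewrite /K; ring.
apply: (lerD _ f0N); apply: (ler_wpM2l piV); apply: (ler_wpM2l c0).
by apply: (le_trans Bopt); apply: (ler_wpM2l _ A1); apply: addr_ge0.
by rewrite !addr_ge0// ltW.
Qed.

End DirichletNorm.

(** * Sums decaying geometrically in |j - k| *)

Section GeometricDistance.
Variable R : realType.

(** The distance |j - k|: one of the truncated differences is 0. *)
Definition ndist (j k : nat) : nat := (j - k) + (k - j).

Lemma ndistSS j k : ndist j.+1 k.+1 = ndist j k.
Proof. by rewrite /ndist !subSS. Qed.

Lemma ndist_addr j m : ndist j (j + m) = m.
Proof. by rewrite /ndist subnDA subnn sub0n addKn. Qed.

Lemma ndist_addl k m : ndist (k + m) k = m.
Proof. by rewrite /ndist addnC; exact: ndist_addr. Qed.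

(** Each distance occurs at most once on either side of [k]. *)
Lemma sum_ndist (F : nat -> R) n k : (forall m, 0 <= F m) ->
  \sum_(j < n) F (ndist j k) <= \sum_(m < n) F m + \sum_(m < k.+1) F m.
Proof.
move=> F0; elim: k n => [|k ih] n.
  rewrite (eq_bigr (fun i : 'I_n => F i)) => [|i _]; last by rewrite /ndist subn0 sub0n addn0.
  by rewrite lerDl sumr_ge0.
case: n => [|n]; first by rewrite !big_ord0 add0r sumr_ge0.
rewrite big_ord_recl [ndist _ _]/ndist sub0n subn0 add0n.
rewrite (eq_bigr (fun i : 'I_n => F (ndist i k))) => [|i _]; last by rewrite lift0 ndistSS.
rewrite [\sum_(m < k.+2) F m]big_ord_recr/= addrA [leLHS]addrC lerD2r.
by apply: le_trans (ih n) _; rewrite lerD2r big_ord_recr/= lerDl.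
Qed.

Lemma sum_pow_from (d : R) N n : 0 <= d -> d < 1 ->
  \sum_(m < n) (if (N <= m)%N then d ^+ m else 0) <= d ^+ N / (1 - d).
Proof.
move=> d0 d1; have d1' : 0 < 1 - d by rewrite subr_gt0.
rewrite ler_pdivlMr//.
suff : (\sum_(m < n) (if (N <= m)%N then d ^+ m else 0)) * (1 - d) + d ^+ maxn N n <= d ^+ N.
  by apply: le_trans; rewrite lerDl exprn_ge0.
elim: n => [|n ih]; first by rewrite big_ord0 mul0r add0r maxn0.
rewrite big_ord_recr/= mulrDl; have [Nn|nN] := leqP N n.
  move: ih; rewrite (maxn_idPr Nn) (maxn_idPr (leqW Nn)) exprS; apply: le_trans.
  by rewrite -addrA lerD2l; set x := d ^+ n; lra.
by rewrite mul0r addr0; move: ih; rewrite (maxn_idPl nN) (maxn_idPl (ltnW nN)).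
Qed.

Lemma sum_pow_ndist (d : R) N n k : 0 <= d -> d < 1 ->
  \sum_(j < n) (if (N <= ndist j k)%N then d ^+ ndist j k else 0) <= 2 * d ^+ N / (1 - d).
Proof.
move=> d0 d1; pose F m : R := if (N <= m)%N then d ^+ m else 0.
have F0 m : 0 <= F m by rewrite /F; case: ifP => // _; exact: exprn_ge0.
apply: le_trans (@sum_ndist F n k F0) _.
by have := lerD (sum_pow_from N n d0 d1) (sum_pow_from N k.+1 d0 d1); rewrite -mulrA mulr_natl mulr2n.
Qed.

Lemma sum_pow_ndist0 (d : R) n k : 0 <= d -> d < 1 ->
  \sum_(j < n) d ^+ ndist j k <= 2 / (1 - d).
Proof. by move=> d0 d1; have := @sum_pow_ndist d 0 n k d0 d1; rewrite expr0 mulr1. Qed.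

End GeometricDistance.

(** * Lacunary polynomials *)

Section LacunaryPolynomials.
Variable R : realType.
Local Notation leb := (@lebesgue_measure R).
Local Notation leb2 := (leb \x leb)%E.
Implicit Types (c : nat -> R).

(** The norms see derivatives, so the coefficients are prescribed for the derivative; the test
    function is its primitive [lac_prim], which vanishes at 0. *)
Definition lac c n (z : C R) : C R := \sum_(j < n) (c j)%:C * z ^+ (2 ^ j).
Definition lac_prim c n (z : C R) : C R := \sum_(j < n) (c j / (2 ^ j).+1%:R)%:C * z ^+ (2 ^ j).+1.
Definition lac_max c n (r : R) : R := \sum_(j < n) c j * r ^+ (2 ^ j).

Lemma cdif_exp A (z : C R) m : cdif A (fun w : C R => w ^+ m.+1) z (m.+1%:R * z ^+ m).
Proof.
elim: m => [|m ih]; first by rewrite expr0 mulr1; exact: cdif_id.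
have := cdifM (cdif_id A z) ih; rewrite mul1r => h.
have -> : m.+2%:R * z ^+ m.+1 = z ^+ m.+1 + z * (m.+1%:R * z ^+ m).
  by rewrite -[m.+2]add1n natrD mulrDl mul1r exprS; ring.
case: h => phi [fE pz cp]; by exists phi.
Qed.

Lemma lac_prim_cdif A c n z : cdif A (lac_prim c n) z (lac c n z).
Proof.
rewrite /lac; elim: n => [|n ih].
  rewrite big_ord0; have [phi [fE pz cp]] := cdif_cst A 0 z; exists phi; split=> // w Aw.
  by rewrite /lac_prim !big_ord0; exact: fE.
rewrite big_ord_recr/=.
have h := cdifD ih (cdifZ (c n / (2 ^ n).+1%:R)%:C (cdif_exp A z (2 ^ n))).
have E : (c n / (2 ^ n).+1%:R)%:C * ((2 ^ n).+1%:R * z ^+ (2 ^ n)) = (c n)%:C * z ^+ (2 ^ n).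
  rewrite mulrA; congr (_ * _); rewrite -(rmorph_nat (real_complex R)) -rmorphM/= divfK// pnatr_eq0.
rewrite E in h; have [phi [fE pz cp]] := h; exists phi; split=> // w Aw.
by rewrite /lac_prim !big_ord_recr/=; exact: fE.
Qed.

Lemma holo_lac_prim c n : holo (lac_prim c n).
Proof. by apply/holo_dfb => z _; exists (lac c n z); exact: lac_prim_cdif. Qed.

Lemma cderiv_lac_prim c n z : cderiv (lac_prim c n) z = lac c n z.
Proof. by have /cdif_derive[] := lac_prim_cdif setT c n z. Qed.

Lemma lac_prim0 c n : lac_prim c n 0 = 0.
Proof. by rewrite /lac_prim big1// => j _; rewrite expr0n/= mulr0. Qed.

Lemma lac_le c c' n z : (forall j, 0 <= c j) -> (forall j, c j <= c' j) ->
  cabs (lac c n z) <= lac_max c' n (cabs z).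
Proof.
move=> c0 cc; apply: le_trans (cabs_sum _ _ _) _; apply: ler_sum => j _.
by rewrite cabsM cabsX (cabs_rcge0 (c0 _)) ler_wpM2r// exprn_ge0// cabs_ge0.
Qed.

Lemma lac_ge c n z k : (k < n)%N -> (forall j, 0 <= c j) ->
  c k * cabs z ^+ (2 ^ k) - \sum_(j < n | (j : nat) != k) c j * cabs z ^+ (2 ^ j) <= cabs (lac c n z).
Proof.
move=> kn c0; rewrite /lac [X in _ <= cabs X](bigD1 (Ordinal kn))//=.
have cE j : cabs ((c j)%:C * z ^+ (2 ^ j)) = c j * cabs z ^+ (2 ^ j).
  by rewrite cabsM cabsX (cabs_rcge0 (c0 _)).
rewrite -[X in _ <= cabs (_ + X)]opprK; apply: le_trans (cabs_subl _ _); rewrite cabsN cE lerD2l lerN2.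
apply: le_trans (cabs_sum _ _ _) _; apply: ler_sum => j _; by rewrite cE.
Qed.

Lemma lac_max_measurable c n (D : set R) : measurable_fun D (lac_max c n).
Proof. by apply: measurable_sum => j; apply: measurable_funM => //; exact: measurable_funX. Qed.

End LacunaryPolynomials.

(** * Integrals over dyadic annuli *)

Section DyadicAnnuli.
Variable R : realType.
Local Notation leb := (@lebesgue_measure R).
Local Notation leb2 := (leb \x leb)%E.

Lemma dyad_inj i j (r : R) : dyad i r -> dyad j r -> i = j.
Proof. by move=> hi hj; apply: (dyad_disjoint (R := R)) => //; exists r. Qed.

Lemma dyadEx (r : R) : 0 <= r < 1 -> exists k, dyad k r.
Proof.
move=> r01; have : (`[0, 1[%classic : set R) r by rewrite /= in_itv.
by rewrite dyad_cover => -[k _ rk]; exists k.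
Qed.

Lemma measurable_dyad_integrand (f : R -> R) k : measurable_fun (`[0, 1[ : set R) f ->
  measurable_fun (dyad k) (EFin \o f).
Proof.
move=> mf; apply/measurable_EFinP; apply: measurable_funS mf => //.
by rewrite dyad_cover; exact: bigcup_sup.
Qed.

Lemma integral_dyad_le (f : R -> R) (b : nat -> R) (B : R) :
  measurable_fun (`[0, 1[ : set R) f -> (forall r, 0 <= r < 1 -> 0 <= f r) ->
  (forall k r, dyad k r -> f r <= b k) ->
  (forall n, \sum_(k < n) b k * eps R k.+1 <= B) ->
  (\int[leb]_(r in `[0%R, 1%R[) (f r)%:E <= B%:E)%E.
Proof.
move=> mf f0 fb hB; rewrite integral_dyad//.
apply: lime_le; first by apply: is_cvg_nneseries => k _ _; apply: integral_ge0 => r /dyad_sub01 ?; rewrite lee_fin f0.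
apply: nearW => n; rewrite big_mkord; apply: (@le_trans _ _ (\sum_(k < n) b k * eps R k.+1)%:E); last by rewrite lee_fin.
rewrite -sumEFin; apply: lee_sum => k _.
have b0 r : dyad k r -> 0 <= f r <= b k by move=> hr; rewrite fb// f0// (dyad_sub01 hr).
have [x -> /andP[_ h]] := integral_dyad_bounds mf (lexx 0) b0.
by rewrite lee_fin.
Qed.

Lemma integral_dyad_ge (f : R -> R) (a : nat -> R) n :
  measurable_fun (`[0, 1[ : set R) f -> (forall r, 0 <= r < 1 -> 0 <= f r) -> (forall k, 0 <= a k) ->
  (forall k r, (k < n)%N -> dyad k r -> a k <= f r) ->
  ((\sum_(k < n) a k * eps R k.+1)%:E <= \int[leb]_(r in `[0%R, 1%R[) (f r)%:E)%E.
Proof.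
move=> mf f0 a0 af; rewrite integral_dyad//.
apply: le_trans (nneseries_lim_ge n _) => [|k _ _]; last first.
  by apply: integral_ge0 => r /dyad_sub01 ?; rewrite lee_fin f0.
rewrite big_mkord -sumEFin; apply: lee_sum => k _.
rewrite EFinM -dyad_length -integral_cst//; last exact: measurable_dyad.
apply: ge0_le_integral => //; first exact: measurable_dyad.
- by move=> r _; rewrite lee_fin.
- exact: measurable_dyad_integrand.
- by move=> r hr; rewrite lee_fin af.
Qed.

(** The area element brings a factor r, at least 1/2 on every annulus but the central one, for which
    [a 0] is therefore 0. *)
Lemma annuli_ge : exists2 c : R, 0 < c & forall (F : R * R -> R) (a : nat -> R) n,
  measurable_fun (@discR R) F -> (forall z, discR z -> 0 <= F z) ->
  (forall k, 0 <= a k) -> a 0%N = 0 -> (forall k z, (k < n)%N -> dyad k (nrm z) -> a k <= F z) ->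
  ((c * \sum_(k < n) a k * eps R k.+1)%:E <= \int[leb2]_(z in @discR R) (F z)%:E)%E.
Proof.
have [k0 k00 hk] := radial_integral R; exists (k0 / 2) => [|F a n mF F0 a0 a00 aF]; first by rewrite divr_gt0.
pose u (r : R) : R := \sum_(k < n) a k * \1_(dyad k) r.
have mu : measurable_fun (`[0, 1[ : set R) u.
  apply: measurable_sum => j; apply: measurable_funM => //.
  by apply: measurable_indic; exact: measurable_dyad.
have uE k r : dyad k r -> u r = if (k < n)%N then a k else 0.
  move=> hk'; rewrite /u; have iE j : (\1_(dyad j) r : R) = (j == k)%:R.
    rewrite indicE; case: eqP => [->|jk]; first by rewrite mem_set.
    by rewrite memNset// => hj; apply: jk; exact: dyad_inj hj hk'.
  under eq_bigr do rewrite iE.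
  case: ifPn => [kn|kn]; last first.
    rewrite big1// => j _; case: eqP => [jk|_]; last by rewrite mulr0.
    by move: kn; rewrite -jk ltn_ord.
  rewrite (bigD1 (Ordinal kn))//= eqxx mulr1 big1 ?addr0// => j jk.
  by case: eqP => [jk'|_]; [case/eqP: jk; exact: val_inj|rewrite mulr0].
have u0 r : 0 <= u r by apply: sumr_ge0 => j _; rewrite mulr_ge0// indicE.
have le1 : (\int[leb2]_(z in @discR R) (u (nrm z))%:E <= \int[leb2]_(z in @discR R) (F z)%:E)%E.
  apply: ge0_le_integral => //.
  - exact: measurable_discR.
  - by move=> z _; rewrite lee_fin.
  - by apply/measurable_EFinP; apply: measurable_radial.
  - exact/measurable_EFinP.
  - move=> z zD; rewrite lee_fin; have h := zD; rewrite discRE/= in h.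
    have [k hk'] : exists k, dyad k (nrm z) by apply: dyadEx; rewrite nrm_ge0 h.
    by rewrite (uE k)//; case: ifP => kn; [exact: aF|exact: F0].
apply: le_trans le1; rewrite (hk (EFin \o u)); last 2 first.
- exact/measurable_EFinP.
- by move=> r _; rewrite lee_fin.
rewrite -mulrA EFinM; apply: lee_wpmul2l; first by rewrite lee_fin ltW.
have -> : 2^-1 * (\sum_(k < n) a k * eps R k.+1) = \sum_(k < n) (a k / 2) * eps R k.+1.
  by rewrite mulr_sumr; apply: eq_bigr => j _; rewrite mulrA [2^-1 * _]mulrC.
have mf : measurable_fun (`[0, 1[ : set R) (fun r => r * u r) by apply: measurable_funM.
apply: (@le_trans _ _ (\int[leb]_(r in `[0%R, 1%R[) (r * u r)%:E)%E); last first.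
  by rewrite le_eqVlt; apply/orP; left; apply/eqP; apply: eq_integral => r _; rewrite EFinM.
apply: (@integral_dyad_ge (fun r => r * u r) (fun k => a k / 2)) => //.
- by move=> r /andP[r0 _]; rewrite mulr_ge0.
- by move=> k; rewrite divr_ge0.
- move=> k r kn hr; rewrite (uE k)// kn; case: k kn hr => [|k] kn hr; first by rewrite a00 mul0r mulr0.
  rewrite mulrC ler_wpM2r//; move/dyadP: hr => /andP[hr _].
  by apply: le_trans hr; have := eps_le R (ltn0Sn k : 1 <= k.+1)%N; rewrite /eps expr1; lra.
Qed.

End DyadicAnnuli.

(** * Coefficients of the lacunary test functions *)

Section LacunaryCoefficients.
Variable R : realType.
Variables (p : R) (om : R -> R) (C0 y q : R).
Hypotheses (p1 : 1 < p) (hom : radial_weight om) (C01 : 1 <= C0).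
Hypothesis hC0 : forall r, 0 <= r < 1 -> omhat om r <= C0 * omhat om ((1 + r) / 2).
Local Notation pp := (conj_exp p).
Hypotheses (ypp : pp < y) (q0 : 0 < q).

(* Equality case of Hoelder: a^q eps^y eps and a^(pq) omk eps^(p(y-1)) eps both equal sk. *)
Definition lac_coef k : R := (eps R k `^ (pp - y) / omk om k `^ (pp - 1)) `^ q^-1.
Local Notation a := lac_coef.

Lemma lac_coef_base_gt0 k : 0 < eps R k `^ (pp - y) / omk om k `^ (pp - 1).
Proof. by rewrite divr_gt0 ?powR_gt0 ?eps_gt0 ?omk_gt0. Qed.

Lemma lac_coef_gt0 k : 0 < a k.
Proof. by rewrite powR_gt0// lac_coef_base_gt0. Qed.

Lemma lac_coef_pow k : a k `^ q = eps R k `^ (pp - y) / omk om k `^ (pp - 1).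
Proof. by rewrite -(powRrM _ q^-1 q) mulVf ?gt_eqF// powRr1// ltW// lac_coef_base_gt0. Qed.

Lemma lac_coef_low k : a k `^ q * (eps R k * eps R k `^ y) = sk p om k.
Proof.
rewrite lac_coef_pow /sk; have e0 : eps R k != 0 by rewrite gt_eqF// eps_gt0.
have -> : eps R k `^ pp = eps R k `^ (pp - y) * eps R k `^ y.
  by rewrite -powRD ?e0 ?implybT// subrK.
by ring.
Qed.

Lemma lac_coef_high k :
  a k `^ (q * p) * (omk om k * (eps R k * eps R k `^ (p * (y - 1)))) = sk p om k.
Proof.
have o0 := omk_gt0 hom k; have e0 := eps_gt0 R k.
rewrite (powRrM _ q p) lac_coef_pow /sk.
have -> : (eps R k `^ (pp - y) / omk om k `^ (pp - 1)) `^ p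
    = eps R k `^ ((pp - y) * p) / (omk om k `^ (pp - 1) * omk om k).
  rewrite (powRM p (powR_ge0 _ _) _) ?invr_ge0 ?powR_ge0// -(powRrM _ (pp - y) p); congr (_ * _).
  rewrite -powR_inv1 ?powR_ge0// -(powRrM _ (-1) p) mulN1r powRN -(powRrM _ (pp - 1) p); congr (_^-1).
  rewrite [_ * p]mulrC (conj_exp_mul p1) -{3}[omk om k]powRr1 ?(ltW o0)//.
  by rewrite -powRD ?subrK// (gt_eqF o0) implybT.
have -> : eps R k `^ pp = eps R k `^ ((pp - y) * p) * eps R k `^ (p * (y - 1)).
  rewrite -powRD ?(gt_eqF e0) ?implybT//; congr (_ `^ _).
  by have h := conj_exp_sub p1; lra.
move: (omk om k `^ _) (powR_gt0 (pp - 1) o0) => P P0; field.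
by rewrite !gt_eqF.
Qed.

(** Since y > p', the factor eps_k^(p'-y) grows geometrically, and 1/omk does not decrease. *)
Lemma lac_coef_up : exists2 d : R, 0 < d < 1 & forall k m, a k <= d ^+ m * a (k + m)%N.
Proof.
pose g : R := 2^-1 `^ (y - pp); have g0 : 0 < g by rewrite powR_gt0.
have qV0 : 0 < q^-1 by rewrite invr_gt0.
exists (g `^ q^-1).
  rewrite powR_gt0//= /g -powRrM; have E : (1 : R) `^ ((y - pp) * q^-1) = 1 by rewrite powR1.
  rewrite -[ltRHS]E; apply: gt0_ltr_powR; rewrite ?nnegrE//.
    by rewrite mulr_gt0// subr_gt0.
  by rewrite invf_lt1// ltr1n.
have step k : a k <= g `^ q^-1 * a k.+1.
  rewrite /a -powRM ?(ltW g0)//; last exact: ltW (lac_coef_base_gt0 _).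
  apply: (powR_le (ltW qV0) (ltW (lac_coef_base_gt0 _))).
  rewrite epsS powRM ?eps_ge0// mulrA [g * _]mulrCA /g -powRD; last by rewrite invr_eq0 pnatr_eq0 implybT.
  have -> : y - pp + (pp - y) = 0 by ring.
  rewrite powRr0 mulr1.
  apply: (ler_wpM2l (powR_ge0 _ _)).
  exact: (powR_le_inv (pp10 p1) (omk_gt0 hom _) (omk_le hom (leqnSn k))).
move=> k; elim=> [|m ih]; first by rewrite expr0 mul1r addn0.
apply: le_trans ih _; rewrite exprSr -mulrA addnS; apply: ler_wpM2l (step _).
by rewrite exprn_ge0// powR_ge0.
Qed.

Lemma lac_coef_growth : exists2 A : R, 0 <= A & forall k m, a (k + m)%N <= A ^+ m * a k.
Proof.
pose g : R := 2^-1 `^ (pp - y) * C0 `^ (pp - 1).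
have qV0 : 0 < q^-1 by rewrite invr_gt0.
have C00 : 0 < C0 by exact: lt_le_trans C01.
have g0 : 0 <= g by rewrite mulr_ge0 ?powR_ge0.
exists (g `^ q^-1); first exact: powR_ge0.
have step k : a k.+1 <= g `^ q^-1 * a k.
  rewrite /a -powRM//; last exact: ltW (lac_coef_base_gt0 _).
  apply: (powR_le (ltW qV0) (ltW (lac_coef_base_gt0 _))).
  rewrite epsS powRM ?eps_ge0//.
  have h : (omk om k.+1 `^ (pp - 1))^-1 <= C0 `^ (pp - 1) / omk om k `^ (pp - 1).
    rewrite ler_pdivlMr ?powR_gt0 ?omk_gt0// ler_pdivrMl ?powR_gt0 ?omk_gt0//.
    rewrite mulrC -powRM ?(ltW C00) ?(ltW (omk_gt0 hom _))//.
    exact: (powR_le (pp10 p1) (ltW (omk_gt0 hom _)) (omk_doubling hC0 k)).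
  have := ler_wpM2l (mulr_ge0 (powR_ge0 (eps R k) (pp - y)) (powR_ge0 2^-1 (pp - y))) h.
  move=> /le_trans; apply; rewrite le_eqVlt; apply/orP; left; apply/eqP; rewrite /g; ring.
move=> k; elim=> [|m ih]; first by rewrite expr0 mul1r addn0.
rewrite addnS; apply: le_trans (step _) _; rewrite exprS -mulrA; apply: ler_wpM2l ih.
exact: powR_ge0.
Qed.

(** On the k-th annulus the k-th term dominates: for j <= k the coefficients grow geometrically
    towards [a k], for j > k the powers r^(2^j) decay faster than the coefficients can grow, by
    [decay]. *)
Lemma lac_coef_term : exists W d : R, [/\ 1 <= W, 0 < d < 1 & forall j k (r : R),
  0 <= r <= 1 -> (j <= k)%N || (r <= 1 - eps R k.+1) ->
  a j * r ^+ (2 ^ j) <= W * d ^+ ndist j k * a k].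
Proof.
have [d1 /andP[d10 d11] h1] := lac_coef_up.
have [A A0 hA] := lac_coef_growth; have [K K0 hK] := decay A0.
have h2 : (0 < 2^-1 :> R) && (2^-1 < 1 :> R) by rewrite invr_gt0 ltr0n invf_lt1// ltr1n.
exists (Num.max 1 K), (Num.max d1 2^-1); split; first by rewrite le_max lexx.
  by rewrite lt_max d10 gt_max d11; case/andP: h2.
have dX m (x : R) : 0 < x -> x <= Num.max d1 2^-1 -> x ^+ m <= Num.max d1 2^-1 ^+ m.
  by move=> x0 xd; apply: lerXn2r => //; rewrite nnegrE ?(ltW x0)// (le_trans _ xd)// ltW.
move=> j k r /andP[r0 r1]; have ak := ltW (lac_coef_gt0 k).
have [jk _|kj /= rk] := leqP j k.
  have -> : ndist j k = (k - j)%N by rewrite -{1}(subnKC jk) ndist_addr.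
  apply: le_trans (ler_piMr (ltW (lac_coef_gt0 j)) (exprn_ile1 _ r0 r1)) _.
  apply: le_trans (h1 j (k - j)%N) _; rewrite (subnKC jk); apply: (ler_wpM2r ak).
  rewrite -[leLHS]mul1r; apply: (ler_pM ler01 (exprn_ge0 _ (ltW d10)) _ (dX _ d1 d10 _)).
    by rewrite le_max lexx.
  by rewrite le_max lexx.
have [m jE] : exists m, j = (k + m)%N by exists (j - k)%N; rewrite subnKC// ltnW.
have -> : ndist j k = m by rewrite jE ndist_addl.
have hd : A ^+ m * (1 - eps R k.+1) ^+ (2 ^ j) <= K * eps R m.
  apply: hK; rewrite ?eps_ge0 ?eps_le1//.
  have -> : 4 * ((2 ^ j)%:R * eps R k.+1) = 2 * 2 ^+ m * (eps R k * 2 ^+ k) :> R.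
    by rewrite epsS jE natrX exprD; field.
  by rewrite epsV mulVf ?mulr1 ?expf_neq0// ler_peMl ?exprn_ge0// ler1n.
apply: (@le_trans _ _ (A ^+ m * a k * (1 - eps R k.+1) ^+ (2 ^ j))).
  rewrite {1}jE; apply: (ler_pM (ltW (lac_coef_gt0 _)) (exprn_ge0 _ r0) (hA k m)).
  by apply: lerXn2r => //; rewrite nnegrE// (le_trans r0 rk).
rewrite mulrAC; apply: (ler_wpM2r ak); apply: (le_trans hd).
apply: (ler_pM K0 (eps_ge0 _ _)); first by rewrite le_max lexx orbT.
by apply: dX; rewrite ?le_max ?lexx ?orbT//; case/andP: h2.
Qed.

End LacunaryCoefficients.

(** * A bounded identity map forces convergence *)

Section LacunaryTest.
Variable R : realType.
Local Notation leb := (@lebesgue_measure R).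
Local Notation leb2 := (leb \x leb)%E.
Variables (p : R) (om : R -> R) (C0 y q : R).
Hypotheses (p1 : 1 < p) (hom : radial_weight om) (C01 : 1 <= C0).
Hypothesis hC0 : forall r, 0 <= r < 1 -> omhat om r <= C0 * omhat om ((1 + r) / 2).
Local Notation pp := (conj_exp p).
Hypotheses (ypp : pp < y) (q0 : 0 < q).
Local Notation a := (lac_coef p om y q).
Local Notation s := (sk p om).

(** Nearer to the circle than the scale of the last frequency 2^n the sum stays of the size of its
    last coefficient; hence [minn k n]. *)
Lemma lac_max_le : exists2 H : R, 0 < H & forall n k r, dyad k r ->
  lac_max a n.+1 r <= H * a (minn k n).
Proof.
have [W [d [W1 /andP[d0 d1] hW]]] := lac_coef_term p1 hom C01 hC0 ypp q0.
have W0 : 0 < W := lt_le_trans ltr01 W1.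
exists (W * (2 / (1 - d))) => [|n k r kr]; first by rewrite mulr_gt0// divr_gt0// subr_gt0.
have /andP[r0 r1] := dyad_sub01 kr; move/dyadP: kr => /andP[_ rk].
apply: (@le_trans _ _ (\sum_(j < n.+1) W * d ^+ ndist j (minn k n) * a (minn k n))).
  apply: ler_sum => j _; apply: hW; first by rewrite r0 ltW.
  by have [kn|nk] := leqP k n; [rewrite (ltW rk) orbT|rewrite -ltnS ltn_ord].
rewrite -mulr_suml -mulr_sumr; apply: (ler_wpM2r (ltW (lac_coef_gt0 _ _ _ hom _))).
apply: (ler_wpM2l (ltW W0)); exact: sum_pow_ndist0 (ltW d0) d1.
Qed.

Local Notation x := (p * (y - 1)).

(** Beyond [n] the coefficient is frozen while eps_k, a factor of the weighted measure of the
    annulus, keeps halving. *)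
Lemma lac_tail n k : a (minn k n) `^ (q * p) * (omk om k * (eps R k * eps R k `^ x))
  <= s (minn k n) * eps R (k - n).
Proof.
have [kn|nk] := leqP k n.
  move/eqP: (kn) => ->; rewrite eps0 mulr1.
  by rewrite (lac_coef_high _ p1 hom q0).
rewrite -(lac_coef_high y p1 hom q0) -!mulrA; apply: (ler_wpM2l (powR_ge0 _ _)).
have -> : omk om n * (eps R n * (eps R n `^ x * eps R (k - n))) = omk om n * (eps R k * eps R n `^ x).
  by rewrite -{2}(subnKC (ltnW nk)) epsD; ring.
apply: (ler_pM (ltW (omk_gt0 hom _)) _ (omk_le hom (ltnW nk))); first by rewrite mulr_ge0 ?eps_ge0 ?powR_ge0.
apply: (ler_wpM2l (eps_ge0 _ _)); apply: powR_le (eps_ge0 _ _) (eps_le R (ltnW nk)).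
have h1 := conj_exp_gt1 p1; apply: mulr_ge0; first by have := p1; lra.
by have := ypp; lra.
Qed.

Lemma lac_tail_sum n N : \sum_(k < N) s (minn k n) * eps R (k - n) <= 3 * \sum_(k < n.+1) s k.
Proof.
have s0 k : 0 <= s k by exact: ltW (sk_gt0 _ hom k).
have F0 k : 0 <= s (minn k n) * eps R (k - n) by rewrite mulr_ge0// eps_ge0.
have E1 : \sum_(k < n.+1) s (minn k n) * eps R (k - n) = \sum_(k < n.+1) s k.
  apply: eq_bigr => -[k kn] _ /=; rewrite (minn_idPl _)//.
  have /eqP -> : (k - n == 0)%N by rewrite subn_eq0.
  by rewrite eps0 mulr1.
have E2 : \sum_(i < N) s (minn (n.+1 + i) n) * eps R (n.+1 + i - n) <= 2 * s n.
  under eq_bigr => i _.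
    have -> : minn (n.+1 + i) n = n by apply/minn_idPr; rewrite addSn leqW// leq_addr.
    have -> : (n.+1 + i - n = i.+1)%N by rewrite addSnnS addKn.
    over.
  rewrite -mulr_sumr mulrC; apply: (ler_wpM2r (s0 n)); apply: le_trans (sum_eps R N).
  by apply: ler_sum => i _; exact: eps_le.
have sn : s n <= \sum_(k < n.+1) s k by rewrite big_ord_recr/= lerDr sumr_ge0.
apply: (@le_trans _ _ (\sum_(k < n.+1 + N) s (minn k n) * eps R (k - n))).
  by rewrite addnC big_split_ord/= lerDl sumr_ge0.
rewrite big_split_ord/= E1; apply: le_trans (lerD (lexx _) E2) _; lra.
Qed.

(** Stated for all coefficients below [a], because it is applied to the thinned sums [lac_sub]. *)
Lemma lac_weighted_upper : exists2 K : R, 0 < K & forall n c,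
  (forall j, 0 <= c j <= a j) ->
  (Dint (q * p) (omhat_x om x) (lac_prim c n.+1) <= (K * \sum_(k < n.+1) s k)%:E)%E.
Proof.
have [H H0 hH] := lac_max_le; have [k0 k00 hk] := radial_integral_le R.
have qp0 : 0 <= q * p by rewrite mulr_ge0 ?(ltW q0)//; have := p1; lra.
exists (k0 * (H `^ (q * p) * 3)) => [|n c hc]; first by rewrite !mulr_gt0// powR_gt0.
have c0 j : 0 <= c j by case/andP: (hc j).
have ca j : c j <= a j by case/andP: (hc j).
have a0 j : 0 <= a j := ltW (lac_coef_gt0 _ _ _ hom j).
pose u r := lac_max a n.+1 r `^ (q * p) * (omhat om r * (1 - r) `^ x).
have mu : measurable_fun (`[0, 1[ : set R) u.
  apply: measurable_funM.
    by apply: (measurableT_comp (measurable_powR (q * p))); exact: lac_max_measurable.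
  apply: measurable_funM; first exact: omhat_measurable.
  by apply: (measurableT_comp (measurable_powR x)); exact: measurable_funB.
have u0 r : 0 <= r < 1 -> 0 <= u r.
  by move=> /andP[r0 _]; rewrite mulr_ge0 ?powR_ge0// mulr_ge0 ?powR_ge0// (omhat_ge0 hom).
apply: (@le_trans _ _ (\int[leb2]_(z in @discR R) (u (nrm z))%:E)%E).
  apply: ge0_le_integral => //.
  - exact: measurable_discR.
  - move=> z zD; rewrite lee_fin mulr_ge0 ?powR_ge0//; apply: (omhat_x_ge0 hom).
    by rewrite discRE in zD.
  - apply/measurable_EFinP; apply: measurable_funM.
      by apply: powR_measurable; apply: measurable_cabs_holo; apply: holo_cderiv; exact: holo_lac_prim.
    by apply: (measurable_radial (u := fun r => omhat om r * (1 - r) `^ x)); apply: measurable_funM; [exact: omhat_measurable|apply: (measurableT_comp (measurable_powR x)); exact: measurable_funB].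
  - by apply/measurable_EFinP; exact: measurable_radial.
  - move=> z zD; rewrite lee_fin; apply: ler_wpM2r.
      by apply: (omhat_x_ge0 hom); rewrite discRE in zD.
    rewrite cderiv_lac_prim; apply: (powR_le qp0 (cabs_ge0 _)); exact: lac_le.
apply: le_trans (hk u mu u0) _; rewrite -mulrA EFinM; apply: lee_wpmul2l; first by rewrite lee_fin ltW.
apply: (integral_dyad_le (b := fun k => (H * a (minn k n)) `^ (q * p) * (omk om k * eps R k `^ x))) => //.
  move=> k r kr; have /andP[r0 r1] := dyad_sub01 kr; have rk := kr; move/dyadP: rk => /andP[rk1 rk2].
  have /andP[_ ok] := omhat_dyad hom kr.
  apply: ler_pM; [exact: powR_ge0|by rewrite mulr_ge0 ?powR_ge0// (omhat_ge0 hom)| |].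
    apply: (powR_le qp0); last exact: hH.
    by apply: sumr_ge0 => j _; rewrite mulr_ge0 ?exprn_ge0.
  apply: (ler_pM (omhat_ge0 hom r0) (powR_ge0 _ _) ok); apply: powR_le; [|by lra|by lra].
  have h1 := conj_exp_gt1 p1; apply: mulr_ge0; first by have := p1; lra.
  by have := ypp; lra.
move=> N; apply: (@le_trans _ _ (\sum_(k < N) H `^ (q * p) * (s (minn k n) * eps R (k - n)))).
  apply: ler_sum => k _; rewrite (powRM _ (ltW H0) (a0 _)) -(mulrA _ _ (eps R k.+1)) -(mulrA (H `^ _)).
  apply: (ler_wpM2l (powR_ge0 _ _)); apply: le_trans (lac_tail n k).
  apply: (ler_wpM2l (powR_ge0 _ _)); rewrite -mulrA.
  apply: (ler_wpM2l (ltW (omk_gt0 hom _))); rewrite mulrC; apply: (ler_wpM2r (powR_ge0 _ _)).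
  exact: eps_le.
rewrite -mulr_sumr -mulrA; apply: (ler_wpM2l (powR_ge0 _ _)); exact: lac_tail_sum.
Qed.

(** Keeps one residue class modulo [N]. Indices of a class are at least [N] apart, so the neighbours
    of the dominant term cannot cancel it; the classes together recover all coefficients. *)
Definition lac_sub N i j : R := if (j %% N == i)%N then a j else 0.

Lemma lac_sub_bounds N i j : 0 <= lac_sub N i j <= a j.
Proof.
by have := ltW (lac_coef_gt0 p y q hom j); rewrite /lac_sub; case: ifP => _ h; rewrite ?lexx h.
Qed.

Lemma ndist_mod N i j k : (j %% N == i)%N -> (k %% N == i)%N -> j != k -> (N <= ndist j k)%N.
Proof.
wlog jk : j k / (j <= k)%N => [hw ji ki jk|ji ki jk'].
  have [l|l] := leqP j k; first exact: hw.
  by rewrite /ndist addnC; apply: hw (ltnW l) ki ji _; rewrite eq_sym.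
rewrite -(subnKC jk) ndist_addr; apply: dvdn_leq; first by rewrite subn_gt0 ltn_neqAle jk'.
by rewrite -eqn_mod_dvd// (eqP ki) (eqP ji).
Qed.

(** The k-th term is at least a_k/16 by [pow_eps_ge]; the others, at distance at least the modulus,
    sum to a geometric tail, which a large modulus brings below a_k/32. *)
Lemma lac_sub_ge : exists2 N : nat, (0 < N)%N & forall i n k z, (0 < k)%N -> (k < n)%N ->
  (k %% N == i)%N -> dyad k (cabs z) -> a k / 32 <= cabs (lac (lac_sub N i) n z).
Proof.
have [W [d [W1 /andP[d0 d1] hW]]] := lac_coef_term p1 hom C01 hC0 ypp q0.
have W0 : 0 < W := lt_le_trans ltr01 W1.
have [N hN] : exists N, d ^+ N.+1 <= (1 - d) / (64 * W).
  have e0 : 0 < (1 - d) / (64 * W) by rewrite divr_gt0 ?mulr_gt0// subr_gt0.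
  have : d ^+ n @[n --> \oo] --> 0 by apply: cvg_expr; rewrite ger0_norm// ltW.
  move=> /cvgrPdist_lt/(_ _ e0)[n _ /(_ n.+1 (leqnSn n))]; rewrite /= sub0r normrN => h.
  by exists n; apply: ltW; rewrite -[ltLHS]ger0_norm// exprn_ge0// ltW.
exists N.+1 => // i n k z k0 kn ki kz.
have /andP[r0 r1] := dyad_sub01 kz; have := kz; move/dyadP => /andP[rk1 rk2].
have ak := lac_coef_gt0 p y q hom k.
have cs0 j : 0 <= lac_sub N.+1 i j by case/andP: (lac_sub_bounds N.+1 i j).
apply: le_trans (lac_ge z kn cs0); rewrite /lac_sub ki -/(lac_sub _ _).
have h1 : a k / 16 <= a k * cabs z ^+ (2 ^ k).
  apply: (ler_wpM2l (ltW ak)); apply: (@le_trans _ _ ((1 - eps R k) ^+ (2 ^ k))).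
    have k2 : ((2 ^ k).+1 < 2 ^ k.+1)%N.
      by rewrite expnS mul2n -addnn -addn1 ltn_add2l -{1}(expn0 2) ltn_exp2l.
    exact: (pow_eps_ge _ k2).
  by apply: lerXn2r => //; rewrite nnegrE//; case/andP: (eps01 R k).
have h2 : \sum_(j < n | (j : nat) != k) lac_sub N.+1 i j * cabs z ^+ (2 ^ j) <= a k / 32.
  apply: (@le_trans _ _ (\sum_(j < n) W * (if (N.+1 <= ndist j k)%N then d ^+ ndist j k else 0) * a k)).
    rewrite big_mkcond/=; apply: ler_sum => j _; case: ifPn => [jk|_]; last first.
      by rewrite mulr_ge0 ?(ltW ak)// mulr_ge0 ?(ltW W0)//; case: ifP => // _; rewrite exprn_ge0 ?(ltW d0).
    rewrite /lac_sub; case: ifPn => ji; last first.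
      by rewrite mul0r mulr_ge0 ?(ltW ak)// mulr_ge0 ?(ltW W0)//; case: ifP => // _; rewrite exprn_ge0 ?(ltW d0).
    rewrite (ndist_mod ji ki jk); apply: hW; first by rewrite r0 ltW.
    by rewrite (ltW rk2) orbT.
  rewrite -mulr_suml -mulr_sumr mulrC; apply: (ler_wpM2l (ltW ak)).
  apply: le_trans (ler_wpM2l (ltW W0) (sum_pow_ndist N.+1 n k (ltW d0) d1)) _.
  rewrite mulrA ler_pdivrMr ?subr_gt0//.
  apply: (@le_trans _ _ (W * (2 * ((1 - d) / (64 * W))))).
    by apply: (ler_wpM2l (ltW W0)); apply: ler_wpM2l hN.
  rewrite le_eqVlt; apply/orP; left; apply/eqP; field; by rewrite gt_eqF.
by rewrite /lac_sub in h2; lra.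
Qed.

Lemma lac_std_lower : exists N (c : R), [/\ (0 < N)%N, 0 < c & forall i n,
  ((c * \sum_(k < n) (if (0 < k)%N && (k %% N == i)%N then s k else 0))%:E
    <= Dint q (@std_weight R y) (lac_prim (lac_sub N i) n))%E].
Proof.
have [N N0 hN] := lac_sub_ge; have [c0 c00 hc] := annuli_ge R.
have y1 : 1 <= y by have := conj_exp_gt1 p1; have := ypp; lra.
have P0 : 0 < 32^-1 `^ q :> R by rewrite powR_gt0.
have Q0 : 0 < 2^-1 `^ y :> R by rewrite powR_gt0.
(* 32^-q comes from [lac_sub_ge], 2^-y from 1 - |z|^2 >= eps_k/2, and the last 1/2 from the length
   of [dyad k]. *)
exists N, (c0 * (32^-1 `^ q * 2^-1 `^ y / 2)); split => // [|i n].
  by rewrite mulr_gt0// divr_gt0// mulr_gt0.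
pose b k := if (0 < k)%N && (k %% N == i)%N then (a k / 32) `^ q * eps R k.+1 `^ y else 0.
have b0 k : 0 <= b k by rewrite /b; case: ifP => // _; rewrite mulr_ge0 ?powR_ge0.
have E : c0 * (32^-1 `^ q * 2^-1 `^ y / 2)
    * \sum_(k < n) (if (0 < k)%N && (k %% N == i)%N then s k else 0) =
    c0 * \sum_(k < n) b k * eps R k.+1.
  rewrite -mulrA mulr_sumr; congr (_ * _); apply: eq_bigr => k _; rewrite /b; case: ifP => _; last by rewrite mulr0 mul0r.
  rewrite -(lac_coef_low p y hom q0) epsS (powRM _ (ltW (lac_coef_gt0 _ _ _ hom _))) ?invr_ge0//.
  by rewrite (powRM _ (eps_ge0 _ _)) ?invr_ge0//; ring.
rewrite E; apply: hc => //.
- apply: measurable_funM.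
    by apply: powR_measurable; apply: measurable_cabs_holo; apply: holo_cderiv; exact: holo_lac_prim.
  apply: measurable_funM => //; apply: powR_measurable.
  apply: measurable_funB => //; apply: measurable_funX.
  by apply: measurable_funTS; exact: measurable_nrm.
- move=> z zD; rewrite mulr_ge0 ?powR_ge0// mulr_ge0 ?powR_ge0//; lra.
move=> k z kn kz; rewrite /b; case: ifPn => [/andP[k0 ki]|_]; last first.
  by rewrite mulr_ge0 ?powR_ge0// mulr_ge0 ?powR_ge0//; lra.
have /andP[r0 r1] := dyad_sub01 kz; have := kz; move/dyadP => /andP[rk1 rk2].
have ak := lac_coef_gt0 p y q hom k.
apply: ler_pM; rewrite ?powR_ge0//.
  apply: (powR_le (ltW q0)); first by rewrite divr_ge0 ?(ltW ak).
  by rewrite cderiv_lac_prim; exact: hN.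
have y10 : 0 <= y by lra.
have h : eps R k.+1 `^ y <= (1 - cabs (pt z) ^+ 2) `^ y.
  apply: (powR_le y10 (eps_ge0 _ _)); rewrite -/(nrm z); move: (nrm z) r0 r1 rk2 => r r0 r1 rk2.
  have := ler_wpM2l r0 (ltW r1); rewrite -expr2 mulr1; lra.
apply: (le_trans h); rewrite /std_weight; apply: ler_peMl; [exact: powR_ge0|lra].
Qed.

(** For each class the q-th power of the target norm dominates that class's part of S_n, while the
    source norm is at most a multiple of S_n^(1/(q p)); the q-th power of the latter is
    S_n^(1/p). *)
Lemma bdd_of_id_bounded :
  id_bounded (q * p) (omhat_x om (p * (y - 1))) q (@std_weight R y) -> bdd s.
Proof.
move=> [K hK]; have [N [c [N0 c0 hlow]]] := lac_std_lower; have [L L0 hup] := lac_weighted_upper.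
have p0 : 0 < p := lt_trans ltr01 p1; have qp0 : 0 < q * p by rewrite mulr_gt0.
have y1 : -1 <= y by have := conj_exp_gt1 p1; have := ypp; lra.
have s0 k : 0 <= s k by exact: ltW (sk_gt0 _ hom k).
pose S n := \sum_(k < n.+1) s k; have S0 n : 0 <= S n by exact: sumr_ge0.
have pV : 0 <= pi^-1 :> R by rewrite invr_ge0 ltW// pi_gt0R.
pose K1 := Num.max K 0; pose B := c^-1 * (pi * (K1 * (pi^-1 * L) `^ (q * p)^-1) `^ q).
have part i n : \sum_(k < n.+1) (if (0 < k)%N && (k %% N == i)%N then s k else 0) <= B * S n `^ p^-1.
  have f0 : cabs (lac_prim (lac_sub N i) n.+1 0) = 0 by rewrite lac_prim0 cabs0.
  have LS : 0 <= L * S n by rewrite mulr_ge0 ?(ltW L0).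
  have [fD fN] := inDsp_bound qp0 (omhat_x_ge0 hom _) (@holo_lac_prim R _ _) LS (hup n _ (lac_sub_bounds N i)).
  have [gD gN] := hK _ fD.
  have [A A0 [AE AN _]] := Dnorm_split q0 (std_weight_ge0 y1) gD.
  rewrite f0 powR0 ?(gt_eqF qp0)// addr0 in fN.
  have h1 := hlow i n.+1; rewrite AE lee_fin in h1.
  rewrite /B -mulrA ler_pdivlMl//; apply: le_trans h1 _; apply: le_trans AN _; rewrite -mulrA.
  apply: ler_wpM2l; first exact: ltW (pi_gt0R _).
  have SE : S n `^ p^-1 = (S n `^ (q * p)^-1) `^ q.
    rewrite -(powRrM (S n) (q * p)^-1 q); congr (_ `^ _).
    by move: p q p0 q0 => p' q' p0' q0'; field; rewrite !gt_eqF.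
  have K10 : 0 <= K1 by rewrite le_max lexx orbT.
  have W0 : 0 <= K1 * (pi^-1 * L) `^ (q * p)^-1 by rewrite mulr_ge0 ?powR_ge0.
  rewrite SE -(powRM q W0 (powR_ge0 _ _)).
  apply: (powR_le (ltW q0) (powR_ge0 _ _)); apply: (le_trans gN).
  apply: (@le_trans _ _ (K1 * Dnorm (q * p) (omhat_x om (p * (y - 1))) (lac_prim (lac_sub N i) n.+1))).
    by apply: (ler_wpM2r (powR_ge0 _ _)); rewrite le_max lexx.
  rewrite -mulrA; apply: (ler_wpM2l K10); apply: (le_trans fN).
  by rewrite mulrA powRM// mulr_ge0// ltW.
have B0 : 0 <= B.
  rewrite mulr_ge0 ?invr_ge0 ?(ltW c0)// mulr_ge0 ?powR_ge0//; exact: ltW (pi_gt0R _).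
have total n : S n <= s 0 + (N%:R * B) * S n `^ p^-1.
  (* [s 0] stands apart since the lower bounds leave out the central annulus. *)
  have E : S n = s 0 + \sum_(i < N) \sum_(k < n.+1) (if (0 < k)%N && (k %% N == i)%N then s k else 0).
    rewrite exchange_big/= /S [LHS]big_ord_recl [X in _ = _ + X]big_ord_recl/= [X in _ = _ + (X + _)]big1 ?add0r//.
    congr (_ + _); apply: eq_bigr => k _; move: (bump 0 k) => m.
    rewrite (bigD1 (Ordinal (ltn_pmod m N0)))//= eqxx big1 ?addr0// => i ik.
    by case: ifP => // /eqP ki; case/eqP: ik; apply: val_inj.
  rewrite [leLHS]E lerD2l; apply: (@le_trans _ _ (\sum_(i < N) B * S n `^ p^-1)).
    by apply: ler_sum => i _; exact: part.
  by rewrite sumr_const card_ord -[_ *+ _]mulr_natl mulrA lexx.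
exists (Num.max 1 ((s 0 + N%:R * B) `^ pp)) => n.
have NB0 : 0 <= N%:R * B by rewrite mulr_ge0.
apply: (@le_trans _ _ (S n)); first by rewrite /S big_ord_recr/= lerDl.
exact: (le_powR_bounded p1 (S0 n) (s0 0%N) NB0 (total n)).
Qed.

End LacunaryTest.

(** The integral of a nonnegative function is a supremum over the simple functions below it, which
    is monotone for arbitrary functions. *)
Lemma ge0_integral_mono (d : measure_display) (T : measurableType d) (R : realType)
    (mu : {measure set T -> \bar R}) (D : set T) (f g : T -> \bar R) :
  (forall x, D x -> 0 <= f x)%E -> (forall x, D x -> f x <= g x)%E ->
  (\int[mu]_(x in D) f x <= \int[mu]_(x in D) g x)%E.
Proof.
move=> f0 fg.
have p0 (h : T -> \bar R) : (forall x, D x -> 0 <= h x)%E -> (forall x, 0 <= (h \_ D) x)%E.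
  by move=> h0 x; rewrite patchE; case: ifPn => // /set_mem; exact: h0.
have g0 x : D x -> (0 <= g x)%E by move=> Dx; apply: le_trans (fg x Dx); exact: f0.
rewrite [leLHS]integral_mkcond [leRHS]integral_mkcond !ge0_integralTE; [|exact: p0|exact: p0].
apply: ub_ereal_sup => _ [h hf <-]; apply: ereal_sup_ubound; exists h => //= x.
apply: le_trans (hf x) _; rewrite !patchE; case: ifPn => // /set_mem; exact: fg.
Qed.

(** * Length of the arcs close to a boundary point *)

Section ArcMeasure.
Variable R : realType.
Local Notation leb := (@lebesgue_measure R).
Local Notation leb2 := (leb \x leb)%E.

Lemma cisD (s t : R) : cis (s + t)%:C = cis s%:C * cis t%:C :> C R.
Proof.
by apply/eqP; rewrite eq_complex/= mulrDr cosD sinD eqxx/= addrC.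
Qed.

(** A weak Jordan inequality: while cos x >= 1/2 the mean value theorem gives slope at least 1/2,
    and afterwards sin x >= 1/4. *)
Lemma sin_ge_lin (x : R) : 0 <= x -> x <= pi / 2 -> x / (2 * pi) <= sin x.
Proof.
move=> x0 xh; have p0 : 0 < pi :> R := pi_gt0 R.
have q4 : x / (2 * pi) <= 4^-1 by rewrite ler_pdivrMr ?mulr_gt0//; lra.
have [c2|c2] := leP (2^-1) (cos x); last first.
  have s0 : 0 <= sin x by apply: sin_ge0_pi; rewrite x0/=; lra.
  have c0 : 0 <= cos x by apply: cos_ge0_pihalf; apply/andP; split; lra.
  apply: le_trans q4 _; rewrite leNgt; apply/negP => h.
  have := cos2Dsin2 x; have : cos x ^+ 2 <= 4^-1 by rewrite expr2; nra.
  have : sin x ^+ 2 <= 16^-1 by rewrite expr2; nra.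
  lra.
have [->|xN0] := eqVneq x 0; first by rewrite mul0r sin0.
have x0' : 0 < x by rewrite lt_neqAle eq_sym xN0.
have [c] := @MVT R sin cos 0 x x0' (fun y _ => is_derive_sin y) (continuous_subspaceT (fun y => @continuous_sin R y)).
rewrite in_itv/= => /andP[c0 cx]; rewrite sin0 !subr0 => ->.
have p1 : 1 <= pi :> R by have := @pi_ge2 R; lra.
have h : cos x <= cos c.
  by apply: ltW; rewrite ltr_cos// in_itv/=; apply/andP; split; lra.
rewrite mulrC; apply: ler_wpM2r => //; apply: le_trans h; apply: le_trans c2.
by rewrite lef_pV2 ?posrE// ?mulr_gt0//; lra.
Qed.

(** With x = |s - t|: up to a quarter turn the imaginary part sin(2 pi x) is at least x; from there
    to a half turn the real part contributes 1 - cos(2 pi x) >= 1. *)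
Lemma chord_ge (s t : R) : `|s - t| <= 2^-1 -> `|s - t| <= cabs (cis s%:C - cis t%:C).
Proof.
wlog ts : s t / t <= s => [hw|].
  by have [/hw//|/ltW/hw] := leP t s; rewrite cabsC distrC.
have p0 : 0 < pi :> R := pi_gt0 R.
have x0 : 0 <= s - t by rewrite subr_ge0.
rewrite ger0_norm// => xh; rewrite -{2}(subrK t s) cisD -{2}[cis t%:C]mul1r -mulrBl cabsM cabs_cis mulr1.
set x := s - t in x0 xh *.
have [x4|x4] := leP x 4^-1.
  apply: le_trans (Im_cabs _); rewrite /= subr0; apply: le_trans (ler_norm _).
  have {1}-> : x = 2 * pi * x / (2 * pi).
    by rewrite [2 * pi * x]mulrC mulfK// (gt_eqF (mulr_gt0 _ p0)).
  by apply: sin_ge_lin; [rewrite !mulr_ge0// ltW|nra].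
apply: le_trans (Re_cabs _) => /=; rewrite distrC; apply: le_trans (ler_norm _).
apply: (@le_trans _ _ 1); first lra.
rewrite lerBrDl gerDr -(@cos_pihalf R); apply: ltW.
by rewrite ltr_cos ?in_itv/=; try (apply/andP; split); nra.
Qed.

Lemma measurable_arc (z : R * R) (ze : C R) (e : R) : nrm z < 1 ->
  measurable_fun (`[0, 1] : set R) (fun t => (cabs (pt (crot t z) - ze) <= e)%R%:R : R).
Proof.
move=> z1.
have /(@measurable_funTS _ _ _ _ (`[0, 1] : set R)) h :
      measurable_fun setT (fun t : R => cabs (cis t%:C * pt z - ze)).
    apply: continuous_measurable_fun => t; apply/cvgrPdist_le => d d0.
    have p0 : 0 < 2 * pi :> R by rewrite mulr_gt0// pi_gt0.
    apply: filterS (nbhsx_ballx t _ (divr_gt0 d0 p0)) => s /= ts.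
    apply: le_trans (@cabs_lip R _ _) _; rewrite opprB addrA subrK -mulrBl cabsM.
    apply: le_trans (ler_piMr (cabs_ge0 _) (ltW z1)) _; apply: le_trans (cis_lip _ _) _.
    by rewrite mulrC -ler_pdivlMr// ltW.
  have h' : measurable_fun (`[0, 1] : set R) (fun t : R => cabs (cis t%:C * pt z - ze) <= e).
    exact: measurable_fun_ler.
  have hb : measurable_fun setT (fun b : bool => (b%:R : R)) by [].
  apply: eq_measurable_fun (measurableT_comp hb h') => t _ /=.
  by rewrite pt_crot.
Qed.

(** For e < 1/2, a parameter [t0] in the arc forces |z| >= 1/2, and all others lie within 4 e of it
    modulo 1, since chords control arcs. Three intervals of length 8 e, about [t0], [t0 + 1] and
    [t0 - 1], make 24 e. *)
Lemma arc_measure (z : R * R) (ze : C R) (e : R) : 0 < e -> nrm z < 1 -> cabs ze = 1 ->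
  (\int[leb]_(t in `[0%R, 1%R]) ((cabs (pt (crot t z) - ze) <= e)%R%:R)%:E <= (24 * e)%:E)%E.
Proof.
move=> e0 z1 ze1; pose A := [set t : R | 0 <= t <= 1 /\ cabs (pt (crot t z) - ze) <= e].
have mA := measurable_arc ze e z1.
have [[t0 [t01 At0]]|noA] := pselect (exists t, A t); last first.
  rewrite integral0_eq ?lee_fin ?mulr_ge0 ?(ltW e0)// => t /=; rewrite in_itv/= => t01.
  by case: leP => // h; case: noA; exists t.
pose I (c : R) : set R := `[c - 4 * e, c + 4 * e].
have mI c : measurable (I c) by exact: measurable_itv.
have mIE c : measurable_fun (setT : set R) (fun t => (\1_(I c) t)%:E : \bar R).
  by apply/measurable_EFinP; exact: measurable_indic.
have iI c : leb (I c) = (8 * e)%:E.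
  rewrite /I lebesgue_measure_itv/= lte_fin ltrD2l; have -> : - (4 * e) < 4 * e by lra.
  by rewrite -EFinD; congr (_%:E); ring.
have iE c : (\int[leb]_t (\1_(I c) t)%:E = (8 * e)%:E)%E.
  by rewrite integral_indic//; [rewrite setIT; exact: iI|exact: mI].
have [ez|ez] := leP (2^-1) e.
  apply: (@le_trans _ _ (\int[leb]_(t in `[0%R, 1%R]) 1)%E).
    by apply: ge0_integral_mono => t _; rewrite lee_fin ?lern1 ?leq_b1.
  by rewrite integral_cst//= lebesgue_measure_itv/= lte_fin ltr01 oppr0 adde0 mule1 lee_fin; lra.
have z2 : 2^-1 <= nrm z.
  have := cabs_subl ze (pt (crot t0 z)); rewrite ze1 pt_crot cabsM cabs_cis mul1r -/(nrm z).
  by rewrite cabsC -pt_crot; lra.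
have sub t : 0 <= t <= 1 -> cabs (pt (crot t z) - ze) <= e -> [\/ I t0 t, I (t0 + 1) t | I (t0 - 1) t].
  move=> t01' At; have h : cabs (cis t%:C - cis t0%:C) <= 4 * e.
    have := cabsB (pt (crot t z) - ze) (pt (crot t0 z) - ze); rewrite opprB addrA subrK.
    rewrite !pt_crot -mulrBl cabsM -/(nrm z) -!pt_crot => h.
    have c0 := cabs_ge0 (cis t%:C - cis t0%:C); nra.
  have cisP : cis (t0 + 1)%:C = cis t0%:C :> C R by rewrite cisD cis1 mulr1.
  have cisM : cis (t0 - 1)%:C = cis t0%:C :> C R by have := cisD (t0 - 1) 1; rewrite subrK cis1 mulr1 => ->.
  have key c : cis c%:C = cis t0%:C :> C R -> `|t - c| <= 2^-1 -> I c t.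
    move=> cE tc; have := chord_ge tc; rewrite cE => /le_trans/(_ h); by rewrite ler_distl /I/= in_itv/=.
  have [c1|c1] := leP `|t - t0| 2^-1; first by apply: Or31; exact: key.
  have [c2|c2] := leP t0 t.
    move: c1; rewrite ger0_norm ?subr_ge0// => c1.
    by apply: Or32; apply: key cisP _; rewrite ler_distl; apply/andP; split; lra.
  move: c1; rewrite ltr0_norm ?subr_lt0// => c1.
  by apply: Or33; apply: key cisM _; rewrite ler_distl; apply/andP; split; lra.
apply: (@le_trans _ _ (\int[leb]_t (\1_(I t0) t + (\1_(I (t0 + 1)%R) t + \1_(I (t0 - 1)%R) t))%:E)%E).
  rewrite [leLHS]integral_mkcond; apply: ge0_integral_mono; first by move=> t _; rewrite patchE; case: ifP.
  move=> t _; rewrite patchE; case: ifPn => [|_]; last by rewrite lee_fin !addr_ge0.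
  rewrite inE/= in_itv/= => t01'; rewrite lee_fin.
  case: (leP (cabs _) e) => h; last by rewrite !addr_ge0.
  have i0 c : 0 <= \1_(I c) t :> R by [].
  have i1 c : I c t -> \1_(I c) t = 1 :> R by move=> hI; rewrite indicE mem_set.
  have sum1 (x y w : R) : 0 <= x -> 0 <= y -> 0 <= w -> [\/ x = 1, y = 1 | w = 1] -> 1 <= x + (y + w).
    by move=> x0 y0 w0 [] ->; lra.
  apply: sum1 => //; case: (sub t t01' h) => /i1; [exact: Or31|exact: Or32|exact: Or33].
under eq_integral do rewrite !EFinD.
rewrite ge0_integralD//; last 3 first.
- exact: mIE.
- by move=> t _; rewrite adde_ge0.
- by apply: emeasurable_funD; exact: mIE.
rewrite ge0_integralD//; [|exact: mIE|exact: mIE].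
rewrite (iE t0) (iE (t0 + 1)) (iE (t0 - 1)).
by rewrite -!EFinD lee_fin; lra.
Qed.

End ArcMeasure.

(** * Weighted mass of caps, and dyadic shells about a boundary point *)

Section ShellMass.
Variable R : realType.
Local Notation leb := (@lebesgue_measure R).
Local Notation leb2 := (leb \x leb)%E.
Variable om : R -> R.
Hypothesis hom : radial_weight om.
Lemma measurable_dist (ze : C R) : measurable_fun setT (fun z : R * R => cabs (pt z - ze)).
Proof.
apply: (measurableT_comp (f := @Num.sqrt R)).
  by apply: continuous_measurable_fun; exact: sqrt_continuous.
case: ze => a b; apply: measurable_funD; apply: measurable_funX => /=; apply: measurable_funB => //.
Qed.

Lemma om_nrm_measurable : measurable_fun (@discR R) (fun z => om (nrm z)).
Proof. by apply: measurable_radial; apply/measurable_EFinP; exact: (om_measurable hom). Qed.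

Lemma om_nrm_ge0 z : discR z -> 0 <= om (nrm z).
Proof. by rewrite discRE /= => z1; rewrite (om_ge0 hom)// nrm_ge0. Qed.

Lemma mem_discR (z : R * R) : (z \in @discR R) = (nrm z < 1).
Proof. by apply/idP/idP; rewrite inE discRE. Qed.

Lemma integral_outer (c rho : R) : 0 <= c -> 0 <= rho < 1 ->
  (\int[leb]_(r in `[0%R, 1%R[) (c * ((rho <= r)%R%:R * om r))%:E = (c * omhat om rho)%:E)%E.
Proof.
move=> c0 /andP[r0 r1]; rewrite EFinM (omhatE hom r0) -ge0_integralZl_EFin//; last 2 first.
- by move=> r; rewrite /= in_itv/= => /andP[rr r1']; rewrite lee_fin (om_ge0 hom)// r1' (le_trans r0).
- by apply: measurable_funS (om_measurable hom) => //; apply: subset_itvr; rewrite bnd_simp.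
rewrite [LHS]integral_mkcond [RHS]integral_mkcond; apply: eq_integral => r _; rewrite !patchE.
rewrite !mem_setE !in_itv/=; case: (leP rho r) => rr; rewrite ?(le_trans r0 rr)/= ?mul1r ?mul0r ?mulr0.
  by case: ifP => // _; rewrite EFinM.
by case: ifP.
Qed.

(** Averaging over rotations separates the variables: on every circle the arc near [ze] has measure
    at most 24 e, and the circles of radius at least [rho] carry the mass omhat(rho). *)
Lemma cap_mass : exists2 K : R, 0 < K & forall (ze : C R) (e rho : R), cabs ze = 1 -> 0 < e -> 0 <= rho < 1 ->
  (\int[leb2]_(z in @discR R) (((cabs (pt z - ze) <= e)%R && (rho <= nrm z)%R)%:R * om (nrm z))%:E
   <= (K * e * omhat om rho)%:E)%E.
Proof.
have [k k0 hk] := radial_integral_le R; exists (24 * k) => [|ze e rho ze1 e0 /andP[r0 r1]]; first by rewrite mulr_gt0.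
pose G (z : R * R) : R := (nrm z < 1)%R%:R * ((rho <= nrm z)%R%:R * om (nrm z)).
have mb (D : set (R * R)) (b : R * R -> bool) : measurable_fun D b -> measurable_fun D (fun z => (b z)%:R : R).
  by move=> h; apply: (measurableT_comp (f := fun b : bool => (b%:R : R)) _ h).
have mO (D : set (R * R)) : measurable_fun D (fun z : R * R => rho <= nrm z).
  by apply: measurable_fun_ler => //; apply: measurable_funTS; exact: measurable_nrm.
have mG1 : measurable_fun (@discR R) (fun z => (rho <= nrm z)%R%:R * om (nrm z)).
  by apply: measurable_funM; [exact: mb|exact: om_nrm_measurable].
have mG : measurable_fun setT G.
  have : measurable_fun setT ((fun z => (rho <= nrm z)%R%:R * om (nrm z)) \_ (@discR R)).
    by apply/measurable_restrict => //; [exact: measurable_discR|rewrite setTI].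
  apply: eq_measurable_fun => z _; rewrite patchE /G mem_discR.
  by case: ifP; rewrite ?mul1r ?mul0r.
have G0 z : 0 <= G z.
  rewrite /G; case: (ltP (nrm z) 1) => h; last by rewrite mul0r.
  by rewrite mul1r mulr_ge0// (om_ge0 hom)// nrm_ge0.
pose F (z : R * R) := (((cabs (pt z - ze) <= e)%R%:R * G z)%:E)%E.
have mF : measurable_fun setT F.
  apply/measurable_EFinP; apply: measurable_funM => //; apply: mb.
  by apply: measurable_fun_ler => //; exact: measurable_dist.
have F0 z : (0 <= F z)%E by rewrite lee_fin mulr_ge0.
have -> : (\int[leb2]_(z in @discR R) (((cabs (pt z - ze) <= e)%R && (rho <= nrm z)%R)%:R * om (nrm z))%:E
    = \int[leb2]_z F z)%E.
  rewrite integral_mkcond; apply: eq_integral => z _; rewrite patchE /F /G mem_discR.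
  case: ifP => _; last by rewrite mul0r mulr0.
  by rewrite mul1r mulrA -natrM mulnb.
rewrite (rot_average mF F0).
have crotn t z : nrm (crot t z) = nrm z by rewrite /nrm pt_crot cabsM cabs_cis mul1r.
apply: (@le_trans _ _ (\int[leb2]_z (24 * e * G z)%:E)%E).
  apply: ge0_integral_mono => z _; first by apply: integral_ge0 => t _; exact: F0.
  have [z1|z1] := ltP (nrm z) 1; last first.
    have Gz : G z = 0 by rewrite /G ltNge z1 mul0r.
    rewrite Gz mulr0 integral0_eq// => t _; rewrite /F.
    by have -> : G (crot t z) = 0; [rewrite /G crotn ltNge z1 mul0r|rewrite mulr0].
  have -> : (\int[leb]_(t in `[0%R, 1%R]) F (crot t z)
      = \int[leb]_(t in `[0%R, 1%R]) ((G z)%:E * ((cabs (pt (crot t z) - ze) <= e)%R%:R)%:E))%E.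
    by apply: eq_integral => t _; rewrite /F /G crotn -EFinM mulrC.
  rewrite ge0_integralZl_EFin//; last by apply/measurable_EFinP; exact: measurable_arc.
  have Gz0 : (0 <= (G z)%:E)%E by rewrite lee_fin.
  by rewrite [24 * e * G z]mulrC EFinM; exact: (lee_wpmul2l Gz0 (arc_measure e0 z1 ze1)).
pose u r : R := 24 * e * ((rho <= r)%R%:R * om r).
have e24 : 0 <= 24 * e by rewrite mulr_ge0 ?(ltW e0).
have u0 r : 0 <= r < 1 -> 0 <= u r.
  by move=> r01; rewrite mulr_ge0// mulr_ge0// (om_ge0 hom).
have mom : measurable_fun (`[0, 1[ : set R) om by apply/measurable_EFinP; exact: (om_measurable hom).
have mu : measurable_fun (`[0, 1[ : set R) u.
  apply: measurable_funM => //; apply: measurable_funM => //.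
  apply: (measurableT_comp (f := fun b : bool => (b%:R : R))) => //.
  exact: measurable_fun_ler.
have -> : (\int[leb2]_z (24 * e * G z)%:E = \int[leb2]_(z in @discR R) (u (nrm z))%:E)%E.
  rewrite [RHS]integral_mkcond; apply: eq_integral => z _; rewrite patchE /G /u mem_discR.
  by case: ifP => _; rewrite ?mul1r ?mul0r ?mulr0.
apply: le_trans (hk u mu u0) _.
rewrite (integral_outer e24) ?r0// -!EFinM lee_fin le_eqVlt; apply/orP; left; apply/eqP; ring.
Qed.

Variable ze : C R.
Hypothesis ze1 : cabs ze = 1.

Definition outer (rho : R) : set (R * R) := [set z | rho <= nrm z].
Definition shell m : set (R * R) := [set z | discR z /\ eps R m < cabs (pt z - ze) <= 2 * eps R m].

Lemma measurable_outer rho : measurable (outer rho).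
Proof.
have -> : outer rho = ~` [set z | nrm z < rho].
  apply/seteqP; split => z; rewrite /outer/=; first by rewrite leNgt => /negP.
  by move=> /negP; rewrite -leNgt.
by apply: measurableC; exact: (measurable_sublevel rho (@measurable_nrm R)).
Qed.

Lemma measurable_shell m : measurable (shell m).
Proof.
have -> : shell m = (@discR R `&` (~` [set z | - cabs (pt z - ze) < - (2 * eps R m)]))
    `&` [set z | - cabs (pt z - ze) < - eps R m].
  apply/seteqP; split => z /=; rewrite !ltrN2.
    by move=> [zD /andP[h1 h2]]; split=> //; split=> //; apply/negP; rewrite -leNgt.
  by move=> [[zD /negP h1] h2]; split=> //; rewrite h2 leNgt.
have mN : measurable_fun setT (fun z : R * R => - cabs (pt z - ze)).
  exact: measurable_funN (measurable_dist ze).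
apply: measurableI; last exact: measurable_sublevel.
apply: measurableI; first exact: measurable_discR.
by apply: measurableC; exact: measurable_sublevel.
Qed.

Lemma shell_sub m : shell m `<=` @discR R.
Proof. by move=> z []. Qed.

Lemma shell_cover : @discR R = \bigcup_m shell m.
Proof.
apply/seteqP; split => [z zD|z [m _]]; last exact: shell_sub.
have z1 : nrm z < 1 by move: zD; rewrite discRE.
have d0 : 0 < cabs (pt z - ze).
  have := cabs_subl ze (pt z); rewrite ze1 cabsC -/(nrm z); lra.
have d2 : cabs (pt z - ze) <= 2.
  by have := cabsB (pt z) ze; rewrite ze1 -/(nrm z); lra.
have ex := eps_cvg0 d0; case: (ex_minnP ex) => m hm mmin; exists m => //; split=> //; rewrite hm/=.
case: m hm mmin => [|m] hm mmin; first by rewrite eps0 mulr1.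
rewrite epsS mulrCA divff ?mulr1// leNgt; apply/negP => /mmin; rewrite ltnn.
by [].
Qed.

Lemma shell_disjoint : trivIset [set: nat] shell.
Proof.
have key i j z : (i < j)%N -> shell i z -> ~ shell j z.
  move=> ij [_ /andP[h1 _]] [_ /andP[_ h2]]; have := eps_le R ij; rewrite epsS.
  by have := lt_le_trans h1 h2; lra.
move=> i j _ _ [z [zi zj]]; case: (ltngtP i j) => // ij; first by have := key _ _ _ ij zi.
by have := key _ _ _ ij zj.
Qed.

End ShellMass.

(** * A Schur test over shells *)

Section ShellSchur.
Variable R : realType.
Local Notation leb := (@lebesgue_measure R).
Local Notation leb2 := (leb \x leb)%E.
Variable om : R -> R.
Hypothesis hom : radial_weight om.

Lemma ndistC j k : ndist j k = ndist k j.
Proof. by rewrite /ndist addnC. Qed.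

(* The sum is at most 2/(1-d) times the largest of the d^(-ndist k m) x_k. *)
Lemma sum_powR_le (P d : R) (x : nat -> R) n m : 0 < P -> 0 < d -> d < 1 -> (forall k, 0 <= x k) ->
  (\sum_(k < n) x k) `^ P <=
    (2 / (1 - d)) `^ P * \sum_(k < n) ((d `^ P)^-1) ^+ ndist k m * x k `^ P.
Proof.
move=> P0 d0 d1 x0; case: n => [|n].
  by rewrite !big_ord0 powR0 ?mulr0// gt_eqF.
have h0 : 0 < d `^ P by rewrite powR_gt0.
pose y k := (d^-1) ^+ ndist k m * x k.
have y0 k : 0 <= y k by rewrite mulr_ge0// exprn_ge0// invr_ge0 ltW.
have [k0 _ ymax] := arg_maxP (fun i : 'I_n.+1 => y i) (isT : xpredT ord0).
have G0 : 0 <= 2 / (1 - d) by rewrite divr_ge0// subr_ge0 ltW.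
have yE k : y k `^ P = ((d `^ P)^-1) ^+ ndist k m * x k `^ P.
  rewrite /y powRM ?exprn_ge0 ?invr_ge0 ?(ltW d0)//; congr (_ * _).
  rewrite -!powR_mulrn ?invr_ge0 ?(ltW d0) ?(ltW h0)// -(powRrM _ (ndist k m)%:R P) [_ * P]mulrC powRrM.
  by rewrite -powR_inv1 ?(ltW d0)// -(powRrM _ (-1) P) mulN1r powRN.
apply: (@le_trans _ _ ((2 / (1 - d) * y k0) `^ P)).
  apply: (powR_le (ltW P0)); first by apply: sumr_ge0 => k _.
  apply: (@le_trans _ _ (\sum_(k < n.+1) d ^+ ndist k m * y k0)).
    apply: ler_sum => k _; have -> : x k = d ^+ ndist k m * y k.
      by rewrite /y mulrA -exprMn divff ?expr1n ?mul1r// gt_eqF.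
    by apply: ler_wpM2l; [rewrite exprn_ge0// ltW|exact: ymax].
  by rewrite -mulr_suml; apply: (ler_wpM2r (y0 _)); exact: sum_pow_ndist0 (ltW d0) d1.
rewrite (powRM _ G0 (y0 _)); apply: (ler_wpM2l (powR_ge0 _ _)); rewrite yE.
rewrite [leRHS](bigD1 k0)//= lerDl; apply: sumr_ge0 => k _.
by rewrite mulr_ge0 ?powR_ge0// exprn_ge0// invr_ge0 ltW.
Qed.

(** [X k m] is the size of the k-th piece on shell [m] and [mu k m] the mass of its support there;
    their contribution to the P-th power is assumed to decay like g^|k-m|. With h = sqrt g,
    [sum_powR_le] costs h^(-|k-m|) and leaves h^|k-m|, summable over [m]. Used with P = p for test
    functions and P = p' for kernels. *)
Lemma shell_schur (P g : R) : 0 < P -> 0 < g -> g < 1 -> exists2 K : R, 0 < K &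
  forall (ze : C R) (F : R * R -> R) (E : nat -> set (R * R)) (X mu : nat -> nat -> R) (s : nat -> R) n,
  cabs ze = 1 -> measurable_fun (@discR R) F -> (forall z, discR z -> 0 <= F z) ->
  (forall k, measurable (E k)) -> (forall k m, 0 <= X k m) -> (forall k, 0 <= s k) ->
  (forall m z, shell ze m z -> F z <= \sum_(k < n) X k m * \1_(E k) z) ->
  (forall k m, (\int[leb2]_(z in shell ze m) (\1_(E k) z * om (nrm z))%:E <= (mu k m)%:E)%E) ->
  (forall k m, X k m `^ P * mu k m <= g ^+ ndist k m * s k) ->
  (\int[leb2]_(z in @discR R) (F z `^ P * om (nrm z))%:E <= (K * \sum_(k < n) s k)%:E)%E.
Proof.
move=> P0 g0 g1; pose h := Num.sqrt g.
have h0 : 0 < h by rewrite sqrtr_gt0.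
have h2 : h ^+ 2 = g by rewrite sqr_sqrtr// ltW.
have h1 : h < 1 by rewrite ltNge; apply/negP => h1; have := exprn_ege1 2 h1; rewrite h2; lra.
pose d := h `^ P^-1; have d0 : 0 < d by rewrite powR_gt0.
have dP : d `^ P = h by rewrite /d -(powRrM h P^-1 P) mulVf ?gt_eqF// powRr1// ltW.
have d1 : d < 1.
  have E : (1 : R) `^ P^-1 = 1 by rewrite powR1.
  by rewrite -[ltRHS]E; apply: gt0_ltr_powR; rewrite ?nnegrE ?(ltW h0) ?invr_gt0.
pose G := (2 / (1 - d)) `^ P; have G0 : 0 < G by rewrite powR_gt0// divr_gt0// subr_gt0.
have H0 : 0 < 2 / (1 - h) by rewrite divr_gt0// subr_gt0.
exists (G * (2 / (1 - h))) => [|ze F E X mu s n ze1 mF F0 mE X0 s0 FX hmu hs]; first exact: mulr_gt0.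
have mom := om_nrm_measurable hom.
have mE1 k : measurable_fun (@discR R) (\1_(E k) : R * R -> R).
  by apply: measurable_indic; exact: mE.
have shellb m : (\int[leb2]_(z in shell ze m) (F z `^ P * om (nrm z))%:E
    <= (G * \sum_(k < n) h ^+ ndist k m * s k)%:E)%E.
  have i0 k z : 0 <= \1_(E k) z :> R by rewrite indicE.
  have o0 z : shell ze m z -> 0 <= om (nrm z) by move=> /shell_sub; exact: om_nrm_ge0.
  have c0 k : 0 <= h^-1 ^+ ndist k m * X k m `^ P.
    by rewrite mulr_ge0 ?powR_ge0// exprn_ge0// invr_ge0 ltW.
  apply: (@le_trans _ _ (\int[leb2]_(z in shell ze m) (\sum_(k < n)
      ((G * (h^-1 ^+ ndist k m * X k m `^ P))%:E * (\1_(E k) z * om (nrm z))%:E))%E)%E).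
    apply: ge0_integral_mono => z zm; first by rewrite lee_fin mulr_ge0 ?powR_ge0// o0.
    rewrite (eq_bigr (fun k : 'I_n => (G * (h^-1 ^+ ndist k m * X k m `^ P) * (\1_(E k) z * om (nrm z)))%:E)) => [|k _]; last by rewrite EFinM.
    rewrite sumEFin lee_fin.
    have -> : \sum_(k < n) G * (h^-1 ^+ ndist k m * X k m `^ P) * (\1_(E k) z * om (nrm z))
        = G * (\sum_(k < n) h^-1 ^+ ndist k m * (X k m * \1_(E k) z) `^ P) * om (nrm z).
      rewrite mulr_sumr mulr_suml; apply: eq_bigr => k _; rewrite powRM//.
      have -> : (\1_(E k) z : R) `^ P = \1_(E k) z.
        by rewrite indicE; case: (_ \in _); [rewrite powR1|rewrite powR0// gt_eqF].
      by ring.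
    apply: ler_wpM2r; first exact: o0.
    have a0 : 0 <= F z by apply: F0; exact: (shell_sub zm).
    apply: le_trans (powR_le (ltW P0) a0 (FX m z zm)) _.
    have xx0 k : 0 <= X k m * \1_(E k) z by rewrite mulr_ge0.
    by have := @sum_powR_le P d (fun k => X k m * \1_(E k) z) n m P0 d0 d1 xx0; rewrite dP.
  have mEo k : measurable_fun (shell ze m) (fun z => (\1_(E k) z * om (nrm z))%:E).
    apply: measurable_funS (@shell_sub R ze m) _; first exact: measurable_discR.
    by apply/measurable_EFinP; apply: measurable_funM.
  have mc (c : R) k : measurable_fun (shell ze m) (fun z : R * R => c%:E * (\1_(E k) z * om (nrm z))%:E)%E.
    by apply: emeasurable_funM.
  have mS := measurable_shell ze m.
  have t0 k z : shell ze m z -> (0 <= (\1_(E k) z * om (nrm z))%:E)%E.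
    by move=> zm; rewrite lee_fin mulr_ge0// o0.
  rewrite (@ge0_integral_sum _ _ _ leb2 _ mS _ (fun (k : 'I_n) z => (G * (h^-1 ^+ ndist k m * X k m `^ P))%:E * (\1_(E k) z * om (nrm z))%:E)%E); last 2 first.
  - by move=> k; exact: mc.
  - by move=> k z zm; rewrite mule_ge0 ?t0// lee_fin mulr_ge0// ltW.
  rewrite mulr_sumr -sumEFin; apply: lee_sum => k _.
  have c1 : 0 <= G * (h^-1 ^+ ndist k m * X k m `^ P) by rewrite mulr_ge0// ltW.
  rewrite (@ge0_integralZl_EFin _ _ _ leb2 _ mS _ (t0 k) (mEo k) _ c1).
  apply: (@le_trans _ _ ((G * (h^-1 ^+ ndist k m * X k m `^ P))%:E * (mu k m)%:E)%E).
    by apply: lee_wpmul2l => //; rewrite lee_fin.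
  rewrite -EFinM lee_fin -!mulrA; apply: (ler_wpM2l (ltW G0)).
  apply: (@le_trans _ _ (h^-1 ^+ ndist k m * (g ^+ ndist k m * s k))).
    by apply: ler_wpM2l (hs k m); rewrite exprn_ge0// invr_ge0 ltW.
  rewrite mulrA -exprMn -h2 expr2 mulrA mulVf ?mul1r//; exact: lt0r_neq0.
rewrite (shell_cover ze1) ge0_integral_bigcup; last 4 first.
- exact: measurable_shell.
- rewrite -(shell_cover ze1); apply/measurable_EFinP; apply: measurable_funM => //.
  exact: powR_measurable.
- move=> z; rewrite -(shell_cover ze1) => zD; rewrite lee_fin mulr_ge0 ?powR_ge0//.
  exact: om_nrm_ge0.
- exact: shell_disjoint.
apply: lime_le.
  apply: is_cvg_nneseries => m _ _; apply: integral_ge0 => z zm.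
  by rewrite lee_fin mulr_ge0 ?powR_ge0// om_nrm_ge0//; exact: shell_sub zm.
apply: nearW => N; rewrite big_mkord.
apply: (@le_trans _ _ (\sum_(m < N) (G * \sum_(k < n) h ^+ ndist k m * s k)%:E)%E).
  by apply: lee_sum => m _; exact: shellb.
rewrite sumEFin lee_fin -mulr_sumr -mulrA; apply: (ler_wpM2l (ltW G0)).
rewrite exchange_big/= mulr_sumr; apply: ler_sum => k _; rewrite -mulr_suml.
apply: (ler_wpM2r (s0 k)); under eq_bigr do rewrite ndistC.
exact: sum_pow_ndist0 (ltW h0) h1.
Qed.

End ShellSchur.

(** * Orthogonality of roots of unity *)

Section RootsOfUnity.
Variable R : realType.

Lemma cis_expn (s : R) n : cis (s *+ n)%:C = cis s%:C ^+ n :> C R.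
Proof.
elim: n => [|n ih]; first by rewrite mulr0n cis0 expr0.
by rewrite mulrS cisD ih exprS.
Qed.

Lemma cis_neq1 (x : R) : 0 < x -> x < 1 -> cis x%:C != 1 :> C R.
Proof.
move=> x0 x1; have p0 : 0 < pi :> R := pi_gt0 R; apply/eqP => /eqP; rewrite eq_complex/= => /andP[/eqP h _].
have s0 : 0 < sin (pi * x) by apply: sin_gt0_pi; rewrite mulr_gt0//= gtr_pMr.
have := cos2Dsin2 (pi * x).
move: h; rewrite -mulrA mulr_natl cos_mulr2n => h.
by have := mulr_gt0 s0 s0; rewrite -expr2; lra.
Qed.

Definition root_of_unity (L : nat) : C R := cis (L%:R^-1)%:C.
Local Notation q := root_of_unity.

Lemma root_of_unityX L l : q L ^+ l = cis (l%:R / L%:R)%:C.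
Proof. by rewrite /root_of_unity -cis_expn; congr (cis _%:C); rewrite -[LHS]mulr_natl. Qed.

Lemma cabs_rootX L l : cabs (q L ^+ l) = 1.
Proof. by rewrite root_of_unityX cabs_cis. Qed.

Lemma root_neq0 L : q L != 0.
Proof. exact: cis_neq0. Qed.

(** A full geometric sum with ratio q^(j-m), which differs from 1 because 0 < |j - m| < L. *)
Lemma root_sum L j m : (m < L)%N -> (j < L + m)%N -> j != m ->
  \sum_(l < L) (q L ^+ l) ^+ j / (q L ^+ l) ^+ m = 0.
Proof.
move=> mL jL jm; have L0 : (0 < L)%N by lia.
have qL : q L ^+ L = 1 by rewrite root_of_unityX divff ?cis1// pnatr_eq0 -lt0n.
have qd d : (0 < d)%N -> (d < L)%N -> q L ^+ d != 1.
  move=> d0 dL; rewrite root_of_unityX; apply: cis_neq1.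
    by rewrite divr_gt0// ltr0n.
  by rewrite ltr_pdivrMr ?ltr0n// mul1r ltr_nat.
pose z := q L ^+ j / q L ^+ m.
have z1 : z != 1.
  rewrite /z; have qn n : q L ^+ n != 0 by rewrite expf_neq0// root_neq0.
  apply/eqP => /(congr1 (fun x => x * q L ^+ m)); rewrite divfK// mul1r => E.
  have [jm'|mj|E'] := ltngtP j m; last by rewrite E' eqxx in jm.
  - have := qd (m - j)%N; rewrite subn_gt0 => /(_ jm' ltac:(lia))/eqP; apply.
    by apply: (mulIf (qn j)); rewrite -exprD subnK 1?ltnW// mul1r.
  - have := qd (j - m)%N; rewrite subn_gt0 => /(_ mj ltac:(lia))/eqP; apply.
    by apply: (mulIf (qn m)); rewrite -exprD subnK 1?ltnW// mul1r.
rewrite (eq_bigr (fun l : 'I_L => z ^+ l)) => [|l _]; last first.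
  by rewrite /z expr_div_n -!exprM mulnC [(m * l)%N]mulnC.
have zL : z ^+ L = 1 by rewrite /z expr_div_n -!exprM mulnC exprM qL expr1n mulnC exprM qL expr1n divr1.
have := subrX1 z L; rewrite zL subrr => /esym/eqP; rewrite mulf_eq0 subr_eq0 (negbTE z1)/= => /eqP h.
exact: h.
Qed.

End RootsOfUnity.

(** * Rotation invariance of the norm *)

Section Moments.
Variable R : realType.
Local Notation leb := (@lebesgue_measure R).
Local Notation leb2 := (leb \x leb)%E.
Variables (p : R) (om : R -> R).
Hypotheses (p0 : 0 < p) (hom : radial_weight om).

Lemma TgE (g f : C R -> C R) z : Tg g f z = cint 0 1 (fun w => f (w * z) * cderiv g (w * z) * z).
Proof. by []. Qed.

Lemma inD_mul (c z : C R) : cabs c <= 1 -> inD z -> inD (c * z).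
Proof.
by move=> c1 zD; rewrite /inD cabsM; apply: le_lt_trans zD; rewrite ler_piMl// cabs_ge0.
Qed.

Lemma holo_rot (f : C R -> C R) c : cabs c <= 1 -> holo f -> holo (fun z => f (c * z)).
Proof.
move=> c1 /holo_dfb hf; apply/holo_dfb.
apply: (dfb_comp (B := @inD R)) hf _ => [z zD|]; first exact: inD_mul.
by apply: dfbM; [exact: dfb_cst|exact: dfb_id].
Qed.

Lemma cderiv_rot (f : C R -> C R) c z : cabs c <= 1 -> holo f -> inD z ->
  cderiv (fun w => f (c * w)) z = cderiv f (c * z) * c.
Proof.
move=> c1 hf zD; apply: (cderivE zD).
have h := holo_cdif hf (inD_mul c1 zD).
have := cdifZ c (cdif_id (@inD R) z); rewrite mulr1 => h2.
exact: (cdif_comp (B := setT) (f := f) (g := fun w => c * w) _ h h2).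
Qed.

Lemma measurable_Dint (f : C R -> C R) : holo f ->
  measurable_fun (@discR R) (fun z => cabs (cderiv f (pt z)) `^ p * om (nrm z)).
Proof.
move=> hf; apply: measurable_funM; last exact: om_nrm_measurable.
by apply: powR_measurable; apply: measurable_cabs_holo; exact: holo_cderiv.
Qed.

Lemma Dint_rot (f : C R -> C R) (t : R) : holo f ->
  Dint p (radial om) (fun z => f (cis t%:C * z)) = Dint p (radial om) f.
Proof.
move=> hf; have c1 : cabs (cis t%:C : C R) <= 1 by rewrite cabs_cis.
pose F := ((fun z => (cabs (cderiv f (pt z)) `^ p * om (nrm z))%:E) \_ (@discR R))%E.
have mF : measurable_fun setT F.
  apply/measurable_restrict => //; first exact: measurable_discR.
  by rewrite setTI; apply/measurable_EFinP; exact: measurable_Dint.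
have F0 z : (0 <= F z)%E.
  rewrite /F patchE; case: ifPn => // /set_mem zD.
  by rewrite lee_fin mulr_ge0 ?powR_ge0// (om_nrm_ge0 hom).
have -> : Dint p (radial om) f = (\int[leb2]_z F z)%E by rewrite /Dint integral_mkcond.
rewrite (@integral_rot R F (cos (2 * pi * t)) (sin (2 * pi * t)) (cos2Dsin2 _) mF F0).
have nc z : nrm (crot t z) = nrm z by rewrite /nrm pt_crot cabsM cabs_cis mul1r.
have FE z : F (rot (cos (2 * pi * t)) (sin (2 * pi * t)) z)
    = if nrm z < 1 then (cabs (cderiv f (cis t%:C * pt z)) `^ p * om (nrm z))%:E else 0%E.
  by rewrite -[rot _ _ z]/(crot t z) /F patchE mem_discR nc pt_crot.
rewrite /Dint integral_mkcond; apply: eq_integral => z _.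
rewrite FE patchE mem_discR; case: (boolP (nrm z < 1)) => [z1|_]; last exact: erefl.
have zD : inD (pt z) := z1.
by rewrite (cderiv_rot c1 hf zD) cabsM cabs_cis mulr1.
Qed.

Lemma inDsp_rot (f : C R -> C R) (t : R) : inDsp p (radial om) f ->
  inDsp p (radial om) (fun z => f (cis t%:C * z)) /\
  Dnorm p (radial om) (fun z => f (cis t%:C * z)) = Dnorm p (radial om) f.
Proof.
move=> [hf fin]; have E : Dpow p (radial om) (fun z => f (cis t%:C * z)) = Dpow p (radial om) f.
  by rewrite !DpowE (Dint_rot t hf) mulr0.
split; last by rewrite /Dnorm E.
by split; [apply: holo_rot => //; rewrite cabs_cis|rewrite E].
Qed.

Lemma dfb_ray (f : C R -> C R) (z : C R) : holo f -> inD z -> dfb (seg 0 1) (fun w => f (w * z)).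
Proof.
move=> /holo_dfb hf zD; apply: (dfb_comp (B := @inD R)) hf _ => [w [t /andP[t0 t1] ->]|].
  by apply: inD_mul => //; rewrite cabs_rcge0.
by apply: dfbM; [exact: dfb_id|exact: dfb_cst].
Qed.

Lemma const_of_cderiv0 (g : C R -> C R) : holo g -> (forall z, inD z -> cderiv g z = 0) -> const_on_D g.
Proof.
move=> hg g0; exists (g 0) => z zD.
have h t : 0 <= t <= 1 -> cdif (seg 0 1) (fun w => g (w * z)) t%:C ((fun=> 0) t%:C : C R).
  move=> /andP[t0 t1]; have tz : inD (t%:C * z) by apply: inD_mul; rewrite ?cabs_rcge0.
  have h1 := holo_cdif hg tz; rewrite (g0 _ tz) in h1.
  have h2 := cdifM (cdif_id (seg 0 1) (t%:C : C R)) (cdif_cst (seg 0 1) z t%:C).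
  by have := cdif_comp (B := setT) (f := g) (g := fun w => w * z) (fun _ _ => I) h1 h2; rewrite mul0r.
have := cint_FTC ler01 h (@dfb_cst R (seg 0 1) 0).
have -> : cint 0 1 (fun=> 0 : C R) = 0.
  apply/eqP; rewrite -cabs_eq0 eq_le cabs_ge0 andbT.
  have := @cint_le R 0 1 (fun=> 0) 0 ler01 (@dfb_cst R (seg 0 1) 0); rewrite mul0r; apply.
  by move=> t _; rewrite cabs0.
by rewrite rmorph1 rmorph0 mul1r mul0r => /esym/eqP; rewrite subr_eq0 => /eqP.
Qed.

End Moments.

(** * Replacing the symbol by a monomial *)

Section MomentBound.
Variable R : realType.
Variables (p : R) (om : R -> R).
Hypotheses (p0 : 0 < p) (hom : radial_weight om).

Lemma exprn_small (d e : R) : 0 <= d -> d < 1 -> 0 < e -> exists N, forall n, (N <= n)%N -> d ^+ n <= e.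
Proof.
move=> d0 d1 e0; have : d ^+ n @[n --> \oo] --> 0 by apply: cvg_expr; rewrite ger0_norm.
move=> /cvgrPdist_lt/(_ _ e0)[N _ h]; exists N => n Nn.
by have /ltW := h n Nn; rewrite /= sub0r normrN ger0_norm ?exprn_ge0.
Qed.

(* Averaging h over the L-th roots of unity isolates its m-th Taylor term. *)
Lemma root_average (h : C R -> C R) (r' B : R) L m (a : C R) : holo h -> 0 < r' -> r' < 1 -> cabs a < r' ->
  (forall t, 0 <= t <= 1 -> cabs (h (circ r' t%:C)) <= B) -> (m < L)%N ->
  cabs (\sum_(l < L) h (a * root_of_unity R L ^+ l) / (root_of_unity R L ^+ l) ^+ m
        - L%:R * (coef h r' m * a ^+ m)) <=
    L%:R * (B * (r' / (r' - cabs a)) * (cabs a / r') ^+ (L + m)).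
Proof.
move=> hh r0 r1 ar hB mL; set q := root_of_unity R L.
have q1 l : cabs (q ^+ l) = 1 := cabs_rootX R L l.
have E : L%:R * (coef h r' m * a ^+ m) =
    \sum_(l < L) (\sum_(j < L + m) coef h r' j * (a * q ^+ l) ^+ j) / (q ^+ l) ^+ m.
  have mLm : (m < L + m)%N by lia.
  rewrite (eq_bigr (fun l : 'I_L => \sum_(j < L + m) coef h r' j * a ^+ j * ((q ^+ l) ^+ j / (q ^+ l) ^+ m))).
    rewrite exchange_big/= (bigD1 (Ordinal mLm))//= [X in _ = _ + X]big1 => [|j jm]; last first.
      by rewrite -mulr_sumr root_sum ?mulr0// ltn_ord.
    rewrite addr0 -mulr_sumr (eq_bigr (fun=> 1)) => [|l _]; last first.
      by rewrite divff// -exprM expf_neq0// root_neq0.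
    by rewrite sumr_const card_ord [RHS]mulrC.
  by move=> l _; rewrite mulr_suml; apply: eq_bigr => j _; rewrite exprMn; ring.
rewrite E -sumrB; apply: le_trans (cabs_sum _ _ _) _.
rewrite -[X in X%:R * _]card_ord mulr_natl -sumr_const; apply: ler_sum => l _.
rewrite -mulrBl cabsM cabsV cabsX q1 expr1n invr1 mulr1.
have aq : cabs (a * q ^+ l) = cabs a by rewrite cabsM q1 mulr1.
by have := @taylor_remainder R h r' (a * q ^+ l) B (L + m) hh; rewrite aq; apply.
Qed.

(** Some Taylor coefficient of g', say the m-th, is not 0. Rotating f by q^-l and evaluating T_g at
    r q^l integrates f(w r) against g'(w r q^l) r q^l; summation with the weights q^(-l(m+1)) keeps
    the m-th term of g', at equal norms. *)
Lemma moment_bound (g : C R -> C R) : holo g -> Tbounded p (radial om) g -> ~ const_on_D g ->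
  exists m (K : R), forall f r, inDsp p (radial om) f -> 0 < r -> r < 1 ->
    r * cabs (cint 0 1 (fun w => f (w * r%:C) * (w * r%:C) ^+ m)) <= K * Dnorm p (radial om) f.
Proof.
move=> hg [C0 hT] ng; pose h := cderiv g; have hh : holo h by exact: holo_cderiv.
have h2 : 0 < 2^-1 :> R by rewrite invr_gt0.
have h21 : 2^-1 < 1 :> R by rewrite invf_lt1// ltr1n.
have [m cm] : exists m, coef h 2^-1 m != 0.
  apply: contrapT => nc; apply: ng; apply: const_of_cderiv0 => //.
  apply: (coef_eq0 hh h2 h21) => m; apply/eqP/negPn/negP => cm; apply: nc; by exists m.
have cm0 : 0 < cabs (coef h 2^-1 m) by rewrite cabs_gt0.
exists m, (C0 / cabs (coef h 2^-1 m)) => f r fD r0 r1.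
set N := Dnorm p (radial om) f; set I := cint _ _ _.
have hf := fD.1; have rD : inD (r%:C : C R) by rewrite /inD cabs_rcge0// ltW.
have dI : dfb (seg 0 1) (fun w : C R => f (w * r%:C) * (w * r%:C) ^+ m).
  apply: dfbM; first exact: dfb_ray.
  by apply: dfbX; apply: dfbM; [exact: dfb_id|exact: dfb_cst].
(* A circle strictly between [r] and 1, on which the Taylor remainder of g' is geometric for points
   of modulus at most [r]. *)
pose r' := (1 + r) / 2; have rr' : r < r' by rewrite /r'; lra.
have r'0 : 0 < r' by lra. have r'1 : r' < 1 by rewrite /r'; lra.
have [B B0 hB] := dfb_bounded ler01 (dfb_subset (@seg_rline R 0 1) (holo_circ_dfb hh r'0 r'1)).
have [Mf Mf0 hMf] := dfb_bounded ler01 (dfb_ray hf rD).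
pose Bc := B * (r' / (r' - r)); pose d := r / r'.
have Bc0 : 0 <= Bc by rewrite mulr_ge0// divr_ge0 ?subr_ge0 ?(ltW r'0)// ltW.
have d0 : 0 <= d by rewrite divr_ge0// ltW.
have d1 : d < 1 by rewrite ltr_pdivrMr// mul1r.
(* The main term is the same for every number [L] of roots, while the error vanishes as [L]
   grows. *)
suff key L : (m < L)%N -> r * (cabs (coef h 2^-1 m) * cabs I) <= C0 * N + Mf * Bc * d ^+ (L + m).
  rewrite mulrAC ler_pdivlMr// -mulrA [cabs I * _]mulrC.
  apply/ler_addgt0Pr => e e0; have MB0 : 0 < Mf * Bc + 1 by have := mulr_ge0 Mf0 Bc0; lra.
  have [L0 hL0] := exprn_small d0 d1 (divr_gt0 e0 MB0).
  apply: le_trans (key (m.+1 + L0)%N _) _; first by rewrite addSn ltnS leq_addr.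
  rewrite lerD2l; apply: (@le_trans _ _ ((Mf * Bc + 1) * (e / (Mf * Bc + 1)))).
    apply: (ler_pM (mulr_ge0 Mf0 Bc0) (exprn_ge0 _ d0)); first by rewrite lerDl.
    by apply: hL0; apply: leq_trans (leq_addr m _); exact: leq_addl.
  by rewrite mulrCA divff ?mulr1// gt_eqF.
move=> mL; have L0 : 0 < L%:R :> R by rewrite ltr0n; exact: leq_ltn_trans (leq0n m) mL.
set q := root_of_unity R L; have q1 l : cabs (q ^+ l) = 1 := cabs_rootX R L l.
have q0 l : q ^+ l != 0 by rewrite expf_neq0// root_neq0.
pose A l := cint 0 1 (fun w => f (w * r%:C) * h (w * (r%:C * q ^+ l)) * (r%:C * q ^+ l)).
have rqD l : inD (r%:C * q ^+ l) by rewrite mulrC; apply: inD_mul => //; rewrite q1.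
have dA l : dfb (seg 0 1) (fun w => f (w * r%:C) * h (w * (r%:C * q ^+ l)) * (r%:C * q ^+ l)).
  apply: dfbM; last exact: dfb_cst.
  by apply: dfbM; [exact: dfb_ray|exact: dfb_ray].
have hA l : cabs (A l) <= C0 * N.
  (* The rotation by 1 - l/L turns undoes the factor [q ^+ l] of the point of evaluation. *)
  have [f1 f2] := inDsp_rot hom (1 - l%:R / L%:R) fD.
  rewrite /N -f2; have -> : A l = Tg g (fun z => f (cis (1 - l%:R / L%:R)%:C * z)) (r%:C * q ^+ l).
    rewrite TgE; apply: eq_cint => t _; congr (f _ * _ * _).
    rewrite mulrCA [_ * (r%:C * _)]mulrCA /q root_of_unityX -cisD subrK cis1 mulr1//.
  exact: hT.
pose G l := fun w : C R => ((q ^+ l) ^+ m.+1)^-1 * (f (w * r%:C) * h (w * (r%:C * q ^+ l)) * (r%:C * q ^+ l)).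
have dG l : dfb (seg 0 1) (G l) by apply: dfbM; [exact: dfb_cst|exact: dA].
have SE : cint 0 1 (fun w => \sum_(l < L) G l w) = \sum_(l < L) ((q ^+ l) ^+ m.+1)^-1 * A l.
  rewrite (cint_sum _ (fun l : 'I_L => dG l)); apply: eq_bigr => l _; exact: cintZ.
have S1 : cabs (cint 0 1 (fun w => \sum_(l < L) G l w)) <= L%:R * (C0 * N).
  rewrite SE; apply: le_trans (cabs_sum _ _ _) _.
  rewrite -[X in X%:R * _]card_ord mulr_natl -sumr_const; apply: ler_sum => l _.
  by rewrite cabsM cabsV cabsX q1 expr1n invr1 mul1r.
pose c0 : C R := L%:R * (coef h 2^-1 m * r%:C).
have D1 : cint 0 1 (fun w => c0 * (f (w * r%:C) * (w * r%:C) ^+ m)) = c0 * I by exact: cintZ.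
have dS : dfb (seg 0 1) (fun w => \sum_(l < L) G l w) by apply: dfb_sum => l.
have dC : dfb (seg 0 1) (fun w => c0 * (f (w * r%:C) * (w * r%:C) ^+ m)).
  by apply: dfbM => //; exact: dfb_cst.
have diff : cabs (cint 0 1 (fun w => \sum_(l < L) G l w) - c0 * I) <= L%:R * (Mf * Bc * d ^+ (L + m)).
  rewrite -D1 -(cintB dS dC).
  apply: le_trans (cint_le ler01 (dfbB dS dC) _) _; last by rewrite subr0 mulr1.
  move=> t t01; have /andP[t0 t1] := t01.
  have tr : cabs (t%:C * r%:C : C R) <= r.
    by rewrite cabsM !cabs_rcge0 ?(ltW r0)// ler_piMl// ltW.
  have -> : \sum_(l < L) G l t%:C - c0 * (f (t%:C * r%:C) * (t%:C * r%:C) ^+ m)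
      = f (t%:C * r%:C) * r%:C * (\sum_(l < L) h (t%:C * r%:C * q ^+ l) / (q ^+ l) ^+ m
        - L%:R * (coef h r' m * (t%:C * r%:C) ^+ m)).
    rewrite (coef_radius m hh r'0 r'1 h2 h21) mulrBr mulr_sumr /c0; congr (_ - _); last by ring.
    apply: eq_bigr => l _; rewrite /G exprS invfM [t%:C * (r%:C * _)]mulrA.
    have := mulfV (q0 l); move: (q ^+ l) (h _) => u v uu.
    transitivity ((u * u^-1) * (f (t%:C * r%:C) * r%:C * (v * (u ^+ m)^-1))); first by ring.
    by rewrite uu mul1r.
  have ar' : cabs (t%:C * r%:C : C R) < r' by exact: le_lt_trans tr rr'.
  have := @root_average h r' B L m (t%:C * r%:C) hh r'0 r'1 ar' hB mL.
  set Z := \sum_(l < L) _ - _; set a := cabs (t%:C * r%:C : C R) in tr ar' * => hZ.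
  have a0 : 0 <= a by exact: cabs_ge0.
  have hZ' : cabs Z <= L%:R * (Bc * d ^+ (L + m)).
    apply: le_trans hZ _; apply: (ler_wpM2l (ltW L0)); apply: ler_pM.
    - by rewrite mulr_ge0// divr_ge0 ?subr_ge0// ltW.
    - by rewrite exprn_ge0// divr_ge0// ltW.
    - apply: (ler_wpM2l B0); apply: (ler_wpM2l (ltW r'0)).
      by rewrite lef_pV2 ?posrE ?subr_gt0// lerD2l lerN2.
    - have r'V : 0 <= r'^-1 by rewrite invr_ge0; exact: ltW.
      apply: lerXn2r; [by rewrite nnegrE; exact: mulr_ge0|by rewrite nnegrE|].
      exact: (ler_wpM2r r'V tr).
  rewrite !cabsM (cabs_rcge0 (ltW r0)).
  apply: (@le_trans _ _ (Mf * 1 * (L%:R * (Bc * d ^+ (L + m))))).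
    apply: ler_pM; rewrite ?cabs_ge0 ?mulr_ge0 ?cabs_ge0 ?(ltW r0)//.
    by apply: ler_pM; rewrite ?cabs_ge0 ?(ltW r0)// ?hMf// ltW.
  by rewrite mulr1 le_eqVlt; apply/orP; left; apply/eqP; ring.
have cc : cabs (c0 * I) = L%:R * (r * (cabs (coef h 2^-1 m) * cabs I)).
  rewrite /c0 !cabsM (cabs_rcge0 (ltW r0)).
  have -> : cabs (L%:R : C R) = L%:R by rewrite -(rmorph_nat (real_complex R)) cabs_rcge0// ltW.
  by ring.
rewrite -(ler_pM2l L0) -cc mulrDr.
have := cabs_subl (c0 * I) (cint 0 1 (fun w => \sum_(l < L) G l w)); rewrite [cabs (_ - _)]cabsC => h3.
by have := lerD S1 diff; lra.
Qed.

End MomentBound.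

(** * A bounded T_g with nonconstant g forces convergence *)

Section KernelSums.
Variable R : realType.
Local Notation leb := (@lebesgue_measure R).
Local Notation leb2 := (leb \x leb)%E.
Variables (p : R) (om : R -> R) (C0 : R).
Hypotheses (p1 : 1 < p) (hom : radial_weight om) (C01 : 1 <= C0).
Hypothesis hC0 : forall r, 0 <= r < 1 -> omhat om r <= C0 * omhat om ((1 + r) / 2).
Local Notation pp := (conj_exp p).
Local Notation s := (sk p om).

(** Of modulus between 1/2 and 1 on the part of the disc within [e] of the point 1, at most e/|z -
    1| elsewhere; the pole is at 1 + e. *)
Definition peak (e : R) (z : C R) : C R := e%:C * (1 + e%:C - z)^-1.

Lemma peak_real (e t r : R) : peak e (t%:C * r%:C) = (e / (1 + e - t * r))%:C.
Proof. by rewrite /peak fmorph_div rmorphB rmorphD rmorph1 rmorphM. Qed.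

Lemma Re_inD (z : C R) : inD z -> complex.Re (z : R[i]) < 1.
Proof. by move=> zD; apply: le_lt_trans zD; apply: le_trans (ler_norm _) (Re_cabs z). Qed.

Lemma peak_den_ge (e : R) (z : C R) : 0 <= e -> inD z ->
  e <= cabs (1 + e%:C - z) /\ cabs (z - 1) <= cabs (1 + e%:C - z).
Proof.
move=> e0 zD; have := Re_inD zD; case: z zD => a b _ /= a1; split.
  by apply: le_trans (Re_cabs _) => /=; apply: le_trans (ler_norm _); lra.
rewrite cabsC /cabs/=; apply: ler_wsqrtr; rewrite addr0 sub0r lerD2r.
by rewrite -subr_ge0 (_ : _ - _ = e * (e + 2 * (1 - a))); [rewrite mulr_ge0//; lra|ring].
Qed.

Lemma peak_den_neq0 (e : R) (z : C R) : 0 < e -> inD z -> 1 + e%:C - z != 0.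
Proof.
move=> e0 zD; rewrite -cabs_gt0; have [h _] := peak_den_ge (ltW e0) zD.
exact: lt_le_trans h.
Qed.

(** The leading factor [e] cancels the 1/e of the derivative peak^2 / e. *)
Lemma peak_cdif (e : R) (z : C R) M : 0 < e -> inD z ->
  cdif (@inD R) (fun w => e%:C * peak e w ^+ M.+1) z (M.+1%:R * peak e z ^+ M.+2).
Proof.
move=> e0 zD; have d0 := peak_den_neq0 e0 zD.
have h1 : cdif (@inD R) (fun w => 1 + e%:C - w) z (-1).
  by have := cdifD (cdif_cst (@inD R) (1 + e%:C) z) (cdifN (cdif_id (@inD R) z)); rewrite add0r.
have h2 := cdifV (fun w wD => peak_den_neq0 e0 wD) d0 h1.
have h3 := cdifZ e%:C h2.
have h4 := cdif_comp (B := setT) (f := fun w => w ^+ M.+1) (g := peak e) (fun _ _ => I) (cdif_exp setT (peak e z) M) h3.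
have := cdifZ e%:C h4; congr (cdif _ _ _ _).
rewrite /peak opprK; move: (1 + e%:C - z) d0 => u u0.
by rewrite !exprS; field.
Qed.

(** Makes v_k eps_k^2 and v_k^p eps_k omk_k both equal to s_k: the first is what the moment
    functional sees, the second the share in the p-th power of the norm. *)
Definition test_coef (k : nat) : R := (eps R k / omk om k) `^ (pp - 1).
Local Notation v := test_coef.

Lemma test_coef_gt0 k : 0 < v k.
Proof. by rewrite powR_gt0// divr_gt0 ?eps_gt0 ?(omk_gt0 hom). Qed.

Lemma test_coefE k : v k * eps R k ^+ 2 = s k.
Proof.
have e0 := eps_gt0 R k; have o0 := omk_gt0 hom k.
rewrite /v /sk powRM ?invr_ge0 ?(ltW e0) ?(ltW o0)//.
have -> : (omk om k)^-1 `^ (pp - 1) = (omk om k `^ (pp - 1))^-1.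
  by rewrite -powR_inv1 ?(ltW o0)// -(powRrM _ (-1) (pp - 1)) mulN1r powRN.
have -> : eps R k `^ pp = eps R k `^ (pp - 1) * eps R k.
  rewrite -[X in _ = _ * X](powRr1 (ltW e0)) -powRD ?subrK//.
  by rewrite (gt_eqF e0) implybT.
by ring.
Qed.

Lemma test_coef_pow k : v k `^ p * (eps R k * omk om k) = s k.
Proof.
have e0 := eps_gt0 R k; have o0 := omk_gt0 hom k; have q0 := divr_gt0 e0 o0.
rewrite -test_coefE /v -(powRrM _ (pp - 1) p) [_ * p]mulrC (conj_exp_mul p1).
have -> : (eps R k / omk om k) `^ pp = (eps R k / omk om k) `^ (pp - 1) * (eps R k / omk om k).
  rewrite -[X in _ = _ * X](powRr1 (ltW q0)) -powRD ?subrK//.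
  by rewrite (gt_eqF q0) implybT.
by rewrite expr2; move: (_ `^ _) => w; field; rewrite (gt_eqF o0).
Qed.

(** The peaks are raised to a power high enough to beat the growth of [omk] that doubling allows. *)
Variable M : nat.
Hypothesis hM : C0 <= 2 ^+ M.

Definition test_fun n (z : C R) : C R :=
  \sum_(k < n) (v k)%:C * ((eps R k)%:C * peak (eps R k) z ^+ M.+1).

Definition test_der n (z : C R) : C R :=
  \sum_(k < n) (v k)%:C * (M.+1%:R * peak (eps R k) z ^+ M.+2).

Lemma test_cdif n z : inD z -> cdif (@inD R) (test_fun n) z (test_der n z).
Proof.
move=> zD; rewrite /test_der; elim: n => [|n ih].
  rewrite big_ord0; apply: (cdif_ext zD _ (cdif_cst _ 0 _)) => w _.
  by rewrite /test_fun big_ord0.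
rewrite big_ord_recr/=; have h := cdifD ih (cdifZ (v n)%:C (peak_cdif M (eps_gt0 R n) zD)).
by apply: (cdif_ext zD _ h) => w _; rewrite /test_fun big_ord_recr.
Qed.

Lemma holo_test n : holo (test_fun n).
Proof. by apply/holo_dfb => z zD; exists (test_der n z); exact: test_cdif. Qed.

Lemma cderiv_test n z : inD z -> cderiv (test_fun n) z = test_der n z.
Proof. by move=> zD; apply: (cderivE zD); exact: test_cdif. Qed.

Lemma peak_le k m z : inD z -> eps R m <= cabs (z - 1) -> cabs (peak (eps R k) z) <= eps R (k - m).
Proof.
move=> zD hm; have [h1 h2] := peak_den_ge (eps_ge0 R k) zD.
have d0 : 0 < cabs (1 + (eps R k)%:C - z) by apply: lt_le_trans h1; exact: eps_gt0.
rewrite /peak cabsM cabsV (cabs_rcge0 (eps_ge0 R k)) ler_pdivrMr//.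
have [km|mk] := leqP k m.
  by have /eqP -> : (k - m == 0)%N; [rewrite subn_eq0|rewrite eps0 mul1r].
apply: le_trans (ler_wpM2l (eps_ge0 R _) (le_trans hm h2)).
by rewrite -epsD subnK// ltnW.
Qed.

(** Bounds the k-th summand of the derivative on shell [m] about 1; the truncated subtraction makes
    the last factor 1 for k <= m. *)
Definition test_shell k m : R := M.+1%:R * v k * eps R (k - m) ^+ M.+2.

Lemma test_shell_ge0 k m : 0 <= test_shell k m.
Proof.
exact: (mulr_ge0 (mulr_ge0 (ler0n _ _) (ltW (test_coef_gt0 k))) (exprn_ge0 _ (eps_ge0 _ _))).
Qed.

Lemma test_der_le n m z : inD z -> eps R m <= cabs (z - 1) ->
  cabs (test_der n z) <= \sum_(k < n) test_shell k m.
Proof.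
move=> zD hm; apply: le_trans (cabs_sum _ _ _) _; apply: ler_sum => k _.
rewrite (cabsM (v k)%:C) (cabsM M.+1%:R) cabsX (cabs_rcge0 (ltW (test_coef_gt0 k))) /test_shell.
have -> : cabs (M.+1%:R : C R) = M.+1%:R by rewrite -(rmorph_nat (real_complex R)) cabs_rcge0.
rewrite mulrCA -(mulrA M.+1%:R); apply: (ler_wpM2l (ler0n _ _)); apply: (ler_wpM2l (ltW (test_coef_gt0 k))).
by apply: lerXn2r; rewrite ?nnegrE ?cabs_ge0 ?eps_ge0// peak_le.
Qed.

(** For k <= m the decay comes from the factor eps_m of the shell's mass. For k = m + d, of the M +
    2 factors 2^-d, M absorb the C0^d of doubling, one turns eps_m into eps_k and one is the
    decay. *)
Lemma test_shell_pow k m :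
  test_shell k m `^ p * (eps R m * omk om m) <= 2^-1 ^+ ndist k m * (M.+1%:R `^ p * s k).
Proof.
have p0 : 0 <= p by have := p1; lra.
have v0 := ltW (test_coef_gt0 k); have e0 := eps_ge0 R (k - m).
rewrite /test_shell (powRM p (mulr_ge0 (ler0n _ _) v0) (exprn_ge0 _ e0)) (powRM p (ler0n _ _) v0).
rewrite -test_coef_pow; move: (M.+1%:R `^ p) (powR_ge0 (M.+1%:R) p : 0 <= M.+1%:R `^ p) => A A0.
move: (v k `^ p) (powR_ge0 (v k) p) => V V0.
suff h : (eps R (k - m) ^+ M.+2) `^ p * (eps R m * omk om m) <= eps R (ndist k m) * (eps R k * omk om k).
  have := ler_wpM2l (mulr_ge0 A0 V0) h; rewrite /eps => h'.
  rewrite -mulrA; apply: le_trans h' _; rewrite le_eqVlt; apply/orP; left; apply/eqP; ring.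
have [km|mk] := leqP k m.
  have /eqP -> : (k - m == 0)%N by rewrite subn_eq0.
  have -> : ndist k m = (m - k)%N by rewrite -{1}(subnKC km) ndist_addr.
  rewrite eps0 expr1n powR1 mul1r -{1}(subnKC km) epsD mulrAC -mulrA [leRHS]mulrCA.
  apply: (ler_wpM2l (eps_ge0 R k)); rewrite mulrC; apply: (ler_wpM2l (eps_ge0 R _)).
  exact: (omk_le hom km).
have [d kE] : exists d, k = (m + d)%N by exists (k - m)%N; rewrite subnKC// ltnW.
have -> : ndist k m = d by rewrite kE ndist_addl.
have -> : (k - m = d)%N by rewrite kE addKn.
have x1 : (eps R d ^+ M.+2) `^ p <= eps R d ^+ M.+2.
  have x0 : 0 <= eps R d ^+ M.+2 by rewrite exprn_ge0 ?eps_ge0.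
  rewrite -{2}(powRr1 x0); have [->|xN0] := eqVneq (eps R d ^+ M.+2) 0.
    by rewrite !powR0 ?oner_neq0// gt_eqF// (lt_trans ltr01 p1).
  by apply: ger_powR; [rewrite lt_neqAle eq_sym xN0 x0 exprn_ile1 ?eps_ge0 ?eps_le1|exact: ltW].
apply: le_trans (ler_wpM2r _ x1) _; first by rewrite mulr_ge0 ?eps_ge0 ?(ltW (omk_gt0 hom _)).
have od := omk_growth C01 hC0 m d; rewrite -kE in od.
apply: (@le_trans _ _ (eps R d ^+ M.+2 * (eps R m * (C0 ^+ d * omk om k)))).
  by apply: ler_wpM2l; [rewrite exprn_ge0 ?eps_ge0|exact: (ler_wpM2l (eps_ge0 R m) od)].
have Cd : C0 ^+ d * eps R d ^+ M <= 1.
  rewrite /eps -exprM mulnC exprM -exprMn; apply: exprn_ile1.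
    by rewrite mulr_ge0 ?exprn_ge0 ?(le_trans ler01 C01).
  by rewrite exprVn ler_pdivrMr ?exprn_gt0// mul1r.
have -> : eps R d ^+ M.+2 * (eps R m * (C0 ^+ d * omk om k))
    = (C0 ^+ d * eps R d ^+ M) * (eps R d * (eps R k * omk om k)).
  by rewrite [in RHS]kE epsD -kE 2!exprS; ring.
by apply: ler_piMl Cd; rewrite !mulr_ge0 ?eps_ge0 ?(ltW (omk_gt0 hom _)).
Qed.

(** Shell [m] about 1 lies in a cap of radius 2 eps_m, and for m >= 1 where |z| >= 1 - eps_(m-1);
    doubling then passes from m - 1 to m. *)
Lemma shell_mass : exists2 K : R, 0 < K & forall m,
  (\int[leb2]_(z in shell (1%R : C R) m) (\1_(@setT (R * R)) z * om (nrm z))%:E <= (K * (eps R m * omk om m))%:E)%E.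
Proof.
have [K K0 hK] := cap_mass hom; exists (K * 2 * C0) => [|m].
  by rewrite !mulr_gt0// (lt_le_trans ltr01 C01).
have h := hK 1 (2 * eps R m) (1 - eps R m.-1) (@cabs1 R) (mulr_gt0 (ltr0n R 2) (eps_gt0 R m)) (eps01 R _).
apply: le_trans (le_trans _ h) _; last first.
  rewrite lee_fin -/(omk om m.-1); have -> : K * 2 * C0 * (eps R m * omk om m) = K * (2 * eps R m) * (C0 * omk om m) by ring.
  apply: ler_wpM2l; first by rewrite !mulr_ge0 ?eps_ge0 ?(ltW K0).
  case: m {h} => [|m] /=; last exact: (omk_doubling hC0).
  by apply: ler_peMl C01; exact: ltW (omk_gt0 hom _).
rewrite [leLHS]integral_mkcond [leRHS]integral_mkcond; apply: ge0_integral_mono => z _.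
  rewrite patchE; case: ifPn => // /set_mem /shell_sub zD.
  by rewrite lee_fin mulr_ge0 ?(om_nrm_ge0 hom)// indicE.
rewrite !patchE; case: ifPn => [/set_mem zm|_]; last first.
  by case: ifPn => // /set_mem zD; rewrite lee_fin mulr_ge0// (om_nrm_ge0 hom).
have zD := shell_sub zm; have [_ /andP[h1 h2]] := zm.
rewrite mem_set// lee_fin indicE in_setT mul1r; suff -> : 1 - eps R m.-1 <= nrm z by rewrite h2 mul1r.
have z1 := cabs_subl 1 (pt z); rewrite cabs1 cabsC -/(nrm z) in z1.
case: m h1 h2 {h zm} => [|m] h1 h2 /=; first by rewrite eps0 subrr nrm_ge0.
by rewrite epsS in h2; lra.
Qed.

Lemma test_Dint : exists2 K : R, 0 < K & forall n,
  (Dint p (radial om) (test_fun n) <= (K * \sum_(k < n) s k)%:E)%E.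
Proof.
have p0 : 0 < p := lt_trans ltr01 p1; have h2 : 2^-1 < 1 :> R by rewrite invf_lt1// ltr1n.
have h20 : 0 < 2^-1 :> R by rewrite invr_gt0.
have [K1 K10 hK1] := shell_mass; have [K2 K20 hK2] := shell_schur hom p0 h20 h2.
pose A : R := M.+1%:R `^ p; have A0 : 0 < A by rewrite powR_gt0.
exists (K2 * (K1 * A)) => [|n]; first by rewrite !mulr_gt0.
have := hK2 1 (fun z => cabs (cderiv (test_fun n) (pt z))) (fun=> setT) test_shell
  (fun _ m => K1 * (eps R m * omk om m)) (fun k => K1 * (A * s k)) n (@cabs1 R).
rewrite -mulr_sumr -mulr_sumr -!mulrA; apply => //.
- by apply: measurable_cabs_holo; apply: holo_cderiv; exact: holo_test.
- by move=> z _; exact: cabs_ge0.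
- exact: test_shell_ge0.
- by move=> k; exact: (mulr_ge0 (ltW K10) (mulr_ge0 (ltW A0) (ltW (sk_gt0 _ hom k)))).
- move=> m z [zD /andP[zm _]]; have zD' : inD (pt z) by move: zD; rewrite discRE.
  rewrite (cderiv_test n zD'); apply: le_trans (test_der_le n zD' (ltW zm)) _.
  by apply: ler_sum => k _; rewrite indicE in_setT mulr1.
- move=> k m; have := ler_wpM2l (ltW K10) (test_shell_pow k m).
  by rewrite mulrCA [leRHS]mulrCA.
Qed.

(** The point 0 is at distance [eps 0] from 1, so the bounds for shell 0 hold there, and
    [sum_powR_le] sums them. *)
Lemma test_at0 : exists2 K : R, 0 < K & forall n, cabs (test_fun n 0) `^ p <= K * \sum_(k < n) s k.
Proof.
have p0 : 0 < p := lt_trans ltr01 p1.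
pose d : R := 2^-1 `^ p^-1; have d0 : 0 < d by rewrite powR_gt0.
have dP : d `^ p = 2^-1 by rewrite /d -(powRrM 2^-1 p^-1 p) mulVf ?gt_eqF// powRr1.
have d1 : d < 1.
  have E : (1 : R) `^ p^-1 = 1 by rewrite powR1.
  rewrite -[ltRHS]E; apply: gt0_ltr_powR; rewrite ?nnegrE ?invr_gt0//.
  by rewrite invf_lt1// ltr1n.
pose G : R := (2 / (1 - d)) `^ p; have G0 : 0 < G by rewrite powR_gt0// divr_gt0// subr_gt0.
pose A : R := M.+1%:R `^ p; have A0 : 0 < A by rewrite powR_gt0.
have o0 := omk_gt0 hom 0.
exists (G * (A / omk om 0)) => [|n]; first by rewrite mulr_gt0// divr_gt0.
have h : cabs (test_fun n 0) <= \sum_(k < n) test_shell k 0.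
  apply: le_trans (cabs_sum _ _ _) _; apply: ler_sum => k _.
  rewrite (cabsM (v k)%:C) (cabsM (eps R k)%:C) cabsX (cabs_rcge0 (ltW (test_coef_gt0 k))) (cabs_rcge0 (eps_ge0 R k)).
  have b : cabs (peak (eps R k) 0) <= eps R k.
    have := @peak_le k 0 0; rewrite subn0; apply; first by rewrite /inD cabs0.
    by rewrite sub0r cabsN cabs1 eps0.
  rewrite /test_shell subn0 -mulrA; apply: (@le_trans _ _ (v k * eps R k ^+ M.+2)).
    apply: (ler_wpM2l (ltW (test_coef_gt0 k))); rewrite (exprS (eps R k) M.+1); apply: (ler_wpM2l (eps_ge0 R k)).
    by apply: lerXn2r; rewrite ?nnegrE ?cabs_ge0 ?eps_ge0.
  apply: ler_peMl; last by rewrite ler1n.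
  exact: (mulr_ge0 (ltW (test_coef_gt0 k)) (exprn_ge0 _ (eps_ge0 _ _))).
apply: le_trans (powR_le (ltW p0) (cabs_ge0 _) h) _.
apply: le_trans (@sum_powR_le R p d (fun k => test_shell k 0) n 0 p0 d0 d1 (fun k => test_shell_ge0 k 0)) _.
rewrite -mulrA; apply: (ler_wpM2l (ltW G0)); rewrite mulr_sumr; apply: ler_sum => k _; rewrite dP.
have := test_shell_pow k 0; rewrite eps0 mul1r -ler_pdivlMr// => h1.
have i0 : 0 <= (2^-1)^-1 ^+ ndist k 0 :> R by rewrite exprn_ge0// invr_ge0.
apply: le_trans (ler_wpM2l i0 h1) _; move: (s k) => S.
by rewrite mulrA (mulrA (_ ^+ _)) -exprMn mulVf// expr1n mul1r mulrAC lexx.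
Qed.

Lemma Re_cint_ge a b (c : R) (F : C R -> C R) : a <= b -> dfb (seg a b) F ->
  (forall t, a <= t <= b -> c <= complex.Re (F t%:C : R[i])) ->
  c * (b - a) <= complex.Re (cint a b F : R[i]).
Proof.
move=> ab dF hc; rewrite /cint/=.
have -> : c * (b - a) = Rintegral leb `[a, b] (fun=> c).
  rewrite Rintegral_cst//= lebesgue_measure_itv/= lte_fin; case: ltP => // ba.
  by rewrite (le_anti (introT andP (conj ab ba))) subrr/=.
apply: le_Rintegral => //.
- exact: (@Re_integrable R a b (fun=> c%:C) (@dfb_cst R _ c%:C)).
- exact: Re_integrable.
Qed.

(** All integrands are real and nonnegative. On [1 - eps_k, 1], for k >= 1, the k-th peak is at
    least 1/3 and t r at least 1/4, so the k-th summand, with its factor v_k eps_k, integrates to at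
    least c v_k eps_k^2 = c s_k. *)
Lemma test_lower m : exists2 c : R, 0 < c & forall n,
  c * \sum_(k < n) s k.+1 <= cabs (cint 0 1 (fun w =>
    test_fun n.+1 (w * (1 - eps R n.+1)%:C) * (w * (1 - eps R n.+1)%:C) ^+ m)).
Proof.
pose c : R := 3^-1 ^+ M.+1 * 4^-1 ^+ m.
have c0 : 0 < c by rewrite mulr_gt0// exprn_gt0.
exists c => // n; set r := 1 - eps R n.+1.
have /andP[r0 r1] : 0 <= r < 1 := eps01 R n.+1.
have rD : inD (r%:C : C R) by rewrite /inD cabs_rcge0.
pose psi k (w : C R) : C R := peak (eps R k) (w * r%:C) ^+ M.+1 * (w * r%:C) ^+ m.
have dpsi k : dfb (seg 0 1) (psi k).
  have dw : dfb (seg 0 1) (fun w : C R => w * r%:C) by apply: dfbM; [exact: dfb_id|exact: dfb_cst].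
  apply: dfbM; last exact: dfbX.
  apply: dfbX; apply: dfbM; first exact: dfb_cst.
  apply: dfbV; last by apply: dfbB => //; exact: dfb_cst.
  move=> w [t /andP[t0 t1] ->]; apply: peak_den_neq0; first exact: eps_gt0.
  by apply: inD_mul => //; rewrite cabs_rcge0.
pose u k t : R := (eps R k / (1 + eps R k - t * r)) ^+ M.+1 * (t * r) ^+ m.
have psiE k t : psi k t%:C = (u k t)%:C.
  by rewrite /psi peak_real -rmorphM -!rmorphXn -rmorphM.
have den k t : 0 <= t <= 1 -> 0 < 1 + eps R k - t * r.
  move=> /andP[t0 t1]; have := eps_gt0 R k; have := ler_wpM2r r0 t1; rewrite mul1r; lra.
have u0 k t : 0 <= t <= 1 -> 0 <= u k t.
  move=> t01; have /andP[t0 t1] := t01; rewrite mulr_ge0 ?exprn_ge0 ?mulr_ge0 ?eps_ge0//.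
  by rewrite invr_ge0 ltW// den.
have E : cint 0 1 (fun w => test_fun n.+1 (w * r%:C) * (w * r%:C) ^+ m)
    = \sum_(k < n.+1) (v k * eps R k)%:C * cint 0 1 (psi k).
  transitivity (cint 0 1 (fun w => \sum_(k < n.+1) (v k * eps R k)%:C * psi k w)).
    apply: eq_cint => t _; rewrite /test_fun mulr_suml; apply: eq_bigr => k _.
    by rewrite /psi rmorphM/=; ring.
  rewrite (cint_sum _ (fun k : 'I_n.+1 => _)); last by move=> k; apply: dfbM; [exact: dfb_cst|exact: dpsi].
  by apply: eq_bigr => k _; exact: cintZ.
have ReE : complex.Re (cint 0 1 (fun w => test_fun n.+1 (w * r%:C) * (w * r%:C) ^+ m) : R[i])
    = \sum_(k < n.+1) v k * eps R k * complex.Re (cint 0 1 (psi k) : R[i]).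
  rewrite E raddf_sum; apply: eq_bigr => k _ /=.
  by case: (cint 0 1 (psi k)) => a b /=; rewrite mul0r subr0.
apply: le_trans (Re_cabs _); apply: le_trans (ler_norm _); rewrite ReE.
have ge0 k : 0 <= v k * eps R k * complex.Re (cint 0 1 (psi k) : R[i]).
  rewrite mulr_ge0 ?mulr_ge0 ?eps_ge0 ?(ltW (test_coef_gt0 k))//.
  have := Re_cint_ge ler01 (dpsi k) (c := 0); rewrite mul0r; apply => t t01.
  by rewrite psiE/= u0.
(* The summand k = 0 is dropped: its interval is all of [0, 1], where t r has no positive lower
   bound. *)
rewrite big_ord_recl; apply: le_trans (ler_wpDl (ge0 _) (lexx _)).
rewrite mulr_sumr; apply: ler_sum => k _; rewrite lift0.
have kn : (k.+1 <= n.+1)%N by rewrite ltnS ltnW.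
have -> : c * s k.+1 = v k.+1 * eps R k.+1 * (c * eps R k.+1) by rewrite -test_coefE; ring.
apply: (ler_wpM2l (mulr_ge0 (ltW (test_coef_gt0 _)) (eps_ge0 _ _))).
have /andP[a0 a1] := eps01 R k.+1; set a := 1 - eps R k.+1 in a0 a1.
have aE : eps R k.+1 = 1 - a by rewrite /a; ring.
have dA : dfb (seg 0 a) (psi k.+1) by apply: dfb_subset (dpsi _); apply: seg_sub => //; exact: ltW.
have dB : dfb (seg a 1) (psi k.+1) by apply: dfb_subset (dpsi _); exact: seg_sub.
rewrite (cint_cat a0 (ltW a1) (dpsi _)) raddfD/= aE.
have h1 : 0 <= complex.Re (cint 0 a (psi k.+1) : R[i]).
  have := Re_cint_ge a0 dA (c := 0); rewrite mul0r; apply => t /andP[t0 ta].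
  by rewrite psiE/= u0// t0 (le_trans ta)// ltW.
apply: le_trans (ler_wpDl h1 (lexx _)); apply: Re_cint_ge => //; first exact: ltW.
move=> t /andP[ta t1]; rewrite psiE/=.
have t01 : 0 <= t <= 1 by rewrite (le_trans a0 ta).
have ar : a <= r by rewrite /a /r lerD2l lerN2 eps_le.
have tr : a * a <= t * r by apply: ler_pM.
have a2 : 2^-1 <= a by rewrite /a; have := eps_le R (ltn0Sn k : (1 <= k.+1)%N); rewrite /eps expr1; lra.
apply: ler_pM; rewrite ?exprn_ge0//.
  apply: lerXn2r; rewrite ?nnegrE// ?divr_ge0 ?eps_ge0 ?(ltW (den _ _ t01))//.
  rewrite ler_pdivlMr ?den// aE; move: tr; move: (t * r) => x xa; nra.
apply: lerXn2r; rewrite ?nnegrE//; first by rewrite mulr_ge0//; case/andP: t01.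
by apply: le_trans tr; nra.
Qed.

Lemma bdd_of_tbounded (g : C R -> C R) : holo g -> Tbounded p (radial om) g -> ~ const_on_D g -> bdd s.
Proof.
move=> hg hT ng; have p0 : 0 < p := lt_trans ltr01 p1.
have [m [K hK]] := moment_bound p0 hom hg hT ng.
have [c c0 hc] := test_lower m; have [K1 K10 hK1] := test_Dint; have [K2 K20 hK2] := test_at0.
pose K' := Num.max K 0; have K'0 : 0 <= K' by rewrite le_max lexx orbT.
have s0 k : 0 <= s k by exact: ltW (sk_gt0 _ hom k).
pose S n := \sum_(k < n.+1) s k; have S0 n : 0 <= S n by exact: sumr_ge0.
have piV : 0 <= pi^-1 :> R by rewrite invr_ge0 ltW// pi_gt0R.
pose W := pi^-1 * K1 + K2; have W0 : 0 <= W by rewrite addr_ge0 ?mulr_ge0 ?(ltW K10) ?(ltW K20).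
pose B := 2 / c * (K' * W `^ p^-1).
have B0 : 0 <= B by rewrite mulr_ge0 ?mulr_ge0 ?powR_ge0// invr_ge0 ltW.
have key n : S n <= s 0 + B * S n `^ p^-1.
  have KS : 0 <= K1 * S n by rewrite mulr_ge0 ?(ltW K10).
  have [fD fN] := inDsp_bound p0 (radial_ge0 hom) (@holo_test n.+1) KS (hK1 n.+1).
  have r0 : 2^-1 <= 1 - eps R n.+1.
    by have := eps_le R (ltn0Sn n : (1 <= n.+1)%N); rewrite /eps expr1; lra.
  have r00 : 0 < 1 - eps R n.+1 by apply: lt_le_trans r0; rewrite invr_gt0.
  have r1 : 1 - eps R n.+1 < 1 by case/andP: (eps01 R n.+1).
  have h := hK _ _ fD r00 r1; have hn := hc n.
  set I := cabs _ in h hn; set N := Dnorm _ _ _ in h fN.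
  have N0 : 0 <= N by exact: powR_ge0.
  have NS : N <= W `^ p^-1 * S n `^ p^-1.
    rewrite -powRM//; apply: le_trans fN _; apply: powR_le; first by rewrite invr_ge0 ltW.
      by rewrite addr_ge0 ?powR_ge0// mulr_ge0.
    by rewrite /W mulrDl mulrA lerD2l; exact: hK2.
  have I2 : I <= 2 * (K' * N).
    have I0 : 0 <= I by exact: cabs_ge0.
    have h1 := ler_wpM2r I0 r0.
    have h3 : K * N <= K' * N by apply: (ler_wpM2r N0); rewrite le_max lexx.
    have := le_trans h1 (le_trans h h3); lra.
  have SE : S n = s 0 + \sum_(k < n) s k.+1.
    by rewrite /S big_ord_recl; congr (_ + _); apply: eq_bigr => k _.
  rewrite {1}SE lerD2l /B -!mulrA.
  rewrite [2 * _]mulrCA ler_pdivlMl//.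
  apply: le_trans hn _; apply: le_trans I2 _; apply: ler_wpM2l => //.
  exact: (ler_wpM2l K'0 NS).
exists (Num.max 1 ((s 0 + B) `^ pp)) => n.
apply: (@le_trans _ _ (S n)); first by rewrite /S big_ord_recr/= lerDl.
exact: (le_powR_bounded p1 (S0 n) (s0 0%N) B0 (key n)).
Qed.

End KernelSums.

(** * Cauchy's formula averaged against the weight *)

Section CauchyAverage.
Variable R : realType.
Local Notation leb := (@lebesgue_measure R).
Local Notation leb2 := (leb \x leb)%E.
Variable om : R -> R.
Hypothesis hom : radial_weight om.

(** Cauchy's formula on the circle through [z]; the unimodular [u] rotates the parametrisation so
    that it starts at [z], as [crot t z] does. *)
Lemma circle_mean_bound (h : C R -> C R) (a : C R) (z : R * R) : holo h -> cabs a < nrm z -> nrm z < 1 ->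
  ((cabs (h a))%:E <= \int[leb]_(t in `[0%R, 1%R])
    (cabs (h (pt (crot t z))) * (nrm z / cabs (pt (crot t z) - a)))%:E)%E.
Proof.
move=> hh az z1; set r := nrm z in az z1 *.
have r0 : 0 < r := le_lt_trans (cabs_ge0 a) az.
have rC0 : (r%:C : C R) != 0 by rewrite -cabs_gt0 cabs_rcge0// ltW.
pose u : C R := pt z / r%:C.
have u1 : cabs u = 1 by rewrite cabsM cabsV (cabs_rcge0 (ltW r0)) -/(nrm z) divff// gt_eqF.
have u0 : u != 0 by rewrite -cabs_gt0 u1.
have ur : u * r%:C = pt z by rewrite divfK.
pose k (x : C R) := h (u * x); have hk : holo k by apply: holo_rot hh; rewrite u1.
have au : cabs (a / u) < r by rewrite cabsM cabsV u1 invr1 mulr1.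
have dI : dfb (seg 0 1) (fun w => k (circ r w) * (circ r w * kern r (a / u) w)).
  apply: (dfb_subset (@seg_rline R 0 1)); apply: dfbM; first exact: holo_circ_dfb.
  by apply: dfbM; [exact: circ_dfb|exact: kern_dfb].
have E : h a = k (a / u) by rewrite /k mulrCA divff// mulr1.
rewrite E (cauchy_formula hk au z1).
apply: (@le_trans _ _ (Rintegral leb `[0, 1] (fun t => cabs (k (circ r t%:C) * (circ r t%:C * kern r (a / u) t%:C))))%:E).
  by rewrite lee_fin; exact: cint_cabs.
rewrite /Rintegral fineK; last first.
  by apply: integrable_fin_num => //; exact: cabs_integrable dI.
rewrite le_eqVlt; apply/orP; left; apply/eqP; apply: eq_integral => t _; congr (_%:E).
have cE : u * circ r t%:C = pt (crot t z) by rewrite pt_crot /circ mulrA ur mulrC.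
rewrite cabsM /k cE; congr (_ * _); rewrite cabsM cabs_circ// /kern cabsV; congr (_ / _).
rewrite -[LHS]mul1r -u1 -cabsM mulrBr cE; congr (cabs (_ - _)).
by rewrite mulrCA divff// mulr1.
Qed.

Lemma measurable_dist_inv (a : C R) : measurable_fun setT (fun z : R * R => (cabs (pt z - a))^-1).
Proof.
have h := powR_measurable (-1) (measurable_dist a).
by apply: eq_measurable_fun h => z _; rewrite powR_inv1// cabs_ge0.
Qed.

Lemma cauchy_average : exists2 c : R, 0 < c & forall (h : C R -> C R) (a : C R) (rho : R),
  holo h -> cabs a < rho -> 2^-1 <= rho -> rho < 1 ->
  ((c * omhat om rho * cabs (h a))%:E <= \int[leb2]_(z in @discR R)
     (cabs (h (pt z)) * ((cabs (pt z - a))^-1 * ((rho <= nrm z)%R%:R * om (nrm z))))%:E)%E.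
Proof.
(* The 1/2 is the lower bound, from rho >= 1/2, of the factor r of the area element. *)
have [k k0 hk] := radial_integral R; exists (k / 2) => [|h a rho hh ar r2 r1]; first by rewrite divr_gt0.
have r0 : 0 <= rho by lra.
pose W (z : R * R) : R := (rho <= nrm z)%R%:R * om (nrm z).
have mW : measurable_fun (@discR R) W.
  apply: measurable_funM; last exact: om_nrm_measurable.
  apply: (measurableT_comp (f := fun b : bool => (b%:R : R))) => //.
  by apply: measurable_fun_ler => //; apply: measurable_funTS; exact: measurable_nrm.
have W0 z : discR z -> 0 <= W z by move=> zD; rewrite mulr_ge0// (om_nrm_ge0 hom).
pose F0 (z : R * R) : R := cabs (h (pt z)) * (nrm z / cabs (pt z - a)) * W z.
pose F := ((EFin \o F0) \_ (@discR R))%E.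
have mF : measurable_fun setT F.
  apply/measurable_restrict => //; first exact: measurable_discR.
  rewrite setTI; apply/measurable_EFinP; apply: measurable_funM => //.
  apply: measurable_funM; first exact: measurable_cabs_holo.
  apply: measurable_funM; first by apply: measurable_funTS; exact: measurable_nrm.
  by apply: measurable_funTS; exact: measurable_dist_inv.
have Fge0 z : (0 <= F z)%E.
  rewrite /F patchE; case: ifPn => // /set_mem zD /=.
  rewrite lee_fin; apply: (mulr_ge0 _ (W0 z zD)); apply: (mulr_ge0 (cabs_ge0 _)).
  exact: divr_ge0 (nrm_ge0 _) (cabs_ge0 _).
apply: (@le_trans _ _ (\int[leb2]_z F z)%E); last first.
  rewrite [leRHS]integral_mkcond; apply: ge0_integral_mono => z _ //.
  rewrite /F !patchE; case: ifPn => [/set_mem zD|_] /=; last by rewrite lexx.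
  rewrite lee_fin /F0 -mulrA.
  apply: (ler_wpM2l (cabs_ge0 _)); rewrite -mulrA.
  have z1 : nrm z < 1 by move: zD; rewrite discRE.
  apply: (ler_piMl _ (ltW z1)); apply: (mulr_ge0 _ (W0 z zD)).
  by rewrite invr_ge0 cabs_ge0.
rewrite (rot_average mF Fge0).
have nc t z : nrm (crot t z) = nrm z by rewrite /nrm pt_crot cabsM cabs_cis mul1r.
apply: (@le_trans _ _ (\int[leb2]_(z in @discR R) (cabs (h a) * W z)%:E)%E); last first.
  rewrite [leLHS]integral_mkcond; apply: ge0_integral_mono => z _.
    by rewrite patchE; case: ifPn => // /set_mem zD; rewrite lee_fin mulr_ge0 ?cabs_ge0 ?W0.
  rewrite patchE; case: ifPn => [/set_mem zD|_]; last by apply: integral_ge0 => t _; exact: Fge0.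
  have [rz|zr] := leP rho (nrm z); last first.
    have -> : W z = 0 by rewrite /W (leNgt rho) zr mul0r.
    by rewrite mulr0; apply: integral_ge0 => t _; exact: Fge0.
  have z1 : nrm z < 1 by move: zD; rewrite discRE.
  (* The weight is constant along the circle and can be moved into the holomorphic function. *)
  have hw : holo (fun x => (W z)%:C * h x).
    by apply/holo_dfb; apply: dfbM; [exact: dfb_cst|exact/holo_dfb].
  have := circle_mean_bound hw (lt_le_trans ar rz) z1.
  rewrite cabsM (cabs_rcge0 (W0 z zD)) mulrC => /le_trans; apply.
  rewrite le_eqVlt; apply/orP; left; apply/eqP; apply: eq_integral => t _.
  rewrite /F patchE mem_discR nc z1 /=; congr (_%:E).
  by rewrite cabsM (cabs_rcge0 (W0 z zD)) /F0 nc /W nc; ring.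
pose u r : R := cabs (h a) * ((rho <= r)%R%:R * om r).
have mu : measurable_fun (`[0, 1[ : set R) u.
  apply: measurable_funM => //; apply: measurable_funM.
    apply: (measurableT_comp (f := fun b : bool => (b%:R : R))) => //.
    exact: measurable_fun_ler.
  by apply/measurable_EFinP; exact: om_measurable hom.
have u0 r : 0 <= r < 1 -> 0 <= u r.
  by move=> r01; rewrite mulr_ge0 ?cabs_ge0// mulr_ge0// (om_ge0 hom).
rewrite (hk (EFin \o u)); last 2 first.
- exact/measurable_EFinP.
- by move=> r r01; rewrite lee_fin u0.
have -> : k / 2 * omhat om rho * cabs (h a) = k * (cabs (h a) / 2 * omhat om rho) by ring.
rewrite EFinM; apply: lee_wpmul2l; first by rewrite lee_fin ltW.
rewrite -(@integral_outer R om hom _ rho) ?r0//; last by rewrite divr_ge0// cabs_ge0.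
apply: ge0_integral_mono => r /=; rewrite in_itv/= => r01.
  by rewrite lee_fin mulr_ge0 ?divr_ge0 ?cabs_ge0// mulr_ge0// (om_ge0 hom).
rewrite -EFinM lee_fin /u; case: (leP rho r) => rr; last by rewrite !mul0r !mulr0.
rewrite !mul1r mulrAC [cabs _ * _ / 2]mulrC; apply: ler_wpM2r; first by rewrite mulr_ge0 ?cabs_ge0// (om_ge0 hom).
exact: le_trans r2 rr.
Qed.

End CauchyAverage.

(** * Dyadic sums of a holomorphic function along a radius *)

Section RadialSums.
Variable R : realType.
Local Notation leb := (@lebesgue_measure R).
Local Notation leb2 := (leb \x leb)%E.
Variables (p : R) (om : R -> R) (C0 : R).
Hypotheses (p1 : 1 < p) (hom : radial_weight om) (C01 : 1 <= C0).
Hypothesis hC0 : forall r, 0 <= r < 1 -> omhat om r <= C0 * omhat om ((1 + r) / 2).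
Local Notation pp := (conj_exp p).
Local Notation s := (sk p om).

(** The gap between 1 - eps_(k+1) and 1 - eps_(k+2) keeps [z] at least eps_k/4 away from u ze, and
    |z - ze| exceeds this distance by at most eps_k. *)
Lemma block_dist (ze : C R) k u (z : R * R) : cabs ze = 1 -> 1 - eps R k <= u <= 1 - eps R k.+1 ->
  1 - eps R k.+2 <= nrm z -> Num.max (eps R k) (cabs (pt z - ze)) <= 8 * cabs (pt z - u%:C * ze).
Proof.
move=> ze1 /andP[u0 u1] rz; have e0 := eps_gt0 R k.
have e1 := epsS R k; have e2 := epsS R k.+1; have /andP[k0 _] := eps01 R k.
have ca : cabs (u%:C * ze) = u by rewrite cabsM ze1 mulr1 cabs_rcge0// (le_trans k0).
have h1 : nrm z - u <= cabs (pt z - u%:C * ze) by rewrite -{1}ca; exact: cabs_subl.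
have h2 : cabs (pt z - ze) <= cabs (pt z - u%:C * ze) + (1 - u).
  have -> : pt z - ze = (pt z - u%:C * ze) - (1 - u)%:C * ze by rewrite rmorphB rmorph1; ring.
  apply: le_trans (cabsB _ _) _; rewrite lerD2l cabsM ze1 mulr1 cabs_rcge0//; lra.
by rewrite ge_max; apply/andP; split; lra.
Qed.

(** Majorises 1/|z - u ze| uniformly for [u] in block [k], on the circles over which that block is
    averaged. *)
Definition block_kernel (ze : C R) k (z : R * R) : R :=
  8 / Num.max (eps R k) (cabs (pt z - ze)) * \1_(outer (1 - eps R k.+2)) z.

Lemma block_kernel_ge0 ze k z : 0 <= block_kernel ze k z.
Proof. by rewrite mulr_ge0 ?divr_ge0 ?indicE// le_max eps_ge0. Qed.

Lemma measurable_block_kernel ze k : measurable_fun setT (block_kernel ze k).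
Proof.
apply: measurable_funM; last by apply: measurable_indic; exact: measurable_outer.
apply: measurable_funM => //.
have h : measurable_fun setT (fun z : R * R => (Num.max (eps R k) (cabs (pt z - ze))) `^ (-1)).
  by apply: powR_measurable; apply: measurable_maxr => //; exact: measurable_dist.
by apply: eq_measurable_fun h => z _; rewrite powR_inv1// le_max eps_ge0.
Qed.

Lemma block_value : exists2 c : R, 0 < c & forall (h : C R -> C R) (ze : C R) k u,
  holo h -> cabs ze = 1 -> 1 - eps R k <= u <= 1 - eps R k.+1 ->
  ((cabs (h (u%:C * ze)))%:E <= \int[leb2]_(z in @discR R)
    (cabs (h (pt z)) * ((c * omk om k.+2)^-1 * block_kernel ze k z * om (nrm z)))%:E)%E.
Proof.
have [c c0 hc] := cauchy_average hom; exists c => // h ze k u hh ze1 /andP[u0 u1].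
have e2 := epsS R k.+1; have e0 := eps_gt0 R k.+1; have /andP[k0 _] := eps01 R k.
have ca : cabs (u%:C * ze) < 1 - eps R k.+2.
  by rewrite cabsM ze1 mulr1 cabs_rcge0 ?(le_trans k0)//; lra.
have r2 : 2^-1 <= 1 - eps R k.+2.
  by have := eps_le R (ltn0Sn k.+1 : (1 <= k.+2)%N); rewrite /eps expr1; lra.
have /andP[_ r1] := eps01 R k.+2.
have co : 0 < c * omk om k.+2 by rewrite mulr_gt0// (omk_gt0 hom).
have hk : holo (fun x => ((c * omk om k.+2)^-1)%:C * h x).
  by apply/holo_dfb; apply: dfbM; [exact: dfb_cst|exact/holo_dfb].
have co' : 0 <= (c * omk om k.+2)^-1 by rewrite invr_ge0 ltW.
have := hc _ _ _ hk ca r2 r1; rewrite cabsM (cabs_rcge0 co') mulrA divff ?gt_eqF// mul1r => /le_trans; apply.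
apply: ge0_integral_mono => z zD.
  by rewrite lee_fin !mulr_ge0 ?cabs_ge0 ?invr_ge0 ?cabs_ge0// (om_nrm_ge0 hom).
rewrite lee_fin cabsM (cabs_rcge0 co') mulrAC [leRHS]mulrC.
rewrite -!mulrA; apply: (ler_wpM2l co'); rewrite /block_kernel /outer indic_setE.
rewrite [leRHS](_ : _ = 8 / Num.max (eps R k) (cabs (pt z - ze)) *
  ((1 - eps R k.+2 <= nrm z)%R%:R * (om (nrm z) * cabs (h (pt z))))); last by ring.
have [rz|_] := leP (1 - eps R k.+2) (nrm z); last by rewrite !mul0r !mulr0.
rewrite !mul1r; apply: ler_wpM2r; first by rewrite mulr_ge0 ?cabs_ge0// (om_nrm_ge0 hom).
have hd := block_dist ze1 (introT andP (conj u0 u1)) rz.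
have M0 : 0 < Num.max (eps R k) (cabs (pt z - ze)) by rewrite lt_max eps_gt0.
by rewrite ler_pdivlMr// mulrC ler_pdivrMr//; lra.
Qed.

(** The decay required by [shell_schur]. For m >= k the mass of the cap halves at each step; for m <
    k the kernel loses a factor 2^-p' per step while the mass gains 2, which leaves 2^-(p'-1). *)
Lemma block_pow (c Km : R) : 0 < c -> 0 < Km -> exists2 K : R, 0 < K & forall k m,
  (eps R k ^+ 2 / (c * omk om k.+2) * (8 / Num.max (eps R k) (eps R m))) `^ pp
    * (Km * (2 * eps R m) * omk om k.+2)
  <= Num.max 2^-1 (2^-1 `^ (pp - 1)) ^+ ndist k m * (K * s k).
Proof.
move=> c0 Km0; set g := Num.max _ _.
have ppp := lt_trans ltr01 (conj_exp_gt1 p1); have q0 := pp10 p1.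
have C00 : 0 < C0 by exact: lt_le_trans C01.
pose A := (8 / c) `^ pp; have A0 : 0 < A by rewrite powR_gt0// divr_gt0.
pose B := (C0 ^+ 2) `^ (pp - 1); have B0 : 0 < B by rewrite powR_gt0// exprn_gt0.
exists (A * (2 * Km) * B) => [|k m]; first by rewrite !mulr_gt0.
have e0 := eps_gt0 R k; have m0 := eps_gt0 R m; have o0 := omk_gt0 hom k.+2.
have O0 := omk_gt0 hom k.
set o := omk om k.+2 in o0 *; set e := eps R k in e0 *; set em := eps R m in m0 *.
set Mx := Num.max e em; have M0 : 0 < Mx by rewrite lt_max e0.
have -> : e ^+ 2 / (c * o) * (8 / Mx) = 8 / c * (e * (e / Mx) / o).
  by field; rewrite !gt_eqF.
have ge2 : 2^-1 <= g by rewrite le_max lexx.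
have gep : 2^-1 `^ (pp - 1) <= g by rewrite le_max lexx orbT.
have key : (e / Mx) `^ pp * em <= g ^+ ndist k m * e.
  have [km|mk] := leqP k m.
    have -> : ndist k m = (m - k)%N by rewrite -{1}(subnKC km) ndist_addr.
    have -> : Mx = e by apply: max_l; exact: eps_le.
    rewrite divff ?gt_eqF// powR1 mul1r /em -(subnKC km) epsD addKn mulrC -/e.
    by apply: (ler_wpM2r (ltW e0)); apply: lerXn2r; rewrite ?nnegrE ?invr_ge0// (le_trans _ ge2)// invr_ge0.
  have [d kE] : exists d, k = (m + d)%N by exists (k - m)%N; rewrite subnKC// ltnW.
  have -> : ndist k m = d by rewrite kE ndist_addl.
  have -> : Mx = em by apply: max_r; apply: eps_le; exact: ltnW.
  have eE : e = em * eps R d by rewrite /e kE epsD.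
  have -> : e / em = eps R d by rewrite eE mulrAC divff ?mul1r// gt_eqF.
  have -> : eps R d `^ pp = (2^-1 `^ (pp - 1)) ^+ d * eps R d.
    have -> : (2^-1 `^ (pp - 1)) ^+ d = eps R d `^ (pp - 1).
      rewrite /eps -!powR_mulrn ?powR_ge0 ?invr_ge0//.
      by rewrite -(powRrM 2^-1 (pp - 1) d%:R) -(powRrM 2^-1 d%:R (pp - 1)) mulrC.
    rewrite -[X in _ = _ * X](powRr1 (eps_ge0 R d)) -powRD ?subrK//.
    by rewrite (gt_eqF (eps_gt0 R d)) implybT.
  rewrite -mulrA [eps R d * em]mulrC -eE; apply: (ler_wpM2r (ltW e0)).
  by apply: lerXn2r; rewrite ?nnegrE ?powR_ge0// (le_trans _ gep)// powR_ge0.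
have omB : (o `^ (pp - 1))^-1 <= B / omk om k `^ (pp - 1).
  have h : omk om k <= C0 ^+ 2 * o by have := omk_growth C01 hC0 k 2; rewrite addn2.
  rewrite ler_pdivlMr ?powR_gt0// ler_pdivrMl ?powR_gt0// /B -powRM ?exprn_ge0 ?(ltW C00) ?(ltW o0)//.
  by apply: (powR_le q0 (ltW O0)); rewrite mulrC in h *.
have oE : (e * (e / Mx) / o) `^ pp * o = e `^ pp * (e / Mx) `^ pp * (o `^ (pp - 1))^-1.
  have x0 : 0 <= e / Mx by rewrite divr_ge0// ltW.
  have y0 : 0 <= e * (e / Mx) by rewrite mulr_ge0// ltW.
  have oV : 0 <= o^-1 by rewrite invr_ge0 ltW.
  rewrite (powRM pp y0 oV) (powRM pp (ltW e0) x0) -[in RHS]mulrA -mulrA -mulrA; congr (_ * (_ * _)).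
  have -> : o^-1 `^ pp = (o `^ pp)^-1 by rewrite -powR_inv1 ?(ltW o0)// -(powRrM o (-1) pp) mulN1r powRN.
  have -> : o `^ pp = o `^ (pp - 1) * o.
    by rewrite -[X in _ = _ * X](powRr1 (ltW o0)) -powRD ?subrK// (gt_eqF o0) implybT.
  by rewrite invfM -mulrA mulVf ?mulr1// gt_eqF.
have X0 : 0 <= e * (e / Mx) / o by rewrite !mulr_ge0 ?invr_ge0 ?(ltW e0) ?(ltW M0) ?(ltW o0).
have c8 : 0 <= 8 / c by rewrite divr_ge0// ltW.
rewrite (powRM pp c8 X0) -/A.
have -> : A * (e * (e / Mx) / o) `^ pp * (Km * (2 * em) * o)
  = A * (2 * Km) * (e `^ pp * ((e / Mx) `^ pp * em) * (o `^ (pp - 1))^-1).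
  transitivity (A * (2 * Km) * ((e * (e / Mx) / o) `^ pp * o * em)); first by ring.
  by rewrite oE; ring.
have -> : g ^+ ndist k m * (A * (2 * Km) * B * s k)
  = A * (2 * Km) * (e `^ pp * (g ^+ ndist k m * e) * (B / omk om k `^ (pp - 1))).
  by rewrite /sk -/e; ring.
apply: ler_wpM2l; first by rewrite !mulr_ge0 ?(ltW A0) ?(ltW Km0).
apply: ler_pM => //; rewrite ?invr_ge0 ?powR_ge0//.
  by rewrite mulr_ge0 ?powR_ge0// mulr_ge0 ?powR_ge0// ltW.
by apply: ler_wpM2l => //; exact: powR_ge0.
Qed.

(** The sum is at most the weighted integral of |h| against a combination [Psi] of block kernels.
    Young's inequality with parameter [t] separates |h|^p from Psi^p', and the Schur test bounds the
    latter. The points of the blocks are free, so maxima are allowed; [k0] serves to isolate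
    tails. *)
Lemma radial_sum : exists2 K : R, 0 < K & forall (h : C R -> C R) (ze : C R) (A t : R) k0 n (b : nat -> R),
  holo h -> cabs ze = 1 -> 0 <= A -> 0 < t ->
  (\int[leb2]_(z in @discR R) (cabs (h (pt z)) `^ p * om (nrm z))%:E <= A%:E)%E ->
  (forall k, exists2 u, 1 - eps R k <= u <= 1 - eps R k.+1 & b k = cabs (h (u%:C * ze))) ->
  \sum_(k < n) (if (k0 <= k)%N then eps R k ^+ 2 * b k else 0)
    <= t `^ (p - 1) * A + t^-1 * (K * \sum_(k < n) (if (k0 <= k)%N then s k else 0)).
Proof.
have ppp := lt_trans ltr01 (conj_exp_gt1 p1); have q0 := pp10 p1.
have [c c0 hc] := block_value; have [Km Km0 hKm] := cap_mass hom.
have [K1 K10 hK1] := block_pow c0 Km0.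
pose g : R := Num.max 2^-1 (2^-1 `^ (pp - 1)).
have g0 : 0 < g by rewrite lt_max invr_gt0 ltr0n.
have g1 : g < 1.
  have E : (1 : R) `^ (pp - 1) = 1 by rewrite powR1.
  rewrite gt_max invf_lt1// ltr1n/= -[ltRHS]E; apply: gt0_ltr_powR; rewrite ?nnegrE ?invr_ge0//.
    by rewrite subr_gt0; exact: conj_exp_gt1.
  by rewrite invf_lt1// ltr1n.
have [K2 K20 hK2] := shell_schur hom ppp g0 g1.
exists (K2 * K1) => [|h ze A t k0 n b hh ze1 A0 t0 hA hb]; first exact: mulr_gt0.
pose x k : R := if (k0 <= k)%N then eps R k ^+ 2 / (c * omk om k.+2) else 0.
have x0 k : 0 <= x k.
  rewrite /x; case: ifP => // _; apply: divr_ge0; first by rewrite exprn_ge0// eps_ge0.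
  by rewrite mulr_ge0// ltW// (omk_gt0 hom).
pose Psi z := \sum_(k < n) x k * block_kernel ze k z.
have Psi0 z : 0 <= Psi z by apply: sumr_ge0 => k _; rewrite mulr_ge0// block_kernel_ge0.
have mPsi : measurable_fun (@discR R) Psi.
  apply: measurable_sum => k; apply: measurable_funM => //.
  by apply: measurable_funTS; exact: measurable_block_kernel.
have mom := om_nrm_measurable hom.
have mD := @measurable_discR R.
have mh : measurable_fun (@discR R) (fun z => cabs (h (pt z))) by exact: measurable_cabs_holo.
have s0 k : 0 <= (if (k0 <= k)%N then s k else 0).
  by case: ifP => // _; exact: ltW (sk_gt0 _ hom k).
have PsiI : (\int[leb2]_(z in @discR R) (Psi z `^ pp * om (nrm z))%:E
    <= (K2 * K1 * \sum_(k < n) (if (k0 <= k)%N then s k else 0))%:E)%E.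
  have X0 k m : 0 <= x k * (8 / Num.max (eps R k) (eps R m)).
    by rewrite mulr_ge0// divr_ge0// le_max eps_ge0.
  have := hK2 ze Psi (fun k => outer (1 - eps R k.+2)) (fun k m => x k * (8 / Num.max (eps R k) (eps R m)))
    (fun k m => Km * (2 * eps R m) * omk om k.+2) (fun k => K1 * (if (k0 <= k)%N then s k else 0)) n ze1 mPsi.
  rewrite -mulr_sumr mulrA; apply => //.
  - by move=> k; exact: measurable_outer.
  - by move=> k; rewrite mulr_ge0 ?(ltW K10).
  - move=> m z [zD /andP[h1 h2]]; apply: ler_sum => k _; rewrite -mulrA; apply: (ler_wpM2l (x0 k)).
    apply: ler_wpM2r; first by rewrite indicE.
    apply: ler_wpM2l => //; rewrite lef_pV2 ?posrE ?lt_max ?eps_gt0//.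
    by rewrite ge_max le_max lexx/= le_max (ltW h1) orbT.
  - move=> k m; have /andP[r0 r1] := eps01 R k.+2.
    apply: le_trans (hKm ze (2 * eps R m) (1 - eps R k.+2) ze1 (mulr_gt0 (ltr0n R 2) (eps_gt0 R m)) (eps01 R k.+2)).
    rewrite [leLHS]integral_mkcond [leRHS]integral_mkcond; apply: ge0_integral_mono => z _.
      rewrite patchE; case: ifPn => // /set_mem /shell_sub zD.
      by rewrite lee_fin mulr_ge0 ?(om_nrm_ge0 hom)// indicE.
    rewrite !patchE; case: ifPn => [/set_mem zm|_]; last first.
      by case: ifPn => // /set_mem zD; rewrite lee_fin mulr_ge0// (om_nrm_ge0 hom).
    have zD := shell_sub zm; have [_ /andP[h1 h2]] := zm.
    by rewrite mem_set// lee_fin /outer indic_setE h2.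
  - move=> k m; rewrite /x; case: ifP => _; first exact: hK1.
    by rewrite !mul0r powR0 ?(gt_eqF ppp)// mul0r !mulr0.
have I1 : ((\sum_(k < n) (if (k0 <= k)%N then eps R k ^+ 2 * b k else 0))%:E
    <= \int[leb2]_(z in @discR R) (cabs (h (pt z)) * Psi z * om (nrm z))%:E)%E.
  have my k : measurable_fun (@discR R) (fun z => (cabs (h (pt z)) * ((c * omk om k.+2)^-1 * block_kernel ze k z * om (nrm z)))%:E).
    apply/measurable_EFinP; apply: measurable_funM => //; apply: measurable_funM => //.
    apply: measurable_funM => //; apply: measurable_funTS; exact: measurable_block_kernel.
  have y0 k z : discR z -> (0 <= (cabs (h (pt z)) * ((c * omk om k.+2)^-1 * block_kernel ze k z * om (nrm z)))%:E)%E.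
    move=> zD; rewrite lee_fin; apply: (mulr_ge0 (cabs_ge0 _)); apply: (mulr_ge0 _ (om_nrm_ge0 hom zD)).
    apply: (mulr_ge0 _ (block_kernel_ge0 _ _ _)); rewrite invr_ge0; exact: (ltW (mulr_gt0 c0 (omk_gt0 hom _))).
  have e20 k : 0 <= eps R k ^+ 2 by rewrite exprn_ge0 ?eps_ge0.
  have myM (k : nat) : measurable_fun (@discR R) (fun z => if (k0 <= k)%N then ((eps R k ^+ 2)%:E * (cabs (h (pt z)) * ((c * omk om k.+2)^-1 * block_kernel ze k z * om (nrm z)))%:E)%E else 0%E).
    by case: (k0 <= k)%N => //; apply: emeasurable_funM.
  apply: (@le_trans _ _ (\sum_(k < n) \int[leb2]_(z in @discR R) (if (k0 <= k)%N then ((eps R k ^+ 2)%:E * (cabs (h (pt z)) * ((c * omk om k.+2)^-1 * block_kernel ze k z * om (nrm z)))%:E)%E else 0%E))%E).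
    rewrite -sumEFin; apply: lee_sum => k _; case: ifP => _; last by rewrite integral0.
    rewrite (@ge0_integralZl_EFin _ _ _ leb2 _ mD _ (y0 k) (my k) _ (e20 k)).
    have [u hu ->] := hb k.
    rewrite EFinM; apply: lee_wpmul2l; first by rewrite lee_fin.
    exact: hc.
  rewrite -(@ge0_integral_sum _ _ _ leb2 _ mD _ (fun (k : 'I_n) z => if (k0 <= k)%N then ((eps R k ^+ 2)%:E * (cabs (h (pt z)) * ((c * omk om k.+2)^-1 * block_kernel ze k z * om (nrm z)))%:E)%E else 0%E)); last 2 first.
  - by move=> k; exact: myM.
  - by move=> k z zD; case: ifP => // _; rewrite mule_ge0 ?y0// lee_fin.
  rewrite le_eqVlt; apply/orP; left; apply/eqP; apply: eq_integral => z _.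
  rewrite (eq_bigr (fun k : 'I_n => (x k * block_kernel ze k z * (cabs (h (pt z)) * om (nrm z)))%:E)) => [|k _].
    by rewrite sumEFin -mulr_suml; congr (_%:E); rewrite -/(Psi z); ring.
  rewrite /x; case: ifP => _; last by rewrite !mul0r.
  by rewrite -EFinM; congr (_%:E); ring.
have tp0 : 0 <= t `^ (p - 1) by exact: powR_ge0.
have tV0 : 0 <= t^-1 by rewrite invr_ge0 ltW.
have mP : measurable_fun (@discR R) (fun z => (cabs (h (pt z)) `^ p * om (nrm z))%:E).
  by apply/measurable_EFinP; apply: measurable_funM => //; exact: powR_measurable.
have mQ : measurable_fun (@discR R) (fun z => (Psi z `^ pp * om (nrm z))%:E).
  by apply/measurable_EFinP; apply: measurable_funM => //; exact: powR_measurable.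
have P0 z : discR z -> (0 <= (cabs (h (pt z)) `^ p * om (nrm z))%:E)%E.
  by move=> zD; rewrite lee_fin mulr_ge0 ?powR_ge0// (om_nrm_ge0 hom).
have Q0 z : discR z -> (0 <= (Psi z `^ pp * om (nrm z))%:E)%E.
  by move=> zD; rewrite lee_fin mulr_ge0 ?powR_ge0// (om_nrm_ge0 hom).
rewrite -lee_fin; apply: le_trans I1 _.
apply: (@le_trans _ _ (\int[leb2]_(z in @discR R) ((t `^ (p - 1))%:E * (cabs (h (pt z)) `^ p * om (nrm z))%:E
    + (t^-1)%:E * (Psi z `^ pp * om (nrm z))%:E))%E).
  apply: ge0_integral_mono => z zD.
    by rewrite lee_fin; apply: (mulr_ge0 _ (om_nrm_ge0 hom zD)); exact: (mulr_ge0 (cabs_ge0 _) (Psi0 _)).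
  rewrite -!EFinM -EFinD lee_fin !mulrA -mulrDl; apply: (ler_wpM2r (om_nrm_ge0 hom zD)).
  exact: (young_le p1 (cabs_ge0 _) (Psi0 z) t0).
have mcP (w : R) : measurable_fun (@discR R) (fun z => (w%:E * (cabs (h (pt z)) `^ p * om (nrm z))%:E)%E).
  exact: emeasurable_funM.
have mcQ (w : R) : measurable_fun (@discR R) (fun z => (w%:E * (Psi z `^ pp * om (nrm z))%:E)%E).
  exact: emeasurable_funM.
rewrite (@ge0_integralD _ _ _ leb2 _ mD (fun z => (t `^ (p - 1))%:E * (cabs (h (pt z)) `^ p * om (nrm z))%:E)%E
  (fun z => (t^-1)%:E * (Psi z `^ pp * om (nrm z))%:E)%E); last 4 first.
- by move=> z zD; rewrite mule_ge0 ?P0// lee_fin.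
- exact: mcP.
- by move=> z zD; rewrite mule_ge0 ?Q0// lee_fin.
- exact: mcQ.
rewrite (@ge0_integralZl_EFin _ _ _ leb2 _ mD _ P0 mP _ tp0) (@ge0_integralZl_EFin _ _ _ leb2 _ mD _ Q0 mQ _ tV0).
by rewrite EFinD !(EFinM _ A) (EFinM t^-1); apply: leeD; apply: lee_wpmul2l; rewrite ?lee_fin.
Qed.

End RadialSums.

(** * The operator T_g for g(z) = z *)

Section IdentityOperator.
Variable R : realType.
Local Notation leb := (@lebesgue_measure R).
Local Notation leb2 := (leb \x leb)%E.
Variables (p : R) (om : R -> R) (C0 S : R).
Hypotheses (p1 : 1 < p) (hom : radial_weight om) (C01 : 1 <= C0).
Hypothesis hC0 : forall r, 0 <= r < 1 -> omhat om r <= C0 * omhat om ((1 + r) / 2).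
Local Notation pp := (conj_exp p).
Local Notation s := (sk p om).
Hypothesis hS : forall n, \sum_(k < n) s k <= S.

(** Integration by parts with the primitive w - 1, which vanishes at the end point: only f(0) and f'
    with the weight 1 - w remain. *)
Lemma Tg_id (f : C R -> C R) z : holo f -> inD z ->
  Tg id f z = f 0 * z + cint 0 1 (fun w => (1 - w) * (cderiv f (w * z) * z ^+ 2)).
Proof.
move=> hf zD; rewrite TgE.
have d1 : dfb (seg 0 1) (fun w => f (w * z) * z) by apply: dfbM; [exact: dfb_ray|exact: dfb_cst].
have d2 : dfb (seg 0 1) (fun w : C R => 1 - w) by apply: dfbB; [exact: dfb_cst|exact: dfb_id].
have d3 : dfb (seg 0 1) (fun w => cderiv f (w * z) * z ^+ 2).
  apply: dfbM; last exact: dfb_cst.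
  exact: (dfb_ray (f := cderiv f) (holo_cderiv hf) zD).
have d4 := dfbM d2 d3.
have tD t : 0 <= t <= 1 -> inD (t%:C * z).
  by move=> /andP[t0 t1]; apply: inD_mul => //; rewrite cabs_rcge0.
have E1 : cint 0 1 (fun w => f (w * z) * cderiv id (w * z) * z) = cint 0 1 (fun w => f (w * z) * z).
  apply: eq_cint => t t01; have -> : cderiv id (t%:C * z) = 1 :> C R.
    by apply: (cderivE (tD t t01)); exact: cdif_id.
  by rewrite mulr1.
rewrite E1; apply/eqP; rewrite -subr_eq -(cintB d1 d4); apply/eqP.
have h t : 0 <= t <= 1 -> cdif (seg 0 1) (fun w => (w - 1) * (f (w * z) * z)) t%:C
    ((fun w => f (w * z) * z - (1 - w) * (cderiv f (w * z) * z ^+ 2)) t%:C).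
  move=> t01; have g1 := holo_cdif hf (tD t t01).
  have g2 := cdifM (cdif_id (seg 0 1) t%:C) (cdif_cst (seg 0 1) z t%:C).
  rewrite mul1r mulr0 addr0 in g2.
  have g3 := cdif_comp (B := setT) (f := f) (g := fun w => w * z) (fun _ _ => I) g1 g2.
  have g4 := cdifM g3 (cdif_cst (seg 0 1) z t%:C).
  have g5 := cdifD (cdif_id (seg 0 1) t%:C) (cdifN (cdif_cst (seg 0 1) (1 : C R) t%:C)).
  by have := cdifM g5 g4; congr (cdif _ _ _ _); ring.
rewrite (cint_FTC ler01 h (dfbB d1 d4)) rmorph1 rmorph0 mul0r subrr mul0r sub0r; ring.
Qed.

Lemma polar (z : C R) : exists2 ze : C R, cabs ze = 1 & z = (cabs z)%:C * ze.
Proof.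
have [->|z0] := eqVneq z 0; first by exists 1; rewrite ?cabs1// cabs0 rmorph0 mul0r.
have c0 : 0 < cabs z by rewrite cabs_gt0.
have cz : ((cabs z)%:C : C R) != 0 by rewrite -cabs_gt0 cabs_rcge0// ltW.
exists (z / (cabs z)%:C); last by rewrite mulrCA divff ?mulr1.
by rewrite cabsM cabsV cabs_rcge0 ?(ltW c0)// divff// gt_eqF.
Qed.

Lemma sk_partial k0 n : \sum_(k < n) (if (k0 <= k)%N then s k else 0) <= S.
Proof.
apply: le_trans (hS n); apply: ler_sum => k _.
by case: ifP => // _; exact: ltW (sk_gt0 _ hom k).
Qed.

Lemma S_ge0 : 0 <= S.
Proof. by have := hS 0; rewrite big_ord0. Qed.

(** Here [h] plays the part of f', or of a difference of two such derivatives. *)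
Definition Dbound (h : C R -> C R) (A : R) : Prop := [/\ holo h, 0 <= A &
  (\int[leb2]_(z in @discR R) (cabs (h (pt z)) `^ p * om (nrm z))%:E <= A%:E)%E].

(** The pointwise bound is [radial_sum] with a single block. For the integral, the segment [0, z] is
    cut at the moduli 1 - eps_k: on block [k] both the weight 1 - w and the length are at most
    eps_k/|z|, and the maximum of |h| on the block serves as [b k]. *)
Lemma growth_tail : exists2 K : R, 0 < K & forall (h : C R -> C R) (A t : R), Dbound h A -> 0 < t ->
  (forall k a, cabs a <= 1 - eps R k -> eps R k ^+ 2 * cabs (h a) <= t `^ (p - 1) * A + t^-1 * (K * S)) /\
  (forall k0 (H : R) z, 0 <= H -> inD z -> (forall a, cabs a <= 1 - eps R k0 -> cabs (h a) <= H) ->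
    exists n, cabs (cint 0 1 (fun w => (1 - w) * (h (w * z) * z ^+ 2))) <=
      H + (t `^ (p - 1) * A + t^-1 * (K * \sum_(k < n) (if (k0 <= k)%N then s k else 0)))).
Proof.
have [K K0 hK] := radial_sum p1 hom C01 hC0; exists K => // h A t [hh A0 hA] t0.
have tV0 : 0 <= t^-1 by rewrite invr_ge0 ltW.
have e20 k : 0 <= eps R k ^+ 2 by rewrite exprn_ge0 ?eps_ge0.
split=> [k a ak|k0 H z H0 zD hH].
  have [ze ze1 aE] := polar a.
  have a1 : cabs a < 1 by apply: le_lt_trans ak _; case/andP: (eps01 R k).
  have [j aj] : exists j, dyad j (cabs a) by apply: dyadEx; rewrite cabs_ge0.
  have /dyadP/andP[j1 j2] := aj.
  have jk : (j <= k)%N.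
    rewrite leqNgt; apply/negP => kj; have := eps_le R kj; rewrite epsS.
    by have := eps_gt0 R k; lra.
  (* Only block [j] counts; the other values are fillers, one being required for each block. *)
  pose b i := if i == j then cabs (h a) else cabs (h ((1 - eps R i)%:C * ze)).
  have hb i : exists2 u, 1 - eps R i <= u <= 1 - eps R i.+1 & b i = cabs (h (u%:C * ze)).
    rewrite /b; case: eqP => [->|_]; first by exists (cabs a); rewrite -?aE// j1 ltW.
    exists (1 - eps R i) => //; rewrite lexx/= lerD2l lerN2; exact: eps_le.
  have := hK h ze A t j j.+1 b hh ze1 A0 t0 hA hb.
  rewrite big_ord_recr/= leqnn /b eqxx => h1.
  apply: (@le_trans _ _ (eps R j ^+ 2 * cabs (h a))).
    apply: ler_wpM2r; first exact: cabs_ge0.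
    by apply: lerXn2r; rewrite ?nnegrE ?eps_ge0// eps_le.
  apply: le_trans (le_trans _ h1) _.
    rewrite lerDr; apply: sumr_ge0 => i _; case: ifP => // _; rewrite mulr_ge0//.
    by case: ifP => _; exact: cabs_ge0.
  rewrite lerD2l; apply: (ler_wpM2l tV0); apply: (ler_wpM2l (ltW K0)); exact: sk_partial.
have [ze ze1 zE] := polar z; set r := cabs z in zE.
have r1 : r < 1 := zD.
have dz : dfb (seg 0 1) (fun w => (1 - w) * (h (w * z) * z ^+ 2)).
  apply: dfbM; first by apply: dfbB; [exact: dfb_cst|exact: dfb_id].
  by apply: dfbM; [exact: dfb_ray|exact: dfb_cst].
have absE t' : 0 <= t' <= 1 -> cabs ((1 - t'%:C) * (h (t'%:C * z) * z ^+ 2)) = (1 - t') * (cabs (h (t'%:C * z)) * r ^+ 2).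
  move=> /andP[t0' t1']; have -> : 1 - t'%:C = (1 - t')%:C :> C R by rewrite rmorphB rmorph1.
  by rewrite (cabsM (1 - t')%:C) (cabsM (h _)) cabsX cabs_rcge0 ?subr_ge0.
have [rz|r0] := eqVneq r 0.
  exists 0%N; rewrite big_ord0 !mulr0 addr0; apply: le_trans (cint_le ler01 dz (M := 0) _) _.
  - by move=> t' t01'; rewrite absE// rz expr0n/= !mulr0.
  - by rewrite mul0r addr_ge0// mulr_ge0 ?powR_ge0.
have rp : 0 < r by rewrite lt_neqAle eq_sym r0 cabs_ge0.
have [b hb] : exists b : nat -> R, forall k, (exists2 u, 1 - eps R k <= u <= 1 - eps R k.+1 & b k = cabs (h (u%:C * ze))) /\
    forall u, 1 - eps R k <= u <= 1 - eps R k.+1 -> cabs (h (u%:C * ze)) <= b k.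
  have : forall k, exists x : R, (exists2 u, 1 - eps R k <= u <= 1 - eps R k.+1 & x = cabs (h (u%:C * ze))) /\
    forall u, 1 - eps R k <= u <= 1 - eps R k.+1 -> cabs (h (u%:C * ze)) <= x.
    move=> k; have le_k : 1 - eps R k <= 1 - eps R k.+1 by rewrite lerD2l lerN2; exact: eps_le.
    have dh : dfb (seg (1 - eps R k) (1 - eps R k.+1)) (fun w => h (w * ze)).
      apply: (dfb_comp (B := @inD R) _ ((holo_dfb h).1 hh)) => [w [u /andP[u0 u1] ->]|].
        have /andP[_ k1] := eps01 R k.+1; have /andP[k00 _] := eps01 R k.
        by rewrite /inD cabsM ze1 mulr1 cabs_rcge0 ?(le_trans k00)//; exact: le_lt_trans k1.
      by apply: dfbM; [exact: dfb_id|exact: dfb_cst].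
    have [u uk hu] := EVT_max le_k (rcont_within (dfb_rcont (@cabs_lip R) dh)).
    exists (cabs (h (u%:C * ze))); split; first by exists u => //; move: uk; rewrite in_itv.
    by move=> u' hu'; apply: hu; rewrite in_itv.
  by move=> hx; have [x hx'] := choice hx; exists x.
have [N hN] : exists N, eps R N < 1 - r by apply: eps_cvg0; rewrite subr_gt0.
(* The parameter at which |w z| reaches 1 - eps_k, cut off at the end point 1. *)
pose tau k := Num.min 1 ((1 - eps R k) / r).
have tau0 k : 0 <= tau k by rewrite le_min ler01 divr_ge0 ?(ltW rp)//; case/andP: (eps01 R k).
have tau1 k : tau k <= 1 by rewrite ge_min lexx.
have taur k : tau k * r <= 1 - eps R k.
  by rewrite -ler_pdivlMr// ge_min lexx orbT.
have tauS k : tau k <= tau k.+1.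
  rewrite le_min tau1/=; apply: (@le_trans _ _ ((1 - eps R k) / r)); first by rewrite ge_min lexx orbT.
  by rewrite ler_pM2r ?invr_gt0// lerD2l lerN2; exact: eps_le.
pose F w := (1 - w) * (h (w * z) * z ^+ 2).
have dsub x y : 0 <= x -> y <= 1 -> dfb (seg x y) F by move=> x0 y1; apply: dfb_subset dz; exact: seg_sub.
have head : cabs (cint 0 (tau k0) F) <= H.
  apply: le_trans (cint_le (tau0 k0) (dsub _ _ (lexx 0) (tau1 k0)) (M := H) _) _.
    move=> t' /andP[t0' t1']; have t01' : 0 <= t' <= 1 by rewrite t0' (le_trans t1').
    have /andP[_ t1''] := t01'.
    rewrite absE//; have h1 : cabs (h (t'%:C * z)) <= H.
      apply: hH; rewrite cabsM cabs_rcge0// -/r; apply: le_trans (taur k0).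
      by apply: (ler_wpM2r (ltW rp)).
    rewrite -[leRHS]mul1r; apply: ler_pM; rewrite ?subr_ge0 ?mulr_ge0 ?cabs_ge0 ?exprn_ge0 ?(ltW rp)//; first by rewrite gerBl.
    apply: le_trans (_ : cabs (h (t'%:C * z)) * 1 <= _); last by rewrite mulr1.
    by apply: ler_wpM2l; [exact: cabs_ge0|rewrite exprn_ile1 ?(ltW rp) ?(ltW r1)].
  by rewrite subr0; apply: ler_piMr.
have block k : cabs (cint (tau k) (tau k.+1) F) <= eps R k ^+ 2 * b k.
  have b0 : 0 <= b k by have [[u _ ->] _] := hb k; exact: cabs_ge0.
  have dk := dsub _ _ (tau0 k) (tau1 k.+1).
  (* If |z| <= 1 - eps_k, the block lies beyond [z] and its segment is a point. *)
  have [kr|kr] := leP 1 ((1 - eps R k) / r).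
    have tk : tau k = 1 by apply: min_l.
    have tk' : tau k.+1 = 1 by apply/le_anti; rewrite tau1/= -{1}tk tauS.
    apply: le_trans (cint_le (tauS k) dk (M := 0) _) _; last by rewrite mul0r mulr_ge0.
    move=> t' /andP[t0' t1']; have t1 : t' = 1 by apply/le_anti; rewrite -{2}tk t0' -{1}tk' t1'.
    by rewrite absE t1 ?subrr ?mul0r// ler01 lexx.
  have tk : tau k = (1 - eps R k) / r by apply: min_r; exact: ltW.
  have tk1 : 1 - tau k <= eps R k / r.
    by rewrite tk ler_pdivlMr// mulrBl divfK ?gt_eqF//; lra.
  apply: le_trans (cint_le (tauS k) dk (M := eps R k / r * (b k * r ^+ 2)) _) _.
    move=> t' /andP[t0' t1']; have t01' : 0 <= t' <= 1 by rewrite (le_trans (tau0 k)) // (le_trans t1').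
    have /andP[t0'' t1''] := t01'.
    rewrite absE//; apply: ler_pM; rewrite ?subr_ge0 ?mulr_ge0 ?cabs_ge0 ?exprn_ge0 ?(ltW rp)//.
      by apply: le_trans tk1; rewrite lerD2l lerN2.
    apply: ler_wpM2r; first by rewrite exprn_ge0 ?(ltW rp).
    have -> : t'%:C * z = (t' * r)%:C * ze by rewrite rmorphM -mulrA -zE.
    have [_] := hb k; apply; apply/andP; split.
      by rewrite -ler_pdivrMr// -tk.
    by apply: le_trans (taur k.+1); exact: (ler_wpM2r (ltW rp)).
  have l1 : tau k.+1 - tau k <= eps R k / r by apply: le_trans tk1; rewrite lerD2r.
  apply: (@le_trans _ _ (eps R k / r * (b k * r ^+ 2) * (eps R k / r))).
    apply: ler_wpM2l l1; apply: mulr_ge0; first by rewrite divr_ge0 ?eps_ge0 ?(ltW rp).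
    by rewrite mulr_ge0 ?exprn_ge0 ?(ltW rp).
  by rewrite le_eqVlt; apply/orP; left; apply/eqP; field; rewrite gt_eqF.
have steps i : cabs (cint 0 (tau (k0 + i)%N) F) <= H + \sum_(k < k0 + i) (if (k0 <= k)%N then eps R k ^+ 2 * b k else 0).
  elim: i => [|i ih].
    rewrite addn0 big1 ?addr0// => k _; case: ifP => // k0k.
    by have := ltn_ord k; rewrite ltnNge k0k.
  rewrite addnS big_ord_recr/= leq_addr addrA (cint_cat (tau0 _) (tauS _) (dsub _ _ (lexx 0) (tau1 _))).
  by apply: le_trans (cabsD _ _) _; apply: lerD (block _).
exists (k0 + N)%N; have tN : tau (k0 + N)%N = 1.
  apply: min_l; rewrite ler_pdivlMr// mul1r.
  by have := eps_le R (leq_addl k0 N); lra.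
have := steps N; rewrite tN => /le_trans; apply; rewrite lerD2l.
by apply: (hK h ze A t k0 (k0 + N)%N b) => // k; have [] := hb k.
Qed.

End IdentityOperator.

(** * Diagonal extraction *)

Section DiagonalExtraction.
Variable R : realType.

Lemma bounded_ultra_lim (G : set_system nat) (x : nat -> R) (B : R) : UltraFilter G ->
  (forall i, `|x i| <= B) -> exists l, forall e, 0 < e -> G [set i | `|x i - l| <= e].
Proof.
move=> UG hB; have PG := @ultra_proper _ _ UG.
have FA : (x @ G) (`[- B, B] : set R).
  have h i : (`[- B, B] : set R) (x i) by rewrite /= in_itv/= -ler_norml.
  exact: (filterS (fun i _ => h i) filterT).
have [l [_ cl]] := segment_compact (fmap_proper_filter x PG) FA.
exists l => e e0; have [//|nG] := in_ultra_setVsetC [set i | `|x i - l| <= e] UG.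
have hA : (x @ G) [set y | ~ (`|y - l| <= e)] by [].
have [y [/= y1 y2]] := cl _ _ hA (nbhsx_ballx l e e0).
by case: y1; rewrite distrC ltW.
Qed.

(** Along one ultrafilter containing all final segments the limits exist for every [j] at once,
    without nested subsequences; [phi n] is picked where the first n + 1 sequences are eps_n-close
    to their limits. *)
Lemma diagonal_extraction (c : nat -> nat -> C R) (B : nat -> R) : (forall j i, cabs (c j i) <= B j) ->
  exists (phi : nat -> nat) (L : nat -> C R), (forall n, (phi n < phi n.+1)%N) /\
    forall j n, (j <= n)%N -> cabs (c j (phi n) - L j) <= eps R n.
Proof.
move=> hB; have [G [UG hG]] := ultraFilterLemma eventually_filter.
have PG := @ultra_proper _ _ UG.
have [L hL] : exists L : nat -> C R, forall j e, 0 < e -> G [set i | cabs (c j i - L j) <= e].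
  suff h j : exists l : C R, forall e, 0 < e -> G [set i | cabs (c j i - l) <= e].
    by have [L hL] := choice h; exists L.
  have [l1 h1] := bounded_ultra_lim UG (fun i => le_trans (Re_cabs (c j i)) (hB j i)).
  have [l2 h2] := bounded_ultra_lim UG (fun i => le_trans (Im_cabs (c j i)) (hB j i)).
  exists (Complex l1 l2) => e e0; have e2 : 0 < e / 2 by rewrite divr_gt0.
  apply: filterS (filterI (h1 _ e2) (h2 _ e2)) => i /= [i1 i2].
  by apply: le_trans (cabs_ReIm _) _; rewrite [leRHS](splitr e); move: i1 i2; case: (c j i) => a b /=; exact: lerD.
have hn n N : exists i, (N < i)%N /\ forall j, (j <= n)%N -> cabs (c j i - L j) <= eps R n.
  have h1 : G [set i | forall j, (j <= n)%N -> cabs (c j i - L j) <= eps R n].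
    have : forall m, G [set i | forall j, (j < m)%N -> cabs (c j i - L j) <= eps R n].
      elim=> [|m ih]; first by apply: filterS filterT.
      apply: filterS (filterI ih (hL m _ (eps_gt0 R n))) => i /= [i1 i2] j.
      by rewrite ltnS leq_eqVlt => /orP[/eqP ->//|]; exact: i1.
    by move=> /(_ n.+1); apply: filterS => i /= hi j jn; exact: hi.
  have h2 : G [set i | (N < i)%N] by apply: hG; exists N.+1.
  by have [i [i1 i2]] := filter_ex (filterI h1 h2); exists i.
have [g hg] : exists g : nat -> nat -> nat, forall n N, (N < g n N)%N /\
    forall j, (j <= n)%N -> cabs (c j (g n N) - L j) <= eps R n.
  suff h n : exists gn : nat -> nat, forall N, (N < gn N)%N /\
      forall j, (j <= n)%N -> cabs (c j (gn N) - L j) <= eps R n.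
    by have [g hg] := choice h; exists g.
  by have [gn hgn] := choice (hn n); exists gn.
pose phi := fix phi n := if n is m.+1 then g n (phi m) else g 0%N 0%N.
exists phi, L; split=> [n|j n jn]; first by have [] := hg n.+1 (phi n).
by case: n jn => [|n] jn; [have [_] := hg 0%N 0%N|have [_] := hg n.+1 (phi n)]; apply.
Qed.

End DiagonalExtraction.

(** * Compactness of T_g for g(z) = z when the series converges *)

Section IdentityCompact.
Variable R : realType.
Local Notation leb := (@lebesgue_measure R).
Local Notation leb2 := (leb \x leb)%E.
Variables (p : R) (om : R -> R) (C0 S : R).
Hypotheses (p1 : 1 < p) (hom : radial_weight om) (C01 : 1 <= C0).
Hypothesis hC0 : forall r, 0 <= r < 1 -> omhat om r <= C0 * omhat om ((1 + r) / 2).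
Local Notation pp := (conj_exp p).
Local Notation s := (sk p om).
Hypothesis hS : forall n, \sum_(k < n) s k <= S.
Local Notation Db := (Dbound p om).

Lemma Dbound_cderiv (f : C R -> C R) : inDsp p (radial om) f ->
  exists A : R, [/\ Db (cderiv f) A, A <= pi * Dnorm p (radial om) f `^ p
    & cabs (f 0) <= Dnorm p (radial om) f].
Proof.
move=> fD; have [A A0 [AE AN f0]] := Dnorm_split (lt_trans ltr01 p1) (radial_ge0 hom) fD.
exists A; split=> //; split=> //; first exact: holo_cderiv fD.1.
by rewrite -AE.
Qed.

Lemma Dbound_le h A A' : Db h A -> A <= A' -> Db h A'.
Proof.
by move=> [hh A0 hA] AA; split; [|exact: le_trans AA|apply: le_trans hA _; rewrite lee_fin].
Qed.

Lemma Dbound_sub h k A : Db h A -> Db k A -> Db (fun z => h z - k z) (2 `^ p * (A + A)).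
Proof.
move=> [hh A0 hA] [hk _ kA]; have p0 : 0 < p := lt_trans ltr01 p1.
have t0 : 0 <= 2 `^ p :> R by exact: powR_ge0.
split; first by apply/holo_dfb; apply: dfbB; exact/holo_dfb.
  by rewrite mulr_ge0// addr_ge0.
have mD := @measurable_discR R; have mom := om_nrm_measurable hom.
have mP (f : C R -> C R) : holo f -> measurable_fun (@discR R) (fun z => (cabs (f (pt z)) `^ p * om (nrm z))%:E).
  move=> hf; apply/measurable_EFinP; apply: measurable_funM => //.
  by apply: powR_measurable; exact: measurable_cabs_holo.
have P0 (f : C R -> C R) z : discR z -> (0 <= (cabs (f (pt z)) `^ p * om (nrm z))%:E)%E.
  by move=> zD; rewrite lee_fin mulr_ge0 ?powR_ge0// (om_nrm_ge0 hom).
apply: (@le_trans _ _ (\int[leb2]_(z in @discR R) ((2 `^ p)%:E *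
    ((cabs (h (pt z)) `^ p * om (nrm z))%:E + (cabs (k (pt z)) `^ p * om (nrm z))%:E))%E)%E).
  apply: ge0_integral_mono => z zD; first exact: (P0 (fun z => h z - k z)).
  rewrite -EFinD -EFinM lee_fin -mulrDl mulrA; apply: (ler_wpM2r (om_nrm_ge0 hom zD)).
  set x := cabs (h (pt z)); set y := cabs (k (pt z)).
  have x0 : 0 <= x by exact: cabs_ge0.
  have y0 : 0 <= y by exact: cabs_ge0.
  apply: (@le_trans _ _ ((2 * Num.max x y) `^ p)).
    apply: (powR_le (ltW p0) (cabs_ge0 _)); apply: le_trans (cabsB _ _) _.
    rewrite mulr_natl mulr2n; apply: lerD; first by rewrite le_max lexx.
    by rewrite le_max lexx orbT.
  rewrite powRM//; last by rewrite le_max x0.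
  apply: (ler_wpM2l t0); case: (leP x y) => _; first by rewrite lerDr powR_ge0.
  by rewrite lerDl powR_ge0.
have mPQ : measurable_fun (@discR R) (fun z => (cabs (h (pt z)) `^ p * om (nrm z))%:E + (cabs (k (pt z)) `^ p * om (nrm z))%:E)%E.
  by apply: emeasurable_funD; exact: mP.
have PQ0 z : discR z -> (0 <= (cabs (h (pt z)) `^ p * om (nrm z))%:E + (cabs (k (pt z)) `^ p * om (nrm z))%:E)%E.
  by move=> zD; rewrite adde_ge0 ?P0.
rewrite (@ge0_integralZl_EFin _ _ _ leb2 _ mD _ PQ0 mPQ _ t0).
rewrite (@ge0_integralD _ _ _ leb2 _ mD _ _ (P0 h) (mP h hh) (P0 k) (mP k hk)).
rewrite EFinM; apply: lee_wpmul2l; first by rewrite lee_fin.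
by rewrite EFinD; exact: leeD hA kA.
Qed.

(** With k0 = 0 the head is the single point 0, where the pointwise part of [growth_tail] bounds f'.
    Head and tail have the same bound, whence the factor 2, and [young_opt] makes it linear in the
    norm. *)
Lemma tbounded_id : Tbounded p (radial om) (@id (C R)).
Proof.
have [K K0 hK] := growth_tail p1 hom C01 hC0 hS.
have KS : 0 <= K * S by rewrite mulr_ge0 ?(ltW K0) ?(S_ge0 hS).
have p0 : 0 < p := lt_trans ltr01 p1; have pV0 : 0 <= p^-1 by rewrite invr_ge0 ltW.
exists (1 + 2 * ((1 + K * S) * pi `^ p^-1)) => f fD z zD.
have hf := fD.1; have [A [DA AN f0]] := Dbound_cderiv fD; have [hh A0 _] := DA.
set N := Dnorm p (radial om) f in AN f0 *; have N0 : 0 <= N by exact: powR_ge0.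
rewrite (Tg_id hf zD); set I := cint _ _ _.
have key : cabs I / 2 <= (1 + K * S) * A `^ p^-1.
  apply: (young_opt p1 A0 KS) => t t0; have [g1 g2] := hK _ A t DA t0.
  have tV0 : 0 <= t^-1 by rewrite invr_ge0 ltW.
  have g0 : cabs (cderiv f 0) <= t `^ (p - 1) * A + t^-1 * (K * S).
    by have := g1 0%N 0; rewrite eps0 expr1n mul1r cabs0 subrr; apply.
  have hH a : cabs a <= 1 - eps R 0 -> cabs (cderiv f a) <= cabs (cderiv f 0).
    rewrite eps0 subrr => a0; have /eqP : cabs a = 0 by apply/le_anti; rewrite a0 cabs_ge0.
    by rewrite cabs_eq0 => /eqP ->.
  have [n hn] := g2 0%N _ z (cabs_ge0 _) zD hH.
  rewrite ler_pdivrMr// mulr_natr mulr2n; apply: le_trans hn _; apply: (lerD g0).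
  by rewrite lerD2l; apply: (ler_wpM2l tV0); apply: (ler_wpM2l (ltW K0)); exact: (sk_partial hom hS 0 n).
have A1 : A `^ p^-1 <= pi `^ p^-1 * N.
  have := powR_le pV0 A0 AN; rewrite powRM ?powR_ge0 ?(ltW (pi_gt0R _))//.
  by rewrite -(powRrM N p p^-1) mulfV ?gt_eqF// powRr1.
apply: le_trans (cabsD _ _) _; rewrite mulrDl mul1r; apply: lerD.
  by rewrite cabsM; apply: le_trans f0; rewrite ler_piMr ?cabs_ge0// ltW.
rewrite ler_pdivrMr// in key; apply: (le_trans key).
rewrite mulrC -!mulrA; apply: ler_wpM2l => //.
by apply: ler_wpM2l A1; rewrite addr_ge0.
Qed.

Lemma coef_le (h : C R -> C R) (r B : R) m : holo h -> 0 < r -> r < 1 ->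
  (forall a, cabs a <= r -> cabs (h a) <= B) -> cabs (coef h r m) <= B * (r ^+ m)^-1.
Proof.
move=> hh r0 r1 hB; rewrite -[leRHS]mulr1 -[X in _ * X]subr0; apply: cint_le => //; first exact: coef_dfb.
move=> t _; rewrite cabsM cabsV cabsX cabs_circ//; apply: ler_wpM2r.
  by rewrite invr_ge0 exprn_ge0// ltW.
by apply: hB; rewrite cabs_circ.
Qed.

Lemma coefB (h k : C R -> C R) (r : R) m : holo h -> holo k -> 0 < r -> r < 1 ->
  coef (fun z => h z - k z) r m = coef h r m - coef k r m.
Proof.
move=> hh hk r0 r1; rewrite /coef -cintB; [|exact: coef_dfb..].
by apply: eq_cint => t _; rewrite mulrBl.
Qed.

Lemma sum_tail_small (e : R) : 0 < e ->
  exists k0, forall n, \sum_(k < n) (if (k0 <= k)%N then s k else 0) <= e.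
Proof.
move=> e0; pose E := [set x | exists n, x = \sum_(k < n) s k].
have s0 k : 0 <= s k by exact: ltW (sk_gt0 _ hom k).
have supE : has_sup E by split; [exists (\sum_(k < 0) s k), 0%N|exists S => _ [n ->]].
have [_ [k0 ->] hk0] := sup_adherent e0 supE.
exists k0 => n; pose m := (k0 + n)%N.
have mono a b : \sum_(k < a) (if (k0 <= k)%N then s k else 0) <= \sum_(k < a + b) (if (k0 <= k)%N then s k else 0).
  by rewrite big_split_ord/= lerDl; apply: sumr_ge0 => k _; case: ifP.
apply: le_trans (mono n k0) _; rewrite addnC.
have h1 : \sum_(k < k0 + n) (if (k0 <= k)%N then s k else 0) = \sum_(k < k0 + n) s k - \sum_(k < k0) s k.
  rewrite !big_split_ord/= big1 => [|k _]; last by rewrite leqNgt ltn_ord.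
  by rewrite add0r addrAC subrr add0r; apply: eq_bigr => k _; rewrite leq_addr.
rewrite h1 lerBlDr; apply: (@le_trans _ _ (sup E)); last by rewrite addrC -lerBlDr ltW.
by apply: sup_upper_bound supE _ _; exists (k0 + n)%N.
Qed.

Lemma powR_small (a e : R) : 0 < a -> 0 < e -> exists2 t : R, 0 < t & t `^ a <= e.
Proof.
move=> a0 e0; exists (e `^ a^-1); first exact: powR_gt0.
by rewrite -(powRrM e a^-1 a) mulVf ?gt_eqF// powRr1// ltW.
Qed.

(** Along a subsequence f(0) and all Taylor coefficients of f' converge, so f' converges uniformly
    on smaller discs; [growth_tail] makes the contribution of the rest of the segment small
    uniformly in the function and in [z]. *)
Lemma tcompact_id : Tcompact p (radial om) (@id (C R)).
Proof.
split=> [|fs M fD fM]; first exact: tbounded_id.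
have sub3 (u v w : C R) : u - v = (u - w) - (v - w) by ring.
have lin (u v w x y : C R) : u * w + x - (v * w + y) = (u - v) * w + (x - y) by ring.
have p0 : 0 < p := lt_trans ltr01 p1.
have [K K0 hK] := growth_tail p1 hom C01 hC0 hS.
have KS : 0 <= K * S by rewrite mulr_ge0 ?(ltW K0) ?(S_ge0 hS).
have M0 : 0 <= M by apply: le_trans (fM 0%N); exact: powR_ge0.
pose A0 := pi * M `^ p; pose A1 := 2 `^ p * (A0 + A0).
have hD i : Db (cderiv (fs i)) A0.
  have [A [DA AN _]] := Dbound_cderiv (fD i); apply: (Dbound_le DA); apply: (le_trans AN).
  apply: ler_wpM2l; first exact: ltW (pi_gt0R R).
  exact: (powR_le (ltW p0) (powR_ge0 _ _) (fM i)).
have hf0 i : cabs (fs i 0) <= M.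
  by have [A [_ _ h]] := Dbound_cderiv (fD i); exact: le_trans h (fM i).
have hDD i j : Db (fun z => cderiv (fs i) z - cderiv (fs j) z) A1 by exact: Dbound_sub.
have A10 : 0 <= A1 by have [] := hDD 0%N 0%N.
have h2 : 0 < 2^-1 :> R by rewrite invr_gt0.
have h21 : 2^-1 < 1 :> R by rewrite invf_lt1// ltr1n.
have E2 : 1 - eps R 1 = 2^-1 by rewrite /eps expr1; lra.
pose B0 := (1 `^ (p - 1) * A0 + 1^-1 * (K * S)) / eps R 1 ^+ 2.
have hB0 i a : cabs a <= 2^-1 -> cabs (cderiv (fs i) a) <= B0.
  rewrite -E2 => ha; have [g1 _] := hK _ A0 1 (hD i) ltr01.
  by rewrite ler_pdivlMr ?exprn_gt0 ?eps_gt0// mulrC; exact: g1.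
(* Index 0 holds the value at 0, index k + 1 the k-th Taylor coefficient of the derivative. *)
pose c j i : C R := if j is k.+1 then coef (cderiv (fs i)) 2^-1 k else fs i 0.
pose B j : R := if j is k.+1 then B0 * ((2^-1) ^+ k)^-1 else M.
have hc j i : cabs (c j i) <= B j.
  case: j => [|k] /=; first exact: hf0.
  by apply: (coef_le _ _ h2 h21); [have [] := hD i|exact: hB0].
have [phi [L [phiS hL]]] := diagonal_extraction hc.
exists phi; split=> // e e0.
have e4 : 0 < e / 4 by rewrite divr_gt0.
(* [t] is fixed before [k0], because the tail of the series is multiplied by 1/t. *)
have [t t0 ht] : exists2 t : R, 0 < t & t `^ (p - 1) * A1 <= e / 4.
  have A11 : 0 < A1 + 1 by rewrite ltr_wpDl.
  have p10 : 0 < p - 1 by rewrite subr_gt0.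
  have [t t0 ht] := powR_small p10 (divr_gt0 e4 A11); exists t => //.
  apply: (@le_trans _ _ (e / 4 / (A1 + 1) * (A1 + 1))); last by rewrite divfK// gt_eqF.
  by apply: (ler_pM (powR_ge0 _ _) A10 ht); rewrite lerDl.
have tK : 0 < t^-1 * K by rewrite mulr_gt0// invr_gt0.
have [k0 hk0] := sum_tail_small (divr_gt0 e4 tK).
(* Uniform smallness is needed for |a| <= rho; expanding from the larger circle of radius [r] makes
   the Taylor remainder geometric with ratio rho/r. *)
pose rho := 1 - eps R k0; pose r := 1 - eps R k0.+1.
have /andP[rho0 rho1] : 0 <= rho < 1 := eps01 R k0.
have /andP[r0' r1] : 0 <= r < 1 := eps01 R k0.+1.
have rr : rho < r by rewrite /rho /r epsS; have := eps_gt0 R k0; lra.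
have r0 : 0 < r by exact: le_lt_trans rr.
pose B1 := (1 `^ (p - 1) * A1 + 1^-1 * (K * S)) / eps R k0.+1 ^+ 2.
have hB1 i j a : cabs a <= r -> cabs (cderiv (fs i) a - cderiv (fs j) a) <= B1.
  move=> ha; have [g1 _] := hK _ A1 1 (hDD i j) ltr01.
  by rewrite ler_pdivlMr ?exprn_gt0 ?eps_gt0// mulrC; exact: g1.
have B10 : 0 <= B1 by apply: le_trans (hB1 0%N 0%N 0 _); rewrite ?cabs_ge0 ?cabs0.
pose d := rho / r; have d0 : 0 <= d by rewrite divr_ge0.
have d1 : d < 1 by rewrite ltr_pdivrMr// mul1r.
pose B2 := B1 * (r / (r - rho)).
have B20 : 0 <= B2 by apply: mulr_ge0 => //; apply: divr_ge0 => //; rewrite subr_ge0 ltW.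
have B21 : 0 < B2 + 1 by rewrite ltr_wpDl.
have e8 : 0 < e / 8 by rewrite divr_gt0.
have [J hJ] := exprn_small d0 d1 (divr_gt0 e8 B21).
have J0 : 0 < 2 * (J.+1)%:R :> R by rewrite mulr_gt0.
have [N0 hN0] := eps_cvg0 (divr_gt0 e8 J0).
exists (maxn J.+1 N0) => m n mN nN z zD.
have epsN i : (maxn J.+1 N0 <= i)%N -> eps R i <= e / 8 / (2 * (J.+1)%:R).
  by move=> hi; apply: le_trans (ltW hN0); apply: eps_le; apply: leq_trans hi; exact: leq_maxr.
have cc j : (j <= J)%N -> cabs (c j (phi m) - c j (phi n)) <= e / 8 / (J.+1)%:R.
  move=> jJ; have jl i : (maxn J.+1 N0 <= i)%N -> (j <= i)%N.
    by move=> hi; apply: leq_trans (leq_trans (leqW jJ) (leq_maxl J.+1 N0)) hi.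
  rewrite (sub3 _ _ (L j)).
  apply: le_trans (cabsB _ _) _; apply: le_trans (lerD (hL _ _ (jl m mN)) (hL _ _ (jl n nN))) _.
  apply: le_trans (lerD (epsN m mN) (epsN n nN)) _.
  rewrite le_eqVlt; apply/orP; left; apply/eqP.
  by move: (J.+1)%:R (ltr0Sn R J) => x x0; field; rewrite gt_eqF.
pose D z := cderiv (fs (phi m)) z - cderiv (fs (phi n)) z.
have DD : Db D A1 := hDD (phi m) (phi n); have [hD' _ _] := DD.
have [hh1 _ _] := hD (phi m); have [hh2 _ _] := hD (phi n).
have head a : cabs a <= rho -> cabs (D a) <= e / 4.
  move=> ha; have ar : cabs a < r by exact: le_lt_trans rr.
  have hBc u : 0 <= u <= 1 -> cabs (D (circ r u%:C)) <= B1.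
    by move=> _; apply: hB1; rewrite cabs_circ.
  have tr := taylor_remainder J hD' ar r1 hBc.
  set T := \sum_(i < J) _ in tr.
  have T1 : cabs T <= e / 8.
    apply: le_trans (cabs_sum _ _ _) _; apply: (@le_trans _ _ (\sum_(i < J) e / 8 / (J.+1)%:R)).
      apply: ler_sum => i _; rewrite (coef_radius i hD' r0 r1 h2 h21) (coefB i hh1 hh2 h2 h21).
      rewrite cabsM cabsX -[leRHS]mulr1; apply: ler_pM; rewrite ?cabs_ge0 ?exprn_ge0 ?cabs_ge0//.
        by have := cc i.+1; apply; exact: ltn_ord.
      by apply: exprn_ile1; [exact: cabs_ge0|exact: ltW (le_lt_trans ha rho1)].
    rewrite sumr_const card_ord -[_ *+ J]mulr_natr mulrAC ler_pdivrMr//.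
    by apply: ler_wpM2l; [exact: ltW|rewrite ler_nat].
  have T2 : B1 * (r / (r - cabs a)) * (cabs a / r) ^+ J <= e / 8.
    apply: (@le_trans _ _ ((B2 + 1) * (e / 8 / (B2 + 1)))); last by rewrite mulrCA divff ?mulr1// gt_eqF.
    have ra : 0 < r - cabs a by rewrite subr_gt0.
    have rV : 0 <= r^-1 by rewrite invr_ge0.
    apply: ler_pM.
    - by apply: mulr_ge0 => //; apply: divr_ge0 => //; exact: ltW.
    - by apply: exprn_ge0; apply: mulr_ge0 => //; exact: cabs_ge0.
    - apply: (@le_trans _ _ B2); last by rewrite lerDl.
      apply: (ler_wpM2l B10); apply: (ler_wpM2l r0').
      by rewrite lef_pV2 ?posrE ?subr_gt0// lerD2l lerN2.
    - apply: le_trans (hJ J (leqnn J)); apply: lerXn2r.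
      + by rewrite nnegrE; apply: mulr_ge0 => //; exact: cabs_ge0.
      + by rewrite nnegrE.
      + exact: (ler_wpM2r rV ha).
  have -> : D a = (D a - T) + T by rewrite subrK.
  apply: le_trans (cabsD _ _) _; apply: le_trans (lerD (le_trans tr T2) T1) _; lra.
have [g1 g2] := hK D A1 t DD t0.
have [q hq] := g2 k0 (e / 4) z (ltW e4) zD head.
have dfbI f : holo f -> dfb (seg 0 1) (fun w => (1 - w) * (f (w * z) * z ^+ 2)).
  move=> hf; apply: dfbM; first by apply: dfbB; [exact: dfb_cst|exact: dfb_id].
  by apply: dfbM; [exact: (dfb_ray hf zD)|exact: dfb_cst].
have E : Tg id (fs (phi m)) z - Tg id (fs (phi n)) z =
    (fs (phi m) 0 - fs (phi n) 0) * z + cint 0 1 (fun w => (1 - w) * (D (w * z) * z ^+ 2)).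
  rewrite (Tg_id (fD _).1 zD) (Tg_id (fD _).1 zD).
  have -> : cint 0 1 (fun w => (1 - w) * (D (w * z) * z ^+ 2))
    = cint 0 1 (fun w => (1 - w) * (cderiv (fs (phi m)) (w * z) * z ^+ 2))
      - cint 0 1 (fun w => (1 - w) * (cderiv (fs (phi n)) (w * z) * z ^+ 2)).
    rewrite -(cintB (dfbI _ hh1) (dfbI _ hh2)); apply: eq_cint => u _; rewrite /D.
    by rewrite -mulrBr -mulrBl.
  exact: lin.
rewrite E; apply: le_trans (cabsD _ _) _.
have f0 : cabs ((fs (phi m) 0 - fs (phi n) 0) * z) <= e / 8.
  rewrite cabsM; apply: (@le_trans _ _ (e / 8 / (J.+1)%:R * 1)).
    by apply: ler_pM; rewrite ?cabs_ge0//; [exact: (cc 0%N)|exact: ltW].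
  rewrite mulr1 ler_pdivrMr//; apply: ler_peMr; [exact: ltW|by rewrite ler1n].
have tail : t^-1 * (K * \sum_(k < q) (if (k0 <= k)%N then s k else 0)) <= e / 4.
  by rewrite mulrA mulrC -ler_pdivlMr//; exact: hk0.
have := lerD f0 hq; move: ht tail; set x := _ * A1; set y := t^-1 * _; lra.
Qed.

End IdentityCompact.

(** * The implications between the four conditions *)

Theorem theorem1p2 (R : realType) (p : R) (om : R -> R) :
  1 < p -> radial_weight om -> Dhat om ->
  let p' := p / (p - 1) in
  let P1 := forall g : C R -> C R,
      holo g -> Tbounded p (radial om) g -> const_on_D g in
  let P1c := forall g : C R -> C R,
      holo g -> Tcompact p (radial om) g -> const_on_D g in
  let P2 := (\int[@lebesgue_measure R]_(r in `[0%R, 1%R[)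
               (((1 - r) `^ p' / omhat om r `^ (p' - 1))%R)%:E = +oo)%E in
  let P3 := (\sum_(0 <= k <oo)
               ((1 / ((k.+1)%:R `^ (2 + p') * moment om k `^ (p' - 1)))%R)%:E
             = +oo)%E in
  let P4 := forall y : R, p' < y -> forall ps : R, 0 < ps ->
      let x := p * (y - 1) in
      ~ id_bounded ps (omhat_x om x) (ps / p) (std_weight y) in
  [/\ P1 <-> P1c, P1 <-> P2, P2 <-> P3 & P3 <-> P4].
Proof.
move=> p1 hom [C0 [C01 hC0]] p' P1 P1c P2 P3 P4.
have p0 : 0 < p := lt_trans ltr01 p1.
have E2 : P2 <-> ~ bdd (sk p om) := integral_series p1 hom C01 hC0.
have E3 : P3 <-> ~ bdd (sk p om) := moment_series p1 hom C01 hC0.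
have P11c : P1 -> P1c by move=> h g hg [hT _]; exact: h.
(* If the series converged, g(z) = z would be a nonconstant symbol with compact T_g. *)
have P1c2 : P1c -> P2.
  move=> h; apply/E2 => -[S hS].
  have hid : holo (@id (C R)) by apply/holo_dfb; exact: dfb_id.
  have [c hc] := h id hid (tcompact_id p1 hom C01 hC0 hS).
  have h0 : inD (0 : C R) by rewrite /inD cabs0.
  have hD : inD ((2^-1 : R)%:C : C R) by rewrite /inD cabs_rcge0 ?invr_ge0// invf_lt1// ltr1n.
  have := hc _ hD; rewrite -(hc _ h0) => /(congr1 (@cabs R)).
  by rewrite cabs0 cabs_rcge0 ?invr_ge0// => /eqP; rewrite invr_eq0 pnatr_eq0.
have P21 : P2 -> P1.
  move=> /E2 nb g hg hT; apply: contrapT => ng.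
  have [M hM] : exists M : nat, C0 <= 2 ^+ M.
    exists (Num.truncn C0).+1; apply: le_trans (ltW (truncnS_gt _)) _.
    by rewrite -natrX ler_nat ltnW// ltn_expl.
  exact: nb (bdd_of_tbounded p1 hom C01 hC0 hM hg hT ng).
split; [by split => // /P1c2/P21|by split=> // h; exact/P1c2/P11c|by rewrite E2 E3|].
rewrite E3; split=> [nb y yp ps ps0 x hid|h4 bs].
  have q0 : 0 < ps / p by rewrite divr_gt0.
  apply: nb; apply: (bdd_of_id_bounded p1 hom C01 hC0 yp q0).
  by rewrite divfK// gt_eqF.
(* A single pair (y, [ps]) with a bounded identity map refutes [P4]. *)
have [y [ps [yp ps0 hid]]] := id_bounded_of_bdd p1 hom C01 hC0 bs.
exact: h4 y yp ps ps0 hid.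
Qed.
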